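(* Let $A$ be the Radon transform on $L^2(\mathbb R^2)$, let $U$ be a random ground truth in $L^2(\mathbb R^2)$, and let $\nu$ be zero-mean random noise in $L^2(\mathbb R\times[0,\pi])$ independent of $U$ (as specified in the context). Put $$\Pi(r,\theta)=\mathbb E\big(|\mathcal F_1AU(r,\theta)|^2\big),\qquad \Delta(r,\theta)=\mathbb E\big(|\mathcal F_1\nu(r,\theta)|^2\big).$$ Filters $\rho:\mathbb R\times[0,\pi]\to\mathbb C$ are required to be essentially bounded (so that the reconstruction operator $R(\cdot;\rho)$ is well-defined and continuous on $L^2$). To fulfill the boundedness of the filter $\overline\rho$ given below, assume that $$\frac{\Delta(r,\theta)}{\Pi(r,\theta)\,|r|}\longrightarrow\infty\quad\text{as }|r|\to\infty,\ \text{for every }\theta\in[0,\pi].$$ Then the optimal filter, i.e. the minimizer over $\rho$ of the expected error $\mathbb E\big(\|U-R(AU+\nu;\rho)\|^2\big)$, is real-valued and given by $$\overline\rho(r,\theta)=|r|\,\frac{\Pi(r,\theta)}{\Pi(r,\theta)+\Delta(r,\theta)},$$ and the expected error using the optimal filter is $$\mathbb E\big(\|U-R(AU+\nu;\overline\rho)\|^2\big)=\int_0^\pi\int_{\mathbb R}|r|\,\Pi(r,\theta)\left(1-\frac{\Pi(r,\theta)}{\Pi(r,\theta)+\Delta(r,\theta)}\right)dr\,d\theta.$$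
   Context: For $\theta\in[0,\pi]$ let $\vec\theta=(\cos\theta,\sin\theta)$. $\mathcal F_2$ is the two-dimensional Fourier transform, $\mathcal F_2u(\xi)=\int_{\mathbb R^2}u(x)e^{-2\pi i x\cdot\xi}\,dx$, and $\mathcal F_1f(r,\theta)=\int_{\mathbb R}f(s,\theta)e^{-2\pi i sr}\,ds$ is the one-dimensional Fourier transform in the offset variable $s$; both are extended to $L^2$ as isometries. The Radon transform $A$ takes a function $u$ on $\mathbb R^2$ to its line integrals $Au(s,\theta)=\int_{\{x\cdot\vec\theta=s\}}u$, and satisfies the central slice theorem $\mathcal F_1Au(r,\theta)=\mathcal F_2u(r\vec\theta)$. Its adjoint $A^*$ is the back-projection, $A^*f(x)=\int_0^\pi f(x\cdot\vec\theta,\theta)\,d\theta$. For a filter $\rho$ the regularized filtered back-projection is $R(f;\rho)=A^*\big(\mathcal F_1^{-1}(\rho\cdot\mathcal F_1f)\big)$; it satisfies $\mathcal F_2R(f;\rho)(r\vec\theta)=\frac{\rho(r,\theta)}{|r|}\mathcal F_1f(r,\theta)$, so that $$\|u-R(f;\rho)\|^2=\int_0^\pi\int_{\mathbb R}|r|\,\Big|\mathcal F_1Au(r,\theta)-\frac{\rho(r,\theta)}{|r|}\mathcal F_1f(r,\theta)\Big|^2dr\,d\theta .$$ $U$ is an $L^2(\mathbb R^2)$-valued random variable with $\mathbb E(\|U\|^2)<\infty$, and $\nu$ is random noise with values in $L^2(\mathbb R\times[0,\pi])$, with mean zero and independent of $U$. $\mathbb E$ is the expectation over the joint distribution of $U$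 and $\nu$. It is assumed that $\Pi>0$ or $\Delta>0$ almost everywhere, so that the quotients $\Pi/(\Pi+\Delta)$ are defined.
   Formalization: The limit Δ/(Π|r|)→∞ as |r|→∞ is assumed uniformly in θ (almost everywhere) instead of separately for every θ, since a θ-dependent rate need not make the optimal filter essentially bounded. *)

(* Defs.v *)
From HB Require Import structures.
From mathcomp Require Import all_boot all_order all_algebra.
From mathcomp Require Import complex.
From mathcomp Require Import all_classical all_reals all_analysis.

Set Implicit Arguments.
Unset Strict Implicit.
Unset Printing Implicit Defensive.

Import Order.TTheory GRing.Theory Num.Theory.
Import numFieldNormedType.Exports.
Import ComplexField.

Local Open Scope classical_set_scope.
Local Open Scope ring_scope.

Section ComplexFunctions.
Context d (X : measurableType d) (R : realType).
Variables (mu : {measure set X -> \bar R}) (D : set X).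
Implicit Types f g : X -> R[i].

Definition cmeasurable f :=
  measurable_fun D (fun x => complex.Re (f x)) /\
  measurable_fun D (fun x => complex.Im (f x)).

Definition cintegral f : R[i] :=
  Complex (\int[mu]_(x in D) complex.Re (f x)) (\int[mu]_(x in D) complex.Im (f x)).

Definition L2normsq f : \bar R :=
  (\int[mu]_(x in D) ((Normc.normc (f x)) ^+ 2)%:E)%E.

Definition L1 f :=
  cmeasurable f /\ (\int[mu]_(x in D) (Normc.normc (f x))%:E < +oo)%E.

Definition L2 f := cmeasurable f /\ (L2normsq f < +oo)%E.

Definition L2cvg (f_ : nat -> X -> R[i]) f :=
  L2normsq (fun x => f_ n x - f x) @[n --> \oo] --> 0%E.

Definition L2dot f g : R[i] := cintegral (fun x => f x * (g x)^*%C).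

(* Elements of the space L^2(D) are represented by functions.  A set open for
   the L^2 pseudometric is automatically invariant under a.e. equality, so the
   open sets below are exactly those of the quotient space. *)
Definition L2open (O : set (X -> R[i])) :=
  O `<=` L2 /\
  forall f, O f -> exists2 e : R, 0 < e &
    forall g, L2 g -> (L2normsq (fun x => (g x - f x)%R) < e%:E)%E -> O g.

End ComplexFunctions.

Section L2RandomVariables.
Context dO (Omega : measurableType dO) (R : realType) (P : probability Omega R).

(* Borel-measurable maps into L^2(D). *)
Definition L2random d (X : measurableType d) (mu : {measure set X -> \bar R})
    (D : set X) (U : Omega -> X -> R[i]) :=
  (forall w, L2 mu D (U w)) /\
  (forall O, L2open mu D O -> measurable (U @^-1` O)).

Definition L2sigma d (X : measurableType d) (mu : {measure set X -> \bar R})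
    (D : set X) (U : Omega -> X -> R[i]) : set (set Omega) :=
  <<s [set U @^-1` O | O in L2open mu D] >>.

Definition L2independent d1 (X1 : measurableType d1)
    (mu1 : {measure set X1 -> \bar R}) (D1 : set X1) (U1 : Omega -> X1 -> R[i])
    d2 (X2 : measurableType d2)
    (mu2 : {measure set X2 -> \bar R}) (D2 : set X2) (U2 : Omega -> X2 -> R[i]) :=
  forall A B, L2sigma mu1 D1 U1 A -> L2sigma mu2 D2 U2 B ->
    P (A `&` B) = (P A * P B)%E.

(* The Bochner integral of U exists (first condition) and vanishes, i.e. it is
   orthogonal to every element of L^2(D) (second condition). *)
Definition L2centered d (X : measurableType d) (mu : {measure set X -> \bar R})
    (D : set X) (U : Omega -> X -> R[i]) :=
  (\int[P]_w (L2normsq mu D (U w) `^ 2^-1) < +oo)%E /\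
  forall phi, L2 mu D phi ->
    cintegral P setT (fun w => L2dot mu D (U w) phi) = 0.

Definition second_moment X (F : Omega * X -> R[i]) (x : X) : \bar R :=
  (\int[P]_w ((Normc.normc (F (w, x))) ^+ 2)%:E)%E.

End L2RandomVariables.

Section Tomography.
Variable R : realType.
Notation leb := (@lebesgue_measure R).

Definition leb2 :
    {measure set (measurableTypeR R * measurableTypeR R)%type -> \bar R} :=
  (leb \x leb)%E.

Definition plane : set (R * R) := setT.

(* Pairs (s, theta), or (r, theta) on the Fourier side. *)
Definition strip : set (R * R) := setT `*` `[0, pi].

(* exp (- 2 pi i t) *)
Definition expm2pi (t : R) : R[i] := Complex (cos (2 * pi * t)) (- sin (2 * pi * t)).

Definition fourier_integral (f : R * R -> R[i]) (z : R * R) : R[i] :=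
  cintegral leb setT (fun s => f (s, z.2) * expm2pi (s * z.1)).

(* g = F_1 f on L^2(R x [0, pi]): the continuous extension of the integral
   formula from the dense subspace L^1 `&` L^2. *)
Definition is_F1 (f g : R * R -> R[i]) :=
  [/\ L2 leb2 strip f, L2 leb2 strip g &
   exists f_ : nat -> R * R -> R[i],
   [/\ forall n, L1 leb2 strip (f_ n) /\ L2 leb2 strip (f_ n),
       L2cvg leb2 strip f_ f &
       L2cvg leb2 strip (fun n => fourier_integral (f_ n)) g]].

(* Integral of u over the line {x | x . theta = s}. *)
Definition radon (u : R * R -> R[i]) (z : R * R) : R[i] :=
  let s := z.1 in let theta := z.2 in
  cintegral leb setT (fun t =>
    u (s * cos theta - t * sin theta, s * sin theta + t * cos theta)).

Definition weighted_normsq (g : R * R -> R[i]) : \bar R :=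
  (\int[leb2]_(z in strip) (`|z.1| * (Normc.normc (g z)) ^+ 2)%:E)%E.

(* g = F_1 A u.  The line integrals of a general u in L^2(R^2) diverge; since
   u |-> F_1 A u is isometric from L^2(R^2) to L^2(R x [0, pi], |r| dr dtheta),
   A is extended by continuity from L^1 `&` L^2, on which it is given by line
   integrals.  A u itself need not belong to L^2(R x [0, pi]). *)
Definition is_F1_radon (u g : R * R -> R[i]) :=
  [/\ L2 leb2 plane u, cmeasurable strip g,
      (weighted_normsq g < +oo)%E &
   exists u_ : nat -> R * R -> R[i],
   [/\ forall n, L1 leb2 plane (u_ n) /\ L2 leb2 plane (u_ n),
       L2cvg leb2 plane u_ u &
       weighted_normsq (fun z => fourier_integral (radon (u_ n)) z - g z)
         @[n --> \oo] --> 0%E]].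

Definition backprojection (f : R * R -> R[i]) (x : R * R) : R[i] :=
  cintegral leb `[0, pi] (fun theta =>
    f (x.1 * cos theta + x.2 * sin theta, theta)).

(* The domain and (up to a.e. equality) the values of the inverse of F_1. *)
Definition F1_invertible (g : R * R -> R[i]) := exists h, is_F1 h g.

Definition F1inv (g : R * R -> R[i]) : R * R -> R[i] :=
  xget (fun=> 0) [set h | is_F1 h g].

(* R(f; rho) as a function of fhat = F_1 f, through which alone it depends
   on f. *)
Definition FBP (fhat rho : R * R -> R[i]) : R * R -> R[i] :=
  backprojection (F1inv (fun z => rho z * fhat z)).

(* || u - R(f; rho) ||^2, with value +oo if rho * F_1 f is not in the domain
   L^2(R x [0, pi]) of the inverse of F_1.  This does not happen for f in
   L^2(R x [0, pi]) and essentially bounded rho. *)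
Definition sq_error (u fhat rho : R * R -> R[i]) : \bar R :=
  if `[< F1_invertible (fun z => rho z * fhat z) >]
  then L2normsq leb2 plane (fun x => u x - FBP fhat rho x)
  else +oo%E.

Definition ess_bounded_filter (rho : R * R -> R[i]) :=
  cmeasurable strip rho /\
  exists M : R, {ae leb2, forall z, strip z -> Normc.normc (rho z) <= M}.

Section RandomData.
Context dO (Omega : measurableType dO) (P : probability Omega R).
Variables (U : Omega -> R * R -> R[i]).

(* F is a jointly measurable version of the random function w |-> T (V w);
   its values at points (r, theta) are what the pointwise second moments
   refer to. *)
Definition measurable_version (T : (R * R -> R[i]) -> (R * R -> R[i]) -> Prop)
    (V : Omega -> R * R -> R[i]) (F : Omega * (R * R) -> R[i]) :=
  cmeasurable (setT `*` strip) F /\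
  {ae P, forall w, T (V w) (fun z => F (w, z))}.

(* E || U - R(A U + nu; rho) ||^2, where FAU = F_1 A U and Fnu = F_1 nu. *)
Definition expected_error (FAU Fnu : Omega * (R * R) -> R[i])
    (rho : R * R -> R[i]) : \bar R :=
  (\int[P]_w sq_error (U w) (fun z => (FAU (w, z) + Fnu (w, z))%R) rho)%E.

End RandomData.

(* Delta / (Pi |r|) --> +oo as |r| --> oo, uniformly in theta: a rate depending
   on theta would not make the filter |r| Pi / (Pi + Delta) essentially bounded
   in (r, theta).  Pi and Delta are determined up to null sets only, whence
   "almost every".  In \bar R one has x / 0 = +oo for x > 0. *)
Definition noise_dominates (Pi Delta : R * R -> \bar R) :=
  forall K : R, exists M : R, {ae leb2, forall z, strip z -> M <= `|z.1| ->
    (K%:E <= Delta z / (Pi z * `|z.1|%:E))%E}.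

(* At points where Delta = +oo the filter is 0, as x / +oo = 0 in \bar R. *)
Definition optimal_filter (Pi Delta : R * R -> \bar R) (z : R * R) : R :=
  `|z.1| * fine (Pi z / (Pi z + Delta z))%E.

End Tomography.

(* Main.v *)
Require Import Defs.
From HB Require Import structures.
From mathcomp Require Import all_boot all_order all_algebra.
From mathcomp Require Import complex.
From mathcomp Require Import all_classical all_reals all_analysis.
From mathcomp Require Import measurable_realfun ring lra.

Set Implicit Arguments.
Unset Strict Implicit.
Unset Printing Implicit Defensive.

Import Order.TTheory GRing.Theory Num.Theory.
Import numFieldNormedType.Exports.

Local Open Scope classical_set_scope.
Local Open Scope ring_scope.

(** Write a = F_1 A u, b = F_1 nu and fhat = a + b.  The theorem reduces to a
    pointwise quadratic minimization once the reconstruction error is moved to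
    the Fourier side, where it reads, for g = rho * fhat = F_1 h,
    [|| u - A^* h ||^2 = int_strip |r| | a - g / |r| |^2 dr dtheta]
    ([error_identity]).  Neither A u nor A^* h is square integrable in general,
    so this is proved by duality, separately in each direction.  For test
    functions phi with exponential decay, Fubini gives <A^* h, phi> = <h, A phi>
    ([backprojection_adjoint]), and the central slice theorem ([slice]) together
    with Parseval in polar coordinates ([ip_Pol], [F1_radon_parseval]) turns
    <u - A^* h, phi> into a pairing of the Fourier-side defect with F_2 phi.
    Truncations of u - A^* h are such test functions, which bounds the left side
    by the right one ([L2normsq_residual_le]); damped inverse transforms of
    truncations of the defect give the other bound ([L2normsq_defect_le]).
    Every square integrable g has such an h ([F1_surjective]); the basis of all
    this is the Plancherel identity on the line ([plancherel1]), obtained from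
    Poisson summability.

    Taking expectations, Tonelli leaves at each frequency the second moment of
    (1 - rho / |r|) a - (rho / |r|) b.  Its cross term E (a * conj b) vanishes almost
    everywhere: a and b are only defined up to null sets in (r, theta), so the
    values at a point are not functions of U and nu, but the plane Fourier
    coefficients of their localizations to bounded sets of frequencies are
    continuous linear functionals of U and nu, hence independent and centered,
    and Parseval in (r, theta) carries this back ([uncorrelated]).  Therefore the
    expected error is
    [int_strip |r| (|1 - tau|^2 Pi + |tau|^2 Delta)] with tau = rho / |r|,
    and the quadratic form under the integral is minimal exactly at
    tau = Pi / (Pi + Delta) ([pointwise_best], [pointwise_le],
    [pointwise_unique]).  The growth condition on the noise makes the resulting
    filter essentially bounded; together with the bound rhobar <= |r| it keeps
    rhobar * fhat square integrable, so that the error of rhobar is given by the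
    formula and is not infinite. *)

(** * Complex scalars as a Euclidean plane *)

Section ComplexDot.
Variable R : realType.
Implicit Types z w : R[i].

(** The real inner product of the plane; with it all L2 pairings are real integrals, and complex pairings are recovered by rotating one argument by i. *)
Definition cdot z w : R :=
  complex.Re z * complex.Re w + complex.Im z * complex.Im w.

Lemma normc_sq z : Normc.normc z ^+ 2 = cdot z z.
Proof.
case: z => a b; rewrite /cdot /= -!expr2 sqr_sqrtr //.
by rewrite addr_ge0 ?sqr_ge0.
Qed.

Lemma cdotC z w : cdot z w = cdot w z.
Proof. by rewrite /cdot; ring. Qed.

Lemma cdotDl z1 z2 w : cdot (z1 + z2) w = cdot z1 w + cdot z2 w.
Proof. by case: z1 z2 w => [? ?] [? ?] [? ?]; rewrite /cdot /=; ring. Qed.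

Lemma cdotNl z w : cdot (- z) w = - cdot z w.
Proof. by case: z w => [? ?] [? ?]; rewrite /cdot /=; ring. Qed.

Lemma cdotBl z1 z2 w : cdot (z1 - z2) w = cdot z1 w - cdot z2 w.
Proof. by rewrite cdotDl cdotNl. Qed.

Lemma cdotZl (a : R) z w : cdot (a%:C%C * z) w = a * cdot z w.
Proof. by case: z w => [? ?] [? ?]; rewrite /cdot /=; ring. Qed.

Lemma cdot0l w : cdot 0 w = 0.
Proof. by rewrite /cdot /= !mul0r addr0. Qed.

Lemma cdotMl u z w : cdot (u * z) w = cdot z (u^*%C * w).
Proof. by case: u z w => [? ?] [? ?] [? ?]; rewrite /cdot /=; ring. Qed.

Lemma cdot_ge0 z : 0 <= cdot z z.
Proof. by rewrite -normc_sq sqr_ge0. Qed.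

Lemma cdot_eq0 z : cdot z z = 0 -> z = 0.
Proof.
rewrite -normc_sq => /eqP; rewrite sqrf_eq0 => /eqP h.
exact: Normc.eq0_normc.
Qed.

Lemma cdotMM u z : cdot (u * z) (u * z) = cdot u u * cdot z z.
Proof. by case: u z => [? ?] [? ?]; rewrite /cdot /=; ring. Qed.

Lemma cdot_conj z : cdot z^*%C z^*%C = cdot z z.
Proof. by case: z => [? ?]; rewrite /cdot /=; ring. Qed.

Lemma cdotBB z w : cdot (z - w) (z - w) = cdot z z - 2 * cdot z w + cdot w w.
Proof. by case: z w => [? ?] [? ?]; rewrite /cdot /=; ring. Qed.

Lemma cdotDD_le z w : cdot (z + w) (z + w) <= 2 * cdot z z + 2 * cdot w w.
Proof.
suff : 0 <= cdot (z - w) (z - w).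
  by case: z w => [? ?] [? ?]; rewrite /cdot /= => ?; lra.
exact: cdot_ge0.
Qed.

Lemma cdotBB_le z w : cdot (z - w) (z - w) <= 2 * cdot z z + 2 * cdot w w.
Proof.
by have := cdotDD_le z (- w); rewrite !(cdotNl w) (cdotC w) cdotNl opprK.
Qed.

Lemma normr_cdot_le z w : `|cdot z w| <= (cdot z z + cdot w w) / 2.
Proof.
rewrite ler_norml; have := cdot_ge0 (z - w); have := cdot_ge0 (z + w).
case: z w => [? ?] [? ?]; rewrite /cdot /= => ? ?.
by apply/andP; split; lra.
Qed.

Lemma normc_ge0 z : 0 <= Normc.normc z.
Proof. by case: z => ? ?; exact: sqrtr_ge0. Qed.

Lemma normcV z : Normc.normc z = Num.sqrt (cdot z z) :> R.
Proof. by rewrite -normc_sq sqrtr_sqr ger0_norm ?normc_ge0. Qed.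

Lemma normr_cdot_leM z w : `|cdot z w| <= Normc.normc z * Normc.normc w.
Proof.
rewrite !normcV -sqrtrM ?cdot_ge0// -sqrtr_sqr ler_wsqrtr//.
case: z w => [a b] [c d]; rewrite /cdot /=.
rewrite -subr_ge0 [leRHS](_ : _ = (a * d - b * c) ^+ 2) ?sqr_ge0//; ring.
Qed.

Lemma Re_cdot z : complex.Re z = cdot z 1.
Proof. by case: z => ? ?; rewrite /cdot /=; ring. Qed.

Lemma Im_cdot z : complex.Im z = cdot z 'i%C.
Proof. by case: z => ? ?; rewrite /cdot /=; ring. Qed.

Lemma normr_Re_le z : `|complex.Re z| <= Normc.normc z.
Proof.
case: z => a b /=; rewrite -sqrtr_sqr ler_sqrt ?sqr_ge0 // ?lerDl ?sqr_ge0 //.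
by rewrite addr_ge0 ?sqr_ge0.
Qed.

Lemma normr_Im_le z : `|complex.Im z| <= Normc.normc z.
Proof.
case: z => a b /=; rewrite -sqrtr_sqr ler_sqrt ?sqr_ge0 // ?lerDr ?sqr_ge0 //.
by rewrite addr_ge0 ?sqr_ge0.
Qed.

Lemma normc_le_sum z : Normc.normc z <= `|complex.Re z| + `|complex.Im z|.
Proof.
have h : 0 <= `|complex.Re z| + `|complex.Im z| by rewrite addr_ge0.
rewrite normcV -[leRHS]ger0_norm// -sqrtr_sqr ler_wsqrtr// /cdot -!expr2.
rewrite -(real_normK (num_real (complex.Re z))).
rewrite -(real_normK (num_real (complex.Im z))).
have := mulr_ge0 (normr_ge0 (complex.Re z)) (normr_ge0 (complex.Im z)).
by nra.
Qed.

Lemma normcM' z w : Normc.normc (z * w) = Normc.normc z * Normc.normc w.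
Proof. exact: Normc.normcM. Qed.

Lemma complexP z w :
  complex.Re z = complex.Re w -> complex.Im z = complex.Im w -> z = w.
Proof. by case: z w => ? ? [? ?] /= -> ->. Qed.

End ComplexDot.

Lemma measurable_sqrt (R : realType) : measurable_fun setT (Num.sqrt : R -> R).
Proof. by apply: continuous_measurable_fun; exact: sqrt_continuous. Qed.

Section MeasurableComplex.
Context d (X : measurableType d) (R : realType).
Variable D : set X.
Implicit Types f g : X -> R[i].

Lemma cmeasurableD f g : cmeasurable D f -> cmeasurable D g ->
  cmeasurable D (fun x => f x + g x).
Proof.
move=> [a b] [c e]; split.
  rewrite (_ : (fun x => _) = (fun x => complex.Re (f x) + complex.Re (g x))).
    exact: measurable_funD.
  by apply/funext => x; case: (f x) (g x) => ? ? [].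
rewrite (_ : (fun x => _) = (fun x => complex.Im (f x) + complex.Im (g x))).
  exact: measurable_funD.
by apply/funext => x; case: (f x) (g x) => ? ? [].
Qed.

Lemma cmeasurableM f g : cmeasurable D f -> cmeasurable D g ->
  cmeasurable D (fun x => f x * g x).
Proof.
move=> [a b] [c e]; split.
  rewrite (_ : (fun x => _) = (fun x => complex.Re (f x) * complex.Re (g x)
     - complex.Im (f x) * complex.Im (g x))).
    by apply: measurable_funB; exact: measurable_funM.
  by apply/funext => x; case: (f x) (g x) => ? ? [].
rewrite (_ : (fun x => _) = (fun x => complex.Re (f x) * complex.Im (g x)
     + complex.Im (f x) * complex.Re (g x))).
  by apply: measurable_funD; exact: measurable_funM.
by apply/funext => x; case: (f x) (g x) => ? ? [].
Qed.

Lemma cmeasurable_real (f : X -> R) : measurable_fun D f ->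
  cmeasurable D (fun x => (f x)%:C%C).
Proof. by move=> ?; split. Qed.

Lemma cmeasurable_conj f : cmeasurable D f -> cmeasurable D (fun x => (f x)^*%C).
Proof.
move=> [a b]; split.
  rewrite (_ : (fun x => _) = (fun x => complex.Re (f x)))//.
  by apply/funext => x; case: (f x).
rewrite (_ : (fun x => _) = (fun x => - complex.Im (f x))).
  exact: measurable_funN.
by apply/funext => x; case: (f x).
Qed.

Lemma cmeasurableN f : cmeasurable D f -> cmeasurable D (fun x => - f x).
Proof.
move=> [a b]; split.
  rewrite (_ : (fun x => _) = (fun x => - complex.Re (f x))).
    exact: measurable_funN.
  by apply/funext => x; case: (f x).
rewrite (_ : (fun x => _) = (fun x => - complex.Im (f x))).
  exact: measurable_funN.
by apply/funext => x; case: (f x).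
Qed.

Lemma cmeasurableB f g : cmeasurable D f -> cmeasurable D g ->
  cmeasurable D (fun x => f x - g x).
Proof. by move=> mf mg; apply: cmeasurableD => //; exact: cmeasurableN. Qed.

Lemma cmeasurable_cst (c : R[i]) : cmeasurable D (fun=> c).
Proof. by split; exact: measurable_cst. Qed.

Lemma measurable_cdot f g : cmeasurable D f -> cmeasurable D g ->
  measurable_fun D (fun x => cdot (f x) (g x)).
Proof.
by move=> [a b] [c e]; apply: measurable_funD; exact: measurable_funM.
Qed.

Lemma measurable_normc f : cmeasurable D f ->
  measurable_fun D (fun x => Normc.normc (f x)).
Proof.
move=> mf; rewrite (_ : (fun x => _) =
    (Num.sqrt : R -> R) \o (fun x => cdot (f x) (f x))).
  apply: measurableT_comp; [exact: measurable_sqrt|exact: measurable_cdot].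
by apply/funext => x; rewrite normcV.
Qed.

End MeasurableComplex.

Lemma cmeasurable_comp d d' (X : measurableType d) (Y : measurableType d')
    (R : realType) (f : Y -> R[i]) (h : X -> Y) :
  cmeasurable setT f -> measurable_fun setT h ->
  cmeasurable setT (fun x => f (h x)).
Proof.
move=> [a b] mh; split.
  exact: (measurableT_comp a).
exact: (measurableT_comp b).
Qed.

(** * Square-integrable functions *)

Section L2Theory.
Context d (X : measurableType d) (R : realType).
Variables (mu : {measure set X -> \bar R}) (D : set X).
Hypothesis mD : measurable D.
Implicit Types f g h : X -> R[i].

Definition ip f g : R := \int[mu]_(x in D) cdot (f x) (g x).

Lemma L2normsqE f :
  L2normsq mu D f = (\int[mu]_(x in D) (cdot (f x) (f x))%:E)%E.
Proof. by apply: eq_integral => x _; rewrite normc_sq. Qed.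

Lemma integrable_cdot f g : L2 mu D f -> L2 mu D g ->
  mu.-integrable D (EFin \o (fun x => cdot (f x) (g x))).
Proof.
move=> [mf ff] [mg gg].
apply/integrableP; split.
  by apply/measurable_EFinP; exact: measurable_cdot.
rewrite L2normsqE in ff; rewrite L2normsqE in gg.
have mff : measurable_fun D (fun x => (cdot (f x) (f x))%:E).
  by apply/measurable_EFinP; exact: measurable_cdot.
have mgg : measurable_fun D (fun x => (cdot (g x) (g x))%:E).
  by apply/measurable_EFinP; exact: measurable_cdot.
apply: le_lt_trans (lte_add_pinfty ff gg).
rewrite -ge0_integralD//; first last.
- by move=> x _; rewrite lee_fin cdot_ge0.
- by move=> x _; rewrite lee_fin cdot_ge0.
apply: ge0_le_integral => //.
- apply: measurableT_comp => //; apply/measurable_EFinP; exact: measurable_cdot.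
- by apply: emeasurable_funD.
move=> x _ /=; rewrite lee_fin; apply: le_trans (normr_cdot_le _ _) _.
have := cdot_ge0 (f x); have := cdot_ge0 (g x); lra.
Qed.

Lemma L2normsq_fin f : L2 mu D f -> L2normsq mu D f = (ip f f)%:E.
Proof.
move=> Lf; rewrite L2normsqE /ip /Rintegral fineK//.
by apply: integrable_fin_num => //; have := integrable_cdot Lf Lf.
Qed.

Lemma ipC f g : ip f g = ip g f.
Proof. by apply: eq_Rintegral => x _; rewrite cdotC. Qed.

Lemma ip_ge0 f : 0 <= ip f f.
Proof. by apply: Rintegral_ge0 => x _; exact: cdot_ge0. Qed.

Lemma L2D f g : L2 mu D f -> L2 mu D g -> L2 mu D (fun x => f x + g x).
Proof.
move=> Lf Lg; have [mf ff] := Lf; have [mg gg] := Lg.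
split; first exact: cmeasurableD.
have If := integrable_cdot Lf Lf; have Ig := integrable_cdot Lg Lg.
rewrite L2normsqE.
have : mu.-integrable D (EFin \o
   (fun x => 2 * cdot (f x) (f x) + 2 * cdot (g x) (g x))).
  rewrite (_ : _ \o _ = (fun x => 2%:E * (cdot (f x) (f x))%:E)%E \+
     (fun x => 2%:E * (cdot (g x) (g x))%:E)%E)//.
  by apply: integrableD => //; apply: integrableZl.
move/(integrableP _ _ _) => [mh]; apply: le_lt_trans.
apply: ge0_le_integral => //.
- by move=> x _; rewrite lee_fin cdot_ge0.
- by apply/measurable_EFinP/measurable_cdot; exact: cmeasurableD.
- exact: measurableT_comp.
move=> x _ /=; rewrite lee_fin ger0_norm ?cdotDD_le//.
by rewrite addr_ge0// mulr_ge0// cdot_ge0.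
Qed.

(** Bounded multipliers preserve L2; scalings, truncations and dampings are instances. *)
Lemma L2M_bounded u f (C : R) : cmeasurable D u ->
  (forall x, D x -> cdot (u x) (u x) <= C) -> L2 mu D f ->
  L2 mu D (fun x => u x * f x).
Proof.
move=> mu_ uC Lf; have [mf ff] := Lf; split; first exact: cmeasurableM.
have If := integrable_cdot Lf Lf.
rewrite L2normsqE.
have : mu.-integrable D (EFin \o (fun x => `|C| * cdot (f x) (f x))).
  rewrite (_ : _ \o _ = (fun x => `|C|%:E * (cdot (f x) (f x))%:E)%E)//.
  by apply: integrableZl.
move/(integrableP _ _ _) => [mh]; apply: le_lt_trans.
apply: ge0_le_integral => //.
- by move=> x _; rewrite lee_fin cdot_ge0.
- by apply/measurable_EFinP/measurable_cdot; exact: cmeasurableM.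
- exact: measurableT_comp.
move=> x Dx /=; rewrite lee_fin cdotMM ger0_norm ?mulr_ge0 ?cdot_ge0//.
by rewrite ler_wpM2r ?cdot_ge0// (le_trans (uC _ Dx))// ler_norm.
Qed.

Lemma L2Z (c : R[i]) f : L2 mu D f -> L2 mu D (fun x => c * f x).
Proof.
by apply: (@L2M_bounded _ _ (cdot c c)) => //; exact: cmeasurable_cst.
Qed.

Lemma L2N f : L2 mu D f -> L2 mu D (fun x => - f x).
Proof.
move=> /(L2Z (-1)) Lf.
by rewrite (_ : (fun x => _) = (fun x => -1 * f x))//; apply/funext => x; rewrite mulN1r.
Qed.

Lemma L2B f g : L2 mu D f -> L2 mu D g -> L2 mu D (fun x => f x - g x).
Proof. by move=> Lf Lg; apply: L2D => //; exact: L2N. Qed.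

Lemma ipDl f g h : L2 mu D f -> L2 mu D g -> L2 mu D h ->
  ip (fun x => f x + g x) h = ip f h + ip g h.
Proof.
move=> Lf Lg Lh; rewrite /ip -RintegralD//; try exact: integrable_cdot.
by apply: eq_Rintegral => x _; rewrite cdotDl.
Qed.

Lemma ipBl f g h : L2 mu D f -> L2 mu D g -> L2 mu D h ->
  ip (fun x => f x - g x) h = ip f h - ip g h.
Proof.
move=> Lf Lg Lh; rewrite /ip -RintegralB//; try exact: integrable_cdot.
by apply: eq_Rintegral => x _; rewrite cdotBl.
Qed.

Lemma ipZl (a : R) f h : L2 mu D f -> L2 mu D h ->
  ip (fun x => a%:C%C * f x) h = a * ip f h.
Proof.
move=> Lf Lh; rewrite /ip -RintegralZl//; last exact: integrable_cdot.
by apply: eq_Rintegral => x _; rewrite cdotZl.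
Qed.

Lemma ipBB f g : L2 mu D f -> L2 mu D g ->
  ip (fun x => f x - g x) (fun x => f x - g x) = ip f f - 2 * ip f g + ip g g.
Proof.
move=> Lf Lg; have Lfg := L2B Lf Lg.
set F := (fun x => f x - g x).
have e h : L2 mu D h -> ip F h = ip f h - ip g h by exact: ipBl.
by rewrite e// (ipC f F) e// (ipC g F) e// (ipC g f); ring.
Qed.

Lemma ipDD f g : L2 mu D f -> L2 mu D g ->
  ip (fun x => f x + g x) (fun x => f x + g x) = ip f f + 2 * ip f g + ip g g.
Proof.
move=> Lf Lg; have Lfg := L2D Lf Lg.
set F := (fun x => f x + g x).
have e h : L2 mu D h -> ip F h = ip f h + ip g h by exact: ipDl.
by rewrite e// (ipC f F) e// (ipC g F) e// (ipC g f); ring.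
Qed.

(** The quadratic [ip (f - t g) (f - t g)] is nonnegative at its minimum in t. *)
Lemma ip_CS f g : L2 mu D f -> L2 mu D g -> ip f g ^+ 2 <= ip f f * ip g g.
Proof.
move=> Lf Lg.
have h (t : R) : 0 <= ip f f - 2 * t * ip f g + t ^+ 2 * ip g g.
  have Ltg := L2Z t%:C%C Lg.
  have := ip_ge0 (fun x => f x - t%:C%C * g x).
  rewrite ipBB//; set F := (fun x => t%:C%C * g x).
  have e h : L2 mu D h -> ip F h = t * ip g h by move=> ?; exact: ipZl.
  rewrite (ipC f F) !e// (ipC g F) e// (ipC g f).
  by move/le_trans; apply; rewrite le_eqVlt; apply/orP; left; apply/eqP; ring.
have gg := ip_ge0 g; have [g0|g0] := eqVneq (ip g g) 0.
  rewrite g0 mulr0; have h1 := h ((ip f f + 1) / (2 * ip f g)).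
  have [->|fg0] := eqVneq (ip f g) 0; first by rewrite expr0n.
  rewrite g0 mulr0 addr0 in h1.
  have e : 2 * ((ip f f + 1) / (2 * ip f g)) * ip f g = ip f f + 1 by field.
  by rewrite e in h1; lra.
have g1 : 0 < ip g g by rewrite lt_def g0.
have := h (ip f g / ip g g).
rewrite (_ : _ + _ = ip f f - ip f g ^+ 2 / ip g g); last by field.
by rewrite subr_ge0 ler_pdivrMr.
Qed.

Lemma L2cvgP (f_ : nat -> X -> R[i]) f :
  (forall n, L2 mu D (f_ n)) -> L2 mu D f -> L2cvg mu D f_ f <->
  ip (fun x => f_ n x - f x) (fun x => f_ n x - f x) @[n --> \oo] --> (0 : R).
Proof.
move=> Lf_ Lf; rewrite /L2cvg.
rewrite (_ : (fun n => L2normsq _ _ _) =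
  EFin \o (fun n => ip (fun x => f_ n x - f x) (fun x => f_ n x - f x))).
  by split=> [/fine_cvgP[_]|?] //; apply: cvg_EFin => //; exact: nearW.
by apply/funext => n /=; rewrite L2normsq_fin//; exact: L2B.
Qed.

Lemma cvg_sqr0 (u : nat -> R) : (fun n => u n ^+ 2) @ \oo --> (0 : R) ->
  u @ \oo --> (0 : R).
Proof.
move=> u2; apply/cvgr0Pnorm_lt => /= e e0.
have e20 : 0 < e ^+ 2 by rewrite exprn_gt0.
have /cvgr0Pnorm_lt/(_ _ e20) := u2.
by apply: filterS => n; rewrite normrX ltr_sqr ?nnegrE ?normr_ge0 ?ltW.
Qed.

(** Weak continuity along L2 limits, the device by which identities for integrable functions pass to their L2 closures. *)
Lemma ip_cvg (f_ : nat -> X -> R[i]) f g :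
  (forall n, L2 mu D (f_ n)) -> L2 mu D f -> L2 mu D g -> L2cvg mu D f_ f ->
  ip (f_ n) g @[n --> \oo] --> ip f g.
Proof.
move=> Lf_ Lf Lg /(L2cvgP Lf_ Lf) c0.
apply/subr_cvg0/cvg_sqr0.
apply: (@squeeze_cvgr _ _ _ _ (cst 0) (fun n => ip (fun x => f_ n x - f x) (fun x => f_ n x - f x) * ip g g)).
- apply: nearW => n /=; rewrite sqr_ge0/= -ipBl//.
  by apply: ip_CS => //; exact: L2B.
- exact: cvg_cst.
- by rewrite -[0](mul0r (ip g g)); apply: cvgMl.
Qed.

Lemma ip_norm_cvg (f_ : nat -> X -> R[i]) f :
  (forall n, L2 mu D (f_ n)) -> L2 mu D f -> L2cvg mu D f_ f ->
  ip (f_ n) (f_ n) @[n --> \oo] --> ip f f.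
Proof.
move=> Lf_ Lf Lc; have /(L2cvgP Lf_ Lf) c0 := Lc.
rewrite (_ : (fun n => _) = (fun n => ip (fun x => f_ n x - f x) (fun x => f_ n x - f x) + 2 * ip (f_ n) f - ip f f)); last first.
  by apply/funext => n; rewrite ipBB//; ring.
rewrite [X in _ --> X](_ : _ = 0 + 2 * ip f f - ip f f); last by ring.
apply: cvgB; last exact: cvg_cst.
by apply: cvgD => //; apply: cvgM; [exact: cvg_cst|exact: ip_cvg].
Qed.

End L2Theory.

(** * Changes of variables in the plane *)

Section MeasurabilityTools.
Context d (X : measurableType d) (R : realType).

Lemma measurable_set_le (u v : X -> R) : measurable_fun setT u ->
  measurable_fun setT v -> measurable [set x | u x <= v x].
Proof.
move=> mu mv; have /(_ measurableT [set true] I) := measurable_fun_ler mu mv.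
rewrite setTI (_ : _ @^-1` _ = [set x | u x <= v x])//.
Qed.

Lemma measurable_inv : measurable_fun setT (fun x : R => x^-1).
Proof.
rewrite (_ : setT = [set~ 0] `|` [set 0]); last by rewrite setUC setUv.
apply/measurable_funU => //; first exact: measurableC.
split; last first.
  by apply/measurable_fun_set1.
apply: open_continuous_measurable_fun.
  by rewrite openC; exact: closed_eq.
by move=> x /set_mem /= /eqP x0; exact: inv_continuous.
Qed.

Lemma measurable_funV (u : X -> R) : measurable_fun setT u ->
  measurable_fun setT (fun x => (u x)^-1).
Proof. by move=> mu; exact: (measurableT_comp measurable_inv). Qed.

Lemma measurable_tan : measurable_fun setT (@tan R).
Proof.
apply: measurable_funM.
  by apply: continuous_measurable_fun; exact: continuous_sin.
apply: (measurableT_comp measurable_inv).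
by apply: continuous_measurable_fun; exact: continuous_cos.
Qed.

Lemma measurable_atan : measurable_fun setT (@atan R).
Proof. by apply: continuous_measurable_fun => x; exact: continuous_atan. Qed.

End MeasurabilityTools.

Section RestrictedMeasure.
Context d (T : measurableType d) (R : realType).
Variables (mu : {measure set T -> \bar R}) (S : set T) (mS : measurable S).

Lemma ge0_integral_mrestr (g : T -> \bar R) : measurable_fun setT g ->
  (forall x, 0 <= g x)%E ->
  (\int[mrestr mu mS]_x g x = \int[mu]_(x in S) g x)%E.
Proof.
move=> mg g0; have mCS : measurable (~` S) by exact: measurableC.
have := @ge0_integral_setU _ _ _ (mrestr mu mS) S (~` S) mS mCS g.
rewrite setUv => -> //; last by apply/disj_setPS => x [].
rewrite [X in (_ + X)%E]null_set_integral//; first last.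
- transitivity (mu (~` S `&` S)); [by []|by rewrite setICl measure0].
- exact: measurable_funTS.
rewrite adde0; apply: eq_measure_integral => A mA AS.
transitivity (mu (A `&` S)); [by []|by rewrite setIidl].
Qed.

End RestrictedMeasure.

Section Affine.
Variable R : realType.
Notation leb := (@lebesgue_measure R).

Let affine (a b : R) : measurableTypeR R -> measurableTypeR R :=
  fun x => a * x + b.

Let measurable_affine a b : measurable_fun setT (affine a b).
Proof.
apply: measurable_funD; last exact: measurable_cst.
by apply: measurable_funM => //; exact: measurable_cst.
Qed.

Let push (a b : R) : {measure set (measurableTypeR R) -> \bar R} :=
  measure_function_pushforward__canonical__measure_function_Measure leb
    (measurable_affine a b).

Let affine_measure (a b : R) (a0 : a != 0) (A : set R) : measurable A ->
  leb A = mscale (NngNum (normr_ge0 a)) (push a b) A.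
Proof.
move=> mA.
apply: (@lebesgue_measure_unique R (mscale (NngNum (normr_ge0 a)) (push a b))) => //.
move=> X [[c e] _ <-].
transitivity (`|a|%:E * leb (affine a b @^-1` `]c, e]%classic))%E; last by [].
rewrite lebesgue_measure_itv/=.
have [a1|a1|a1] := ltgtP 0 a; last by rewrite a1 eqxx in a0.
- have -> : affine a b @^-1` `]c, e]%classic = `](c - b) / a, (e - b) / a]%classic.
    apply/seteqP; split => x /=; rewrite /affine !in_itv/= ltr_pdivrMr// ler_pdivlMr//;
      by rewrite ltrBlDr lerBrDr (mulrC x).
  rewrite lebesgue_measure_itv/= !lte_fin ltr_pM2r ?invr_gt0// ltrD2r.
  case: ifP => _; last by rewrite mule0.
  by rewrite -!EFinB -EFinM gtr0_norm//; congr EFin; field; exact: lt0r_neq0.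
have -> : affine a b @^-1` `]c, e]%classic = `[(e - b) / a, (c - b) / a[%classic.
  apply/seteqP; split => x /=; rewrite /affine !in_itv/= ler_ndivrMr// ltr_ndivlMr//;
    by rewrite ltrBlDr lerBrDr (mulrC x) andbC.
rewrite lebesgue_measure_itv/= !lte_fin ltr_nM2r ?invr_lt0// ltrD2r.
case: ifP => _; last by rewrite mule0.
by rewrite -!EFinB -EFinM ltr0_norm//; congr EFin; field.
Qed.

(** Uniqueness of Lebesgue measure among measures with the right values on intervals. *)
Lemma ge0_integral_affine (a b : R) (f : R -> \bar R) : a != 0 ->
  measurable_fun setT f -> (forall x, 0 <= f x)%E ->
  (\int[leb]_x f x = `|a|%:E * \int[leb]_x f (a * x + b)%R)%E.
Proof.
move=> a0 mf f0.
rewrite (eq_measure_integral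
  (mscale (NngNum (normr_ge0 a)) (push a b))); last first.
  by move=> A mA _; exact: affine_measure.
rewrite ge0_integral_mscale//=; congr (_ * _)%E.
by rewrite (ge0_integral_pushforward (measurable_affine a b)).
Qed.

Lemma ge0_integral_shift (b : R) (f : R -> \bar R) :
  measurable_fun setT f -> (forall x, 0 <= f x)%E ->
  (\int[leb]_x f (x + b)%R = \int[leb]_x f x)%E.
Proof.
move=> mf f0; rewrite [RHS](@ge0_integral_affine 1 b)// normr1 mul1e.
by apply: eq_integral => x _; rewrite mul1r.
Qed.

End Affine.

Section Plane.
Variable R : realType.
Notation leb := (@lebesgue_measure R).
Notation mu2 := (@leb2 R).
Implicit Types f : R * R -> \bar R.

Lemma leb2_tonelli1 f : measurable_fun setT f -> (forall z, 0 <= f z)%E ->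
  (\int[mu2]_z f z = \int[leb]_x \int[leb]_y f (x, y))%E.
Proof. exact: (@fubini_tonelli1 _ _ _ _ R leb leb f). Qed.

Lemma leb2_tonelli2 f : measurable_fun setT f -> (forall z, 0 <= f z)%E ->
  (\int[mu2]_z f z = \int[leb]_y \int[leb]_x f (x, y))%E.
Proof. exact: (@fubini_tonelli2 _ _ _ _ R leb leb f). Qed.

Lemma measurable_integral_fst f : measurable_fun setT f ->
  (forall z, 0 <= f z)%E -> measurable_fun setT (fun y => \int[leb]_x f (x, y))%E.
Proof. exact: (@measurable_fun_fubini_tonelli_G _ _ _ _ R leb f). Qed.

Lemma measurable_integral_snd f : measurable_fun setT f ->
  (forall z, 0 <= f z)%E -> measurable_fun setT (fun x => \int[leb]_y f (x, y))%E.
Proof. exact: (@measurable_fun_fubini_tonelli_F _ _ _ _ R leb f). Qed.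

Lemma eq_integral2 f g : (forall x y, f (x, y) = g (x, y)) ->
  (\int[mu2]_z f z = \int[mu2]_z g z)%E.
Proof.
by move=> h; rewrite (_ : f = g)//; apply/funext => -[x y].
Qed.

Lemma measurable_pair2 d (X : measurableType d) (u v : X -> R) :
  measurable_fun setT u -> measurable_fun setT v ->
  measurable_fun setT (fun x => (u x, v x)).
Proof. exact: measurable_fun_pair. Qed.

Lemma ge0_integral_swap f : measurable_fun setT f -> (forall z, 0 <= f z)%E ->
  (\int[mu2]_z f (z.2, z.1) = \int[mu2]_z f z)%E.
Proof.
move=> mf f0; rewrite leb2_tonelli1// ?leb2_tonelli2//.
apply: (measurableT_comp mf).
by apply: measurable_pair2; [exact: measurable_snd|exact: measurable_fst].
Qed.

Lemma ge0_integral_shear1 (a : R) f : measurable_fun setT f ->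
  (forall z, 0 <= f z)%E ->
  (\int[mu2]_z f (z.1 + a * z.2, z.2)%R = \int[mu2]_z f z)%E.
Proof.
move=> mf f0; rewrite [RHS]leb2_tonelli2// leb2_tonelli2; [| |by move=> z; exact: f0]; last first.
  apply: (measurableT_comp mf); apply: measurable_pair2; last exact: measurable_snd.
  by apply: measurable_funD => //; exact: measurable_funM.
apply: eq_integral => y _ /=; rewrite (@ge0_integral_shift _ _ (fun x => f (x, y)))//.
exact: measurableT_comp.
Qed.

Lemma ge0_integral_shear2 (a : R) f : measurable_fun setT f ->
  (forall z, 0 <= f z)%E ->
  (\int[mu2]_z f (z.1, z.2 + a * z.1)%R = \int[mu2]_z f z)%E.
Proof.
move=> mf f0; rewrite [RHS]leb2_tonelli1// leb2_tonelli1; [| |by move=> z; exact: f0]; last first.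
  apply: (measurableT_comp mf); apply: measurable_pair2; first exact: measurable_fst.
  by apply: measurable_funD => //; exact: measurable_funM.
apply: eq_integral => y _ /=; rewrite (@ge0_integral_shift _ _ (fun x => f (y, x)))//.
exact: measurableT_comp.
Qed.

Lemma ge0_integral_opp2 f : measurable_fun setT f ->
  (forall z, 0 <= f z)%E ->
  (\int[mu2]_z f (- z.1, - z.2)%R = \int[mu2]_z f z)%E.
Proof.
move=> mf f0; rewrite [RHS]leb2_tonelli1// leb2_tonelli1; [| |by move=> z; exact: f0]; last first.
  apply: (measurableT_comp mf); apply: measurable_pair2; exact: measurableT_comp.
have N (g : R -> \bar R) : measurable_fun setT g -> (forall x, 0 <= g x)%E ->
    (\int[leb]_x g (- x)%R = \int[leb]_x g x)%E.
  move=> mg g0; rewrite [RHS](@ge0_integral_affine _ (-1) 0)// ?oppr_eq0 ?oner_eq0//.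
  rewrite normrN1 mul1e; apply: eq_integral => x _; by rewrite mulN1r addr0.
rewrite -[RHS]N; first last.
- by move=> x; exact: integral_ge0.
- exact: measurable_fun_fubini_tonelli_F.
apply: eq_integral => y _ /=; rewrite (N (fun x => f (- y, x)))//.
exact: measurableT_comp.
Qed.

(** The frame used by the line integrals: (s, t) in rotated coordinates. *)
Definition rot (theta : R) (z : R * R) : R * R :=
  (z.1 * cos theta - z.2 * sin theta, z.1 * sin theta + z.2 * cos theta).

Lemma measurable_rot theta : measurable_fun setT (rot theta).
Proof.
apply: measurable_pair2.
  by apply: measurable_funB; apply: measurable_funM.
by apply: measurable_funD; apply: measurable_funM.
Qed.

(** A rotation is a product of three shears, and each shear is a family of one-dimensional translations. *)
Lemma ge0_integral_rot (theta : R) f : measurable_fun setT f ->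
  (forall z, 0 <= f z)%E ->
  (\int[mu2]_z f (rot theta z) = \int[mu2]_z f z)%E.
Proof.
move=> mf f0; rewrite /rot; have := cos2Dsin2 theta.
set c := cos theta; set s := sin theta => cs.
have [s0|s0] := eqVneq s 0.
  move: cs; rewrite s0 expr0n addr0 => /eqP; rewrite sqrf_eq1 => /orP[]/eqP ->.
    by apply: eq_integral2 => x y; rewrite /= !mulr0 !mulr1 subr0 add0r.
  rewrite -[RHS]ge0_integral_opp2//; apply: eq_integral2 => x y /=.
  by rewrite !mulr0 !mulrN1 subr0 add0r.
pose t := (1 - c) / s.
have m1 a : measurable_fun setT (fun z : R * R => (z.1 + a * z.2, z.2)).
  apply: measurable_pair2 => //.
  by apply: measurable_funD => //; exact: measurable_funM.
have m2 a : measurable_fun setT (fun z : R * R => (z.1, z.2 + a * z.1)).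
  apply: measurable_pair2 => //.
  by apply: measurable_funD => //; exact: measurable_funM.
rewrite -[RHS](ge0_integral_shear1 (- t))//.
rewrite -[RHS](ge0_integral_shear2 s (f := fun z => f (z.1 + - t * z.2, z.2)))//; last first.
  exact: (measurableT_comp mf).
rewrite -[RHS](ge0_integral_shear1 (- t) (f := fun z => f (z.1 + - t * (z.2 + s * z.1), z.2 + s * z.1)))//; last first.
  exact: (measurableT_comp (measurableT_comp mf (m1 (- t))) (m2 s)).
apply: eq_integral2 => x y /=; congr (f (_, _)); rewrite /t.
  have -> : y * s = y * ((1 - c ^+ 2) / s).
    by congr (_ * _); rewrite -cs [c ^+ 2 + _]addrC addrK expr2 mulfK.
  by field.
by field.
Qed.

End Plane.

Section TanSubstitution.
Variable R : realType.
Notation leb := (@lebesgue_measure R).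
Notation mu2 := (@leb2 R).

Let w (t : R) : R := cos t ^- 2.
Let Iv : set R := `]- (pi / 2), (pi / 2)[%classic.
Let S : set (R * R) := [set z | Iv z.1 /\ 0 <= z.2 <= w z.1].

Let measurable_w : measurable_fun setT w.
Proof.
apply: measurable_funV; apply: measurable_funX.
by apply: continuous_measurable_fun; exact: continuous_cos.
Qed.

Let w_ge0 t : 0 <= w t.
Proof. by rewrite invr_ge0 sqr_ge0. Qed.

Let measurable_S : measurable S.
Proof.
rewrite (_ : S = (fst @^-1` Iv) `&` ([set z | 0 <= z.2] `&` [set z | z.2 <= w z.1])).
  apply: measurableI.
    have := @measurable_fst _ _ (measurableTypeR R) (measurableTypeR R)
      measurableT Iv (measurable_itv _).
    by rewrite setTI.
  apply: measurableI; apply: measurable_set_le => //.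
  exact: (measurableT_comp measurable_w).
apply/seteqP; split => z /=; first by case=> ? /andP[].
by move=> [? [? ?]]; split => //; apply/andP.
Qed.

Let phi (z : measurableTypeR R * measurableTypeR R) : measurableTypeR R := tan z.1.

Let measurable_phi : measurable_fun setT phi.
Proof. exact: (measurableT_comp (@measurable_tan R)). Qed.

Let nu : {measure set (measurableTypeR R) -> \bar R} :=
  measure_function_pushforward__canonical__measure_function_Measure
    (mrestr mu2 measurable_S) measurable_phi.

Let section_S (G : R -> \bar R) : measurable_fun setT G ->
  (forall x, 0 <= G x)%E ->
  (\int[mu2]_(z in S) G (tan z.1) =
   \int[leb]_(t in Iv) ((w t)%:E * G (tan t)))%E.
Proof.
move=> mG G0; have mGt : measurable_fun setT (fun t => G (tan t)).
  exact: (measurableT_comp mG (@measurable_tan R)).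
rewrite integral_mkcond leb2_tonelli1; first last.
- by move=> z; rewrite patchE; case: ifP.
- apply/(measurable_restrictT _ measurable_S)/measurable_funTS.
  exact: (measurableT_comp mGt).
rewrite [RHS]integral_mkcond; apply: eq_integral => t _.
rewrite [RHS]patchE; case: ifPn => tI; last first.
  apply: integral0_eq => y _; rewrite patchE; case: ifPn => // /set_mem[/= It _].
  by rewrite mem_set in tI.
rewrite (_ : (fun y => _) = (fun=> G (tan t)) \_ `[0, w t]%classic).
  rewrite -integral_mkcond integral_cst//= lebesgue_measure_itv/= lte_fin.
  rewrite muleC; case: ifPn => [_|]; first by rewrite -EFinB subr0.
  by rewrite -leNgt => h; rewrite (@le_anti _ R (w t) 0)// h w_ge0.
apply/funext => y; rewrite !patchE; congr (if _ then _ else _).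
apply/idP/idP => /set_mem h; apply/mem_set; rewrite /= in_itv/= in h *.
  by case: h.
by split => //; exact: set_mem.
Qed.

Let nu_itv (c e : R) : c < e -> nu `]c, e]%classic = (e - c)%:E.
Proof.
move=> ce; have m1 : measurable (`]c, e]%classic : set R) by exact: measurable_itv.
transitivity (\int[mu2]_(z in S) (\1_(`]c, e]%classic) (tan z.1))%:E)%E.
  rewrite (_ : (fun z => _) = (fun z => (\1_(phi @^-1` `]c, e]%classic) z)%:E))//.
  rewrite integral_indic//.
  have := measurable_phi measurableT m1; by rewrite setTI.
rewrite (section_S (G := fun x => (\1_(`]c, e]%classic) x)%:E))//; last first.
  by apply/measurable_EFinP; exact: measurable_indic.
rewrite (_ : (fun t => _) = ((fun t => (w t)%:E) \_ (tan @^-1` `]c, e]%classic))); last first.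
  by apply/funext => t; rewrite epatch_indic.
rewrite -integral_mkcondr (_ : _ `&` _ = `]atan c, atan e]%classic); last first.
  apply/seteqP; split => t /=; rewrite !in_itv/=.
    move=> [It /andP[ct te]]; rewrite -(tanK It).
    by rewrite lt_atan// le_atan.
  move=> /andP[ct te]; have It : t \in `]- (pi / 2), (pi / 2)[.
    rewrite in_itv/= (lt_trans (atan_gtNpi2 c) ct)/=.
    exact: (le_lt_trans te (atan_ltpi2 e)).
  split => //; rewrite -(atanK c) -(atanK e); apply/andP; split.
    by rewrite ltr_tan// in_itv/= atan_gtNpi2 atan_ltpi2.
  by rewrite leNgt ltr_tan// ?in_itv/= ?atan_gtNpi2 ?atan_ltpi2// -leNgt.
have cos_neq0 t : t \in `[atan c, atan e] -> cos t != 0.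
  rewrite in_itv/= => /andP[ct te]; apply: lt0r_neq0; apply: cos_gt0_pihalf.
  by rewrite (lt_le_trans (atan_gtNpi2 c) ct) (le_lt_trans te (atan_ltpi2 e)).
rewrite integral_itv_obnd_cbnd; last first.
  by apply/measurable_EFinP; exact: measurable_funTS.
rewrite (@continuous_FTC2 _ _ tan) ?lt_atan//.
- by rewrite !atanK.
- apply: continuous_in_subspaceT => t /set_mem /cos_neq0 ct.
  apply: cvgV; first by rewrite sqrf_eq0.
  apply: (@continuous_comp _ _ _ cos (fun x => x ^+ 2)).
    exact: continuous_cos.
  exact: exprn_continuous.
- split.
  + by move=> t /subset_itv_oo_cc /cos_neq0; exact: derivable_tan.
  + apply: cvg_at_right_filter; apply: continuous_tan; apply: cos_neq0.
    by rewrite in_itv/= lexx ltW// lt_atan.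
  + apply: cvg_at_left_filter; apply: continuous_tan; apply: cos_neq0.
    by rewrite in_itv/= lexx ltW// lt_atan.
- move=> t /subset_itv_oo_cc /cos_neq0 ct.
  by rewrite derive1E; have [_ ->] := is_derive_tan ct.
Qed.

(** The substitution x = tan theta on an open half turn, the angular part of polar coordinates. *)
Lemma ge0_integral_tan (G : R -> \bar R) : measurable_fun setT G ->
  (forall x, 0 <= G x)%E ->
  (\int[leb]_(t in `](- (pi / 2))%R, (pi / 2)%R[) ((cos t ^- 2)%R%:E * G (tan t)) =
   \int[leb]_m G m)%E.
Proof.
move=> mG G0; rewrite -section_S// [RHS](eq_measure_integral nu); last first.
  move=> A mA _; apply: lebesgue_measure_unique => // _ [[c e] _ <-] /=.
  rewrite [LHS]lebesgue_measure_itv/= lte_fin.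
  case: ifPn => [ce|]; first by rewrite nu_itv.
  rewrite -leNgt => ec; rewrite set_itv_ge; last by rewrite bnd_simp -leNgt.
  by rewrite measure0.
have mGphi : measurable_fun setT (G \o phi) by exact: (measurableT_comp mG).
have h := @ge0_integral_pushforward _ _ _ _ R phi measurable_phi
  (mrestr mu2 measurable_S) setT G measurableT mG (fun y _ => G0 y).
rewrite preimage_setT in h.
have h' := ge0_integral_mrestr mu2 measurable_S mGphi (fun x => G0 _).
exact: (etrans (esym h') (esym h)).
Qed.

End TanSubstitution.

Section Polar.
Variable R : realType.
Notation leb := (@lebesgue_measure R).
Notation mu2 := (@leb2 R).
Implicit Types F : R * R -> \bar R.

Lemma measurable_strip : measurable (@strip R : set (measurableTypeR R * measurableTypeR R)).
Proof. by apply: measurableX => //; exact: measurable_itv. Qed.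

Lemma ge0_integral_strip F : measurable_fun (@strip R) F ->
  (forall z, strip z -> 0 <= F z)%E ->
  (\int[mu2]_(z in @strip R) F z = \int[leb]_(t in `[0%R, pi]) \int[leb]_r F (r, t))%E.
Proof.
move=> mF F0; rewrite integral_mkcond leb2_tonelli2; first last.
- by move=> z; rewrite patchE; case: ifPn => // /set_mem; exact: F0.
- exact/(measurable_restrictT _ measurable_strip).
rewrite [RHS]integral_mkcond; apply: eq_integral => t _.
rewrite [RHS]patchE; case: ifPn => tI.
  apply: eq_integral => r _; rewrite patchE mem_set//.
  by split => //; exact: set_mem.
apply: integral0_eq => r _; rewrite patchE; case: ifPn => // /set_mem[_ /= It].
by rewrite mem_set in tI.
Qed.

(** half a turn is the symmetry r |-> - r *)
Let integral_halfturn (H : R -> \bar R) : measurable_fun setT H ->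
  (forall t, 0 <= H t)%E -> (forall t, H (t + pi)%R = H t) ->
  (\int[leb]_(t in `[0%R, pi]) H t =
   \int[leb]_(t in `](- (pi / 2))%R, (pi / 2)%R[) H t)%E.
Proof.
move=> mH H0 Hpi; have pi0 := pi_gt0 R.
have mHS (A : set R) : measurable_fun A H by exact: measurable_funTS.
have -> : `[0%R, pi]%classic = `[0%R, pi / 2[%classic `|` `[pi / 2, pi]%classic :> set R.
  apply/seteqP; split => x /=; rewrite !in_itv/=.
    by move=> /andP[x0 xp]; case: (ltP x (pi / 2)) => h; [left|right]; rewrite ?x0 ?h ?xp.
  by case=> /andP[? ?]; apply/andP; split; lra.
have -> : `](- (pi / 2))%R, (pi / 2)%R[%classic =
    `[0%R, pi / 2[%classic `|` `](- (pi / 2))%R, 0%R[%classic :> set R.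
  apply/seteqP; split => x /=; rewrite !in_itv/=.
    by move=> /andP[x0 xp]; case: (ltP x 0) => h; [right|left]; rewrite ?x0 ?h ?xp.
  by case=> /andP[? ?]; apply/andP; split; lra.
rewrite [LHS]ge0_integral_setU; [|exact: measurable_itv|exact: measurable_itv|
  exact: mHS|by move=> x _; exact: H0|]; last first.
  by apply/disj_setPS => x /=; rewrite !in_itv/= => -[/andP[? ?] /andP[? ?]]; lra.
rewrite [RHS]ge0_integral_setU; [|exact: measurable_itv|exact: measurable_itv|
  exact: mHS|by move=> x _; exact: H0|]; last first.
  by apply/disj_setPS => x /=; rewrite !in_itv/= => -[/andP[? ?] /andP[? ?]]; lra.
congr (_ + _)%E.
rewrite -[LHS]integral_itv_obnd_cbnd// -[LHS]integral_itv_bndo_bndc//.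
rewrite [LHS]integral_mkcond -[LHS](@ge0_integral_shift _ pi); first last.
- by move=> x; rewrite patchE; case: ifP.
- by apply/(measurable_restrictT _ (measurable_itv _)); exact: mHS.
rewrite [RHS]integral_mkcond; apply: eq_integral => t _.
rewrite !patchE Hpi; congr (if _ then _ else _).
by apply/idP/idP => /set_mem /=; rewrite in_itv/= => /andP[? ?]; apply/mem_set;
  rewrite /= in_itv/=; apply/andP; split; lra.
Qed.

Lemma measurable_polar : measurable_fun setT
  (fun z : measurableTypeR R * measurableTypeR R => (z.1 * cos z.2, z.1 * sin z.2) : R * R).
Proof.
have mc : measurable_fun setT (@cos R).
  by apply: continuous_measurable_fun; exact: continuous_cos.
have ms : measurable_fun setT (@sin R).
  by apply: continuous_measurable_fun; exact: continuous_sin.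
apply: measurable_pair2; apply: measurable_funM => //.
  exact: (measurableT_comp mc).
exact: (measurableT_comp ms).
Qed.

(** Over theta in [0, pi] and r in R every point off the axis is met once. On vertical lines x is fixed and y = x tan theta, which reduces the formula to the tangent substitution and a scaling. *)
Lemma ge0_integral_polar F : measurable_fun setT F -> (forall z, 0 <= F z)%E ->
  (\int[mu2]_(z in @strip R) (`|z.1|%:E * F (z.1 * cos z.2, z.1 * sin z.2)%R) =
   \int[mu2]_z F z)%E.
Proof.
move=> mF F0.
have mn : measurable_fun setT (fun z : R * R => `|z.1|%:E).
  by apply/measurable_EFinP; exact: (measurableT_comp (@normr_measurable R setT)).
pose P z := (`|z.1|%:E * F (z.1 * cos z.2, z.1 * sin z.2)%R)%E.
have mP : measurable_fun setT P.
  by apply: emeasurable_funM => //; exact: (measurableT_comp mF measurable_polar).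
have P0 z : (0 <= P z)%E by rewrite mule_ge0.
rewrite ge0_integral_strip; [|exact: measurable_funTS|by move=> z _; exact: P0].
pose Q (z : R * R) := (`|z.1|%:E * F (z.1, z.1 * z.2)%R)%E.
have mQ : measurable_fun setT Q.
  apply: emeasurable_funM => //; apply: (measurableT_comp mF).
  by apply: measurable_pair2 => //; exact: measurable_funM.
have Q0 z : (0 <= Q z)%E by rewrite mule_ge0.
have mG : measurable_fun setT (fun m => \int[leb]_x Q (x, m))%E.
  exact: measurable_integral_fst.
rewrite (@integral_halfturn (fun t => \int[leb]_r P (r, t))%E); first last.
- move=> t; rewrite [RHS](@ge0_integral_affine _ (-1) 0) ?oppr_eq0 ?oner_eq0//.
    rewrite normrN1 mul1e; apply: eq_integral => r _; rewrite /P/= addr0.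
    by rewrite cosDpi sinDpi mulN1r normrN mulrN mulNr mulrN mulNr.
  by apply: (measurableT_comp mP); exact: pair2_measurable.
- by move=> t; exact: integral_ge0.
- exact: (measurable_integral_fst mP P0).
transitivity (\int[leb]_(t in `](- (pi / 2))%R, (pi / 2)%R[)
    ((cos t ^- 2)%R%:E * (\int[leb]_x Q (x, tan t))))%E.
  apply: eq_integral => t /set_mem /= tI.
  have ct : 0 < cos t by apply: cos_gt0_pihalf; rewrite in_itv/= in tI.
  rewrite (@ge0_integral_affine _ (cos t)^-1 0) ?invr_eq0 ?gt_eqF//; last first.
    by apply: (measurableT_comp mP); exact: pair2_measurable.
  have -> : (cos t ^- 2 = (cos t)^-1 * (cos t)^-1)%R by rewrite expr2 invfM.
  rewrite gtr0_norm ?invr_gt0// EFinM -muleA; congr (_ * _)%E.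
  rewrite -ge0_integralZl//; first last.
  - by rewrite lee_fin invr_ge0 ltW.
  - by apply: (measurableT_comp mQ); exact: pair2_measurable.
  apply: eq_integral => x _; rewrite /P /Q/= addr0 normrM gtr0_norm ?invr_gt0//.
  rewrite EFinM -muleA; congr (_ * (_ * F (_, _)))%E.
    by field; exact: lt0r_neq0.
  by rewrite /tan; field; exact: lt0r_neq0.
rewrite (@ge0_integral_tan _ (fun m => \int[leb]_x Q (x, m))%E)//; last first.
  by move=> m; exact: integral_ge0.
rewrite -leb2_tonelli2// !leb2_tonelli1//.
apply: ae_eq_integral => //.
- exact: (measurable_integral_snd mQ Q0).
- exact: measurable_integral_snd.
exists [set 0]; split => //; first exact: lebesgue_measure_set1.
move=> x /=; apply: contra_notP => /eqP x0 _.
rewrite [RHS](@ge0_integral_affine _ x 0)//; last first.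
  by apply: (measurableT_comp mF); exact: pair1_measurable.
rewrite -ge0_integralZl//; last first.
  apply: (measurableT_comp mF); apply: measurable_pair2 => //.
  by apply: measurable_funD => //; apply: measurable_funM.
by apply: eq_integral => m _; rewrite /Q/= addr0.
Qed.

End Polar.

(** * Real-valued Fubini and dominated convergence *)

Section ParametrizedIntegral.
Context d1 d2 (T1 : measurableType d1) (T2 : measurableType d2) (R : realType).
Variables (m1 : {sigma_finite_measure set T1 -> \bar R})
          (m2 : {sigma_finite_measure set T2 -> \bar R}).

Lemma measurable_Rintegral1 (f : T1 * T2 -> R) : measurable_fun setT f ->
  measurable_fun setT (fun x => \int[m2]_y f (x, y)).
Proof.
move=> mf; have mEf : measurable_fun setT (EFin \o f) by exact/measurable_EFinP.
apply: (measurableT_comp (fine_measurable _)) => //.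
rewrite (_ : (fun x => _) = (fun x => \int[m2]_y (EFin \o f)^\+ (x, y)) \-
   (fun x => \int[m2]_y (EFin \o f)^\- (x, y)))%E.
  apply: emeasurable_funB; apply: measurable_fun_fubini_tonelli_F => //.
    exact: measurable_funepos.
  exact: measurable_funeneg.
apply/funext=> x; rewrite [LHS]integralE.
by congr (_ - _)%E; apply: eq_integral => y _; rewrite ?funeposE ?funenegE.
Qed.

Lemma measurable_Rintegral2 (f : T1 * T2 -> R) : measurable_fun setT f ->
  measurable_fun setT (fun y => \int[m1]_x f (x, y)).
Proof.
move=> mf; have mEf : measurable_fun setT (EFin \o f) by exact/measurable_EFinP.
apply: (measurableT_comp (fine_measurable _)) => //.
rewrite (_ : (fun x => _) = (fun y => \int[m1]_x (EFin \o f)^\+ (x, y)) \-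
   (fun y => \int[m1]_x (EFin \o f)^\- (x, y)))%E.
  apply: emeasurable_funB; apply: measurable_fun_fubini_tonelli_G => //.
    exact: measurable_funepos.
  exact: measurable_funeneg.
apply/funext=> x; rewrite [LHS]integralE.
by congr (_ - _)%E; apply: eq_integral => y _; rewrite ?funeposE ?funenegE.
Qed.

End ParametrizedIntegral.

Section RealFubini.
Context d1 d2 (T1 : measurableType d1) (T2 : measurableType d2) (R : realType).
Variables (m1 : {sigma_finite_measure set T1 -> \bar R})
          (m2 : {sigma_finite_measure set T2 -> \bar R}).
Variable f : T1 * T2 -> R.
Hypothesis If : (m1 \x m2)%E.-integrable setT (EFin \o f).

Let fine_integrable d (T : measurableType d) (m : {measure set T -> \bar R})
    (F : T -> \bar R) : m.-integrable setT F ->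
  m.-integrable setT (EFin \o (fine \o F)) /\
  \int[m]_x fine (F x) = fine (\int[m]_x F x)%E.
Proof.
move=> IF; have mF := measurable_int _ IF.
have mFF : measurable_fun setT (EFin \o (fine \o F)).
  by apply/measurable_EFinP; apply: (measurableT_comp _ mF); exact: fine_measurable.
split.
  apply: (le_integrable measurableT mFF _ IF) => x _ /=.
  by case: (F x) => //=; rewrite normr0 leey.
rewrite /Rintegral; congr fine; apply: ae_eq_integral => //.
have := integrable_ae measurableT IF.
by apply: filterS => x h _ /=; rewrite fineK//; exact: h.
Qed.

Lemma Rfubini_ae1 :
  {ae m1, forall x, m2.-integrable setT (EFin \o (fun y => f (x, y)))}.
Proof. exact: ae_integrable1 If. Qed.

Lemma Rfubini_ae2 :
  {ae m2, forall y, m1.-integrable setT (EFin \o (fun x => f (x, y)))}.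
Proof. exact: ae_integrable2 If. Qed.

Let integrable_G : m2.-integrable setT (fubini_G m1 (EFin \o f)).
Proof.
have mf : measurable_fun setT (EFin \o f) := measurable_int _ If.
have mA : measurable_fun setT (fun y => \int[m1]_x `|(f (x, y))%:E|)%E.
  apply: (measurable_fun_fubini_tonelli_G (abse \o (EFin \o f))) => //=.
  exact: measurableT_comp.
apply: (@le_integrable _ _ _ _ _ measurableT _ (fun y => \int[m1]_x `|(f (x, y))%:E|)%E).
- exact: (measurable_fubini_G If).
- move=> y _; rewrite [leRHS]gee0_abs ?integral_ge0//.
  by apply: le_abse_integral => //; exact: (measurableT_comp mf).
apply/integrableP; split => //.
apply: le_lt_trans ((integrable21ltyP m1 m2 mf).1 If).
apply: ge0_le_integral => //; first exact: measurableT_comp.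
by move=> y _; rewrite gee0_abs// integral_ge0.
Qed.

Lemma Rfubini1 : \int[m1]_x \int[m2]_y f (x, y) = \int[(m1 \x m2)%E]_z f z.
Proof.
rewrite (proj2 (fine_integrable (integrable_fubini_F If))).
by rewrite integral12_prod_meas1.
Qed.

Lemma Rfubini2 : \int[m2]_y \int[m1]_x f (x, y) = \int[(m1 \x m2)%E]_z f z.
Proof.
rewrite (proj2 (fine_integrable (integrable_G))).
by rewrite integral21_prod_meas1.
Qed.

Lemma integrable_Rfubini1 :
  m1.-integrable setT (EFin \o (fun x => \int[m2]_y f (x, y))).
Proof. exact: (proj1 (fine_integrable (integrable_fubini_F If))). Qed.

Lemma integrable_Rfubini2 :
  m2.-integrable setT (EFin \o (fun y => \int[m1]_x f (x, y))).
Proof. exact: (proj1 (fine_integrable (integrable_G))). Qed.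

End RealFubini.

Section IntegralTools.
Context d (T : measurableType d) (R : realType).
Variable mu : {measure set T -> \bar R}.
Variable D : set T.
Hypothesis mD : measurable D.

Lemma Rdominated_convergence (f_ : nat -> T -> R) (f g : T -> R) :
  (forall n, measurable_fun D (f_ n)) ->
  measurable_fun D f ->
  (forall x, D x -> f_ ^~ x @ \oo --> f x) ->
  mu.-integrable D (EFin \o g) ->
  (forall n x, D x -> `|f_ n x| <= g x) ->
  mu.-integrable D (EFin \o f) /\
  \int[mu]_(x in D) f_ n x @[n --> \oo] --> \int[mu]_(x in D) f x.
Proof.
move=> mf_ mf f_f Ig fg.
have [|||||If _ c] := @dominated_convergence _ _ _ mu D mD
  (fun n x => (f_ n x)%:E) (EFin \o f) (EFin \o g).
- by move=> n; exact/measurable_EFinP.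
- exact/measurable_EFinP.
- apply: aeW => x Dx; apply: cvg_EFin; [exact: nearW|exact: f_f].
- by [].
- by apply: aeW => x n Dx /=; rewrite lee_fin fg.
split => //.
have fin := integrable_fin_num mD If.
by move: c; rewrite -(fineK fin) => /fine_cvgP[].
Qed.

Lemma ge0_integrableP (f : T -> R) : measurable_fun D f ->
  (forall x, D x -> 0 <= f x) ->
  mu.-integrable D (EFin \o f) <-> (\int[mu]_(x in D) (f x)%:E < +oo)%E.
Proof.
move=> mf f0; have e : (\int[mu]_(x in D) `|(f x)%:E| = \int[mu]_(x in D) (f x)%:E)%E.
  by apply: eq_integral => x /set_mem Dx; rewrite gee0_abs// lee_fin f0.
split=> [/integrableP[_]|h]; first by rewrite -e.
by apply/integrableP; split; [exact/measurable_EFinP|rewrite e].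
Qed.

Lemma Rle_integrable (f g : T -> R) : measurable_fun D f ->
  (forall x, D x -> `|f x| <= g x) -> mu.-integrable D (EFin \o g) ->
  mu.-integrable D (EFin \o f).
Proof.
move=> mf fg Ig; apply: (le_integrable mD _ _ Ig); first exact/measurable_EFinP.
by move=> x Dx /=; rewrite lee_fin (le_trans (fg _ Dx))// ler_norm.
Qed.

Lemma EFin_Rintegral (f : T -> R) : mu.-integrable D (EFin \o f) ->
  (\int[mu]_(x in D) f x)%:E = (\int[mu]_(x in D) (f x)%:E)%E.
Proof. by move=> If; rewrite fineK//; exact: integrable_fin_num. Qed.

End IntegralTools.

(** * Products and affine images of integrable functions *)

Section PlaneMeasure.
Variable R : realType.
Notation leb := (@lebesgue_measure R).

Lemma leb2_sigma_finite : sigma_finite setT (@leb2 R).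
Proof.
exists (fun n : nat => `[- n%:R, n%:R]%classic `*` `[- n%:R, n%:R]%classic).
  apply/esym/seteqP; split => // -[x y] _.
  have [n xn] : exists n : nat, Num.max `|x| `|y| <= n%:R.
    by exists (Num.truncn (Num.max `|x| `|y|)).+1; apply: ltW; exact: truncnS_gt.
  exists n => //=; rewrite !in_itv/= -!ler_norml.
  by move: xn; rewrite ge_max => /andP[].
move=> n; split; first by apply: measurableX; exact: measurable_itv.
rewrite /leb2 /= product_measure1E//=; try exact: measurable_itv.
rewrite lebesgue_measure_itv/=; case: ifP => _; last by rewrite mul0e.
by rewrite -EFinB -EFinM ltry.
Qed.

Definition plane_measure : set (measurableTypeR R * measurableTypeR R) -> \bar R :=
  (leb \x leb)%E.

HB.instance Definition _ := Measure.copy plane_measure (@leb2 R).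
HB.instance Definition _ :=
  @Measure_isSigmaFinite.Build _ _ _ plane_measure leb2_sigma_finite.

End PlaneMeasure.

Section ProductIntegral.
Context d1 d2 (T1 : measurableType d1) (T2 : measurableType d2) (R : realType).
Variables (m1 : {sigma_finite_measure set T1 -> \bar R})
          (m2 : {sigma_finite_measure set T2 -> \bar R}).

Lemma integrable_mul (a : T1 -> R) (b : T2 -> R) :
  m1.-integrable setT (EFin \o a) -> m2.-integrable setT (EFin \o b) ->
  (m1 \x m2)%E.-integrable setT (EFin \o (fun z => a z.1 * b z.2)).
Proof.
move=> Ia Ib.
have ma : measurable_fun setT a by apply/measurable_EFinP; exact: measurable_int Ia.
have mb : measurable_fun setT b by apply/measurable_EFinP; exact: measurable_int Ib.
have mab : measurable_fun setT (fun z : T1 * T2 => a z.1 * b z.2).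
  by apply: measurable_funM; [exact: (measurableT_comp ma)|exact: (measurableT_comp mb)].
apply/integrable12ltyP; first exact/measurable_EFinP.
have bb : (\int[m2]_y `|(b y)%:E|)%E \is a fin_num.
  by apply: integrable_fin_num => //; exact: integrable_abse.
rewrite (eq_integral (fun x => `|(a x)%:E| * \int[m2]_y `|(b y)%:E|)%E); last first.
  move=> x _; rewrite -ge0_integralZl//; last first.
    by apply: measurableT_comp => //; exact/measurable_EFinP.
  by apply: eq_integral => y _; rewrite /= normrM EFinM.
rewrite -(fineK bb) ge0_integralZr//; first last.
- by apply: fine_ge0; exact: integral_ge0.
- by apply: measurableT_comp => //; exact/measurable_EFinP.
have /integrableP[_ aa] := Ia.
apply: lte_mul_pinfty; [exact: integral_ge0| |by rewrite ltry].
by rewrite ge0_fin_numE ?integral_ge0.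
Qed.

Lemma Rintegral_mul (a : T1 -> R) (b : T2 -> R) :
  m1.-integrable setT (EFin \o a) -> m2.-integrable setT (EFin \o b) ->
  \int[(m1 \x m2)%E]_z (a z.1 * b z.2) = (\int[m1]_x a x) * (\int[m2]_y b y).
Proof.
move=> Ia Ib; rewrite -(Rfubini1 (integrable_mul Ia Ib))/= mulrC -RintegralZl//.
by apply: eq_Rintegral => x _; rewrite mulrC -RintegralZl.
Qed.

End ProductIntegral.

Section RealAffine.
Variable R : realType.
Notation leb := (@lebesgue_measure R).

Lemma measurable_affine (a b : R) : measurable_fun setT (fun x : R => a * x + b).
Proof.
apply: measurable_funD; last exact: measurable_cst.
by apply: measurable_funM => //; exact: measurable_cst.
Qed.

Lemma integrable_affine (a b : R) (f : R -> R) : a != 0 ->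
  leb.-integrable setT (EFin \o f) ->
  leb.-integrable setT (EFin \o (fun x => f (a * x + b))).
Proof.
move=> a0 /integrableP[mf ff]; apply/integrableP; split.
  exact: (measurableT_comp mf (measurable_affine a b)).
move: ff; rewrite (@ge0_integral_affine _ a b)//; last exact: measurableT_comp.
move=> h; have a1 : 0 < `|a| by rewrite normr_gt0.
by rewrite -(lte_pmul2l (z := `|a|%:E))// ?lte_fin// (lt_le_trans h)// gt0_muley ?lte_fin.
Qed.

Lemma Rintegral_affine (a b : R) (f : R -> R) : a != 0 ->
  leb.-integrable setT (EFin \o f) ->
  \int[leb]_x f x = `|a| * \int[leb]_x f (a * x + b).
Proof.
move=> a0 If; have Ifa := integrable_affine b a0 If.
have mf := measurable_int _ If.
rewrite /Rintegral integralE [in RHS]integralE.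
rewrite (@ge0_integral_affine _ a b (EFin \o f)^\+%E)//; last exact: measurable_funepos.
rewrite (@ge0_integral_affine _ a b (EFin \o f)^\-%E)//; last exact: measurable_funeneg.
have p1 := integrable_pos_fin_num measurableT Ifa.
have p2 := integrable_neg_fin_num measurableT Ifa.
have e1 : (\int[leb]_x (EFin \o f)^\+%E (a * x + b)%R = \int[leb]_x (EFin \o (fun x => f (a * x + b)%R))^\+%E x)%E.
  by apply: eq_integral => y _; rewrite ?funeposE.
have e2 : (\int[leb]_x (EFin \o f)^\-%E (a * x + b)%R = \int[leb]_x (EFin \o (fun x => f (a * x + b)%R))^\-%E x)%E.
  by apply: eq_integral => y _; rewrite ?funenegE.
rewrite e1 e2 -muleBr//; last by rewrite fin_num_adde_defr.
by rewrite fineM// fin_numB p1.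
Qed.

End RealAffine.

(** * The Poisson kernel *)

Section Poisson.
Variable R : realType.
Notation leb := (@lebesgue_measure R).

Definition poisson (e x : R) : R := 2 * e / (e ^+ 2 + (2 * pi * x) ^+ 2).


Let is_derive_lin (a x : R) : is_derive x 1 (fun r => a * r) a.
Proof.
have h : is_derive x 1 ( *%R a : R -> R) a.
  apply/is_derive1_caratheodory; exists (fun=> a); split => //.
    by move=> z; rewrite mulrBr.
  exact: cvg_cst.
exact: h.
Qed.

(** antiderivative of exp (- e r) (1 + cos (a r)) *)
Let prim (e a r : R) : R := - (e^-1 * expR (- e * r)) +
  (e ^+ 2 + a ^+ 2)^-1 * (expR (- e * r) * (a * sin (a * r) - e * cos (a * r))).

Let is_derive_prim (e a r : R) : 0 < e ->
  is_derive r 1 (prim e a) (expR (- e * r) * (1 + cos (a * r))).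
Proof.
move=> e0; have dE : is_derive r 1 (fun r => expR (- e * r)) (expR (- e * r) * - e).
  exact: (is_derive1_comp (is_derive_expR (- e * r)) (is_derive_lin (- e) r)).
have dS : is_derive r 1 (fun r => sin (a * r)) (cos (a * r) * a).
  exact: (is_derive1_comp (is_derive_sin (a * r)) (is_derive_lin a r)).
have dC : is_derive r 1 (fun r => cos (a * r)) (- sin (a * r) * a).
  exact: (is_derive1_comp (is_derive_cos (a * r)) (is_derive_lin a r)).
have dcst (c : R) : is_derive r 1 (fun _ : R => c) 0 by exact: is_derive_cst.
have d1 := is_deriveN (is_deriveM (dcst e^-1) dE).
have d2 := is_deriveM (dcst a) dS.
have d3 := is_deriveM (dcst e) dC.
have d4 := is_deriveM (dcst (e ^+ 2 + a ^+ 2)^-1) (is_deriveM dE (is_deriveB d2 d3)).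
have d5 := is_deriveD d1 d4.
apply: (is_derive_eq d5).
rewrite /GRing.scale/= ?scaler0 /=.
have ea : e ^+ 2 + a ^+ 2 != 0 by rewrite gt_eqF// ltr_pwDl ?sqr_ge0// exprn_gt0.
have e1 : e != 0 by rewrite gt_eqF.
set E := expR (- e * r); set S := sin (a * r); set C := cos (a * r).
transitivity (- (e^-1 * (E * - e) + E * 0) + ((e ^+ 2 + a ^+ 2)^-1 *
  (E * (a * (C * a) + S * 0 - (e * (- S * a) + C * 0)) +
   (a * S - e * C) * (E * - e)) + (E * (a * S - e * C)) * 0)); first by [].
by field; rewrite ea e1.
Qed.

Let cvg_prim (e a : R) : 0 < e -> prim e a r @[r --> +oo%R] --> (0 : R).
Proof.
move=> e0; pose C := e^-1 + `|(e ^+ 2 + a ^+ 2)^-1| * (`|a| + e).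
have cE : expR (- e * r) @[r --> +oo%R] --> (0 : R).
  have h : (e * r) @[r --> +oo%R] --> +oo%R.
    by apply: gt0_cvgMry => //; exact: cvg_id.
  have := cvg_comp _ _ h (@cvgr_expR R); apply: cvg_trans.
  by apply: near_eq_cvg; apply: nearW => r /=; rewrite mulNr.
apply: norm_cvg0.
apply: (@squeeze_cvgr _ _ _ _ (cst 0) (fun r => C * expR (- e * r))).
- apply: nearW => r /=; rewrite normr_ge0/= /prim.
  apply: le_trans (ler_normD _ _) _; rewrite normrN !normrM.
  have ei : 0 <= e^-1 by rewrite invr_ge0 ltW.
  rewrite !(ger0_norm (expR_ge0 _)) (ger0_norm ei).
  rewrite /C mulrDl; apply: lerD => //; rewrite -mulrA ler_wpM2l// mulrC ler_wpM2r ?expR_ge0//.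
  apply: le_trans (ler_normB _ _) _; rewrite !normrM (gtr0_norm e0).
  have s1 : `|sin (a * r)| <= 1 by rewrite ler_norml sin_geN1 sin_le1.
  have c1 : `|cos (a * r)| <= 1 by rewrite ler_norml cos_geN1 cos_le1.
  rewrite lerD//; first by rewrite ler_piMr.
  by rewrite ler_piMr// ltW.
- exact: cvg_cst.
- by rewrite -[X in _ --> X](mulr0 C); apply: cvgM => //; exact: cvg_cst.
Qed.

Let integral_expcos (e a : R) : 0 < e ->
  (\int[leb]_(r in `[0%R, +oo[) (expR (- e * r) * (1 + cos (a * r)))%:E =
   (e^-1 + e / (e ^+ 2 + a ^+ 2))%:E)%E.
Proof.
move=> e0; rewrite (@ge0_continuous_FTC2y _ _ (prim e a) 0 0).
- rewrite -EFinB /prim !mulr0 expR0 sin0 cos0; congr EFin.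
  have ea : e ^+ 2 + a ^+ 2 != 0 by rewrite gt_eqF// ltr_pwDl ?sqr_ge0// exprn_gt0.
  by field; rewrite ea gt_eqF.
- move=> x _; rewrite mulr_ge0 ?expR_ge0//; have := cos_geN1 (a * x); lra.
- apply: continuous_subspaceT => x; apply: cvgM.
    apply: (continuous_comp (f := fun r => - e * r) (g := expR)).
      exact: mulrl_continuous.
    exact: continuous_expR.
  apply: cvgD; first exact: cvg_cst.
  apply: (continuous_comp (f := fun r => a * r) (g := cos)).
    exact: mulrl_continuous.
  exact: continuous_cos.
- exact: cvg_prim.
- by move=> x _; have [] := is_derive_prim a x e0.
- apply: cvg_at_right_filter; apply: differentiable_continuous.
  by apply/derivable1_diffP; have [] := is_derive_prim a 0 e0.
- by move=> x _; rewrite derive1E; have [_ ->] := is_derive_prim a x e0.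
Qed.

Definition expabs (e r : R) : R := expR (- e * `|r|).

Lemma expabs_ge0 e r : 0 <= expabs e r. Proof. exact: expR_ge0. Qed.

Lemma expabs_le1 e r : 0 < e -> expabs e r <= 1.
Proof.
move=> e0; rewrite -expR0 ler_expR mulNr oppr_le0 mulr_ge0//.
exact: ltW.
Qed.

Lemma continuous_expabs e : continuous (expabs e).
Proof.
move=> x; apply: (continuous_comp (f := fun r => - e * `|r|) (g := expR)).
  apply: (continuous_comp (f := fun r : R => `|r|) (g := fun r => - e * r)).
    exact: norm_continuous.
  exact: mulrl_continuous.
exact: continuous_expR.
Qed.

Lemma measurable_expabs e : measurable_fun setT (expabs e).
Proof. by apply: continuous_measurable_fun; exact: continuous_expabs. Qed.

Lemma continuous_cosM (a : R) : continuous (fun r => cos (a * r)).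
Proof.
move=> x; apply: (continuous_comp (f := fun r => a * r) (g := cos)).
  exact: mulrl_continuous.
exact: continuous_cos.
Qed.

Lemma continuous_sinM (a : R) : continuous (fun r => sin (a * r)).
Proof.
move=> x; apply: (continuous_comp (f := fun r => a * r) (g := sin)).
  exact: mulrl_continuous.
exact: continuous_sin.
Qed.

Lemma norm_cos_le1 (x : R) : `|cos x| <= 1.
Proof. by rewrite ler_norml cos_geN1 cos_le1. Qed.

Lemma norm_sin_le1 (x : R) : `|sin x| <= 1.
Proof. by rewrite ler_norml sin_geN1 sin_le1. Qed.

Let integralT_expcos (e a : R) : 0 < e ->
  (\int[leb]_r (expabs e r * (1 + cos (a * r)))%:E =
   (2 * (e^-1 + e / (e ^+ 2 + a ^+ 2)))%:E)%E.
Proof.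
move=> e0; rewrite ge0_symfun_integralT.
- rewrite EFinM; congr (_ * _)%E; rewrite -integral_expcos// -set_itvcy.
  apply: eq_integral => r /set_mem /=; rewrite in_itv/= andbT => r0.
  by rewrite /expabs ger0_norm.
- move=> x; rewrite mulr_ge0 ?expR_ge0//; have := cos_geN1 (a * x); lra.
- move=> x; apply: cvgM; first exact: continuous_expabs.
  by apply: cvgD; [exact: cvg_cst|exact: continuous_cosM].
- by move=> x /=; rewrite /expabs normrN mulrN cosN.
Qed.

Lemma integral_expabs (e : R) : 0 < e ->
  (\int[leb]_r (expabs e r)%:E = (2 / e)%:E)%E.
Proof.
move=> e0; have := integralT_expcos 0 e0.
rewrite (eq_integral (fun r : measurableTypeR R => 2%:E * (expabs e r)%:E)%E); last first.
  by move=> r _; rewrite mul0r cos0 -EFinM mulrC.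
rewrite ge0_integralZl//; first last.
- by move=> x _; rewrite lee_fin expabs_ge0.
- by apply/measurable_EFinP; exact: measurable_expabs.
move/(congr1 (fun x => 2^-1%:E * x)%E); rewrite muleA -EFinM mulVf// mul1e => ->.
by rewrite -EFinM; congr EFin; field; rewrite gt_eqF.
Qed.

Lemma integrable_expabs (e : R) : 0 < e ->
  leb.-integrable setT (EFin \o expabs e).
Proof.
move=> e0; apply/(ge0_integrableP leb) => //; first exact: measurable_expabs.
  by move=> x _; exact: expabs_ge0.
by rewrite integral_expabs// ltry.
Qed.

Lemma integrable_expabsM (e : R) (c : R -> R) : 0 < e -> measurable_fun setT c ->
  (forall x, `|c x| <= 1) ->
  leb.-integrable setT (EFin \o (fun r => expabs e r * c r)).
Proof.
move=> e0 mc c1; apply: (Rle_integrable measurableT _ _ (integrable_expabs e0)) => //.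
  by apply: measurable_funM => //; exact: measurable_expabs.
by move=> x _; rewrite normrM ger0_norm ?expabs_ge0// ler_piMr ?expabs_ge0.
Qed.

Lemma Rintegral_expabs_cos (e x : R) : 0 < e ->
  \int[leb]_r (expabs e r * cos (2 * pi * x * r)) = poisson e x.
Proof.
move=> e0; set a := 2 * pi * x.
have mc : measurable_fun setT (fun r : R => cos (a * r)).
  by apply: continuous_measurable_fun; exact: continuous_cosM.
have Ic := integrable_expabsM e0 mc (fun r => norm_cos_le1 (a * r)).
have Ie := integrable_expabs e0.
have := integralT_expcos a e0; rewrite -(EFin_Rintegral (D := setT))//; last first.
  rewrite (_ : _ \o _ = (EFin \o expabs e) \+ (EFin \o (fun r => expabs e r * cos (a * r)))).
    exact: integrableD.
  by apply/funext => r /=; rewrite mulrDr mulr1.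
move=> [].
have -> : \int[leb]_r (expabs e r * (1 + cos (a * r))) =
    \int[leb]_r expabs e r + \int[leb]_r (expabs e r * cos (a * r)).
  rewrite -RintegralD//; apply: eq_Rintegral => r _.
  by rewrite mulrDr mulr1.
have -> : \int[leb]_r expabs e r = 2 / e by rewrite /Rintegral integral_expabs.
rewrite /poisson -/a => h; apply: (addrI (2 / e)); rewrite h.
have ea : e ^+ 2 + a ^+ 2 != 0 by rewrite gt_eqF// ltr_pwDl ?sqr_ge0// exprn_gt0.
by field; rewrite ea gt_eqF.
Qed.

Lemma Rintegral_expabs_sin (e x : R) : 0 < e ->
  \int[leb]_r (expabs e r * sin (2 * pi * x * r)) = 0.
Proof.
move=> e0; set a := 2 * pi * x.
have mc : measurable_fun setT (fun r : R => sin (a * r)).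
  by apply: continuous_measurable_fun; exact: continuous_sinM.
have Is := integrable_expabsM e0 mc (fun r => norm_sin_le1 (a * r)).
have := Rintegral_affine 0 (negbT (lt_eqF (ltrN10 R))) Is.
rewrite normrN1 mul1r.
have -> : \int[leb]_r (expabs e (-1 * r + 0) * sin (a * (-1 * r + 0))) =
    - 1 * \int[leb]_r (expabs e r * sin (a * r)).
  rewrite -RintegralZl//; apply: eq_Rintegral => r _.
  by rewrite addr0 mulN1r /expabs normrN mulrN sinN mulrN mulN1r.
by lra.
Qed.

Lemma poisson_ge0 e x : 0 < e -> 0 <= poisson e x.
Proof.
move=> e0; rewrite divr_ge0 ?addr_ge0 ?sqr_ge0// mulr_ge0//.
exact: ltW.
Qed.

Lemma measurable_poisson e : measurable_fun setT (poisson e).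
Proof.
apply: measurable_funM; first exact: measurable_cst.
apply: measurable_funV; apply: measurable_funD; first exact: measurable_cst.
by apply: measurable_funX; apply: measurable_funM => //; exact: measurable_cst.
Qed.

(** The substitution that turns the kernel into the derivative of arctangent. *)
Lemma integral_poisson e : 0 < e -> (\int[leb]_x (poisson e x)%:E = 1)%E.
Proof.
move=> e0; have pi0 := pi_gt0 R.
pose f (y : R) : R := (oneDsqr y)^-1.
have mf : measurable_fun setT f.
  apply: measurable_funV; apply: measurable_funD; first exact: measurable_cst.
  exact: measurable_funX.
have d0 y : 0 < oneDsqr y by exact: (lt_le_trans ltr01 (oneDsqr_ge1 y)).
have f0 y : (0 <= (f y)%:E)%E by rewrite lee_fin invr_ge0 ltW.
have h : (\int[leb]_y (f y)%:E = pi%:E)%E.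
  rewrite ge0_symfun_integralT.
  - rewrite -set_itvcy integral0y_oneDsqr -EFinM; congr EFin; by field.
  - by move=> x; exact: (f0 x).
  - move=> x; apply: cvgV; first by rewrite gt_eqF.
    exact: continuous_oneDsqr.
  - by move=> x /=; rewrite /f /oneDsqr sqrrN.
have a0 : 2 * pi / e != 0 :> R by rewrite gt_eqF// divr_gt0// mulr_gt0.
rewrite (@ge0_integral_affine _ (2 * pi / e) 0)//= in h; last exact/measurable_EFinP.
rewrite (eq_integral (fun x : measurableTypeR R => (pi^-1 * (2 * pi / e))%:E * (f (2 * pi / e * x + 0))%:E)%E); last first.
  move=> x _; rewrite -EFinM /f /oneDsqr /poisson addr0; congr EFin.
  have d1 : e ^+ 2 + (2 * pi * x) ^+ 2 != 0.
    by rewrite gt_eqF// ltr_pwDl ?sqr_ge0// exprn_gt0.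
  move: pi0 d1; move: (pi : R) => p p0 d1.
  have -> : 1 + (2 * p / e * x) ^+ 2 = (e ^+ 2 + (2 * p * x) ^+ 2) / e ^+ 2.
    by field; rewrite gt_eqF.
  by field; rewrite d1 !gt_eqF.
rewrite ge0_integralZl//; first last.
- by rewrite lee_fin mulr_ge0// ?divr_ge0 ?mulr_ge0 ?invr_ge0 ?ltW.
- by apply/measurable_EFinP; exact: (measurableT_comp mf (measurable_affine _ _)).
rewrite EFinM -muleA; rewrite gtr0_norm ?divr_gt0 ?mulr_gt0// in h.
by rewrite h -EFinM mulVf// gt_eqF.
Qed.

Lemma integrable_poisson e : 0 < e -> leb.-integrable setT (EFin \o poisson e).
Proof.
move=> e0; apply/(ge0_integrableP leb) => //; first exact: measurable_poisson.
  by move=> x _; exact: poisson_ge0.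
by rewrite integral_poisson// ltry.
Qed.

Lemma poissonN e x : poisson e (- x) = poisson e x.
Proof. by rewrite /poisson mulrN sqrrN. Qed.

(** the kernel for e is the unit kernel rescaled to width e *)
Lemma poisson_scale e x : 0 < e -> e * poisson e (e * x) = poisson 1 x.
Proof.
move=> e0; rewrite /poisson; move: (2 * pi : R) => p.
have d : 1 + (p * x) ^+ 2 != 0.
  by apply: lt0r_neq0; apply: ltr_wpDr => //; exact: sqr_ge0.
have -> : e ^+ 2 + (p * (e * x)) ^+ 2 = e ^+ 2 * (1 + (p * x) ^+ 2) by ring.
by rewrite expr1n; field; rewrite d gt_eqF.
Qed.

End Poisson.

(** * Continuity of translations in L2 *)

Lemma ge0_cvg0_le (R : realType) (u : nat -> \bar R) : (forall n, 0 <= u n)%E ->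
  (forall e : R, 0 < e -> \forall n \near \oo, (u n <= e%:E)%E) ->
  u @ \oo --> 0%E.
Proof.
move=> u0 h; apply/fine_cvgP; split.
  have := h 1 ltr01; apply: filterS => n un.
  by rewrite ge0_fin_numE// (le_lt_trans un)// ltry.
apply/cvgr0Pnorm_le => /= e e0; have := h e e0; apply: filterS => n un.
have ufin : u n \is a fin_num by rewrite ge0_fin_numE// (le_lt_trans un)// ltry.
by rewrite ger0_norm ?fine_ge0// -lee_fin fineK.
Qed.

Section Translation.
Variable R : realType.
Notation leb := (@lebesgue_measure R).
Implicit Types a g : R -> R.

Definition modulus a (y : R) : \bar R := (\int[leb]_t ((a (t + y) - a t) ^+ 2)%:E)%E.

Let msqE a : measurable_fun setT a -> measurable_fun setT (fun t => (a t ^+ 2)%:E).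
Proof. by move=> ma; apply/measurable_EFinP; exact: measurable_funX. Qed.

Let mshift a (y : R) : measurable_fun setT a -> measurable_fun setT (fun t : R => a (t + y)).
Proof.
move=> ma; apply: (measurableT_comp ma).
by apply: measurable_funD => //; exact: measurable_cst.
Qed.

Let sq_ge0 (x : R) : (0 <= (x ^+ 2)%:E)%E. Proof. by rewrite lee_fin sqr_ge0. Qed.

Lemma modulus_ge0 a y : (0 <= modulus a y)%E.
Proof. by apply: integral_ge0 => x _. Qed.

Lemma modulus_le a y : measurable_fun setT a ->
  (modulus a y <= 4%:E * \int[leb]_t (a t ^+ 2)%:E)%E.
Proof.
move=> ma; have may := mshift y ma.
rewrite [leRHS](_ : _ =
    (\int[leb]_t (2%:E * (a (t + y) ^+ 2)%:E + 2%:E * (a t ^+ 2)%:E))%E); last first.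
  rewrite ge0_integralD//; first last.
  - by apply: measurable_funeM; exact: msqE.
  - by move=> x _; rewrite mule_ge0.
  - by apply: measurable_funeM; exact: msqE.
  - by move=> x _; rewrite mule_ge0.
  rewrite !ge0_integralZl//; try exact: msqE.
  rewrite (@ge0_integral_shift _ y (fun t => (a t ^+ 2)%:E))//; last exact: msqE.
  rewrite -ge0_muleDl// -EFinD; congr (_%:E * _)%E; ring.
apply: ge0_le_integral => //.
- by apply: msqE; exact: measurable_funB.
- by apply: emeasurable_funD; apply: measurable_funeM; exact: msqE.
move=> t _; rewrite -!EFinM -EFinD lee_fin.
have := sqr_ge0 (a (t + y) + a t); nra.
Qed.

Lemma modulusD_le a g y : measurable_fun setT a -> measurable_fun setT g ->
  (modulus a y <= 2%:E * modulus g y +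
     8%:E * \int[leb]_t ((a t - g t) ^+ 2)%:E)%E.
Proof.
move=> ma mg; have mag : measurable_fun setT (fun t => a t - g t).
  exact: measurable_funB.
have h : (2%:E * modulus (fun t => (a t - g t)%R) y <=
    8%:E * \int[leb]_t ((a t - g t) ^+ 2)%:E)%E.
  have -> : 8 = 2 * 4 :> R by ring.
  by rewrite EFinM -muleA; apply: lee_wpmul2l => //; exact: modulus_le.
apply: (@le_trans _ _ (2%:E * modulus g y + 2%:E * modulus (fun t => (a t - g t)%R) y)%E); last first.
  exact: leeD2l.
have m1 : measurable_fun setT (fun t : R => ((g (t + y) - g t) ^+ 2)%:E).
  by apply: msqE; apply: measurable_funB => //; exact: mshift.
have m2 : measurable_fun setT (fun t : R => ((a (t + y) - g (t + y) - (a t - g t)) ^+ 2)%:E).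
  by apply: msqE; apply: measurable_funB => //; exact: (mshift y mag).
rewrite /modulus -!ge0_integralZl//.
rewrite -ge0_integralD//; first last.
- by apply: measurable_funeM.
- by move=> x _; rewrite mule_ge0.
- by apply: measurable_funeM.
- by move=> x _; rewrite mule_ge0.
apply: ge0_le_integral => //.
- by apply: msqE; apply: measurable_funB => //; exact: mshift.
- by apply: emeasurable_funD; apply: measurable_funeM.
move=> t _; rewrite -!EFinM -EFinD lee_fin.
set p := a _; set q := a _; set p' := g _; set q' := g _.
have := sqr_ge0 ((p' - q') - (p - p' - (q - q'))); nra.
Qed.

Section ContinuousOnInterval.
Variables (M : R) (c : R -> R).
Hypotheses (M0 : 0 < M) (cc : continuous c) (cM : forall x, `|c x| <= M).
Let E : set R := `[- M, M]%classic.
Let g := c \_ E.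

Let measurable_g : measurable_fun setT g.
Proof.
apply/(measurable_restrictT _ (measurable_itv _)); apply: measurable_funTS.
exact: continuous_measurable_fun.
Qed.

Let gM x : `|g x| <= M.
Proof. by rewrite /g patchE; case: ifP => // _; rewrite normr0 ltW. Qed.

Let continuous_g t : t != M -> t != - M -> {for t, continuous g}.
Proof.
move=> tM tNM.
have [tI|tI] := boolP (`|t| < M).
  have : \forall z \near t, c z = g z.
    have : \forall z \near t, `|z| < M.
      have /cvgr_lt := @norm_continuous _ R^o t; exact.
    apply: filterS => z zM; rewrite /g patchE mem_set// /E/= in_itv/=.
    by rewrite -ler_norml ltW.
  have gt : g t = c t.
    rewrite /g patchE mem_set// /E/= in_itv/=.
    by rewrite -ler_norml ltW.
  by move=> h; rewrite /prop_for /continuous_at gt; have := @cc t; apply: cvg_trans; exact: near_eq_cvg.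
have tM' : M < `|t|.
  rewrite lt_def leNgt tI andbT.
  by apply/eqP => h; move: tM tNM; case: (ger0P t) h => _ <-; rewrite ?opprK eqxx.
have z0 z : M < `|z| -> g z = 0.
  move=> Mz; rewrite /g patchE memNset// /E/= in_itv/= -ler_norml.
  by apply/negP; rewrite -ltNge.
have : \forall z \near t, 0 = g z.
  have : \forall z \near t, M < `|z|.
    have /cvgr_gt := @norm_continuous _ R^o t; exact.
  by apply: filterS => z /z0 ->.
move=> h; rewrite /prop_for /continuous_at z0//.
have h0 : (fun=> 0 : R) @ t --> (0 : R) by exact: cvg_cst.
move: h0; apply: cvg_trans; exact: near_eq_cvg.
Qed.

Lemma modulus_itv_cvg0 (y : nat -> R) (Y : R) : y @ \oo --> 0 ->
  (forall n, `|y n| <= Y) -> modulus g (y n) @[n --> \oo] --> 0%E.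
Proof.
move=> y0 yY; pose B : set R := `[- (M + Y), M + Y]%classic.
have mB : measurable B by exact: measurable_itv.
have [|||||_ _] := @dominated_convergence _ _ _ leb setT measurableT
  (fun n t => ((g (t + y n) - g t) ^+ 2)%:E) (cst 0)%E
  (fun t => ((2 * M) ^+ 2 * \1_B t)%:E).
- by move=> n; apply: msqE; apply: measurable_funB => //; exact: mshift.
- exact: measurable_cst.
- have n2 : leb.-negligible [set M; - M].
    exists [set M; - M]; split => //; last first.
      by rewrite countable_lebesgue_measure0//; apply: finite_set_countable; exact: finite_set2.
    by apply: measurableU.
  apply: negligibleS n2 => t /= h; apply: contrapT => /not_orP[tM tNM]; apply: h => _.
  have -> : (0 = (((g t - g t) ^+ 2)%:E : \bar R))%E by rewrite subrr expr0n.
  apply: cvg_EFin; first exact: nearW.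
  have cg : g (t + y n) @[n --> \oo] --> g t.
    have c1 : (t + y n) @[n --> \oo] --> t.
      by rewrite -[X in _ --> X]addr0; apply: cvgD => //; exact: cvg_cst.
    apply: (cvg_comp _ _ c1); apply: continuous_g; exact/eqP.
  have c2 : (g (t + y n) - g t) @[n --> \oo] --> g t - g t.
    by apply: cvgB => //; exact: cvg_cst.
  exact: (cvg_comp _ _ c2 (@exprn_continuous R 2 _)).
- rewrite (_ : (fun t => _) = (fun t => ((2 * M) ^+ 2)%:E * (\1_B t)%:E))%E//.
  by apply: integrableZl => //; exact: integrable_indic_itv.
- apply: aeW => t n _; rewrite gee0_abs// lee_fin.
  have := gM t; have := gM (t + y n); rewrite !ler_norml => /andP[? ?] /andP[? ?].
  rewrite indicE; case: (boolP (t \in B)) => tB; rewrite ?mulr1.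
    rewrite -subr_ge0; set p := g _; set q := g t.
    rewrite (_ : _ - _ = (2 * M - p + q) * (2 * M + p - q)); last by ring.
    by apply: mulr_ge0; rewrite /p /q; lra.
  have : g t = 0 /\ g (t + y n) = 0.
    move: tB => /negP tB; split; rewrite /g patchE memNset// /E/= in_itv/= => /andP[? ?];
      apply: tB; apply/mem_set; rewrite /B/= in_itv/=;
      have := yY n; rewrite ler_norml => /andP[? ?]; apply/andP; split; lra.
  by move=> [-> ->]; rewrite subr0 expr0n mulr0.
by rewrite integral_cst// mul0e.
Qed.

End ContinuousOnInterval.

Let truncation_cvg a : measurable_fun setT a ->
  leb.-integrable setT (EFin \o (fun t => a t ^+ 2)) ->
  forall e : R, 0 < e -> exists2 M : R, 0 < M &
    \int[leb]_t ((a t - (a \_ [set t | `|t| <= M /\ `|a t| <= M]) t) ^+ 2) < e.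
Proof.
move=> ma Ia e e0; pose B n : set R := [set t | `|t| <= n.+1%:R /\ `|a t| <= n.+1%:R].
have mB n : measurable (B n : set (measurableTypeR R)).
  rewrite (_ : B n = [set t | `|t| <= n.+1%:R] `&` [set t | `|a t| <= n.+1%:R])//.
  by apply: measurableI; apply: measurable_set_le => //; exact: measurableT_comp.
have maB n : measurable_fun setT (a \_ (B n)).
  by apply/(measurable_restrictT _ (mB n)); exact: measurable_funTS.
have [|||||_ c] := @Rdominated_convergence _ _ _ leb setT measurableT
  (fun n t => (a t - (a \_ (B n)) t) ^+ 2) (cst 0) (fun t => a t ^+ 2).
- by move=> n; apply: measurable_funX; apply: measurable_funB => //; exact: maB.
- exact: measurable_cst.
- move=> t _; pose N := Num.truncn (Num.max `|t| `|a t|).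
  have tN : Num.max `|t| `|a t| < N.+1%:R by exact: truncnS_gt.
  apply: cvg_near_cst; exists N => // n /= Nn.
  rewrite patchE mem_set ?subrr ?expr0n//; move: tN; rewrite gt_max => /andP[h1 h2].
  have hn : N.+1%:R <= n.+1%:R :> R by rewrite ler_nat ltnS.
  by split; apply: ltW; [exact: lt_le_trans h1 hn|exact: lt_le_trans h2 hn].
- exact: Ia.
- move=> n t _; rewrite ger0_norm ?sqr_ge0// patchE; case: ifP => _.
    by rewrite subrr expr0n sqr_ge0.
  by rewrite subr0.
move: c; rewrite Rintegral_cst// mul0r => /cvgr0Pnorm_lt/(_ _ e0)[N _ /(_ N (leqnn N))].
rewrite ger0_norm; last by apply: Rintegral_ge0 => x _; exact: sqr_ge0.
by move=> h; exists N.+1%:R.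
Qed.

(** Truncation, then approximation of the bounded part by a continuous function. *)
Lemma L2_approximation a : measurable_fun setT a ->
  leb.-integrable setT (EFin \o (fun t => a t ^+ 2)) ->
  forall e : R, 0 < e -> exists M : R, exists c : R -> R,
    [/\ 0 < M, continuous c, forall x, `|c x| <= M &
     (\int[leb]_t ((a t - (c \_ `[- M, M]%classic) t) ^+ 2)%:E <= e%:E)%E].
Proof.
move=> ma Ia e e0; have e4 : 0 < e / 4 by rewrite divr_gt0.
have [M M0 aM] := truncation_cvg ma Ia e4.
pose E : set R := `[- M, M]%classic.
have mE : measurable (E : set (measurableTypeR R)) by exact: measurable_itv.
have fE : (leb E < +oo)%E.
  by rewrite /E lebesgue_measure_itv/=; case: ifP => // _; rewrite -EFinB ltry.
set B : set R := [set t | _] in aM.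
have mB : measurable (B : set (measurableTypeR R)).
  rewrite (_ : B = [set t | `|t| <= M] `&` [set t | `|a t| <= M])//.
  by apply: measurableI; apply: measurable_set_le => //; exact: measurableT_comp.
pose b := a \_ B.
have mb : measurable_fun setT b.
  by apply/(measurable_restrictT _ mB); exact: measurable_funTS.
have bM x : `|b x| <= M.
  by rewrite /b patchE; case: ifPn => [/set_mem[]//|_]; rewrite normr0 ltW.
have bE x : ~ E x -> b x = 0.
  move=> nE; rewrite /b patchE memNset// => -[xM _]; apply: nE.
  by rewrite /E /= in_itv/= -ler_norml.
have Ib : leb.-integrable E (EFin \o b).
  apply: measurable_bounded_integrable => //; first exact: measurable_funTS.
  by exists M; split; [exact: num_real|move=> r Mr x _; exact: le_trans (bM x) (ltW Mr)].
have [g [cg Ig gb]] := approximation_continuous_integrable mE fE Ib.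
have d0 : 0 < e / (8 * M) by rewrite divr_gt0// mulr_gt0.
have /fine_cvgP[gfin /cvgr0Pnorm_lt/(_ _ d0)] := gb.
move=> gd; have [N _ /(_ N (leqnn N))[hfin hd]] := filterI gfin gd.
pose c x := Num.max (- M) (Num.min M (g N x)).
have cM x : `|c x| <= M.
  rewrite ler_norml /c le_max lexx/= ge_max ge_min lexx andbT/=.
  by rewrite -subr_ge0 opprK addr_ge0 ?ltW.
have cc : continuous c.
  move=> x; have cst (r : R) : {for x, continuous (fun=> r : R^o)} by exact: cvg_cst.
  exact: (continuous_max (cst (- M)) (continuous_min (cst M) (cg N x))).
exists M, c; split => //.
have mc : measurable_fun setT (c \_ E).
  apply/(measurable_restrictT _ mE); apply: measurable_funTS.
  exact: continuous_measurable_fun.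
have bc : (\int[leb]_t ((b t - (c \_ E) t) ^+ 2)%:E <= (e / 4)%:E)%E.
  rewrite (_ : (fun t => _) = (fun t => ((b t - c t) ^+ 2)%:E) \_ E); last first.
    apply/funext => t; rewrite !patchE; case: ifPn => // tE.
    by rewrite bE ?subr0 ?expr0n// => tE'; rewrite mem_set in tE.
  rewrite -integral_mkcond.
  apply: (@le_trans _ _ (\int[leb]_(t in E) ((2 * M)%:E * `|(b t - g N t)%:E|))%E).
    apply: ge0_le_integral => //.
    - apply/measurable_EFinP/measurable_funTS/measurable_funX.
      by apply: measurable_funB => //; exact: continuous_measurable_fun.
    - apply: measurable_funeM; apply: measurableT_comp => //.
      apply/measurable_EFinP/measurable_funTS.
      by apply: measurable_funB => //; exact: continuous_measurable_fun.
    move=> t _; rewrite -EFinM lee_fin.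
    have h1 : `|b t - c t| <= `|b t - g N t|.
      have := bM t; rewrite ler_norml => /andP[b1 b2].
      rewrite /c; case: (leP M (g N t)) => h.
        rewrite max_r; last by lra.
        by rewrite !ler0_norm; lra.
      by case: (leP (- M) (g N t)) => h2 //; rewrite !ger0_norm; lra.
    have h2 : `|b t - c t| <= 2 * M.
      have := bM t; have := cM t; have := ler_normB (b t) (c t); lra.
    rewrite -real_normK ?num_real// expr2.
    by apply: ler_pM.
  rewrite ge0_integralZl//; first last.
  - by rewrite lee_fin mulr_ge0// ltW.
  - apply: measurableT_comp => //; apply/measurable_EFinP/measurable_funTS.
    by apply: measurable_funB => //; exact: continuous_measurable_fun.
  rewrite -(fineK hfin) -EFinM lee_fin.
  move: hd; rewrite /= ger0_norm; last by apply: fine_ge0; exact: integral_ge0.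
  rewrite ltr_pdivlMr ?mulr_gt0// => hd; rewrite ler_pdivlMr//.
  by move: hd; set x := fine _ => hd; lra.
have mab : measurable_fun setT (fun t => ((a t - b t) ^+ 2)%:E).
  by apply: msqE; exact: measurable_funB.
have mbc : measurable_fun setT (fun t => ((b t - (c \_ E) t) ^+ 2)%:E).
  by apply: msqE; exact: measurable_funB.
have ab : (\int[leb]_t ((a t - b t) ^+ 2)%:E <= (e / 4)%:E)%E.
  rewrite -EFin_Rintegral ?lee_fin ?ltW//.
  apply: (Rle_integrable measurableT _ _ Ia); first by apply/measurable_EFinP.
  move=> t _; rewrite ger0_norm ?sqr_ge0// /b patchE; case: ifP => _.
    by rewrite subrr expr0n sqr_ge0.
  by rewrite subr0.
apply: (@le_trans _ _ (2%:E * (e / 4)%:E + 2%:E * (e / 4)%:E)%E); last first.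
  by rewrite -!EFinM -EFinD lee_fin; lra.
apply: (@le_trans _ _ (2%:E * \int[leb]_t ((a t - b t) ^+ 2)%:E +
    2%:E * \int[leb]_t ((b t - (c \_ E) t) ^+ 2)%:E)%E); last first.
  by apply: leeD; apply: lee_wpmul2l.
rewrite -!ge0_integralZl// -ge0_integralD//; first last.
- by apply: measurable_funeM.
- by move=> x _; rewrite mule_ge0.
- by apply: measurable_funeM.
- by move=> x _; rewrite mule_ge0.
apply: ge0_le_integral => //.
- by apply: msqE; exact: measurable_funB.
- by apply: emeasurable_funD; apply: measurable_funeM.
move=> t _; rewrite -!EFinM -EFinD lee_fin.
set p := a t; set q := b t; set r := _ t.
have := sqr_ge0 ((p - q) - (q - r)); nra.
Qed.

(** Uniform continuity settles continuous compactly supported functions, and the modulus is stable under small L2 perturbations. *)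
Lemma modulus_cvg0 a (y : nat -> R) (Y : R) : measurable_fun setT a ->
  leb.-integrable setT (EFin \o (fun t => a t ^+ 2)) ->
  y @ \oo --> 0 -> (forall n, `|y n| <= Y) -> modulus a (y n) @[n --> \oo] --> 0%E.
Proof.
move=> ma Ia y0 yY; apply: ge0_cvg0_le => [n|e e0]; first exact: modulus_ge0.
have e16 : 0 < e / 16 by rewrite divr_gt0.
have [M [c [M0 cc cM ac]]] := L2_approximation ma Ia e16.
have mc : measurable_fun setT (c \_ `[- M, M]%classic).
  apply/(measurable_restrictT _ (measurable_itv _)); apply: measurable_funTS.
  exact: continuous_measurable_fun.
have := modulus_itv_cvg0 M0 cc cM y0 yY.
have e4 : 0 < e / 4 by rewrite divr_gt0.
move=> /fine_cvgP[gfin /cvgr0Pnorm_lt/(_ _ e4) gd].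
apply: (filterS _ (filterI gfin gd)) => n [hfin].
rewrite /= ger0_norm; last by apply: fine_ge0; exact: modulus_ge0.
move=> hd; apply: le_trans (modulusD_le _ ma mc) _.
rewrite -(fineK hfin).
apply: (@le_trans _ _ (2%:E * (e / 4)%:E + 8%:E * (e / 16)%:E)%E).
  by apply: leeD; apply: lee_wpmul2l => //; rewrite lee_fin ltW.
by rewrite -!EFinM -EFinD lee_fin; lra.
Qed.

End Translation.

(** * Smoothing by the Poisson kernel *)

Section PoissonDefect.
Variable R : realType.
Notation leb := (@lebesgue_measure R).
Notation mu2 := (@leb2 R).
Implicit Types f : R -> R[i].

Definition cmodulus f (y : R) : \bar R :=
  (\int[leb]_t (cdot (f (t + y)%R - f t) (f (t + y)%R - f t))%:E)%E.

Let cmodulusE f y : cmeasurable setT f -> cmodulus f y =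
  (modulus (fun t => complex.Re (f t)) y + modulus (fun t => complex.Im (f t)) y)%E.
Proof.
move=> [mr mi]; have sh (a : R -> R) : measurable_fun setT a ->
    measurable_fun setT (fun t : R => (((a (t + y) - a t) ^+ 2)%:E)).
  move=> ma; apply/measurable_EFinP/measurable_funX/measurable_funB => //.
  apply: (measurableT_comp ma).
  by apply: measurable_funD => //; exact: measurable_cst.
rewrite /modulus -ge0_integralD//; first last.
- exact: sh.
- by move=> x _; rewrite lee_fin sqr_ge0.
- exact: sh.
- by move=> x _; rewrite lee_fin sqr_ge0.
apply: eq_integral => t _; rewrite -EFinD; congr EFin.
by case: (f (t + y)) (f t) => ? ? [? ?]; rewrite /cdot /= -!expr2.
Qed.

Let measurable_parts f : cmeasurable setT f ->
  measurable_fun setT (fun t => (complex.Re (f t) ^+ 2)%:E) /\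
  measurable_fun setT (fun t => (complex.Im (f t) ^+ 2)%:E).
Proof. by move=> [? ?]; split; apply/measurable_EFinP; exact: measurable_funX. Qed.

Let normsq_parts f : cmeasurable setT f -> L2normsq leb setT f =
  (\int[leb]_t (complex.Re (f t) ^+ 2)%:E + \int[leb]_t (complex.Im (f t) ^+ 2)%:E)%E.
Proof.
move=> mf; have [mr mi] := measurable_parts mf.
by rewrite L2normsqE -ge0_integralD//; move=> x _; rewrite lee_fin sqr_ge0.
Qed.

Let integrable_parts f : L2 leb setT f ->
  leb.-integrable setT (EFin \o (fun t => complex.Re (f t) ^+ 2)) /\
  leb.-integrable setT (EFin \o (fun t => complex.Im (f t) ^+ 2)).
Proof.
move=> Lf; have [mf _] := Lf; have [mr mi] := mf.
have := integrable_cdot measurableT Lf Lf.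
by move=> If; split; apply: (Rle_integrable measurableT _ _ If);
  rewrite ?ger0_norm ?sqr_ge0//; try (exact: measurable_funX);
  move=> x _; rewrite ger0_norm ?sqr_ge0// /cdot -!expr2 ?lerDl ?lerDr ?sqr_ge0.
Qed.

Lemma cmodulus_le f y : cmeasurable setT f ->
  (cmodulus f y <= 4%:E * L2normsq leb setT f)%E.
Proof.
move=> mf; have [mr mi] := mf; rewrite cmodulusE// normsq_parts//.
rewrite ge0_muleDr; [|by apply: integral_ge0 => x _; rewrite lee_fin sqr_ge0..].
by apply: leeD; exact: modulus_le.
Qed.

Lemma cmodulus_ge0 f y : (0 <= cmodulus f y)%E.
Proof. by apply: integral_ge0 => x _; rewrite lee_fin cdot_ge0. Qed.

Lemma cmodulus_cvg0 f (y : nat -> R) (Y : R) : L2 leb setT f ->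
  y @ \oo --> 0 -> (forall n, `|y n| <= Y) -> cmodulus f (y n) @[n --> \oo] --> 0%E.
Proof.
move=> Lf y0 yY; have [mf _] := Lf; have [mr mi] := mf.
have [Ir Ii] := integrable_parts Lf.
rewrite (_ : (fun n => _) = (fun n => modulus (fun t => complex.Re (f t)) (y n) +
   modulus (fun t => complex.Im (f t)) (y n)))%E; last first.
  by apply/funext => n; rewrite cmodulusE.
by rewrite -[X in _ --> X]add0e; apply: cvgeD => //; exact: modulus_cvg0 yY.
Qed.

Definition poisson_defect (e : R) f : \bar R :=
  (\int[mu2]_z (cdot (f z.1 - f z.2) (f z.1 - f z.2) * poisson e (z.1 - z.2))%:E)%E.

Let mshift f : cmeasurable setT f ->
  measurable_fun setT (fun z : R * R => cdot (f (z.2 + z.1) - f z.2) (f (z.2 + z.1) - f z.2)).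
Proof.
move=> mf; have mS : measurable_fun setT (fun z : R * R => z.2 + z.1).
  by apply: measurable_funD.
have m1 : cmeasurable setT (fun z : R * R => f (z.2 + z.1) - f z.2).
  apply: cmeasurableB; first exact: (cmeasurable_comp mf mS).
  exact: (cmeasurable_comp mf (@measurable_snd _ _ _ _)).
exact: measurable_cdot.
Qed.

Lemma poisson_defectE e f : 0 < e -> cmeasurable setT f ->
  poisson_defect e f = (\int[leb]_u ((poisson 1 u)%:E * cmodulus f (e * u)%R))%E.
Proof.
move=> e0 mf; have mp e' := @measurable_poisson R e'.
pose F (z : R * R) := (cdot (f (z.2 + z.1)%R - f z.2) (f (z.2 + z.1)%R - f z.2) *
  poisson e z.1)%:E.
have mF : measurable_fun setT F.
  apply/measurable_EFinP/measurable_funM; first exact: mshift.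
  exact: (measurableT_comp (mp e)).
have F0 z : (0 <= F z)%E by rewrite lee_fin mulr_ge0 ?cdot_ge0 ?poisson_ge0.
rewrite /poisson_defect leb2_tonelli2; first last.
- by move=> z; rewrite lee_fin mulr_ge0 ?cdot_ge0 ?poisson_ge0.
- apply/measurable_EFinP/measurable_funM.
    have m1 : cmeasurable setT (fun z : R * R => f z.1 - f z.2).
      apply: cmeasurableB; first exact: (cmeasurable_comp mf (@measurable_fst _ _ _ _)).
      exact: (cmeasurable_comp mf (@measurable_snd _ _ _ _)).
    exact: measurable_cdot.
  apply: (measurableT_comp (mp e)); exact: measurable_funB.
transitivity (\int[leb]_t \int[leb]_y F (y, t))%E.
  apply: eq_integral => t _.
  rewrite -(@ge0_integral_shift _ t) /=; first last.
  - by move=> z; rewrite lee_fin mulr_ge0 ?cdot_ge0 ?poisson_ge0.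
  - apply/measurable_EFinP/measurable_funM.
      have m1 : cmeasurable setT (fun z : R => f z - f t).
        by apply: cmeasurableB => //; exact: cmeasurable_cst.
      exact: measurable_cdot.
    by apply: (measurableT_comp (mp e)); apply: measurable_funB.
  by apply: eq_integral => y _; rewrite /F/= addrK (addrC t).
rewrite -leb2_tonelli2; [|exact: mF|exact: F0].
rewrite leb2_tonelli1; [|exact: mF|exact: F0].
rewrite (@ge0_integral_affine _ e 0); first last.
- by move=> y; apply: integral_ge0 => x _; exact: F0.
- exact: measurable_integral_snd.
- by rewrite gt_eqF.
have mcm y : measurable_fun setT
    (fun t : R => (cdot (f (t + y) - f t) (f (t + y) - f t))%:E).
  apply/measurable_EFinP.
  exact: (measurableT_comp (mshift mf) (@pair1_measurable _ _ _ _ y)).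
rewrite -ge0_integralZl//; first last.
- by move=> x _; apply: integral_ge0 => y _; exact: F0.
- apply: (measurableT_comp (measurable_integral_snd mF F0)).
  exact: measurable_affine.
apply: eq_integral => u _; rewrite addr0 gtr0_norm//.
rewrite -(poisson_scale u e0) EFinM -muleA; congr (_ * _)%E.
have cp := @poisson_ge0 R e (e * u) e0.
rewrite /cmodulus -ge0_integralZl_EFin//; last exact: mcm.
  by apply: eq_integral => t _; rewrite /F /= EFinM muleC.
by move=> x _; rewrite lee_fin cdot_ge0.
Qed.

(** The Poisson kernel is a unit mass concentrating at 0, so averaging the translation modulus against it tends to 0. *)
Lemma poisson_defect_cvg0 f : L2 leb setT f ->
  poisson_defect n.+1%:R^-1 f @[n --> \oo] --> 0%E.
Proof.
move=> Lf; have [mf ff] := Lf.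
have e0 n : 0 < n.+1%:R^-1 :> R by rewrite invr_gt0.
rewrite (_ : (fun n => _) = (fun n => \int[leb]_u
    ((poisson 1 u)%:E * cmodulus f (n.+1%:R^-1 * u)%R))%E); last first.
  by apply/funext => n; exact: poisson_defectE.
have Lfin : L2normsq leb setT f \is a fin_num.
  by rewrite L2normsq_fin.
pose C := fine (L2normsq leb setT f).
have mcm : measurable_fun setT (cmodulus f).
  rewrite /cmodulus; apply: (@measurable_integral_snd _ (fun z =>
    (cdot (f (z.2 + z.1)%R - f z.2) (f (z.2 + z.1)%R - f z.2))%:E)).
    by apply/measurable_EFinP; exact: mshift.
  by move=> z; rewrite lee_fin cdot_ge0.
have mp : measurable_fun setT (fun u : R => (poisson 1 u)%:E).
  by apply/measurable_EFinP; exact: measurable_poisson.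
have mn n : measurable_fun setT
    (fun u : R => ((poisson 1 u)%:E * cmodulus f (n.+1%:R^-1 * u)%R)%E).
  apply: emeasurable_funM => //; apply: (measurableT_comp mcm).
  by apply: measurable_funM => //; exact: measurable_cst.
have p0 u : (0 <= (poisson 1 u)%:E :> \bar R)%E by rewrite lee_fin poisson_ge0.
have [|||||_ _] := @dominated_convergence _ _ _ leb setT measurableT
  (fun n u => ((poisson 1 u)%:E * cmodulus f (n.+1%:R^-1 * u)%R)%E) (cst 0)%E
  (fun u => (4 * C)%:E * (poisson 1 u)%:E)%E.
- exact: mn.
- exact: measurable_cst.
- apply: aeW => u _; rewrite -(mule0 (poisson 1 u)%:E).
  apply: cvgeZl => //; apply: (@cmodulus_cvg0 _ _ `|u|) => //.
    rewrite -[X in _ --> X](mul0r u); apply: cvgM; last exact: cvg_cst.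
    exact: cvg_harmonic.
  move=> n; rewrite normrM ler_piMl// ger0_norm ?invr_ge0//.
  by rewrite invf_le1// ler1n.
- apply: integrableZl => //; exact: integrable_poisson.
- apply: aeW => u n _; rewrite gee0_abs ?mule_ge0 ?cmodulus_ge0//.
  rewrite muleC; apply: lee_wpmul2r => //.
  apply: le_trans (cmodulus_le _ mf) _.
  by rewrite EFinM /C fineK.
by rewrite integral0.
Qed.

End PoissonDefect.

(** * Complex integrals and the Plancherel identity on the line *)

Section ComplexIntegral.
Context d (X : measurableType d) (R : realType).
Variable mu : {measure set X -> \bar R}.
Implicit Types f g u : X -> R[i].

Lemma L1P f : L1 mu setT f <-> cmeasurable setT f /\
  mu.-integrable setT (EFin \o (fun x => Normc.normc (f x) : R)).
Proof.
split=> -[mf h]; split => //.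
  apply/(ge0_integrableP mu) => //; first exact: measurable_normc.
  by move=> x _; exact: normc_ge0.
apply/(ge0_integrableP mu (f := fun x => Normc.normc (f x) : R)) => //.
  exact: measurable_normc.
by move=> x _; exact: normc_ge0.
Qed.

Lemma L1_cdot f (w : R[i]) : L1 mu setT f ->
  mu.-integrable setT (EFin \o (fun x => cdot (f x) w)).
Proof.
move=> /L1P[mf If].
have : mu.-integrable setT (EFin \o (fun x => Normc.normc w * Normc.normc (f x) : R)).
  rewrite (_ : _ \o _ = (fun x => (Normc.normc w)%:E * (Normc.normc (f x) : R)%:E)%E)//.
  exact: integrableZl.
apply: Rle_integrable => //.
  by apply: measurable_cdot => //; exact: cmeasurable_cst.
by move=> x _; rewrite mulrC; exact: normr_cdot_leM.
Qed.

Lemma L1_Re f : L1 mu setT f ->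
  mu.-integrable setT (EFin \o (fun x => complex.Re (f x))).
Proof.
move=> /(L1_cdot 1); congr integrable; apply/funext => x /=.
by rewrite [in RHS]Re_cdot.
Qed.

Lemma L1_Im f : L1 mu setT f ->
  mu.-integrable setT (EFin \o (fun x => complex.Im (f x))).
Proof.
move=> /(L1_cdot 'i%C); congr integrable; apply/funext => x /=.
by rewrite [in RHS]Im_cdot.
Qed.

Lemma L1M_bounded u f (C : R) : cmeasurable setT u ->
  (forall x, Normc.normc (u x) <= C) -> L1 mu setT f ->
  L1 mu setT (fun x => u x * f x).
Proof.
move=> mu_ uC /L1P[mf If]; apply/L1P; split; first exact: cmeasurableM.
have : mu.-integrable setT (EFin \o (fun x => C * Normc.normc (f x) : R)).
  rewrite (_ : _ \o _ = (fun x => C%:E * (Normc.normc (f x) : R)%:E)%E)//.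
  exact: integrableZl.
apply: Rle_integrable => //; first by apply: measurable_normc; exact: cmeasurableM.
by move=> x _; rewrite ger0_norm ?normc_ge0// normcM' ler_wpM2r ?normc_ge0.
Qed.

Lemma cdot_cintegral f (w : R[i]) : L1 mu setT f ->
  cdot (cintegral mu setT f) w = \int[mu]_x cdot (f x) w.
Proof.
move=> Lf; have Ir := L1_Re Lf; have Ii := L1_Im Lf.
rewrite /cdot /= mulrC [X in _ + X]mulrC -!RintegralZl// -RintegralD//; first last.
- rewrite (_ : _ \o _ = (fun x => (complex.Im w)%:E * (complex.Im (f x))%:E)%E)//.
  exact: integrableZl.
- rewrite (_ : _ \o _ = (fun x => (complex.Re w)%:E * (complex.Re (f x))%:E)%E)//.
  exact: integrableZl.
by apply: eq_Rintegral => x _; rewrite mulrC [X in _ + X]mulrC.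
Qed.

Lemma normc_cintegral_le f : L1 mu setT f ->
  Normc.normc (cintegral mu setT f) <= \int[mu]_x (Normc.normc (f x) : R).
Proof.
move=> Lf; set c := cintegral _ _ _.
have /L1P[mf If] := Lf.
have c0 := normc_ge0 c; have i0 : 0 <= \int[mu]_x (Normc.normc (f x) : R).
  by apply: Rintegral_ge0 => x _; exact: normc_ge0.
have [->|cn0] := eqVneq (Normc.normc c : R) 0; first by [].
have cp : 0 < (Normc.normc c : R) by rewrite lt_def cn0.
rewrite -(ler_pM2l cp) -expr2 normc_sq cdot_cintegral// -RintegralZl//.
apply: le_Rintegral => //; first exact: L1_cdot.
- rewrite (_ : _ \o _ = (fun x => (Normc.normc c)%:E * (Normc.normc (f x) : R)%:E)%E)//.
  exact: integrableZl.
move=> x _; rewrite mulrC; apply: le_trans (normr_cdot_leM _ _).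
exact: ler_norm.
Qed.

Lemma eq_cintegral D f g : (forall x, D x -> f x = g x) ->
  cintegral mu D f = cintegral mu D g.
Proof.
by move=> h; congr Complex; apply: eq_Rintegral => x /set_mem Dx; rewrite h.
Qed.

Lemma cintegral_L1D f g : L1 mu setT f -> L1 mu setT g ->
  cintegral mu setT (fun x => f x + g x) = cintegral mu setT f + cintegral mu setT g.
Proof.
move=> Lf Lg; apply: complexP; rewrite /= -RintegralD//; try exact: L1_Re;
  try exact: L1_Im; apply: eq_Rintegral => x _; by case: (f x) (g x) => ? ? [].
Qed.

Lemma cintegral_L1B f g : L1 mu setT f -> L1 mu setT g ->
  cintegral mu setT (fun x => f x - g x) = cintegral mu setT f - cintegral mu setT g.
Proof.
move=> Lf Lg; apply: complexP; rewrite /= -RintegralB//; try exact: L1_Re;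
  try exact: L1_Im; apply: eq_Rintegral => x _; by case: (f x) (g x) => ? ? [].
Qed.

End ComplexIntegral.

Section ComplexFubini.
Context d1 d2 (T1 : measurableType d1) (T2 : measurableType d2) (R : realType).
Variables (m1 : {sigma_finite_measure set T1 -> \bar R})
          (m2 : {sigma_finite_measure set T2 -> \bar R}).

Lemma cmeasurable_cintegral1 (F : T1 * T2 -> R[i]) : cmeasurable setT F ->
  cmeasurable setT (fun x => cintegral m2 setT (fun y => F (x, y))).
Proof.
move=> [mr mi]; split; first exact: (measurable_Rintegral1 m2 mr).
exact: (measurable_Rintegral1 m2 mi).
Qed.

Lemma cmeasurable_cintegral2 (F : T1 * T2 -> R[i]) : cmeasurable setT F ->
  cmeasurable setT (fun y => cintegral m1 setT (fun x => F (x, y))).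
Proof.
move=> [mr mi]; split; first exact: (measurable_Rintegral2 m1 mr).
exact: (measurable_Rintegral2 m1 mi).
Qed.

Lemma cdot_cintegral_prod (f : T1 -> R[i]) (g : T2 -> R[i]) :
  L1 m1 setT f -> L1 m2 setT g ->
  cdot (cintegral m1 setT f) (cintegral m2 setT g) =
  \int[(m1 \x m2)%E]_z cdot (f z.1) (g z.2).
Proof.
move=> Lf Lg.
have Ir := integrable_mul (L1_Re Lf) (L1_Re Lg).
have Ii := integrable_mul (L1_Im Lf) (L1_Im Lg).
rewrite {1}/cdot /= -(Rintegral_mul (L1_Re Lf) (L1_Re Lg)).
by rewrite -(Rintegral_mul (L1_Im Lf) (L1_Im Lg)) -RintegralD.
Qed.

End ComplexFubini.

Section Plancherel1.
Variable R : realType.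
Notation leb := (@lebesgue_measure R).
Notation mu2 := (@plane_measure R).
Implicit Types f : R -> R[i].

Lemma expm2pi_normsq (t : R) : cdot (expm2pi t) (expm2pi t) = 1.
Proof. by rewrite /cdot /= mulrNN -!expr2 cos2Dsin2. Qed.

Lemma normc_expm2pi (t : R) : Normc.normc (expm2pi t) = 1 :> R.
Proof. by rewrite normcV expm2pi_normsq sqrtr1. Qed.

Lemma cmeasurable_expm2pi : cmeasurable setT (@expm2pi R).
Proof.
split; first by apply: continuous_measurable_fun; exact: continuous_cosM.
apply: measurable_funN; apply: continuous_measurable_fun; exact: continuous_sinM.
Qed.

Lemma cmeasurable_expm2pi_comp d (X : measurableType d) (u : X -> R) :
  measurable_fun setT u -> cmeasurable setT (fun x => expm2pi (u x)).
Proof. by move=> mu; exact: (cmeasurable_comp cmeasurable_expm2pi mu). Qed.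

Definition fourier1 f (r : R) : R[i] :=
  cintegral leb setT (fun s => f s * expm2pi (s * r)).

Lemma cmeasurable_fourier1 f : cmeasurable setT f -> cmeasurable setT (fourier1 f).
Proof.
move=> mf; apply: (@cmeasurable_cintegral2 _ _ _ _ R leb (fun z : R * R => f z.1 * expm2pi (z.1 * z.2))).
apply: cmeasurableM; first exact: (cmeasurable_comp mf (@measurable_fst _ _ _ _)).
by apply: cmeasurable_expm2pi_comp; exact: measurable_funM.
Qed.

Lemma L1_expm2pi d (X : measurableType d) (mu : {measure set X -> \bar R})
    (f : X -> R[i]) (u : X -> R) : measurable_fun setT u ->
  L1 mu setT f -> L1 mu setT (fun s => f s * expm2pi (u s)).
Proof.
move=> mu_ Lf; rewrite (_ : (fun s => _) = fun s => expm2pi (u s) * f s).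
  apply: (@L1M_bounded _ _ _ _ _ _ 1) => //; first exact: cmeasurable_expm2pi_comp.
  by move=> x; rewrite normc_expm2pi.
by apply/funext => s; rewrite mulrC.
Qed.

Let mulr_measurable (r : R) : measurable_fun setT (fun s : R => s * r).
Proof. by apply: measurable_funM => //; exact: measurable_cst. Qed.

Let L1_exp f r : L1 leb setT f -> L1 leb setT (fun s => f s * expm2pi (s * r)).
Proof. exact: (@L1_expm2pi _ _ leb f (fun s : R => s * r) (mulr_measurable r)). Qed.

Let Phi e f (z : R * (R * R)) : R :=
  expabs e z.1 * cdot (f z.2.1 * expm2pi (z.2.1 * z.1)) (f z.2.2 * expm2pi (z.2.2 * z.1)).

Let PhiE e f r s t : Phi e f (r, (s, t)) =
  cdot (f s) (f t) * (expabs e r * cos (2 * pi * (s - t) * r)) +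
  cdot (f s) ('i%C * f t) * (expabs e r * sin (2 * pi * (s - t) * r)).
Proof.
rewrite /Phi /=.
have -> : 2 * pi * (s - t) * r = 2 * pi * (s * r) - 2 * pi * (t * r) by ring.
rewrite cosB sinB /expm2pi.
move: (cos _) (sin _) (cos _) (sin _) (expabs e r) => c1 s1 c2 s2 E.
by case: (f s) (f t) => a b [a' b']; rewrite /cdot /=; ring.
Qed.

Let integrable_Phi e f : 0 < e -> L1 leb setT f ->
  (leb \x mu2)%E.-integrable setT (EFin \o Phi e f).
Proof.
move=> e0 /L1P[mf If].
have I0 : mu2.-integrable setT
    (EFin \o (fun z : R * R => (Normc.normc (f z.1) : R) * (Normc.normc (f z.2) : R))).
  exact: (@integrable_mul _ _ _ _ R leb leb _ _ If If).
have I1 := @integrable_mul _ _ _ _ R leb mu2 _ _ (integrable_expabs e0) I0.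
apply: (Rle_integrable measurableT _ _ I1); last first.
  move=> [r [s t]] _; rewrite /Phi/= normrM ger0_norm ?expabs_ge0//.
  rewrite ler_wpM2l ?expabs_ge0//; apply: le_trans (normr_cdot_leM _ _) _.
  by rewrite !normcM' !normc_expm2pi !mulr1.
have m2 : measurable_fun setT (fun z : R * (R * R) => z.2).
  exact: (@measurable_snd _ _ (measurableTypeR R) (measurableTypeR R * measurableTypeR R)%type).
have m1 : measurable_fun setT (fun z : R * (R * R) => z.1).
  exact: (@measurable_fst _ _ (measurableTypeR R) (measurableTypeR R * measurableTypeR R)%type).
have m21 : measurable_fun setT (fun z : R * (R * R) => z.2.1).
  exact: (measurableT_comp (@measurable_fst _ _ (measurableTypeR R) (measurableTypeR R)) m2).
have m22 : measurable_fun setT (fun z : R * (R * R) => z.2.2).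
  exact: (measurableT_comp (@measurable_snd _ _ (measurableTypeR R) (measurableTypeR R)) m2).
apply: measurable_funM.
  exact: (measurableT_comp (@measurable_expabs R e) m1).
apply: measurable_cdot; apply: cmeasurableM.
- exact: (cmeasurable_comp mf m21).
- by apply: cmeasurable_expm2pi_comp; exact: measurable_funM.
- exact: (cmeasurable_comp mf m22).
- by apply: cmeasurable_expm2pi_comp; exact: measurable_funM.
Qed.

(** regularised energy of the transform, computed on the space side *)
Let regularized e f : 0 < e -> L1 leb setT f ->
  leb.-integrable setT (EFin \o (fun r => expabs e r * cdot (fourier1 f r) (fourier1 f r))) /\
  \int[leb]_r (expabs e r * cdot (fourier1 f r) (fourier1 f r)) =
  \int[mu2]_z (cdot (f z.1) (f z.2) * poisson e (z.1 - z.2)).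
Proof.
move=> e0 Lf; have IPhi := integrable_Phi e0 Lf.
have h r : expabs e r * cdot (fourier1 f r) (fourier1 f r) = \int[mu2]_z Phi e f (r, z).
  rewrite /fourier1 cdot_cintegral_prod; [|exact: L1_exp..].
  rewrite -RintegralZl//.
  have Lr := L1_exp r Lf.
  have := integrableD measurableT (integrable_mul (L1_Re Lr) (L1_Re Lr))
    (integrable_mul (L1_Im Lr) (L1_Im Lr)).
  exact.
split.
  have := integrable_Rfubini1 IPhi; congr integrable.
  by apply/funext => r /=; rewrite h.
rewrite (_ : (fun r => _) = (fun r => \int[mu2]_z Phi e f (r, z))); last first.
  by apply/funext => r; rewrite h.
rewrite (Rfubini1 IPhi) -(Rfubini2 IPhi); apply: eq_Rintegral => -[s t] _ /=.
have mc : measurable_fun setT (fun r : R => cos (2 * pi * (s - t) * r)).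
  by apply: continuous_measurable_fun; exact: continuous_cosM.
have ms : measurable_fun setT (fun r : R => sin (2 * pi * (s - t) * r)).
  by apply: continuous_measurable_fun; exact: continuous_sinM.
have Ic := integrable_expabsM e0 mc (fun r => norm_cos_le1 _).
have Is := integrable_expabsM e0 ms (fun r => norm_sin_le1 _).
rewrite (_ : (fun r => _) = (fun r =>
  cdot (f s) (f t) * (expabs e r * cos (2 * pi * (s - t) * r)) +
  cdot (f s) ('i%C * f t) * (expabs e r * sin (2 * pi * (s - t) * r)))); last first.
  by apply/funext => r; rewrite PhiE.
rewrite RintegralD//; first last.
- rewrite (_ : _ \o _ = (fun x => (cdot (f s) ('i%C * f t))%:E *
    (expabs e x * sin (2 * pi * (s - t) * x))%:E)%E)//.
  exact: integrableZl.
- rewrite (_ : _ \o _ = (fun x => (cdot (f s) (f t))%:E *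
    (expabs e x * cos (2 * pi * (s - t) * x))%:E)%E)//.
  exact: integrableZl.
rewrite !RintegralZl// Rintegral_expabs_cos// Rintegral_expabs_sin//.
by rewrite mulr0 addr0.
Qed.

Let integral_poisson_sub e (s : R) : 0 < e ->
  (\int[leb]_t (poisson e (s - t))%:E = 1)%E.
Proof.
move=> e0; rewrite -(integral_poisson e0).
have m1 : (-1 : R) != 0 by rewrite oppr_eq0 oner_eq0.
rewrite [RHS](@ge0_integral_affine _ (-1) s)//; first last.
- by move=> x; rewrite lee_fin poisson_ge0.
- by apply/measurable_EFinP; exact: measurable_poisson.
rewrite normrN1 mul1e; apply: eq_integral => t _.
by rewrite mulN1r addrC.
Qed.

Let measurable_poisson_sub e : measurable_fun setT (fun z : R * R => poisson e (z.1 - z.2)).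
Proof.
by apply: (measurableT_comp (@measurable_poisson R e)); exact: measurable_funB.
Qed.

Let poisson_marginal1 e (a : R -> R) : 0 < e -> measurable_fun setT a ->
  (forall s, 0 <= a s) ->
  (\int[mu2]_z (a z.1 * poisson e (z.1 - z.2))%:E = \int[leb]_s (a s)%:E)%E.
Proof.
move=> e0 ma a0; rewrite (leb2_tonelli1 (f := fun z => (a z.1 * poisson e (z.1 - z.2))%:E)); first last.
- by move=> z; rewrite lee_fin mulr_ge0 ?poisson_ge0.
- apply/measurable_EFinP/measurable_funM; last exact: measurable_poisson_sub.
  exact: (measurableT_comp ma).
apply: eq_integral => s _; rewrite -[RHS]mule1 -(integral_poisson_sub s e0).
have mp : measurable_fun setT (fun t : R => (poisson e (s - t))%:E).
  apply/measurable_EFinP; apply: (measurableT_comp (@measurable_poisson R e)).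
  by apply: measurable_funB => //; exact: measurable_cst.
rewrite -ge0_integralZl_EFin//.
by move=> t _; rewrite lee_fin poisson_ge0.
Qed.

Let poisson_marginal2 e (a : R -> R) : 0 < e -> measurable_fun setT a ->
  (forall s, 0 <= a s) ->
  (\int[mu2]_z (a z.2 * poisson e (z.1 - z.2))%:E = \int[leb]_s (a s)%:E)%E.
Proof.
move=> e0 ma a0; rewrite -(poisson_marginal1 e0 ma a0).
rewrite -[RHS](ge0_integral_swap (f := fun z => (a z.1 * poisson e (z.1 - z.2))%:E)).
- by apply: (@eq_integral2 R) => x y /=; rewrite -(opprB y) poissonN.
- apply/measurable_EFinP/measurable_funM; last exact: measurable_poisson_sub.
  exact: (measurableT_comp ma).
- by move=> z; rewrite lee_fin mulr_ge0 ?poisson_ge0.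
Qed.

Let regularized_defect e f : 0 < e -> L1 leb setT f -> L2 leb setT f ->
  poisson_defect e f \is a fin_num /\
  \int[leb]_r (expabs e r * cdot (fourier1 f r) (fourier1 f r)) =
  ip leb setT f f - fine (poisson_defect e f) / 2.
Proof.
move=> e0 Lf L2f; have [mf ff] := L2f.
have mcf : measurable_fun setT (fun s => cdot (f s) (f s)) by exact: measurable_cdot.
have pe z : 0 <= poisson e (z : R) by exact: poisson_ge0.
have m1 := @measurable_fst _ _ (measurableTypeR R) (measurableTypeR R).
have m2 := @measurable_snd _ _ (measurableTypeR R) (measurableTypeR R).
have E1 := poisson_marginal1 e0 mcf (fun s => cdot_ge0 (f s)).
have E2 := poisson_marginal2 e0 mcf (fun s => cdot_ge0 (f s)).
have ef : (\int[leb]_s (cdot (f s) (f s))%:E = (ip leb setT f f)%:E)%E.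
  by rewrite -L2normsqE L2normsq_fin.
have I1 : mu2.-integrable setT (EFin \o (fun z : R * R => cdot (f z.1) (f z.1) * poisson e (z.1 - z.2))).
  apply/(ge0_integrableP mu2).
  - by apply: measurable_funM; [exact: (measurableT_comp mcf m1)|exact: measurable_poisson_sub].
  - by move=> z _; rewrite mulr_ge0 ?cdot_ge0.
  - by rewrite E1 ef ltry.
have I2 : mu2.-integrable setT (EFin \o (fun z : R * R => cdot (f z.2) (f z.2) * poisson e (z.1 - z.2))).
  apply/(ge0_integrableP mu2).
  - by apply: measurable_funM; [exact: (measurableT_comp mcf m2)|exact: measurable_poisson_sub].
  - by move=> z _; rewrite mulr_ge0 ?cdot_ge0.
  - by rewrite E2 ef ltry.
have cm1 := cmeasurable_comp mf m1; have cm2 := cmeasurable_comp mf m2.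
have I12 : mu2.-integrable setT (EFin \o (fun z : R * R =>
    2 * (cdot (f z.1) (f z.1) * poisson e (z.1 - z.2)) +
    2 * (cdot (f z.2) (f z.2) * poisson e (z.1 - z.2)))).
  have := integrableD measurableT (integrableZl measurableT 2 I1) (integrableZl measurableT 2 I2).
  exact.
have ID : mu2.-integrable setT (EFin \o (fun z : R * R =>
    cdot (f z.1 - f z.2) (f z.1 - f z.2) * poisson e (z.1 - z.2))).
  apply: (Rle_integrable measurableT _ _ I12).
    apply: measurable_funM; last exact: measurable_poisson_sub.
    by apply: measurable_cdot; exact: cmeasurableB.
  move=> z _; rewrite ger0_norm; last by rewrite mulr_ge0 ?cdot_ge0.
  apply: le_trans (ler_wpM2r (pe _) (cdotBB_le _ _)) _.
  by rewrite mulrDl !mulrA.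
have IC : mu2.-integrable setT (EFin \o (fun z : R * R =>
    cdot (f z.1) (f z.2) * poisson e (z.1 - z.2))).
  apply: (Rle_integrable measurableT _ _ I12).
    apply: measurable_funM; last exact: measurable_poisson_sub.
    exact: measurable_cdot.
  move=> z _; rewrite normrM (ger0_norm (pe _)).
  apply: le_trans (ler_wpM2r (pe _) (normr_cdot_le _ _)) _.
  have := mulr_ge0 (cdot_ge0 (f z.1)) (pe (z.1 - z.2)).
  have := mulr_ge0 (cdot_ge0 (f z.2)) (pe (z.1 - z.2)).
  lra.
have eD : poisson_defect e f = (\int[mu2]_z (cdot (f z.1 - f z.2) (f z.1 - f z.2) *
    poisson e (z.1 - z.2)))%:E.
  by rewrite EFin_Rintegral.
split; first by rewrite eD.
rewrite (proj2 (regularized e0 Lf)) eD /=.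
have R1 : \int[mu2]_z (cdot (f z.1) (f z.1) * poisson e (z.1 - z.2)) = ip leb setT f f.
  by rewrite /Rintegral E1 ef.
have R2 : \int[mu2]_z (cdot (f z.2) (f z.2) * poisson e (z.1 - z.2)) = ip leb setT f f.
  by rewrite /Rintegral E2 ef.
have I3 : mu2.-integrable setT (EFin \o (fun z : R * R =>
    cdot (f z.1) (f z.1) * poisson e (z.1 - z.2) + cdot (f z.2) (f z.2) * poisson e (z.1 - z.2))).
  by have := integrableD measurableT I1 I2.
have : \int[mu2]_z (cdot (f z.1 - f z.2) (f z.1 - f z.2) * poisson e (z.1 - z.2)) =
   ip leb setT f f + ip leb setT f f - 2 * \int[mu2]_z (cdot (f z.1) (f z.2) * poisson e (z.1 - z.2)).
  rewrite -{1}R1 -R2 -RintegralD// -RintegralZl// -RintegralB//; last first.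
    by have := integrableZl measurableT 2 IC.
  by apply: eq_Rintegral => z _; rewrite cdotBB; ring.
move=> ->; move: (\int[mu2]_z _) (ip _ _ _ _) => x y.
by field.
Qed.

(** Damping by exp (- e |r|) makes Fubini available and yields the energy minus a Poisson average of the translation modulus; the latter vanishes as e tends to 0. *)
Lemma plancherel1 f : L1 leb setT f -> L2 leb setT f ->
  L2normsq leb setT (fourier1 f) = L2normsq leb setT f.
Proof.
move=> Lf L2f; have [mf _] := L2f; have mh := cmeasurable_fourier1 mf.
have e0 n : 0 < n.+1%:R^-1 :> R by rewrite invr_gt0.
pose h r := cdot (fourier1 f r) (fourier1 f r).
have mhh : measurable_fun setT h by exact: measurable_cdot.
have h0 r : 0 <= h r by exact: cdot_ge0.
pose g n r := (expabs n.+1%:R^-1 r * h r)%:E.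
have mg n : measurable_fun setT (g n).
  by apply/measurable_EFinP/measurable_funM => //; exact: measurable_expabs.
have g0 n r : (0 <= g n r)%E by rewrite lee_fin mulr_ge0 ?expabs_ge0.
have nd r : {homo g ^~ r : n m / (n <= m)%N >-> (n <= m)%E}.
  move=> n m nm; rewrite lee_fin ler_wpM2r// ler_expR ler_wpM2r//.
  by rewrite lerN2 lef_pV2 ?posrE// ler_nat ltnS.
have glim r : g n r @[n --> \oo] --> (h r)%:E.
  apply: cvg_EFin; first exact: nearW.
  rewrite -[X in _ --> X]mul1r; apply: cvgM; last exact: cvg_cst.
  have c0 : - n.+1%:R^-1 * `|r| @[n --> \oo] --> (0 : R).
    rewrite -[X in _ --> X](mul0r `|r|) -oppr0; apply: cvgM; last exact: cvg_cst.
    by apply: cvgN; exact: cvg_harmonic.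
  have := cvg_comp _ _ c0 (@continuous_expR R 0).
  by rewrite expR0.
have lhs : L2normsq leb setT (fourier1 f) = limn (fun n => \int[leb]_r g n r)%E.
  have mc := @monotone_convergence _ _ _ leb setT measurableT g mg
    (fun n x _ => g0 n x) (fun x _ => nd x).
  rewrite L2normsqE -mc.
  by apply: eq_integral => r _; apply/esym/cvg_lim => //; exact: glim.
rewrite lhs L2normsq_fin//; apply/cvg_lim => //.
rewrite (_ : (fun n => _) = EFin \o
    (fun n => ip leb setT f f - fine (poisson_defect n.+1%:R^-1 f) / 2)); last first.
  apply/funext => n /=; have [_ <-] := regularized_defect (e0 n) Lf L2f.
  by rewrite EFin_Rintegral//; have [] := regularized (e0 n) Lf.
apply: cvg_EFin; first exact: nearW.
rewrite -[X in _ --> X]subr0; apply: cvgB; first exact: cvg_cst.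
rewrite -[X in _ --> X](mul0r 2^-1); apply: cvgM; last exact: cvg_cst.
by have /fine_cvgP[] := poisson_defect_cvg0 L2f.
Qed.

End Plancherel1.

(** * The partial Fourier transform on the plane *)

Lemma normcD_le (R : realType) (z w : R[i]) :
  Normc.normc (z + w) <= (Normc.normc z : R) + (Normc.normc w : R).
Proof.
have z0 := normc_ge0 z; have w0 := normc_ge0 w.
rewrite [leLHS]normcV -[leRHS]ger0_norm ?addr_ge0// -sqrtr_sqr ler_wsqrtr//.
rewrite [leRHS]sqrrD !normc_sq cdotDl !(cdotC _ (z + w)) !cdotDl (cdotC w z).
have := le_trans (ler_norm _) (normr_cdot_leM z w); rewrite -mulr_natr => ?.
lra.
Qed.

Section RintegralAE.
Context d (T : measurableType d) (R : realType).
Variable mu : {measure set T -> \bar R}.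

Lemma ae_eq_Rintegral (D : set T) (f g : T -> R) : measurable D ->
  measurable_fun D f -> measurable_fun D g ->
  {ae mu, forall x, D x -> f x = g x} ->
  \int[mu]_(x in D) f x = \int[mu]_(x in D) g x.
Proof.
move=> mD mf mg fg; rewrite /Rintegral; congr fine; apply: ae_eq_integral => //.
- exact/measurable_EFinP.
- exact/measurable_EFinP.
by apply: filterS fg => x h /h ->.
Qed.

Lemma ae_imp (P Q : T -> Prop) : (forall x, P x -> Q x) ->
  {ae mu, forall x, P x} -> {ae mu, forall x, Q x}.
Proof. by move=> h; apply: filterS. Qed.

Lemma ae_imp2 (P Q S : T -> Prop) : (forall x, P x -> Q x -> S x) ->
  {ae mu, forall x, P x} -> {ae mu, forall x, Q x} -> {ae mu, forall x, S x}.
Proof. by move=> h; apply: filterS2. Qed.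

End RintegralAE.

Section KernelAdjoint.
Context d1 d2 (T1 : measurableType d1) (T2 : measurableType d2) (R : realType).
Variables (m1 : {sigma_finite_measure set T1 -> \bar R})
          (m2 : {sigma_finite_measure set T2 -> \bar R}).
Variable k : T1 * T2 -> R.
Hypothesis mk : measurable_fun setT k.

(** The adjoint of an integral transform with a unimodular kernel, by Fubini. *)
Lemma ip_kernel (u : T1 -> R[i]) (V : T2 -> R[i]) :
  L1 m1 setT u -> L1 m2 setT V ->
  ip m2 setT (fun y => cintegral m1 setT (fun x => u x * expm2pi (k (x, y)))) V =
  ip m1 setT u (fun x => cintegral m2 setT (fun y => V y * expm2pi (- k (x, y)))).
Proof.
move=> Lu LV; have /L1P[mu Iu] := Lu; have /L1P[mV IV] := LV.
pose G (z : T1 * T2) := cdot (u z.1 * expm2pi (k z)) (V z.2).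
have mG : measurable_fun setT G.
  apply: measurable_cdot; first apply: cmeasurableM.
  - exact: (cmeasurable_comp mu (@measurable_fst _ _ _ _)).
  - exact: cmeasurable_expm2pi_comp.
  - exact: (cmeasurable_comp mV (@measurable_snd _ _ _ _)).
have IG : (m1 \x m2)%E.-integrable setT (EFin \o G).
  apply: (Rle_integrable measurableT mG _ (integrable_mul Iu IV)) => z _.
  by apply: le_trans (normr_cdot_leM _ _) _; rewrite normcM' normc_expm2pi mulr1.
have mk1 y : measurable_fun setT (fun x => k (x, y)).
  exact: (measurableT_comp mk (@pair2_measurable _ _ _ _ y)).
have mk2 x : measurable_fun setT (fun y => - k (x, y)).
  by apply: measurable_funN; exact: (measurableT_comp mk (@pair1_measurable _ _ _ _ x)).
transitivity (\int[m2]_y \int[m1]_x G (x, y)).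
  apply: eq_Rintegral => y _; rewrite cdot_cintegral//.
  by apply: L1_expm2pi.
rewrite (Rfubini2 IG) -(Rfubini1 IG); apply: eq_Rintegral => x _.
rewrite [RHS]cdotC cdot_cintegral; last by apply: L1_expm2pi.
apply: eq_Rintegral => y _; rewrite /G /= [RHS]cdotC.
have -> : expm2pi (- k (x, y)) = (expm2pi (k (x, y)))^*%C.
  by rewrite /expm2pi mulrN cosN sinN /= opprK.
rewrite [X in cdot X _]mulrC cdotMl; congr cdot.
by rewrite mulrC.
Qed.

End KernelAdjoint.

Section PlaneTransforms.
Variable R : realType.
Notation leb := (@lebesgue_measure R).
Notation mu2 := (@leb2 R).
Implicit Types f g u v : R * R -> R[i].

Lemma measurable_R21 : measurable_fun setT (fun z : R * (R * R) => z.2.1).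
Proof.
exact: (measurableT_comp (@measurable_fst _ _ (measurableTypeR R) (measurableTypeR R))
  (@measurable_snd _ _ (measurableTypeR R) (measurableTypeR R * measurableTypeR R)%type)).
Qed.

Lemma measurable_R22 : measurable_fun setT (fun z : R * (R * R) => z.2.2).
Proof.
exact: (measurableT_comp (@measurable_snd _ _ (measurableTypeR R) (measurableTypeR R))
  (@measurable_snd _ _ (measurableTypeR R) (measurableTypeR R * measurableTypeR R)%type)).
Qed.

Lemma measurable_R1 : measurable_fun setT (fun z : R * (R * R) => z.1).
Proof.
exact: (@measurable_fst _ _ (measurableTypeR R) (measurableTypeR R * measurableTypeR R)%type).
Qed.

Lemma measurable_R1_22 : measurable_fun setT (fun z : R * (R * R) => (z.1, z.2.2)).
Proof. by apply: measurable_pair2; [exact: measurable_R1|exact: measurable_R22]. Qed.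

Lemma cmeasurable_fst_section f y : cmeasurable setT f -> cmeasurable setT (fun s => f (s, y)).
Proof.
move=> mf; exact: (cmeasurable_comp mf (@pair2_measurable _ _ (measurableTypeR R) (measurableTypeR R) y)).
Qed.

Lemma measurable_swap : measurable_fun setT (fun z : R * R => (z.2, z.1)).
Proof. by apply: measurable_pair2; [exact: measurable_snd|exact: measurable_fst]. Qed.

Lemma cmeasurable_fourier_integral f : cmeasurable setT f ->
  cmeasurable setT (fourier_integral f).
Proof.
move=> mf; apply: (@cmeasurable_cintegral2 _ _ _ _ R leb
  (fun z : R * (R * R) => f (z.1, z.2.2) * expm2pi (z.1 * z.2.1))).
apply: cmeasurableM; first exact: (cmeasurable_comp mf measurable_R1_22).
apply: cmeasurable_expm2pi_comp; apply: measurable_funM; first exact: measurable_R1.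
exact: measurable_R21.
Qed.

Let msq f : cmeasurable setT f -> measurable_fun setT (fun z => (cdot (f z) (f z))%:E).
Proof. by move=> mf; apply/measurable_EFinP; exact: measurable_cdot. Qed.

Let sq0 f z : (0 <= (cdot (f z) (f z))%:E :> \bar R)%E.
Proof. by rewrite lee_fin cdot_ge0. Qed.

(** almost all slices of a square integrable function are square integrable *)
Lemma L2_section f : L2 mu2 setT f -> {ae leb, forall y, L2 leb setT (fun s => f (s, y))}.
Proof.
move=> [mf ff]; rewrite L2normsqE leb2_tonelli2 in ff; [|exact: msq|exact: sq0].
have mi := measurable_integral_fst (msq mf) (sq0 f).
have : leb.-integrable setT (fun y => \int[leb]_x (cdot (f (x, y)) (f (x, y)))%:E)%E.
  apply/integrableP; split => //.
  apply: le_lt_trans ff; rewrite le_eqVlt; apply/orP; left; apply/eqP.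
  apply: eq_integral => y _; rewrite gee0_abs//; apply: integral_ge0 => x _.
  exact: (sq0 f (x, y)).
move/(integrable_ae measurableT); apply: ae_imp => y h.
split; first exact: cmeasurable_fst_section.
rewrite L2normsqE; move: (h I); rewrite ge0_fin_numE//.
by apply: integral_ge0 => x _; exact: (sq0 f (x, y)).
Qed.

Lemma L1_section f : L1 mu2 setT f -> {ae leb, forall y, L1 leb setT (fun s => f (s, y))}.
Proof.
move=> /L1P[mf If]; have := @Rfubini_ae2 _ _ _ _ R leb leb _ If.
apply: ae_imp => y Iy; apply/L1P; split => //; exact: cmeasurable_fst_section.
Qed.

(** The identity on the line, applied on almost every fibre. *)
Lemma plancherel_partial f : L2 mu2 setT f ->
  {ae leb, forall y, L1 leb setT (fun s => f (s, y))} ->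
  L2normsq mu2 setT (fourier_integral f) = L2normsq mu2 setT f.
Proof.
move=> Lf L1f; have [mf ff] := Lf; have mF := cmeasurable_fourier_integral mf.
rewrite !L2normsqE leb2_tonelli2; [|exact: msq|exact: sq0].
rewrite [RHS]leb2_tonelli2; [|exact: msq|exact: sq0].
apply: ae_eq_integral => //.
- exact: (measurable_integral_fst (msq mF) (sq0 _)).
- exact: (measurable_integral_fst (msq mf) (sq0 _)).
move: L1f (L2_section Lf); apply: ae_imp2 => y L1y L2y _.
by have := plancherel1 L1y L2y; rewrite !L2normsqE.
Qed.

Lemma L2_fourier_integral f : L2 mu2 setT f ->
  {ae leb, forall y, L1 leb setT (fun s => f (s, y))} ->
  L2 mu2 setT (fourier_integral f).
Proof.
move=> Lf L1f; have [mf ff] := Lf; split; first exact: cmeasurable_fourier_integral.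
by rewrite plancherel_partial.
Qed.

Lemma ip_fibres f g f' g' : L2 mu2 setT f -> L2 mu2 setT g -> L2 mu2 setT f' ->
  L2 mu2 setT g' ->
  {ae leb, forall y, ip leb setT (fun s => f (s, y)) (fun s => g (s, y)) =
     ip leb setT (fun s => f' (s, y)) (fun s => g' (s, y))} ->
  ip mu2 setT f g = ip mu2 setT f' g'.
Proof.
move=> Lf Lg Lf' Lg' h.
have I1 := integrable_cdot measurableT Lf Lg.
have I2 := integrable_cdot measurableT Lf' Lg'.
have e1 := @Rfubini2 _ _ _ _ R leb leb _ I1.
have e2 := @Rfubini2 _ _ _ _ R leb leb _ I2.
transitivity (\int[leb]_y \int[leb]_s cdot (f (s, y)) (g (s, y))); first exact: esym e1.
transitivity (\int[leb]_y \int[leb]_s cdot (f' (s, y)) (g' (s, y))); last exact: e2.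
apply: ae_eq_Rintegral => //; last exact: (ae_imp _ h).
- have [[mf _] [mg _]] := (Lf, Lg).
  exact: (@measurable_Rintegral2 _ _ _ _ R leb _ (measurable_cdot mf mg)).
- have [[mf _] [mg _]] := (Lf', Lg').
  exact: (@measurable_Rintegral2 _ _ _ _ R leb _ (measurable_cdot mf mg)).
Qed.

Lemma fourier1D (a b : R -> R[i]) r : L1 leb setT a -> L1 leb setT b ->
  fourier1 (fun s => a s + b s) r = fourier1 a r + fourier1 b r.
Proof.
move=> La Lb; have mr : measurable_fun setT (fun s : R => s * r).
  by apply: measurable_funM => //; exact: measurable_cst.
have L (a' : R -> R[i]) : L1 leb setT a' -> L1 leb setT (fun s => a' s * expm2pi (s * r)).
  exact: (@L1_expm2pi _ _ _ leb a' (fun s : R => s * r) mr).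
rewrite /fourier1 -cintegral_L1D; [|exact: L..].
by apply: eq_cintegral => s _; rewrite mulrDl.
Qed.

Lemma L1D d (X : measurableType d) (mu : {measure set X -> \bar R}) (a b : X -> R[i]) :
  L1 mu setT a -> L1 mu setT b -> L1 mu setT (fun s => a s + b s).
Proof.
move=> /L1P[ma Ia] /L1P[mb Ib]; apply/L1P; split; first exact: cmeasurableD.
have I := integrableD measurableT Ia Ib.
apply: (Rle_integrable measurableT _ _ I).
  by apply: measurable_normc; exact: cmeasurableD.
move=> x _; rewrite ger0_norm ?normc_ge0//; exact: normcD_le.
Qed.

Lemma L2_fourier1 (a : R -> R[i]) : L1 leb setT a -> L2 leb setT a -> L2 leb setT (fourier1 a).
Proof.
move=> L1a L2a; have [ma aa] := L2a; split; first exact: cmeasurable_fourier1.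
by rewrite plancherel1.
Qed.

Lemma parseval1 (a b : R -> R[i]) : L1 leb setT a -> L2 leb setT a ->
  L1 leb setT b -> L2 leb setT b ->
  ip leb setT (fourier1 a) (fourier1 b) = ip leb setT a b.
Proof.
move=> L1a L2a L1b L2b; have L1ab := L1D L1a L1b; have L2ab := L2D measurableT L2a L2b.
have Fa := L2_fourier1 L1a L2a; have Fb := L2_fourier1 L1b L2b.
have n (c : R -> R[i]) : L1 leb setT c -> L2 leb setT c ->
    ip leb setT (fourier1 c) (fourier1 c) = ip leb setT c c.
  move=> L1c L2c; have Fc := L2_fourier1 L1c L2c.
  by apply: EFin_inj; rewrite -!L2normsq_fin// plancherel1.
have := n _ L1ab L2ab.
rewrite (_ : fourier1 (fun x => a x + b x) = fun r => fourier1 a r + fourier1 b r); last first.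
  by apply/funext => r; exact: fourier1D.
rewrite !ipDD// !n//; lra.
Qed.

Lemma parseval_partial f g : L2 mu2 setT f -> L2 mu2 setT g ->
  {ae leb, forall y, L1 leb setT (fun s => f (s, y))} ->
  {ae leb, forall y, L1 leb setT (fun s => g (s, y))} ->
  ip mu2 setT (fourier_integral f) (fourier_integral g) = ip mu2 setT f g.
Proof.
move=> Lf Lg L1f L1g; have Ff := L2_fourier_integral Lf L1f.
have Fg := L2_fourier_integral Lg L1g; apply: (ip_fibres Ff Fg Lf Lg).
have {}Lf : {ae leb, forall y, L1 leb setT (fun s => f (s, y)) /\ L2 leb setT (fun s => f (s, y))}.
  by move: L1f (L2_section Lf); apply: ae_imp2.
have {}Lg : {ae leb, forall y, L1 leb setT (fun s => g (s, y)) /\ L2 leb setT (fun s => g (s, y))}.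
  by move: L1g (L2_section Lg); apply: ae_imp2.
by move: Lf Lg; apply: ae_imp2 => y [L1a L2a] [L1b L2b]; exact: (parseval1 L1a L2a L1b L2b).
Qed.

Definition fourier_integral_inv g (z : R * R) : R[i] :=
  cintegral leb setT (fun r => g (r, z.2) * expm2pi (- (z.1 * r))).

Lemma fourier_integral_invE g z :
  fourier_integral_inv g z = fourier_integral g (- z.1, z.2).
Proof.
by apply: eq_cintegral => r _ /=; rewrite mulrN (mulrC r).
Qed.

Lemma L2normsq_opp1 g : cmeasurable setT g ->
  L2normsq mu2 setT (fun z => g (- z.1, z.2)) = L2normsq mu2 setT g.
Proof.
move=> mg; have mo : measurable_fun setT (fun z : R * R => (- z.1, z.2)).
  by apply: measurable_pair2 => //; exact: measurable_funN.
have mg' := cmeasurable_comp mg mo.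
rewrite !L2normsqE leb2_tonelli2; [|exact: (msq mg')|by move=> z; rewrite lee_fin cdot_ge0].
rewrite [RHS]leb2_tonelli2; [|exact: msq|exact: sq0].
apply: eq_integral => y _ /=; have m1 : (-1 : R) != 0 by rewrite oppr_eq0 oner_eq0.
rewrite [RHS](@ge0_integral_affine _ (-1) 0)//.
  rewrite normrN1 mul1e; apply: eq_integral => x _; by rewrite addr0 mulN1r.
apply/measurable_EFinP; apply: measurable_cdot; exact: cmeasurable_fst_section.
Qed.

Lemma cmeasurable_fourier_integral_inv g : cmeasurable setT g ->
  cmeasurable setT (fourier_integral_inv g).
Proof.
move=> mg; rewrite (_ : fourier_integral_inv g = fun z => fourier_integral g (- z.1, z.2)).
  apply: (cmeasurable_comp (cmeasurable_fourier_integral mg)).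
  by apply: measurable_pair2 => //; exact: measurable_funN.
by apply/funext => z; exact: fourier_integral_invE.
Qed.

Lemma plancherel_partial_inv g : L2 mu2 setT g ->
  {ae leb, forall y, L1 leb setT (fun s => g (s, y))} ->
  L2normsq mu2 setT (fourier_integral_inv g) = L2normsq mu2 setT g.
Proof.
move=> Lg L1g; have [mg _] := Lg.
rewrite (_ : fourier_integral_inv g = fun z => fourier_integral g (- z.1, z.2)).
  by rewrite L2normsq_opp1 ?plancherel_partial//; exact: cmeasurable_fourier_integral.
by apply/funext => z; exact: fourier_integral_invE.
Qed.

Lemma L2_fourier_integral_inv g : L2 mu2 setT g ->
  {ae leb, forall y, L1 leb setT (fun s => g (s, y))} ->
  L2 mu2 setT (fourier_integral_inv g).
Proof.
move=> Lg L1g; have [mg gg] := Lg; split; first exact: cmeasurable_fourier_integral_inv.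
by rewrite plancherel_partial_inv.
Qed.

Lemma ip_fourier_integral f g : L2 mu2 setT f -> L2 mu2 setT g ->
  {ae leb, forall y, L1 leb setT (fun s => f (s, y))} ->
  {ae leb, forall y, L1 leb setT (fun s => g (s, y))} ->
  ip mu2 setT (fourier_integral f) g = ip mu2 setT f (fourier_integral_inv g).
Proof.
move=> Lf Lg L1f L1g; have Ff := L2_fourier_integral Lf L1f.
have Fg := L2_fourier_integral_inv Lg L1g; apply: (ip_fibres Ff Lg Lf Fg).
move: L1f L1g; apply: ae_imp2 => y L1fy L1gy.
have mk : measurable_fun setT (fun z : R * R => z.1 * z.2) by exact: measurable_funM.
exact: (@ip_kernel _ _ _ _ R leb leb (fun z : R * R => z.1 * z.2) mk _ _ L1fy L1gy).
Qed.

End PlaneTransforms.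

(** * The plane Fourier transform and the central slice theorem *)

Section ComplexFubini2.
Context d1 d2 (T1 : measurableType d1) (T2 : measurableType d2) (R : realType).
Variables (m1 : {sigma_finite_measure set T1 -> \bar R})
          (m2 : {sigma_finite_measure set T2 -> \bar R}).
Variable G : T1 * T2 -> R[i].
Hypothesis LG : L1 (m1 \x m2)%E setT G.

Lemma cintegral_fubini1 :
  cintegral m1 setT (fun x => cintegral m2 setT (fun y => G (x, y))) =
  cintegral (m1 \x m2)%E setT G.
Proof.
apply: complexP => /=; first exact: (Rfubini1 (L1_Re LG)).
exact: (Rfubini1 (L1_Im LG)).
Qed.

Lemma cintegral_fubini2 :
  cintegral m2 setT (fun y => cintegral m1 setT (fun x => G (x, y))) =
  cintegral (m1 \x m2)%E setT G.
Proof.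
apply: complexP => /=; first exact: (Rfubini2 (L1_Re LG)).
exact: (Rfubini2 (L1_Im LG)).
Qed.

Let L1_of_parts d (T : measurableType d) (m : {measure set T -> \bar R}) (h : T -> R[i]) :
  cmeasurable setT h ->
  m.-integrable setT (EFin \o (fun x => complex.Re (h x))) ->
  m.-integrable setT (EFin \o (fun x => complex.Im (h x))) -> L1 m setT h.
Proof.
move=> mh /integrable_norm Ir /integrable_norm Ii; apply/L1P; split => //.
apply: (Rle_integrable measurableT _ _ (integrableD measurableT Ir Ii)).
  exact: measurable_normc.
by move=> x _; rewrite ger0_norm ?normc_ge0//; exact: normc_le_sum.
Qed.

Lemma L1_fubini1 : L1 m1 setT (fun x => cintegral m2 setT (fun y => G (x, y))).
Proof.
apply: L1_of_parts; [|exact: (integrable_Rfubini1 (L1_Re LG))|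
  exact: (integrable_Rfubini1 (L1_Im LG))].
by apply: cmeasurable_cintegral1; have [] := LG.
Qed.

Lemma L1_fubini2 : L1 m2 setT (fun y => cintegral m1 setT (fun x => G (x, y))).
Proof.
apply: L1_of_parts; [|exact: (integrable_Rfubini2 (L1_Re LG))|
  exact: (integrable_Rfubini2 (L1_Im LG))].
by apply: cmeasurable_cintegral2; have [] := LG.
Qed.

Lemma L1_slices1 : {ae m1, forall x, L1 m2 setT (fun y => G (x, y))}.
Proof.
have /L1P[mG IG] := LG; apply: (ae_imp _ (Rfubini_ae1 IG)) => x Ix.
apply/L1P; split => //; exact: (cmeasurable_comp mG (@pair1_measurable _ _ _ _ x)).
Qed.

End ComplexFubini2.

Section CintegralMore.
Context d (T : measurableType d) (R : realType).
Variable mu : {measure set T -> \bar R}.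

Lemma cintegralMr (f : T -> R[i]) (c : R[i]) : L1 mu setT f ->
  cintegral mu setT (fun x => f x * c) = cintegral mu setT f * c.
Proof.
move=> Lf; have Lfc : L1 mu setT (fun x => f x * c).
  rewrite (_ : (fun x => _) = (fun x => c * f x)); last by apply/funext => x; rewrite mulrC.
  by apply: (@L1M_bounded _ _ _ _ _ _ (Normc.normc c)) => //; exact: cmeasurable_cst.
apply: complexP; rewrite !(Re_cdot, Im_cdot) [in RHS]mulrC cdotMl.
  rewrite !cdot_cintegral//; apply: eq_Rintegral => x _.
  by rewrite [X in cdot X _]mulrC cdotMl.
rewrite !cdot_cintegral//; apply: eq_Rintegral => x _.
by rewrite [X in cdot X _]mulrC cdotMl.
Qed.

Lemma ae_eq_cintegral (f g : T -> R[i]) : cmeasurable setT f -> cmeasurable setT g ->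
  {ae mu, forall x, f x = g x} -> cintegral mu setT f = cintegral mu setT g.
Proof.
move=> [? ?] [? ?] fg; apply: complexP => /=; apply: ae_eq_Rintegral => //;
  by apply: (ae_imp _ fg) => x ->.
Qed.

End CintegralMore.

Section MeasurePreserving.
Context d1 d2 (T1 : measurableType d1) (T2 : measurableType d2) (R : realType).
Variables (mu : {measure set T1 -> \bar R}) (nu : {measure set T2 -> \bar R}).
Variable phi : T1 -> T2.
Hypothesis mphi : measurable_fun setT phi.
Hypothesis phiP : forall g : T2 -> \bar R, measurable_fun setT g ->
  (forall y, 0 <= g y)%E -> (\int[mu]_x g (phi x) = \int[nu]_y g y)%E.

Lemma integrable_preserving (f : T2 -> R) : nu.-integrable setT (EFin \o f) ->
  mu.-integrable setT (EFin \o (f \o phi)).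
Proof.
move=> /integrableP[mf ff]; apply/integrableP; split; first exact: (measurableT_comp mf).
have m1 : measurable_fun setT (fun y => `|(EFin \o f) y|%E) by exact: measurableT_comp.
by move: ff; rewrite -(phiP m1).
Qed.

Lemma Rintegral_preserving (f : T2 -> R) : nu.-integrable setT (EFin \o f) ->
  \int[mu]_x f (phi x) = \int[nu]_y f y.
Proof.
move=> If; have mf := measurable_int _ If.
rewrite /Rintegral integralE [in RHS]integralE; congr (fine (_ - _)%E).
  by rewrite -(phiP (measurable_funepos mf))//; apply: eq_integral => x _; rewrite !funeposE.
by rewrite -(phiP (measurable_funeneg mf))//; apply: eq_integral => x _; rewrite !funenegE.
Qed.

Lemma L1_preserving (f : T2 -> R[i]) : L1 nu setT f -> L1 mu setT (f \o phi).
Proof.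
move=> /L1P[mf If]; apply/L1P; split; first exact: cmeasurable_comp.
exact: (integrable_preserving If).
Qed.

Lemma cintegral_preserving (f : T2 -> R[i]) : L1 nu setT f ->
  cintegral mu setT (f \o phi) = cintegral nu setT f.
Proof.
move=> Lf; apply: complexP => /=; first exact: (Rintegral_preserving (L1_Re Lf)).
exact: (Rintegral_preserving (L1_Im Lf)).
Qed.

Lemma L2normsq_preserving (f : T2 -> R[i]) : cmeasurable setT f ->
  L2normsq mu setT (f \o phi) = L2normsq nu setT f.
Proof.
move=> mf; rewrite !L2normsqE -(phiP (g := fun y => (cdot (f y) (f y))%:E))//.
  by apply/measurable_EFinP; exact: measurable_cdot.
by move=> y; rewrite lee_fin cdot_ge0.
Qed.

End MeasurePreserving.

Section Fourier2.
Variable R : realType.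
Notation leb := (@lebesgue_measure R).
Notation mu2 := (@leb2 R).
Implicit Types u v V : R * R -> R[i].

Let dot2 (z : (R * R) * (R * R)) : R := z.1.1 * z.2.1 + z.1.2 * z.2.2.

Let m11 : measurable_fun setT (fun z : (R * R) * (R * R) => z.1.1).
Proof.
exact: (measurableT_comp (@measurable_fst _ _ (measurableTypeR R) (measurableTypeR R))
  (@measurable_fst _ _ (measurableTypeR R * measurableTypeR R)%type (measurableTypeR R * measurableTypeR R)%type)).
Qed.

Let m12 : measurable_fun setT (fun z : (R * R) * (R * R) => z.1.2).
Proof.
exact: (measurableT_comp (@measurable_snd _ _ (measurableTypeR R) (measurableTypeR R))
  (@measurable_fst _ _ (measurableTypeR R * measurableTypeR R)%type (measurableTypeR R * measurableTypeR R)%type)).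
Qed.

Let m21 : measurable_fun setT (fun z : (R * R) * (R * R) => z.2.1).
Proof.
exact: (measurableT_comp (@measurable_fst _ _ (measurableTypeR R) (measurableTypeR R))
  (@measurable_snd _ _ (measurableTypeR R * measurableTypeR R)%type (measurableTypeR R * measurableTypeR R)%type)).
Qed.

Let m22 : measurable_fun setT (fun z : (R * R) * (R * R) => z.2.2).
Proof.
exact: (measurableT_comp (@measurable_snd _ _ (measurableTypeR R) (measurableTypeR R))
  (@measurable_snd _ _ (measurableTypeR R * measurableTypeR R)%type (measurableTypeR R * measurableTypeR R)%type)).
Qed.

Let measurable_dot2 : measurable_fun setT dot2.
Proof. by apply: measurable_funD; exact: measurable_funM. Qed.

Definition fourier2 u (xi : R * R) : R[i] :=
  cintegral mu2 setT (fun x => u x * expm2pi (x.1 * xi.1 + x.2 * xi.2)).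

Lemma cmeasurable_fourier2 u : cmeasurable setT u -> cmeasurable setT (fourier2 u).
Proof.
move=> mu_; apply: (@cmeasurable_cintegral2 _ _ _ _ R (@plane_measure R)
  (fun z : (R * R) * (R * R) => u z.1 * expm2pi (dot2 z))).
apply: cmeasurableM; last exact: cmeasurable_expm2pi_comp.
exact: (cmeasurable_comp mu_ (@measurable_fst _ _ (measurableTypeR R * measurableTypeR R)%type
  (measurableTypeR R * measurableTypeR R)%type)).
Qed.

Let measurable_lin (xi : R * R) : measurable_fun setT (fun x : R * R => x.1 * xi.1 + x.2 * xi.2).
Proof. by apply: measurable_funD; apply: measurable_funM. Qed.

Lemma L1_fourier2_kernel u xi : L1 mu2 setT u ->
  L1 mu2 setT (fun x => u x * expm2pi (x.1 * xi.1 + x.2 * xi.2)).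
Proof. exact: (@L1_expm2pi _ _ _ mu2 u (fun x : R * R => x.1 * xi.1 + x.2 * xi.2) (measurable_lin xi)). Qed.

Let expm2piD (a b : R) : expm2pi (a + b) = expm2pi a * expm2pi b.
Proof.
rewrite /expm2pi mulrDr cosD sinD; apply: complexP => /=; last by ring.
by rewrite mulrNN.
Qed.

Let partial u z := fourier_integral u (z.2, z.1).

Let L1_partial u xi1 : L1 mu2 setT u -> L1 leb setT (fun x2 => partial u (x2, xi1)).
Proof.
move=> Lu.
have L : L1 mu2 setT (fun x => u x * expm2pi (x.1 * xi1)).
  apply: (@L1_expm2pi _ _ _ mu2 u (fun x : R * R => x.1 * xi1)) => //.
  by apply: measurable_funM.
exact: (@L1_fubini2 _ _ _ _ _ leb leb _ L).
Qed.

(** The plane transform is the composition of the two partial transforms. *)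
Lemma fourier2E u xi : L1 mu2 setT u ->
  fourier2 u xi = fourier_integral (partial u) (xi.2, xi.1).
Proof.
move=> Lu; have L := L1_fourier2_kernel xi Lu; have [mu_ _] := Lu.
rewrite /fourier2 -[LHS](@cintegral_fubini2 _ _ _ _ _ leb leb _ L).
have [mL2 _] := @L1_fubini2 _ _ _ _ _ leb leb _ L.
apply: ae_eq_cintegral => //.
  have [m _] := L1_partial xi.1 Lu; apply: cmeasurableM => //.
  apply: cmeasurable_expm2pi_comp; apply: measurable_funM => //; exact: measurable_cst.
apply: (ae_imp _ (L1_section Lu)) => y Ly /=.
have mr : measurable_fun setT (fun s : R => s * xi.1).
  by apply: measurable_funM => //; exact: measurable_cst.
rewrite /partial /fourier_integral/= -cintegralMr; last exact: (@L1_expm2pi _ _ _ leb _ (fun s : R => s * xi.1) mr Ly).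
by apply: eq_cintegral => x _; rewrite expm2piD mulrA.
Qed.

Let L2normsq_swap V : cmeasurable setT V ->
  L2normsq mu2 setT (fun z => V (z.2, z.1)) = L2normsq mu2 setT V.
Proof.
move=> mV; apply: (@L2normsq_preserving _ _ _ _ _ mu2 mu2 (fun z : R * R => (z.2, z.1))) => //.
by move=> g mg g0; exact: ge0_integral_swap.
Qed.

Lemma plancherel2 u : L1 mu2 setT u -> L2 mu2 setT u ->
  L2normsq mu2 setT (fourier2 u) = L2normsq mu2 setT u.
Proof.
move=> L1u L2u; have [mu_ uu] := L2u.
have mP := cmeasurable_fourier_integral mu_.
have mpart : cmeasurable setT (partial u) by exact: (cmeasurable_comp mP (@measurable_swap R)).
rewrite (_ : fourier2 u = fun xi => fourier_integral (partial u) (xi.2, xi.1)); last first.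
  by apply/funext => xi; exact: fourier2E.
rewrite L2normsq_swap; last exact: cmeasurable_fourier_integral.
have e : L2normsq mu2 setT (partial u) = L2normsq mu2 setT u.
  by rewrite L2normsq_swap// plancherel_partial//; exact: L1_section.
rewrite plancherel_partial//; first by split => //; rewrite e.
by apply: aeW => y; exact: L1_partial.
Qed.

Lemma L2_fourier2 u : L1 mu2 setT u -> L2 mu2 setT u -> L2 mu2 setT (fourier2 u).
Proof.
move=> L1u L2u; have [mu_ uu] := L2u; split; first exact: cmeasurable_fourier2.
by rewrite plancherel2.
Qed.

Lemma fourier2D u v xi : L1 mu2 setT u -> L1 mu2 setT v ->
  fourier2 (fun x => u x + v x) xi = fourier2 u xi + fourier2 v xi.
Proof.
move=> Lu Lv; rewrite /fourier2 -cintegral_L1D; [|exact: L1_fourier2_kernel..].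
by apply: eq_cintegral => x _; rewrite mulrDl.
Qed.

Lemma parseval2 u v : L1 mu2 setT u -> L2 mu2 setT u ->
  L1 mu2 setT v -> L2 mu2 setT v ->
  ip mu2 setT (fourier2 u) (fourier2 v) = ip mu2 setT u v.
Proof.
move=> L1u L2u L1v L2v; have L1uv := L1D L1u L1v; have L2uv := L2D measurableT L2u L2v.
have Fu := L2_fourier2 L1u L2u; have Fv := L2_fourier2 L1v L2v.
have n w : L1 mu2 setT w -> L2 mu2 setT w ->
    ip mu2 setT (fourier2 w) (fourier2 w) = ip mu2 setT w w.
  move=> L1w L2w; have Fw := L2_fourier2 L1w L2w.
  by apply: EFin_inj; rewrite -!L2normsq_fin// plancherel2.
have := n _ L1uv L2uv.
rewrite (_ : fourier2 (fun x => u x + v x) = fun xi => fourier2 u xi + fourier2 v xi); last first.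
  by apply/funext => xi; exact: fourier2D.
rewrite (ipDD measurableT Fu Fv) (ipDD measurableT L2u L2v) (n u)// (n v)//.
by move: (ip _ _ _ _) (ip _ _ _ _) (ip _ _ _ _) (ip _ _ _ _) => a b c e; lra.
Qed.

Definition fourier2_inv V (x : R * R) : R[i] :=
  cintegral mu2 setT (fun xi => V xi * expm2pi (- (x.1 * xi.1 + x.2 * xi.2))).

Lemma fourier2_invE V x : fourier2_inv V x = fourier2 V (- x.1, - x.2).
Proof.
apply: eq_cintegral => xi _ /=; rewrite opprD !mulrN.
by rewrite (mulrC x.1) (mulrC x.2).
Qed.

Let measurable_opp2 : measurable_fun setT (fun x : R * R => (- x.1, - x.2)).
Proof. by apply: measurable_pair2; exact: measurable_funN. Qed.

Lemma cmeasurable_fourier2_inv V : cmeasurable setT V -> cmeasurable setT (fourier2_inv V).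
Proof.
move=> mV; rewrite (_ : fourier2_inv V = fun x => fourier2 V (- x.1, - x.2)); last first.
  by apply/funext => x; exact: fourier2_invE.
exact: (cmeasurable_comp (cmeasurable_fourier2 mV) measurable_opp2).
Qed.

Lemma plancherel2_inv V : L1 mu2 setT V -> L2 mu2 setT V ->
  L2normsq mu2 setT (fourier2_inv V) = L2normsq mu2 setT V.
Proof.
move=> L1V L2V; have [mV _] := L2V.
rewrite (_ : fourier2_inv V = fun x => fourier2 V (- x.1, - x.2)); last first.
  by apply/funext => x; exact: fourier2_invE.
rewrite -(plancherel2 L1V L2V).
apply: (@L2normsq_preserving _ _ _ _ _ mu2 mu2 (fun z : R * R => (- z.1, - z.2))) => //.
  by move=> g mg g0; exact: ge0_integral_opp2.
exact: cmeasurable_fourier2.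
Qed.

Lemma L2_fourier2_inv V : L1 mu2 setT V -> L2 mu2 setT V -> L2 mu2 setT (fourier2_inv V).
Proof.
move=> L1V L2V; have [mV VV] := L2V; split; first exact: cmeasurable_fourier2_inv.
by rewrite plancherel2_inv.
Qed.

Lemma ip_fourier2 u V : L1 mu2 setT u -> L1 mu2 setT V ->
  ip mu2 setT (fourier2 u) V = ip mu2 setT u (fourier2_inv V).
Proof.
move=> Lu LV.
exact: (@ip_kernel _ _ _ _ R (@plane_measure R) (@plane_measure R) dot2 measurable_dot2 u V Lu LV).
Qed.

(** Rotating coordinates aligns the frequency r theta with the first axis, and the integral along the second axis is the line integral. *)
Lemma slice u r theta : L1 mu2 setT u ->
  fourier_integral (radon u) (r, theta) = fourier2 u (r * cos theta, r * sin theta).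
Proof.
move=> Lu; pose RR := (measurableTypeR R * measurableTypeR R)%type.
have mrot : measurable_fun (setT : set RR) (rot theta : RR -> RR).
  exact: (@measurable_rot R theta).
have P (g : RR -> \bar R) : measurable_fun setT g -> (forall y, 0 <= g y)%E ->
    (\int[mu2]_x g (rot theta x) = \int[mu2]_y g y)%E.
  exact: (@ge0_integral_rot R theta g).
pose H x := u x * expm2pi (x.1 * (r * cos theta) + x.2 * (r * sin theta)).
have LH : L1 mu2 setT H by exact: (@L1_fourier2_kernel u (r * cos theta, r * sin theta)).
have Lur : L1 mu2 setT (u \o rot theta) 
  by refine (@L1_preserving _ _ _ _ R mu2 mu2 (rot theta) mrot P u Lu).
have LHr : L1 mu2 setT (H \o rot theta) 
  by refine (@L1_preserving _ _ _ _ R mu2 mu2 (rot theta) mrot P H LH).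
have e : cintegral mu2 setT (H \o rot theta) = cintegral mu2 setT H.
  by refine (@cintegral_preserving _ _ _ _ R mu2 mu2 (rot theta) P H LH).
rewrite /fourier2 -/H -e.
rewrite -[RHS](@cintegral_fubini1 _ _ _ _ _ leb leb _ LHr).
have [m1 _] := @L1_fubini1 _ _ _ _ _ leb leb _ LHr.
have [m2 _] := @L1_fubini1 _ _ _ _ _ leb leb _ Lur.
apply: ae_eq_cintegral => //.
  apply: cmeasurableM; first exact: m2.
  by apply: cmeasurable_expm2pi_comp; apply: measurable_funM => //; exact: measurable_cst.
apply: (ae_imp _ (@L1_slices1 _ _ _ _ _ leb leb _ Lur)) => s Ls /=.
rewrite /radon /= -cintegralMr//; apply: eq_cintegral => t _; rewrite /H /rot /=.
congr (_ * expm2pi _); have cs := cos2Dsin2 theta.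
transitivity (s * r * (cos theta ^+ 2 + sin theta ^+ 2)); first by rewrite cs mulr1.
ring.
Qed.

End Fourier2.

(** * Extension by zero and completeness of L2 *)

Definition zext (R : realType) (T : Type) (D : set T) (f : T -> R[i]) x : R[i] :=
  if x \in D then f x else 0.

Section ZeroExtension.
Context d (X : measurableType d) (R : realType).
Variables (mu : {measure set X -> \bar R}) (D : set X) (mD : measurable D).
Implicit Types f g : X -> R[i].
Local Notation zext := (zext D).

Let zextE (k : R[i] -> R) f : k 0 = 0 ->
  (fun x => k (zext f x)) = (fun x => k (f x)) \_ D.
Proof.
by move=> k0; apply/funext => x; rewrite patchE /zext; case: ifP.
Qed.

Lemma cmeasurable_zext f : cmeasurable D f -> cmeasurable setT (zext f).
Proof.
move=> [mr mi]; split.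
  by rewrite (zextE (k := @complex.Re R))//; apply/(measurable_restrictT _ mD).
by rewrite (zextE (k := @complex.Im R))//; apply/(measurable_restrictT _ mD).
Qed.

Lemma cmeasurableTS f : cmeasurable setT f -> cmeasurable D f.
Proof. by move=> [? ?]; split; exact: measurable_funTS. Qed.

Lemma L2normsq_zext f : L2normsq mu setT (zext f) = L2normsq mu D f.
Proof.
rewrite !L2normsqE [RHS]integral_mkcond; apply: eq_integral => x _.
by rewrite patchE /zext; case: ifP => // _; rewrite cdot0l.
Qed.

Lemma L2_zext f : L2 mu D f -> L2 mu setT (zext f).
Proof.
by move=> [mf ff]; split; [exact: cmeasurable_zext|rewrite L2normsq_zext].
Qed.

Lemma L1_zext f : L1 mu D f -> L1 mu setT (zext f).
Proof.
move=> [mf ff]; split; first exact: cmeasurable_zext.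
apply: le_lt_trans ff; rewrite [leRHS]integral_mkcond le_eqVlt; apply/orP; left.
apply/eqP; apply: eq_integral => x _.
by rewrite patchE /zext; case: ifP => // _; rewrite Normc.normc0.
Qed.

Lemma ip_zext f g : ip mu setT (zext f) (zext g) = ip mu D f g.
Proof.
rewrite /ip [RHS]Rintegral_mkcond; apply: eq_Rintegral => x _.
by rewrite patchE /zext; case: ifP => // _; rewrite cdot0l.
Qed.

Lemma zextB f g x : zext (fun x => f x - g x) x = zext f x - zext g x.
Proof. by rewrite /zext; case: ifP => // _; rewrite subr0. Qed.

Lemma zext_id f x : D x -> zext f x = f x.
Proof. by move=> Dx; rewrite /zext mem_set. Qed.

Lemma L2normsq_subset f : cmeasurable setT f -> (L2normsq mu D f <= L2normsq mu setT f)%E.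
Proof.
move=> mf; rewrite !L2normsqE; apply: ge0_subset_integral => //.
- by apply/measurable_EFinP; exact: measurable_cdot.
- by move=> x _; rewrite lee_fin cdot_ge0.
Qed.

Lemma L2_subset f : L2 mu setT f -> L2 mu D f.
Proof.
move=> [mf ff]; split; first exact: cmeasurableTS.
exact: le_lt_trans (L2normsq_subset mf) ff.
Qed.

Lemma L1_subset f : L1 mu setT f -> L1 mu D f.
Proof.
move=> [mf ff]; split; first exact: cmeasurableTS.
apply: le_lt_trans ff; apply: ge0_subset_integral => //.
- by apply/measurable_EFinP; exact: measurable_normc.
- by move=> x _; rewrite lee_fin normc_ge0.
Qed.

Lemma L2cvg_subset (f_ : nat -> X -> R[i]) f : (forall n, cmeasurable setT (f_ n)) ->
  cmeasurable setT f -> L2cvg mu setT f_ f -> L2cvg mu D f_ f.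
Proof.
move=> mf_ mf; rewrite /L2cvg => h.
apply: (@squeeze_cvge _ _ _ _ (cst 0%E) _ (fun n => L2normsq mu setT (fun x => f_ n x - f x))) => //.
- apply: nearW => n; apply/andP; split.
    by rewrite L2normsqE; apply: integral_ge0 => x _; rewrite lee_fin cdot_ge0.
  by apply: L2normsq_subset; exact: cmeasurableB.
- exact: cvg_cst.
Qed.

Lemma L2cvg_zext (f_ : nat -> X -> R[i]) f : L2cvg mu D f_ f ->
  L2cvg mu setT (fun n => zext (f_ n)) (zext f).
Proof.
rewrite /L2cvg (_ : (fun n => L2normsq mu setT _) = (fun n => L2normsq mu D (fun x => f_ n x - f x)))//.
apply/funext => n; rewrite -L2normsq_zext; congr L2normsq.
by apply/funext => x; rewrite zextB.
Qed.

End ZeroExtension.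

Section RieszFischer.
Context d (X : measurableType d) (R : realType).
Variable mu : {measure set X -> \bar R}.
Implicit Types f g : X -> R[i].

(** A real sequence with geometrically small increments is a convergent series of its increments. *)
Lemma cvg_geometric_increments (u : nat -> R) (C : R) :
  (forall k, `|u k.+1 - u k| <= C * 2^-1 ^+ k) -> cvgn u.
Proof.
move=> uC; have : cvgn [normed series (telescope u)].
  apply: (@series_le_cvg _ (fun k => `|telescope u k|) (geometric C 2^-1)) => //.
  - by move=> k; rewrite /geometric/= mulr_ge0 ?exprn_ge0//;
      have := le_trans (normr_ge0 _) (uC 0%N); rewrite expr0 mulr1.
  - apply: is_cvg_geometric_series; rewrite ger0_norm ?invr_ge0// invf_lt1//.
    by rewrite ltr1n.
move=> /normed_cvg h.
rewrite (_ : u = (fun n => u 0%N + series (telescope u) n)).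
  by apply: is_cvgD => //; exact: is_cvg_cst.
by apply/funext => n; rewrite seriesEnat /= telescope_sumr//; ring.
Qed.

Let sq_le (x S : R) k : 4 ^+ k * x <= S -> 0 <= x -> 0 <= S ->
  Num.sqrt x <= Num.sqrt S * 2^-1 ^+ k.
Proof.
move=> h x0 S0.
have e : Num.sqrt S * 2^-1 ^+ k = Num.sqrt (S * 4^-1 ^+ k).
  rewrite sqrtrM//; congr (_ * _).
  have -> : (4^-1 : R) = 2^-1 ^+ 2 by field.
  by rewrite exprAC sqrtr_sqr ger0_norm// exprn_ge0.
rewrite e ler_wsqrtr// exprVn ler_pdivlMr ?exprn_gt0//.
by rewrite mulrC.
Qed.

(** Riesz-Fischer: along a subsequence with increments below 8^-k the series of 4^k times the squared increments is integrable, which gives pointwise convergence off a null set; Fatou identifies the limit. *)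
Lemma L2_complete (f_ : nat -> X -> R[i]) : (forall n, L2 mu setT (f_ n)) ->
  (forall e : R, 0 < e -> exists N : nat, forall n m, (N <= n)%N -> (N <= m)%N ->
     ip mu setT (fun x => f_ n x - f_ m x) (fun x => f_ n x - f_ m x) <= e) ->
  exists2 f, L2 mu setT f & L2cvg mu setT f_ f.
Proof.
move=> Lf cauchy.
have LB n m : L2 mu setT (fun x => f_ n x - f_ m x) by exact: L2B.
have c8 k : 0 < (8^-1 : R) ^+ k by rewrite exprn_gt0.
pose N k := sval (cid (cauchy _ (c8 k))).
have NP k n m : (N k <= n)%N -> (N k <= m)%N ->
    ip mu setT (fun x => f_ n x - f_ m x) (fun x => f_ n x - f_ m x) <= 8^-1 ^+ k.
  by rewrite /N; case: cid => /= M; exact.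
pose nk := fix nk k := if k is k'.+1 then maxn (nk k').+1 (N k) else N 0%N.
have nkN k : (N k <= nk k)%N by case: k => //= k; exact: leq_maxr.
have nkS k : (nk k < nk k.+1)%N by exact: leq_maxl.
have nk_id k : (k <= nk k)%N by elim: k => // k IH; exact: leq_ltn_trans IH (nkS k).
pose D k x := cdot (f_ (nk k.+1) x - f_ (nk k) x) (f_ (nk k.+1) x - f_ (nk k) x).
have mDk k : measurable_fun setT (fun x => (4 ^+ k * D k x)%:E).
  apply/measurable_EFinP/measurable_funM; first exact: measurable_cst.
  by have [m _] := LB (nk k.+1) (nk k); exact: measurable_cdot.
have D0 k x : (0 <= (4 ^+ k * D k x)%:E)%E.
  by rewrite lee_fin mulr_ge0 ?exprn_ge0 ?cdot_ge0.
pose S x := (\sum_(k <oo) (4 ^+ k * D k x)%:E)%E.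
have mS : measurable_fun setT S by exact: ge0_emeasurable_sum.
have S0 x : (0 <= S x)%E by exact: nneseries_ge0.
have IS : (\int[mu]_x S x < +oo)%E.
  rewrite integral_nneseries//.
  apply: (@le_lt_trans _ _ (\sum_(k <oo) (geometric 1 2^-1 k)%:E)%E).
    apply: lee_nneseries => [k _ _|k _]; first by apply: integral_ge0 => x _; exact: D0.
    rewrite (eq_integral (fun x => (4 ^+ k)%:E * (D k x)%:E)%E)//.
    have [m _] := LB (nk k.+1) (nk k).
    rewrite ge0_integralZl_EFin; [|by []|by move=> x _; rewrite lee_fin cdot_ge0|
      by apply/measurable_EFinP; exact: measurable_cdot|exact: exprn_ge0].
    have h := NP k _ _ (leq_trans (nkN k) (ltnW (nkS k))) (nkN k).
    rewrite -L2normsqE L2normsq_fin// -EFinM lee_fin /geometric/= mul1r.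
    have -> : (2^-1 : R) ^+ k = 4 ^+ k * 8^-1 ^+ k.
      by rewrite -exprMn; congr (_ ^+ _); field.
    by rewrite ler_wpM2l// exprn_ge0.
  have cg : cvgn (series (geometric (1:R) 2^-1)).
    apply: is_cvg_geometric_series; rewrite ger0_norm ?invr_ge0// invf_lt1//.
    by rewrite ltr1n.
  have h1 : `|2^-1 : R| < 1 by rewrite ger0_norm ?invr_ge0// invf_lt1// ltr1n.
  have := cvg_geometric_series (a := 1) h1 => cgs.
  have : (fun n => (\sum_(0 <= k < n) (geometric (1:R) 2^-1 k)%:E)%E) @ \oo --> ((1 / (1 - 2^-1))%:E : \bar R).
    rewrite (_ : (fun n => _) = EFin \o series (geometric 1 2^-1)).
      by apply: cvg_EFin => //; exact: nearW.
    by apply/funext => n; rewrite /= sumEFin seriesEnat.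
  by move/cvg_lim => ->//; rewrite ltry.
pose A := [set x | S x < +oo]%E.
have mA : measurable A by have := emeasurable_fun_infty_o measurableT mS +oo%E; rewrite setTI.
have Aae : mu (~` A) = 0%E.
  have ISint : mu.-integrable setT S.
    apply/integrableP; split => //.
    by rewrite (eq_integral S)// => x _; rewrite gee0_abs.
  have [M [mM M0 MA]] := integrable_ae measurableT ISint.
  apply/eqP; rewrite eq_le measure_ge0 andbT -M0 le_measure ?inE//; first exact: measurableC.
  by move=> x nA; apply: MA => /= /(_ I); rewrite ge0_fin_numE.
pose g k := zext A (f_ (nk k)).
have mg k : cmeasurable setT (g k).
  by apply: cmeasurable_zext => //; apply: cmeasurableTS; have [] := Lf (nk k).
have gC x : exists C : R, forall k, Normc.normc (g k.+1 x - g k x) <= C * 2^-1 ^+ k.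
  have [xA|nA] := boolP (x \in A); last first.
    by exists 0 => k; rewrite /g /zext (negbTE nA) subrr Normc.normc0 mul0r.
  have Ax := set_mem xA.
  exists (Num.sqrt (fine (S x))) => k; rewrite /g !zext_id// normcV.
  have Sfin : S x \is a fin_num by rewrite ge0_fin_numE.
  apply: sq_le; [|exact: cdot_ge0|exact: fine_ge0].
  rewrite -lee_fin fineK//.
  have h := @nneseries_lim_ge R (fun k => (4 ^+ k * D k x)%:E) xpredT 0 k.+1
    (fun n _ _ => D0 n x).
  by apply: le_trans h; rewrite big_nat_recr//= leeDr// sume_ge0.
have cr x : cvgn (fun k => complex.Re (g k x)).
  have [C hC] := gC x; apply: (@cvg_geometric_increments _ C) => k.
  apply: le_trans (hC k); rewrite [X in `|X|](_ : _ = complex.Re (g k.+1 x - g k x)).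
    exact: normr_Re_le.
  by case: (g k.+1 x) (g k x) => ? ? [].
have ci x : cvgn (fun k => complex.Im (g k x)).
  have [C hC] := gC x; apply: (@cvg_geometric_increments _ C) => k.
  apply: le_trans (hC k); rewrite [X in `|X|](_ : _ = complex.Im (g k.+1 x - g k x)).
    exact: normr_Im_le.
  by case: (g k.+1 x) (g k x) => ? ? [].
pose f x := Complex (limn (fun k => complex.Re (g k x))) (limn (fun k => complex.Im (g k x))).
have mf : cmeasurable setT f.
  have mgr k : measurable_fun setT (fun x => complex.Re (g k x)) by have [] := mg k.
  have mgi k : measurable_fun setT (fun x => complex.Im (g k x)) by have [] := mg k.
  split.
    apply: (measurable_fun_cvg (h := fun k x => complex.Re (g k x)) mgr) => x _.
    exact: cr.
  apply: (measurable_fun_cvg (h := fun k x => complex.Im (g k x)) mgi) => x _.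
  exact: ci.
have key n e : 0 < e -> (forall m, (n <= m)%N ->
    ip mu setT (fun x => f_ n x - f_ m x) (fun x => f_ n x - f_ m x) <= e) ->
    (L2normsq mu setT (fun x => (f_ n x - f x)%R) <= e%:E)%E.
  move=> e0 he.
  pose h k x : \bar R := (cdot (f_ n x - g k x)%R (f_ n x - g k x)%R)%:E.
  have [mfn _] := Lf n.
  have mh k : measurable_fun setT (h k).
    by apply/measurable_EFinP; apply: measurable_cdot; exact: cmeasurableB.
  have h0 k x : (0 <= h k x)%E by rewrite lee_fin cdot_ge0.
  have hl x : h k x @[k --> \oo] --> (cdot (f_ n x - f x)%R (f_ n x - f x)%R)%:E.
    apply: cvg_EFin; first exact: nearW.
    have E (z w : R[i]) : cdot (z - w) (z - w) =
       (complex.Re z - complex.Re w) * (complex.Re z - complex.Re w) +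
       (complex.Im z - complex.Im w) * (complex.Im z - complex.Im w).
      by case: z w => ? ? [].
    rewrite (_ : fine \o _ = fun k =>
       (complex.Re (f_ n x) - complex.Re (g k x)) * (complex.Re (f_ n x) - complex.Re (g k x)) +
       (complex.Im (f_ n x) - complex.Im (g k x)) * (complex.Im (f_ n x) - complex.Im (g k x))).
      rewrite E; have c1 := cr x; have c2 := ci x.
      by apply: cvgD; apply: cvgM; apply: cvgB => //; exact: cvg_cst.
    by apply/funext => k /=; exact: E.
  pose h' k := h (k + n)%N.
  have hl' x : h' k x @[k --> \oo] --> (cdot (f_ n x - f x)%R (f_ n x - f x)%R)%:E.
    have := hl x; rewrite -(cvg_shiftn n); exact.
  rewrite L2normsqE.
  rewrite (_ : (fun x => _) = (fun x => limn_einf (h' ^~ x))); last first.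
    by apply/funext => x; have [-> _] := cvg_limn_einf_sup (hl' x).
  apply: le_trans (fatou mu measurableT (fun k => mh _) (fun k x _ => h0 _ x)) _.
  rewrite (_ : (fun k => _) = (fun k => \int[mu]_x (cdot (f_ n x - f_ (nk (k + n)%N) x)%R (f_ n x - f_ (nk (k + n)%N) x)%R)%:E)%E); last first.
    apply/funext => k; apply: ae_eq_integral => //.
    - have [m _] := LB n (nk (k + n)%N).
      by apply/measurable_EFinP; exact: measurable_cdot.
    exists (~` A); split => //; first exact: measurableC.
    move=> x /=; apply: contra_not => Ax _.
    by rewrite /h' /h /g zext_id.
  rewrite limn_einf_lim; apply: lime_le; first exact: is_cvg_einfs.
  apply: nearW => k; apply: (@le_trans _ _
    (\int[mu]_x (cdot (f_ n x - f_ (nk (k + n)%N) x)%R (f_ n x - f_ (nk (k + n)%N) x)%R)%:E)%E).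
    by apply: ereal_inf_lbound; exists k => /=.
  rewrite -L2normsqE L2normsq_fin// lee_fin; apply: he.
  exact: leq_trans (leq_addl k n) (nk_id _).
have Lff : L2 mu setT f.
  have [M MP] := cauchy 1 ltr01.
  have := key M 1 ltr01 (fun m Mm => MP _ _ (leqnn M) Mm) => hM.
  have LfM : L2 mu setT (fun x => f_ M x - f x).
    split; last by apply: le_lt_trans hM _; rewrite ltry.
    by apply: cmeasurableB => //; have [] := Lf M.
  have := L2B measurableT (Lf M) LfM.
  by congr L2; apply/funext => x; rewrite opprB addrC subrK.
exists f => //; apply: ge0_cvg0_le => [n|e e0].
  by rewrite L2normsqE; apply: integral_ge0 => x _; rewrite lee_fin cdot_ge0.
have [M MP] := cauchy e e0; exists M => // n /= Mn.
by apply: key => // m nm; apply: MP => //; exact: leq_trans Mn nm.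
Qed.

End RieszFischer.

(** * Parseval and surjectivity for the offset transform on the strip *)

Section Truncation.
Context d (X : measurableType d) (R : realType).
Variable mu : {measure set X -> \bar R}.
Implicit Types f g : X -> R[i].

Lemma L2_finite_support f (S : set X) : measurable S -> (mu S < +oo)%E ->
  (forall x, ~ S x -> f x = 0) -> L2 mu setT f -> L1 mu setT f.
Proof.
move=> mS fS f0 [mf ff]; split => //.
have mcf : measurable_fun setT (fun x => (cdot (f x) (f x))%:E).
  by apply/measurable_EFinP; exact: measurable_cdot.
have mi : measurable_fun setT (EFin \o \1_S : X -> \bar R).
  by apply/measurable_EFinP; exact: measurable_indic.
apply: (@le_lt_trans _ _ (\int[mu]_x ((\1_S x)%:E + (cdot (f x) (f x))%:E))%E).
  apply: ge0_le_integral => //.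
  - by move=> x _; rewrite lee_fin normc_ge0.
  - by apply/measurable_EFinP; exact: measurable_normc.
  - exact: emeasurable_funD.
  move=> x _; rewrite -EFinD lee_fin indicE.
  have [xS|xS] := boolP (x \in S).
    rewrite -normc_sq; move: (Normc.normc (f x)) => a; have := sqr_ge0 (a - 2^-1).
    rewrite /=; nra.
  rewrite f0; last by move/mem_set; rewrite (negbTE xS).
  by rewrite Normc.normc0 cdot0l addr0.
rewrite ge0_integralD//.
- by rewrite integral_indic// setIT -L2normsqE lte_add_pinfty.
- by move=> x _; rewrite lee_fin cdot_ge0.
Qed.

Lemma bounded_finite_support f (S : set X) (C : R) : measurable S -> (mu S < +oo)%E ->
  (forall x, ~ S x -> f x = 0) -> (forall x, Normc.normc (f x) <= C) ->
  cmeasurable setT f -> L1 mu setT f /\ L2 mu setT f.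
Proof.
move=> mS fS f0 fC mf.
suff Lf : L2 mu setT f by split => //; exact: (L2_finite_support mS).
split => //; rewrite L2normsqE.
have mi : measurable_fun setT (EFin \o \1_S : X -> \bar R).
  by apply/measurable_EFinP; exact: measurable_indic.
apply: (@le_lt_trans _ _ (\int[mu]_x ((C ^+ 2)%:E * (\1_S x)%:E))%E).
  apply: ge0_le_integral => //.
  - by move=> x _; rewrite lee_fin cdot_ge0.
  - by apply/measurable_EFinP; exact: measurable_cdot.
  - by apply: measurable_funeM.
  move=> x _; rewrite -EFinM lee_fin indicE.
  have [xS|xS] := boolP (x \in S).
    by rewrite mulr1 -normc_sq ler_sqr ?nnegrE ?normc_ge0// (le_trans (normc_ge0 _) (fC x)).
  rewrite f0; last by move/mem_set; rewrite (negbTE xS).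
  by rewrite cdot0l mulr0.
rewrite ge0_integralZl_EFin ?sqr_ge0//.
  by rewrite integral_indic// setIT lte_mul_pinfty// lee_fin sqr_ge0.
Qed.

Lemma L1B f g : L1 mu setT f -> L1 mu setT g -> L1 mu setT (fun x => f x - g x).
Proof.
move=> Lf /L1P[mg Ig]; apply: L1D => //; apply/L1P; split; first exact: cmeasurableN.
rewrite (_ : (fun x => _) = fun x => Normc.normc (g x))//.
by apply/funext => x; rewrite !normcV !(cdotNl, cdotC _ (- _)) opprK.
Qed.

Lemma L2cvg_truncation f (A : nat -> set X) : (forall n, measurable (A n)) ->
  (forall x, \forall n \near \oo, A n x) -> L2 mu setT f ->
  L2cvg mu setT (fun n => zext (A n) f) f.
Proof.
move=> mA Ax Lf; have [mf _] := Lf.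
have mz n : cmeasurable setT (zext (A n) f).
  by apply: cmeasurable_zext => //; exact: cmeasurableTS.
have Lz n : L2 mu setT (zext (A n) f) by apply: L2_zext => //; exact: L2_subset.
apply/(L2cvgP measurableT) => //.
have [|||||_ c] := @Rdominated_convergence _ _ _ mu setT measurableT
  (fun n x => cdot (zext (A n) f x - f x) (zext (A n) f x - f x)) (cst 0)
  (fun x => cdot (f x) (f x)).
- by move=> n; apply: measurable_cdot; exact: cmeasurableB.
- exact: measurable_cst.
- move=> x _; apply: cvg_near_cst; apply: filterS (Ax x) => n Anx.
  by rewrite zext_id// subrr cdot0l.
- exact: integrable_cdot.
- move=> n x _; rewrite ger0_norm ?cdot_ge0// /zext; case: ifP => _.
    by rewrite subrr cdot0l cdot_ge0.
  by rewrite sub0r !cdotNl cdotC !cdotNl opprK.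
by move: c; rewrite /ip Rintegral_cst// mul0r.
Qed.

End Truncation.

Section FourierStrip.
Variable R : realType.
Notation leb := (@lebesgue_measure R).
Notation mu2 := (@leb2 R).
Notation strip := (@strip R).
Implicit Types f g u v : R * R -> R[i].

Lemma fourier_integral_zext f : fourier_integral (zext strip f) = zext strip (fourier_integral f).
Proof.
apply/funext => -[r y]; rewrite /zext.
have [yI|yI] := boolP ((r, y) \in strip).
  apply: eq_cintegral => s _ /=; congr (_ * _); rewrite mem_set//.
  by move/set_mem : yI => [_ ?]; split.
have -> : fourier_integral (fun x => if x \in strip then f x else 0) (r, y) =
    cintegral leb setT (fun=> 0).
  apply: eq_cintegral => s _ /=; rewrite ifF ?mul0r//.
  apply/negbTE; move: yI; apply: contra => /set_mem[_ h]; apply/mem_set; split => //.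
by apply: complexP; rewrite /= Rintegral_cst// mul0r.
Qed.

Lemma L2_zextP d (X : measurableType d) (mu : {measure set X -> \bar R}) (D : set X)
    (f : X -> R[i]) : measurable D -> L2 mu setT (zext D f) -> L2 mu D f.
Proof.
move=> mD [mf ff]; split; last by rewrite -L2normsq_zext.
have [mr mi] : cmeasurable D (zext D f) by exact: cmeasurableTS.
split.
  by apply: eq_measurable_fun mr => x /set_mem Dx; rewrite zext_id.
by apply: eq_measurable_fun mi => x /set_mem Dx; rewrite zext_id.
Qed.

Lemma L1_strip_section f : L1 mu2 strip f ->
  {ae leb, forall y, L1 leb setT (fun s => zext strip f (s, y))}.
Proof. by move=> Lf; apply: L1_section; apply: L1_zext Lf; exact: measurable_strip. Qed.

Lemma L2_fourier_strip f : L1 mu2 strip f -> L2 mu2 strip f ->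
  L2 mu2 strip (fourier_integral f).
Proof.
have mS := @measurable_strip R.
move=> L1f L2f; apply: (L2_zextP mS); rewrite -fourier_integral_zext.
apply: L2_fourier_integral; last exact: L1_strip_section.
exact: L2_zext.
Qed.

Lemma fourier_integral_inv_zext f :
  fourier_integral_inv (zext strip f) = zext strip (fourier_integral_inv f).
Proof.
apply/funext => z; rewrite fourier_integral_invE fourier_integral_zext.
rewrite /zext; have -> : ((- z.1, z.2) \in strip) = (z \in strip).
  by apply/idP/idP => /set_mem[_ ?]; apply/mem_set; split.
by rewrite fourier_integral_invE.
Qed.

Lemma L2_fourier_inv_strip f : L1 mu2 strip f -> L2 mu2 strip f ->
  L2 mu2 strip (fourier_integral_inv f).
Proof.
have mS := @measurable_strip R.
move=> L1f L2f; apply: (L2_zextP mS); rewrite -fourier_integral_inv_zext.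
apply: L2_fourier_integral_inv; last exact: L1_strip_section.
exact: L2_zext.
Qed.

(** Both sides are continuous along the approximating sequence that defines F_1. *)
Lemma F1_adjoint f g psi : is_F1 f g -> L1 mu2 strip psi -> L2 mu2 strip psi ->
  ip mu2 strip g psi = ip mu2 strip f (fourier_integral_inv psi).
Proof.
have mS := @measurable_strip R.
move=> [Lf Lg [f_ [Lf_ cf cg]]] L1p L2p.
have e n : ip mu2 strip (fourier_integral (f_ n)) psi =
    ip mu2 strip (f_ n) (fourier_integral_inv psi).
  have [L1n L2n] := Lf_ n.
  rewrite -ip_zext -fourier_integral_zext ip_fourier_integral.
  - by rewrite fourier_integral_inv_zext ip_zext.
  - exact: L2_zext.
  - exact: L2_zext.
  - exact: L1_strip_section.
  - exact: L1_strip_section.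
have c1 : ip mu2 strip (fourier_integral (f_ n)) psi @[n --> \oo] --> ip mu2 strip g psi.
  by apply: (ip_cvg mS) => // n; have [? ?] := Lf_ n; exact: L2_fourier_strip.
have c2 : ip mu2 strip (f_ n) (fourier_integral_inv psi) @[n --> \oo] -->
    ip mu2 strip f (fourier_integral_inv psi).
  apply: (ip_cvg mS) => //; last exact: L2_fourier_inv_strip.
  by move=> n; have [] := Lf_ n.
by apply: cvg_unique c2 => //; move: c1; under eq_cvg do rewrite e.
Qed.

Lemma F1_parseval f g phi : is_F1 f g -> L1 mu2 strip phi -> L2 mu2 strip phi ->
  ip mu2 strip g (fourier_integral phi) = ip mu2 strip f phi.
Proof.
have mS := @measurable_strip R.
move=> [Lf Lg [f_ [Lf_ cf cg]]] L1p L2p.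
have e n : ip mu2 strip (fourier_integral (f_ n)) (fourier_integral phi) =
    ip mu2 strip (f_ n) phi.
  have [L1n L2n] := Lf_ n.
  rewrite -ip_zext -!fourier_integral_zext parseval_partial.
  - by rewrite ip_zext.
  - exact: L2_zext.
  - exact: L2_zext.
  - exact: L1_strip_section.
  - exact: L1_strip_section.
have c1 : ip mu2 strip (fourier_integral (f_ n)) (fourier_integral phi) @[n --> \oo] -->
    ip mu2 strip g (fourier_integral phi).
  apply: (ip_cvg mS) => //; last exact: L2_fourier_strip.
  by move=> n; have [? ?] := Lf_ n; exact: L2_fourier_strip.
have c2 : ip mu2 strip (f_ n) phi @[n --> \oo] --> ip mu2 strip f phi.
  by apply: (ip_cvg mS) => // n; have [] := Lf_ n.
by apply: cvg_unique c2 => //; move: c1; under eq_cvg do rewrite e.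
Qed.


(** the part of the strip with |s| <= n *)
Definition strip_box (n : nat) : set (R * R) := [set z | `|z.1| <= n%:R] `&` strip.

Lemma strip_boxE n : strip_box n = `[- n%:R, n%:R] `*` `[0, pi].
Proof.
apply/seteqP; split=> -[s y] /=; rewrite /strip_box /Defs.strip/= !in_itv/= ler_norml.
  by move=> [a [_ b]].
by move=> [a b].
Qed.

Lemma measurable_strip_box n :
  measurable (strip_box n : set (measurableTypeR R * measurableTypeR R)).
Proof. by rewrite strip_boxE; apply: measurableX; exact: measurable_itv. Qed.

Lemma leb_itv_lty a b : (leb [set` `[a, b]] < +oo)%E.
Proof. by rewrite lebesgue_measure_itv/=; case: ifP => _; rewrite ?ltry// -EFinB ltry. Qed.

Lemma strip_box_lty n : (mu2 (strip_box n) < +oo)%E.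
Proof.
rewrite strip_boxE [X in (X < _)%E](@product_measure1E _ _ _ _ R leb leb); [|exact: measurable_itv|exact: measurable_itv].
apply: lte_mul_pinfty => //; last exact: leb_itv_lty.
by rewrite ge0_fin_numE//; exact: leb_itv_lty.
Qed.

Lemma fourier_integral_invB f g z :
  L1 leb setT (fun s => f (s, z.2)) -> L1 leb setT (fun s => g (s, z.2)) ->
  fourier_integral_inv (fun z => f z - g z) z =
  fourier_integral_inv f z - fourier_integral_inv g z.
Proof.
move=> Lf Lg; rewrite -cintegral_L1B.
- by apply: eq_cintegral => s _; rewrite mulrBl.
- by apply: L1_expm2pi => //; apply: measurable_funN; exact: measurable_funM.
- by apply: L1_expm2pi => //; apply: measurable_funN; exact: measurable_funM.
Qed.

(** Truncating values as well as offsets makes every section integrable, not only almost every one, so that transforms of truncations are additive everywhere. *)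
Lemma bounded_strip_section f n (C : R) y : cmeasurable setT f ->
  (forall z, ~ strip_box n z -> f z = 0) -> (forall z, Normc.normc (f z) <= C) ->
  L1 leb setT (fun s => f (s, y)).
Proof.
move=> mf f0 fC.
have fin : (leb `[(- n%:R)%R, n%:R%R]%classic < +oo)%E by exact: leb_itv_lty.
have mI : measurable (`[(- n%:R)%R, n%:R%R]%classic : set (measurableTypeR R)).
  exact: measurable_itv.
have z0 s : ~ `[(- n%:R)%R, n%:R%R]%classic s -> f (s, y) = 0.
  by move=> /= sn; apply: f0; apply: contra_not sn; rewrite strip_boxE => -[]/=.
have [] // := @bounded_finite_support _ _ _ leb (fun s => f (s, y)) _ C mI fin z0 (fun s => fC (s, y)).
exact: cmeasurable_fst_section.
Qed.

(** The preimage h is the L2 limit of inverse transforms of bounded truncations of g; its own truncations f_k have transforms converging to g, since [|| F f_k - g ||^2 = || g ||^2 - || f_k ||^2]. *)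
Lemma F1_surjective g : L2 mu2 strip g -> F1_invertible g.
Proof.
have mS := @measurable_strip R.
move=> Lg; pose G := zext strip g.
have LG : L2 mu2 setT G by exact: L2_zext.
have [mG _] := LG.
pose A n := strip_box n `&` [set z | Normc.normc (G z) <= n%:R].
have mn : measurable_fun setT (fun z => Normc.normc (G z) : R) by exact: measurable_normc.
have mA n : measurable (A n : set (measurableTypeR R * measurableTypeR R)).
  apply: measurableI; first exact: measurable_strip_box.
  by apply: measurable_set_le => //; exact: measurable_cst.
pose Gn n := zext (A n) G.
have mGn n : cmeasurable setT (Gn n).
  by apply: cmeasurable_zext; [exact: mA|exact: cmeasurableTS].
have Gn0 n z : ~ strip_box n z -> Gn n z = 0.
  by rewrite /Gn /zext; case: ifP => // /set_mem[].
have Gnle n z : Normc.normc (Gn n z) <= n%:R :> R.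
  by rewrite /Gn /zext; case: ifP => [/set_mem[]//|_]; rewrite Normc.normc0.
have LGn n : L1 mu2 setT (Gn n) /\ L2 mu2 setT (Gn n).
  exact: (@bounded_finite_support _ _ _ mu2 _ _ n%:R (measurable_strip_box n)
    (strip_box_lty n) (Gn0 n) (Gnle n) (mGn n)).
have Gns n y : L1 leb setT (fun s => Gn n (s, y)).
  exact: (bounded_strip_section y (mGn n) (Gn0 n) (Gnle n)).
(* truncations exhaust G *)
have Gc : L2cvg mu2 setT Gn G.
  rewrite (_ : Gn = fun n => zext ([set z | Normc.normc (G z) <= n%:R] `&` [set z | `|z.1| <= n%:R]) G).
    apply: L2cvg_truncation => // [n|z].
      apply: measurableI; first by apply: measurable_set_le => //; exact: measurable_cst.
      by apply: measurable_set_le; [exact: measurableT_comp|exact: measurable_cst].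
    by apply: filterI; exact: nbhs_infty_ger.
  apply/funext => n; apply/funext => z; rewrite /Gn /zext.
  have [zS|zS] := boolP (z \in strip); last first.
    have Gz : G z = 0 by rewrite /G /zext (negbTE zS).
    by rewrite Gz !if_same.
  congr (if _ then _ else _); apply/idP/idP => /set_mem.
    by move=> [[? ?] ?]; apply/mem_set.
  by move=> [? ?]; apply/mem_set; do 2?split => //; exact: set_mem.
pose hn n := fourier_integral_inv (Gn n).
have Lhn n : L2 mu2 setT (hn n).
  have [_ L2n] := LGn n.
  by apply: L2_fourier_integral_inv => //; apply: nearW.
have hnB n m : ip mu2 setT (fun z => hn n z - hn m z) (fun z => hn n z - hn m z) =
    ip mu2 setT (fun z => Gn n z - Gn m z) (fun z => Gn n z - Gn m z).
  have [_ Ln] := LGn n; have [_ Lm] := LGn m.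
  have LB := L2B measurableT Ln Lm.
  apply: EFin_inj; rewrite -!L2normsq_fin//; last exact: L2B.
  rewrite -[RHS]plancherel_partial_inv//.
    congr L2normsq; apply/funext => z.
    by rewrite (@fourier_integral_invB (Gn n) (Gn m) z (Gns n z.2) (Gns m z.2)).
  by apply: nearW => y; exact: (L1B (Gns n y) (Gns m y)).
have [h' Lh' ch'] : exists2 f, L2 mu2 setT f & L2cvg mu2 setT hn f.
  apply: L2_complete => // e e0.
  have Ln n : L2 mu2 setT (Gn n) by have [] := LGn n.
  have e4 : 0 < e / 4 by rewrite divr_gt0.
  have /(L2cvgP measurableT Ln LG)/cvgr0Pnorm_le/(_ _ e4)[N _ NP] := Gc.
  exists N => n m Nn Nm; rewrite hnB.
  have := NP n Nn; have := NP m Nm; rewrite /= !ger0_norm ?ip_ge0//.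
  have Lnm := L2B measurableT (Ln n) LG; have Lmm := L2B measurableT (Ln m) LG.
  have := ip_ge0 mu2 setT (fun z => (Gn n z - G z) + (Gn m z - G z)).
  rewrite (ipDD measurableT Lnm Lmm).
  have -> : (fun z => Gn n z - Gn m z) = (fun z => (Gn n z - G z) - (Gn m z - G z)).
    by apply/funext => z; rewrite opprB addrA subrK.
  rewrite (ipBB measurableT Lnm Lmm).
  move: (ip _ _ _ _) (ip _ _ _ _) (ip _ _ _ _) => a b c; lra.
pose h := zext strip h'.
have Lh : L2 mu2 setT h by apply: L2_zext => //; exact: L2_subset.
have ch : L2cvg mu2 setT hn h.
  rewrite (_ : hn = fun n => zext strip (hn n)).
    apply: L2cvg_zext => //; apply: L2cvg_subset => //.
    - by move=> n; have [] := Lhn n.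
    - by have [] := Lh'.
  apply/funext => n; rewrite -fourier_integral_inv_zext; congr fourier_integral_inv.
  apply/funext => z; rewrite /zext; case: ifP => // /negbT zS.
  by apply: Gn0 => -[_ /mem_set]; rewrite (negbTE zS).
pose fk k := zext (strip_box k) h.
have Lfk k : L2 mu2 setT (fk k).
  by apply: L2_zext; [exact: measurable_strip_box|apply: L2_subset => //; exact: measurable_strip_box].
have L1fk k : L1 mu2 setT (fk k).
  apply: (L2_finite_support (measurable_strip_box k) (strip_box_lty k)) => // z.
  by rewrite /fk /zext; case: ifP => // /set_mem.
have fks k := L1_section (L1fk k).
have fkc : L2cvg mu2 setT fk h.
  rewrite (_ : fk = fun n => zext [set z | `|z.1| <= n%:R] h).
    apply: L2cvg_truncation => // [n|z]; last exact: nbhs_infty_ger.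
    by apply: measurable_set_le; [exact: measurableT_comp|exact: measurable_cst].
  apply/funext => n; apply/funext => z; rewrite /fk /zext.
  have [zS|zS] := boolP (z \in strip); last first.
    have hz : h z = 0 by rewrite /h /zext (negbTE zS).
    by rewrite hz !if_same.
  congr (if _ then _ else _); apply/idP/idP => /set_mem.
    by move=> [? ?]; apply/mem_set.
  by move=> ?; apply/mem_set; split => //; exact: set_mem.
have hfk k : ip mu2 setT h (fk k) = ip mu2 setT (fk k) (fk k).
  by apply: eq_Rintegral => z _; rewrite /fk /zext; case: ifP => // _; rewrite [LHS]cdotC !cdot0l.
have Gfk k : ip mu2 setT (fourier_integral (fk k)) G = ip mu2 setT (fk k) (fk k).
  rewrite -hfk ipC.
  have c1 : ip mu2 setT (Gn n) (fourier_integral (fk k)) @[n --> \oo] --> ip mu2 setT G (fourier_integral (fk k)).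
    apply: (ip_cvg measurableT) => //; last exact: L2_fourier_integral.
    by move=> n; have [] := LGn n.
  have c2 := ip_cvg measurableT Lhn Lh (Lfk k) ch.
  have e n : ip mu2 setT (Gn n) (fourier_integral (fk k)) = ip mu2 setT (hn n) (fk k).
    have [_ L2n] := LGn n.
    rewrite ipC ip_fourier_integral//; last by apply: nearW => y; exact: Gns.
    exact: ipC.
  by move: c1; rewrite (funext e) => c1; exact: (cvg_unique _ c1 c2).
have nG : ip mu2 setT G G = ip mu2 setT h h.
  have Ln n : L2 mu2 setT (Gn n) by have [] := LGn n.
  have c1 := ip_norm_cvg measurableT Ln LG Gc.
  have c2 := ip_norm_cvg measurableT Lhn Lh ch.
  have e n : ip mu2 setT (Gn n) (Gn n) = ip mu2 setT (hn n) (hn n).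
    apply: EFin_inj; rewrite -!L2normsq_fin// plancherel_partial_inv//.
    by apply: nearW => y; exact: Gns.
  by move: c1; rewrite (funext e) => c1; exact: (cvg_unique _ c1 c2).
exists h; split => //.
  exact: L2_subset.
exists fk; split.
- by move=> k; split; [exact: L1_subset|exact: L2_subset].
- by apply: L2cvg_subset => // [n|]; [have [] := Lfk n|have [] := Lh].
have LF k : L2 mu2 setT (fourier_integral (fk k)) by exact: L2_fourier_integral.
have cG : L2cvg mu2 setT (fun k => fourier_integral (fk k)) G.
  apply/(L2cvgP measurableT LF LG).
  have e k : ip mu2 setT (fun z => fourier_integral (fk k) z - G z) (fun z => fourier_integral (fk k) z - G z) =
      ip mu2 setT (fk k) (fk k) - 2 * ip mu2 setT (fk k) (fk k) + ip mu2 setT h h.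
    rewrite (ipBB measurableT (LF k) LG) Gfk nG; congr (_ - _ + _).
    by apply: EFin_inj; rewrite -!L2normsq_fin// plancherel_partial.
  rewrite (funext e); have c := ip_norm_cvg measurableT Lfk Lh fkc.
  have e0 : 0 = ip mu2 setT h h - 2 * ip mu2 setT h h + ip mu2 setT h h by ring.
  rewrite [X in _ --> X]e0; apply: cvgD; last exact: cvg_cst.
  by apply: cvgB => //; apply: cvgMr.
have := L2cvg_subset mS (fun n => proj1 (LF n)) mG cG.
rewrite /L2cvg; set a := (fun n => _); set b := (X in _ -> X @ _ --> _).
suff -> : b = a by [].
apply/funext => n; apply: eq_integral => z /set_mem zS.
by rewrite /G zext_id.
Qed.

End FourierStrip.

(** * Polar isometry and duality of Radon transform and backprojection *)

Lemma integrableCl d (X : measurableType d) (R : realType) (mu : {measure set X -> \bar R})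
    (C : R) (f : X -> R) : mu.-integrable setT (EFin \o f) ->
  mu.-integrable setT (EFin \o (fun x => C * f x)).
Proof.
move=> If; have := integrableZl measurableT C If; congr integrable.
Qed.

Lemma ae_eq_L1 d (X : measurableType d) (R : realType) (mu : {measure set X -> \bar R})
    (f g : X -> R[i]) : L1 mu setT f -> cmeasurable setT g ->
  {ae mu, forall x, f x = g x} -> L1 mu setT g.
Proof.
move=> [mf ff] mg fg; split => //; apply: le_lt_trans ff.
rewrite le_eqVlt; apply/orP; left; apply/eqP; apply: ae_eq_integral => //.
- by apply/measurable_EFinP; exact: measurable_normc.
- by apply/measurable_EFinP; exact: measurable_normc.
- by apply: ae_imp fg => x ->.
Qed.

Section PolarIsometry.
Variable R : realType.
Notation leb := (@lebesgue_measure R).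
Notation mu2 := (@leb2 R).
Notation strip := (@strip R).
Implicit Types F G a b : R * R -> R[i].

Definition polar (z : R * R) : R * R := (z.1 * cos z.2, z.1 * sin z.2).

(** Multiplication by sqrt |r| identifies the weighted space of F_1 A u with L2 of the strip. *)
Definition wt a z : R[i] := (Num.sqrt `|z.1|)%:C%C * a z.

(** The isometry of L2 of the plane into L2 of the strip given by polar coordinates. *)
Definition Pol F : R * R -> R[i] := wt (F \o polar).

Lemma cdot_wt a b z : cdot (wt a z) (wt b z) = `|z.1| * cdot (a z) (b z).
Proof. by rewrite cdotZl cdotC cdotZl cdotC mulrA -expr2 sqr_sqrtr. Qed.

Lemma cmeasurable_wt D a : cmeasurable D a -> cmeasurable D (wt a).
Proof.
move=> ma; apply: cmeasurableM => //; apply: cmeasurable_real.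
apply: measurable_funTS; apply: (measurableT_comp (@measurable_sqrt R)).
exact: (measurableT_comp (@normr_measurable R setT)).
Qed.

Lemma cmeasurable_Pol F : cmeasurable setT F -> cmeasurable setT (Pol F).
Proof.
move=> mF; apply: cmeasurable_wt; exact: (cmeasurable_comp mF (@measurable_polar R)).
Qed.

Lemma L2normsq_wt a : L2normsq mu2 strip (wt a) = weighted_normsq a.
Proof.
by rewrite L2normsqE; apply: eq_integral => z _; rewrite cdot_wt -normc_sq.
Qed.

Lemma L2normsq_Pol F : cmeasurable setT F -> L2normsq mu2 strip (Pol F) = L2normsq mu2 setT F.
Proof.
move=> mF; rewrite [RHS]L2normsqE -(ge0_integral_polar (F := fun z => (cdot (F z) (F z))%:E)).
- by rewrite L2normsqE; apply: eq_integral => z _; rewrite cdot_wt EFinM.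
- by apply/measurable_EFinP; exact: measurable_cdot.
- by move=> z; rewrite lee_fin cdot_ge0.
Qed.

Lemma L2_Pol F : L2 mu2 setT F -> L2 mu2 strip (Pol F).
Proof.
move=> [mF fF]; split; last by rewrite L2normsq_Pol.
by apply: cmeasurableTS; exact: cmeasurable_Pol.
Qed.

Lemma PolD F G z : Pol (fun x => F x + G x) z = Pol F z + Pol G z.
Proof. by rewrite /Pol /wt /= mulrDr. Qed.

Lemma PolB F G z : Pol (fun x => F x - G x) z = Pol F z - Pol G z.
Proof. by rewrite /Pol /wt /= mulrBr. Qed.

Lemma ip_Pol F G : L2 mu2 setT F -> L2 mu2 setT G ->
  ip mu2 strip (Pol F) (Pol G) = ip mu2 setT F G.
Proof.
have mS := @measurable_strip R.
move=> LF LG; have LS := L2D measurableT LF LG.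
have n V : L2 mu2 setT V -> ip mu2 strip (Pol V) (Pol V) = ip mu2 setT V V.
  move=> LV; apply: EFin_inj; rewrite -!L2normsq_fin//; last exact: L2_Pol.
  by apply: L2normsq_Pol; case: LV.
have := n _ LS; rewrite (ipDD measurableT LF LG).
have -> : Pol (fun x => F x + G x) = (fun z => Pol F z + Pol G z).
  by apply/funext => z; rewrite PolD.
rewrite (ipDD mS (L2_Pol LF) (L2_Pol LG)) (n _ LF) (n _ LG).
by move: (ip _ _ _ _) (ip _ _ _ _) (ip _ _ _ _) (ip _ _ _ _) => a b c d; lra.
Qed.

End PolarIsometry.

Section DecayingFunctions.
Variable R : realType.
Notation leb := (@lebesgue_measure R).
Notation mu2 := (@leb2 R).
Notation strip := (@strip R).
Implicit Types phi h : R * R -> R[i].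

(** The class of test functions: it contains bounded functions with bounded support as well as exponentially damped bounded functions, and their Radon transforms decay exponentially in the offset. *)
Definition decays phi := cmeasurable setT phi /\
  exists C e : R, [/\ 0 <= C, 0 < e &
    forall x, Normc.normc (phi x) <= C * (expabs e x.1 * expabs e x.2)].

Lemma L2_bounded_L1 d (X : measurableType d) (mu : {measure set X -> \bar R})
    (f : X -> R[i]) (C : R) : L1 mu setT f -> (forall x, Normc.normc (f x) <= C) ->
  L2 mu setT f.
Proof.
move=> /L1P[mf If] fC; split => //; rewrite L2normsqE.
apply/(ge0_integrableP mu) => //.
- exact: measurable_cdot.
- by move=> x _; exact: cdot_ge0.
have IC : mu.-integrable setT (EFin \o (fun x => C * Normc.normc (f x) : R)).
  rewrite (_ : _ \o _ = (fun x => C%:E * (Normc.normc (f x) : R)%:E)%E)//.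
  exact: integrableZl.
apply: (Rle_integrable measurableT _ _ IC); first exact: measurable_cdot.
by move=> x _; rewrite ger0_norm ?cdot_ge0// -normc_sq expr2 ler_wpM2r ?normc_ge0.
Qed.

Lemma integrable_expabs2 (e : R) : 0 < e ->
  mu2.-integrable setT (EFin \o (fun x : R * R => expabs e x.1 * expabs e x.2)).
Proof.
by move=> e0; exact: (integrable_mul (integrable_expabs e0) (integrable_expabs e0)).
Qed.

Lemma decays_L12 phi : decays phi -> L1 mu2 setT phi /\ L2 mu2 setT phi.
Proof.
move=> [mphi [C [e [C0 e0 phiC]]]].
have L1phi : L1 mu2 setT phi.
  apply/L1P; split => //.
  have IC : mu2.-integrable setT (EFin \o (fun x : R * R => C * (expabs e x.1 * expabs e x.2))).
    by apply: integrableCl; exact: integrable_expabs2.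
  apply: (Rle_integrable measurableT _ _ IC); first exact: measurable_normc.
  by move=> x _; rewrite ger0_norm ?normc_ge0.
split => //; apply: (L2_bounded_L1 (C := C)) => // x.
apply: le_trans (phiC x) _; rewrite -[leRHS]mulr1 ler_wpM2l//.
by rewrite -[leRHS]mulr1 ler_pM ?expabs_ge0// expabs_le1.
Qed.

(** Both rotated coordinates are bounded by the sum of the absolute values of the original ones. *)
Lemma decays_rot phi : decays phi -> exists C e : R, [/\ 0 <= C, 0 < e &
  forall theta s t, Normc.normc (phi (rot theta (s, t))) <= C * (expabs e s * expabs e t)].
Proof.
move=> [_ [C [e [C0 e0 phiC]]]]; exists C, (e / 2); split => //; first exact: divr_gt0.
move=> theta s t; apply: le_trans (phiC _) _; rewrite ler_wpM2l//.
rewrite /expabs -!expRD ler_expR /rot /=.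
have hc := norm_cos_le1 theta; have hs := norm_sin_le1 theta.
set x := s * cos theta - t * sin theta; set y := s * sin theta + t * cos theta.
have cs := cos2Dsin2 theta.
have sE : s = x * cos theta + y * sin theta.
  rewrite /x /y; rewrite -[LHS]mulr1 -cs; ring.
have tE : t = y * cos theta - x * sin theta.
  rewrite /x /y; rewrite -[LHS]mulr1 -cs; ring.
have sx : `|s| <= `|x| + `|y|.
  rewrite {1}sE (le_trans (ler_normD _ _))// !normrM lerD// -[leRHS]mulr1 ler_wpM2l//.
have tx : `|t| <= `|x| + `|y|.
  rewrite {1}tE (le_trans (ler_normB _ _))// !normrM addrC lerD// -[leRHS]mulr1 ler_wpM2l//.
clearbody x y; nra.
Qed.

Lemma L1_line phi s theta : decays phi ->
  L1 leb setT (fun t => phi (rot theta (s, t))).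
Proof.
move=> dphi; have [mphi _] := dphi; have [C [e [C0 e0 phiC]]] := decays_rot dphi.
have mr : cmeasurable setT (fun t => phi (rot theta (s, t))).
  apply: (cmeasurable_comp (h := fun t => rot theta (s, t)) mphi).
  exact: (measurableT_comp (measurable_rot theta) (@pair1_measurable _ _ _ _ s)).
apply/L1P; split => //.
have IC : leb.-integrable setT (EFin \o (fun t => C * expabs e s * expabs e t)).
  by apply: integrableCl; exact: integrable_expabs.
apply: (Rle_integrable measurableT _ _ IC); first exact: measurable_normc.
by move=> t _; rewrite ger0_norm ?normc_ge0// -mulrA.
Qed.

Lemma normc_radon_le phi : decays phi -> exists C e : R, [/\ 0 <= C, 0 < e &
  forall z, Normc.normc (radon phi z) <= C * expabs e z.1].
Proof.
move=> dphi; have [C [e [C0 e0 phiC]]] := decays_rot dphi.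
exists (C * (2 / e)), e; split => //; first by rewrite mulr_ge0// divr_ge0// ltW.
move=> [s theta]; have L1l := L1_line s theta dphi.
apply: le_trans (normc_cintegral_le L1l) _.
have /L1P[ml Il] := L1l.
have IC : leb.-integrable setT (EFin \o (fun t => C * expabs e s * expabs e t)).
  by apply: integrableCl; exact: integrable_expabs.
apply: (@le_trans _ _ (\int[leb]_t (C * expabs e s * expabs e t))).
  by apply: le_Rintegral => // t _; rewrite -mulrA.
rewrite RintegralZl//; last exact: integrable_expabs.
rewrite /Rintegral integral_expabs//= mulrAC; lra.
Qed.

Let m11 : measurable_fun setT (fun z : (R * R) * R => z.1.1).
Proof.
exact: (measurableT_comp (@measurable_fst _ _ (measurableTypeR R) (measurableTypeR R))
  (@measurable_fst _ _ (measurableTypeR R * measurableTypeR R)%type (measurableTypeR R))).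
Qed.

Let m12 : measurable_fun setT (fun z : (R * R) * R => z.1.2).
Proof.
exact: (measurableT_comp (@measurable_snd _ _ (measurableTypeR R) (measurableTypeR R))
  (@measurable_fst _ _ (measurableTypeR R * measurableTypeR R)%type (measurableTypeR R))).
Qed.

Let m2 : measurable_fun setT (fun z : (R * R) * R => z.2).
Proof. exact: (@measurable_snd _ _ (measurableTypeR R * measurableTypeR R)%type (measurableTypeR R)). Qed.

Let mcos d (X : measurableType d) (u : X -> R) : measurable_fun setT u ->
  measurable_fun setT (fun x => cos (u x)).
Proof.
apply: measurableT_comp; apply: continuous_measurable_fun; exact: continuous_cos.
Qed.

Let msin d (X : measurableType d) (u : X -> R) : measurable_fun setT u ->
  measurable_fun setT (fun x => sin (u x)).
Proof.
apply: measurableT_comp; apply: continuous_measurable_fun; exact: continuous_sin.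
Qed.

(** (s, theta), t |-> the point of the line (s, theta) with parameter t *)
Let line (w : (R * R) * R) : R * R := rot w.1.2 (w.1.1, w.2).

Let mline : measurable_fun setT line.
Proof.
apply: measurable_pair2 => /=.
  by apply: measurable_funB; apply: measurable_funM => //; [exact: mcos|exact: msin].
by apply: measurable_funD; apply: measurable_funM => //; [exact: msin|exact: mcos].
Qed.

Lemma cmeasurable_radon phi : cmeasurable setT phi -> cmeasurable setT (radon phi).
Proof.
move=> mphi; have mF : cmeasurable setT (phi \o line) by exact: cmeasurable_comp.
exact: (cmeasurable_cintegral1 leb mF).
Qed.

Lemma radon_L12 phi : decays phi -> L1 mu2 strip (radon phi) /\ L2 mu2 strip (radon phi).
Proof.
have mS := @measurable_strip R.
move=> dphi; have [mphi _] := dphi; have mr := cmeasurable_radon mphi.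
have [C [e [C0 e0 phiC]]] := normc_radon_le dphi.
have mz : cmeasurable setT (zext strip (radon phi)).
  by apply: cmeasurable_zext => //; exact: cmeasurableTS.
have L1z : L1 mu2 setT (zext strip (radon phi)).
  apply/L1P; split => //.
  have Ii : leb.-integrable setT (EFin \o (\1_(`[0, pi]%classic : set (measurableTypeR R)) : R -> R)).
    have mI : measurable (`[0, pi]%classic : set (measurableTypeR R)) by exact: measurable_itv.
    apply/(ge0_integrableP leb) => //.
    by rewrite integral_indic// setIT; exact: leb_itv_lty.
  have IC : mu2.-integrable setT (EFin \o (fun z : R * R => C * (expabs e z.1 * \1_(`[0, pi]%classic : set (measurableTypeR R)) z.2))).
    by apply: integrableCl; exact: (integrable_mul (integrable_expabs e0) Ii).
  apply: (Rle_integrable measurableT _ _ IC); first exact: measurable_normc.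
  move=> z _; rewrite ger0_norm ?normc_ge0// /zext; case: ifP => [/set_mem[_ zI]|_].
    by rewrite indicE mem_set// mulr1.
  by rewrite Normc.normc0 !mulr_ge0// ?expabs_ge0// indicE.
have L2z : L2 mu2 setT (zext strip (radon phi)).
  apply: (L2_bounded_L1 (C := C)) => // z; rewrite /zext; case: ifP => _.
    by apply: le_trans (phiC z) _; rewrite -[leRHS]mulr1 ler_wpM2l// expabs_le1.
  by rewrite Normc.normc0.
split; last exact: (L2_zextP mS).
have [_ fz] := L1z; split; first exact: cmeasurableTS.
apply: le_lt_trans fz; rewrite [leLHS]integral_mkcond le_eqVlt; apply/orP; left.
apply/eqP; apply: eq_integral => z _.
by rewrite patchE /zext; case: ifP => // _; rewrite Normc.normc0.
Qed.

(** At fixed theta the map is a rotation of the plane. *)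
Lemma ge0_integral_line (g : (R * R) * R -> \bar R) : measurable_fun setT g ->
  (forall w, 0 <= g w)%E ->
  (\int[(@plane_measure R \x leb)%E]_w g (line w, w.1.2) =
   \int[(@plane_measure R \x leb)%E]_w g w)%E.
Proof.
move=> mg g0.
have mT : measurable_fun setT (fun w : (R * R) * R => (line w, w.1.2)).
  by apply: measurable_fun_pair; [exact: mline|exact: m12].
have mgT : measurable_fun setT (fun w => g (line w, w.1.2)) by exact: (measurableT_comp mg mT).
rewrite (@fubini_tonelli1 _ _ _ _ R (@plane_measure R) leb _ mgT); last by move=> w.
rewrite [RHS](@fubini_tonelli2 _ _ _ _ R (@plane_measure R) leb _ mg g0).
have mF := @measurable_fun_fubini_tonelli_F _ _ _ _ R leb _ mgT (fun w => g0 _).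
rewrite [LHS](@leb2_tonelli2 R _ mF); last by move=> z; apply: integral_ge0 => t _.
apply: eq_integral => theta _ /=; rewrite /fubini_F /=.
have mgt : measurable_fun setT (fun x => g (x, theta)).
  exact: (measurableT_comp mg (@pair2_measurable _ _ _ _ theta)).
transitivity (\int[mu2]_z g (rot theta z, theta))%E; last exact: (ge0_integral_rot theta mgt).
rewrite (@leb2_tonelli1 R)//.
exact: (measurableT_comp mgt (measurable_rot theta)).
Qed.

Section BackprojectionDuality.
Variable h : R * R -> R[i].
Hypothesis Lh : L2 mu2 strip h.

Let H := zext strip h.

Let mH : cmeasurable setT H.
Proof. by have [m _] := L2_zext (@measurable_strip R) Lh. Qed.

(** x, theta |-> (x . theta, theta) *)
Let foot (w : (R * R) * R) : R * R := (w.1.1 * cos w.2 + w.1.2 * sin w.2, w.2).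

Let mfoot : measurable_fun setT foot.
Proof.
apply: measurable_pair2; last exact: m2.
by apply: measurable_funD; apply: measurable_funM => //; [exact: mcos|exact: msin].
Qed.

Let foot_line w : foot (line w, w.1.2) = w.1.
Proof.
case: w => -[s th] t; rewrite /foot /line /rot /=; congr pair.
rewrite -[RHS]mulr1 -(cos2Dsin2 th); ring.
Qed.

Lemma backprojectionE x : backprojection h x = cintegral leb setT (fun th => H (foot (x, th))).
Proof.
have e (k : R[i] -> R) : k 0 = 0 ->
    \int[leb]_(th in `[0, pi]) k (h (x.1 * cos th + x.2 * sin th, th)) =
    \int[leb]_th k (H (foot (x, th))).
  move=> k0; rewrite Rintegral_mkcond; apply: eq_Rintegral => th _.
  rewrite patchE /H /zext /foot /=.
  have -> : ((x.1 * cos th + x.2 * sin th, th) \in strip) = (th \in `[0, pi]%classic).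
    apply/idP/idP => /set_mem => [[_ ?]|?]; apply/mem_set => //; by split.
  by case: ifP.
by apply: complexP => /=; [exact: (e (@complex.Re R))|exact: (e (@complex.Im R))].
Qed.

Lemma cmeasurable_backprojection : cmeasurable setT (backprojection h).
Proof.
have mF : cmeasurable setT (H \o foot) by exact: (cmeasurable_comp mH mfoot).
rewrite (_ : backprojection h = fun x => cintegral leb setT (fun th => (H \o foot) (x, th))).
  exact: (cmeasurable_cintegral1 leb mF).
by apply/funext => x; rewrite backprojectionE.
Qed.

Let F phi (w : (R * R) * R) : R[i] := H (foot w) * (phi w.1)^*%C.

Let mF phi : cmeasurable setT phi -> cmeasurable setT (F phi).
Proof.
move=> mphi; apply: cmeasurableM; first exact: (cmeasurable_comp mH mfoot).
by apply: cmeasurable_conj; apply: (cmeasurable_comp mphi); exact: measurable_fst.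
Qed.

Let L1F phi : decays phi -> L1 (@plane_measure R \x leb)%E setT (F phi).
Proof.
move=> dphi; have [mphi _] := dphi; have [C [e [C0 e0 phiC]]] := decays_rot dphi.
split; first exact: mF.
rewrite -(ge0_integral_line (g := fun w => (Normc.normc (F phi w) : R)%:E)); first last.
- by move=> w; rewrite lee_fin normc_ge0.
- by apply/measurable_EFinP; apply: measurable_normc; exact: mF.
have IH : mu2.-integrable setT (EFin \o (fun z : R * R => Normc.normc (H z) * (C * expabs e z.1) : R)).
  have Ii : leb.-integrable setT (EFin \o (\1_(`[0, pi]%classic : set (measurableTypeR R)) : R -> R)).
    have mI : measurable (`[0, pi]%classic : set (measurableTypeR R)) by exact: measurable_itv.
    apply/(ge0_integrableP leb) => //.
    by rewrite integral_indic// setIT; exact: leb_itv_lty.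
  have I1 : mu2.-integrable setT (EFin \o (fun z : R * R => expabs e z.1 * \1_(`[0, pi]%classic : set (measurableTypeR R)) z.2)).
    exact: (integrable_mul (integrable_expabs e0) Ii).
  have I2 := integrable_cdot measurableT (L2_zext (@measurable_strip R) Lh) (L2_zext (@measurable_strip R) Lh).
  have I3 : mu2.-integrable setT (EFin \o (fun z : R * R => C * expabs e z.1 * \1_(`[0, pi]%classic : set (measurableTypeR R)) z.2 + C * cdot (H z) (H z))).
    have := integrableD measurableT (integrableCl C I1) (integrableCl C I2).
    by congr integrable; apply/funext => z /=; rewrite mulrA.
  apply: (Rle_integrable measurableT _ _ I3).
    apply: measurable_funM; first exact: measurable_normc.
    apply: measurable_funM; first exact: measurable_cst.
    exact: (measurableT_comp (measurable_expabs e)).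
  move=> z _; rewrite ger0_norm ?mulr_ge0 ?normc_ge0 ?expabs_ge0// -normc_sq.
  have a0 := expabs_ge0 e z.1; have a1 := expabs_le1 z.1 e0.
  rewrite indicE; have [zS|zS] := boolP (z \in strip).
    have -> : (z.2 \in `[0, pi]%classic) by have [_ ?] := set_mem zS; apply/mem_set.
    rewrite mulr1; move: (Normc.normc (H z)) (expabs e z.1) a0 a1 => n a a0 a1.
    rewrite -mulrDr mulrCA ler_wpM2l//.
    have := sqr_ge0 (n - 2^-1); have := sqr_ge0 n; nra.
  rewrite {1}/H /zext (negbTE zS) Normc.normc0 mul0r.
  by apply: addr_ge0; [apply: mulr_ge0 => //; rewrite mulr_ge0 ?expabs_ge0|rewrite mulr_ge0 ?sqr_ge0].
have IB : (@plane_measure R \x leb)%E.-integrable setT (EFin \o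
    (fun w : (R * R) * R => Normc.normc (H w.1) * (C * expabs e w.1.1) * expabs e w.2 : R)).
  exact: (@integrable_mul _ _ _ _ R (@plane_measure R) leb _ _ IH (integrable_expabs e0)).
have mFl : cmeasurable setT (fun w => F phi (line w, w.1.2)).
  apply: (cmeasurable_comp (h := fun w : (R * R) * R => (line w, w.1.2)) (mF mphi)).
  by apply: measurable_fun_pair; [exact: mline|exact: m12].
have mnF := measurable_normc mFl.
apply: (proj1 (@ge0_integrableP _ _ _ (@plane_measure R \x leb)%E setT
  (fun w => Normc.normc (F phi (line w, w.1.2)) : R) mnF (fun w _ => normc_ge0 _))).
apply: (Rle_integrable measurableT _ _ IB); first exact: measurable_normc.
have nc (z : R[i]) : Normc.normc z^*%C = Normc.normc z :> R by rewrite !normcV cdot_conj.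
move=> w _; rewrite ger0_norm ?normc_ge0// /F foot_line normcM' nc /=.
rewrite -mulrA ler_wpM2l ?normc_ge0// -mulrA; exact: phiC.
Qed.

(** Fubini for one strictly positive test function shows that the defining integral converges at almost every point. *)
Lemma L1_backprojection : {ae mu2, forall x, L1 leb setT (fun th => H (foot (x, th)))}.
Proof.
pose E (x : R * R) : R[i] := (expabs 1 x.1 * expabs 1 x.2)%:C%C.
have dE : decays E.
  split.
    apply: cmeasurable_real; apply: measurable_funM.
      exact: (measurableT_comp (measurable_expabs 1)).
    exact: (measurableT_comp (measurable_expabs 1)).
  exists 1, 1; split => // x; rewrite mul1r normcV /cdot/= mul0r addr0 -expr2 sqrtr_sqr ger0_norm// mulr_ge0 ?expabs_ge0//.
have := L1_slices1 (L1F dE); apply: ae_imp => x.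
move=> LFx.
have Ex : E x != 0.
  by apply/eqP => -[/eqP]; rewrite mulf_eq0 /expabs !gt_eqF// expR_gt0.
have := L1M_bounded (C := Normc.normc (E x)^-1) (cmeasurable_cst _ (E x)^-1) (fun=> lexx _) LFx.
congr L1; apply/funext => th.
have e : (E x)^*%C = E x by rewrite /E /= oppr0.
by rewrite /F [(x, th).1]/= e mulrCA mulVf// mulr1.
Qed.

Let cdot_Re (z w : R[i]) : cdot z w = complex.Re (z * w^*%C).
Proof. by case: z w => [? ?] [? ?]; rewrite /cdot /=; ring. Qed.

Let aeF phi : {ae mu2, forall x, cintegral leb setT (fun th => F phi (x, th)) =
  backprojection h x * (phi x)^*%C}.
Proof.
by have := L1_backprojection; apply: ae_imp => x Lx; rewrite backprojectionE -cintegralMr.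
Qed.

Lemma integrable_backprojection phi : decays phi ->
  mu2.-integrable setT (EFin \o (fun x => cdot (backprojection h x) (phi x))).
Proof.
move=> dphi; have [mphi _] := dphi.
have LF : L1 mu2 setT (fun x => cintegral leb setT (fun th => F phi (x, th))).
  exact: (L1_fubini1 (L1F dphi)).
have LB : L1 mu2 setT (fun x => backprojection h x * (phi x)^*%C).
  apply: ae_eq_L1 (aeF phi) => //.
  apply: cmeasurableM; first exact: cmeasurable_backprojection.
  exact: cmeasurable_conj.
by have := L1_Re LB; congr integrable; apply/funext => x /=; rewrite cdot_Re.
Qed.

(** Fubini after the change of variables from points to lines. *)
Lemma backprojection_adjoint phi : decays phi ->
  ip mu2 setT (backprojection h) phi = ip mu2 strip h (radon phi).
Proof.
move=> dphi; have [mphi _] := dphi; have LF := L1F dphi.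
have [mLF _] := L1_fubini1 LF.
have mB := cmeasurable_backprojection.
have mT : measurable_fun setT (fun w : (R * R) * R => (line w, w.1.2)).
  by apply: measurable_fun_pair; [exact: mline|exact: m12].
have LFT : L1 (@plane_measure R \x leb)%E setT (F phi \o (fun w => (line w, w.1.2))).
  by refine (@L1_preserving _ _ _ _ R (@plane_measure R \x leb)%E (@plane_measure R \x leb)%E
    (fun w => (line w, w.1.2)) mT ge0_integral_line _ LF).
transitivity (complex.Re (cintegral (@plane_measure R \x leb)%E setT (F phi))).
  rewrite -(cintegral_fubini1 LF) /=.
  apply: ae_eq_Rintegral => //; first exact: measurable_cdot.
  - by case: mLF.
  - by have := aeF phi; apply: ae_imp => x h' _; rewrite cdot_Re -h'.
have eT := @cintegral_preserving _ _ _ _ R (@plane_measure R \x leb)%E (@plane_measure R \x leb)%E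
    (fun w => (line w, w.1.2)) ge0_integral_line _ LF.
rewrite -eT -(cintegral_fubini1 LFT) /=.
rewrite -ip_zext; apply: eq_Rintegral => -[s th] _.
rewrite cdotC.
transitivity (cdot (radon phi (s, th)) (H (s, th))); last first.
  rewrite /H /zext; case: ifP => // _.
  by rewrite cdot0l cdotC cdot0l.
rewrite /radon /= (cdot_cintegral _ (L1_line s th dphi)).
apply: eq_Rintegral => t _; rewrite cdotC cdot_Re /F foot_line //=.
Qed.

End BackprojectionDuality.

End DecayingFunctions.

(** * Parseval for the Radon transform, inversion of polar coordinates *)

Section RadonParseval.
Variable R : realType.
Notation leb := (@lebesgue_measure R).
Notation mu2 := (@leb2 R).
Notation strip := (@strip R).
Implicit Types u a phi V : R * R -> R[i].

Lemma fourier_radonE phi : L1 mu2 setT phi ->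
  fourier_integral (radon phi) = fourier2 phi \o @polar R.
Proof. by move=> Lphi; apply/funext => -[r th]; rewrite slice. Qed.

Let approx u a G (A : (R * R -> R[i]) -> R) : is_F1_radon u a -> L2 mu2 setT G ->
  (forall v, L1 mu2 setT v -> L2 mu2 setT v -> ip mu2 setT (fourier2 v) G = A v) ->
  forall u_ : nat -> R * R -> R[i],
  (forall n, L1 mu2 setT (u_ n) /\ L2 mu2 setT (u_ n)) ->
  weighted_normsq (fun z => fourier_integral (radon (u_ n)) z - a z) @[n --> \oo] --> 0%E ->
  A (u_ n) @[n --> \oo] --> ip mu2 strip (wt a) (Pol G).
Proof.
have mS := @measurable_strip R.
move=> [_ ma fa _] LG AP u_ Lu ca.
have Lwa : L2 mu2 strip (wt a).
  by split; [exact: cmeasurable_wt|rewrite L2normsq_wt].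
have LP n : L2 mu2 strip (Pol (fourier2 (u_ n))).
  by have [? ?] := Lu n; apply: L2_Pol; exact: L2_fourier2.
have cP : L2cvg mu2 strip (fun n => Pol (fourier2 (u_ n))) (wt a).
  rewrite /L2cvg (_ : (fun n => _) = fun n => weighted_normsq (fun z => fourier_integral (radon (u_ n)) z - a z))//.
  apply/funext => n; rewrite -L2normsq_wt; congr L2normsq; apply/funext => z.
  have [L1u _] := Lu n.
  by rewrite fourier_radonE// /Pol /wt /= mulrBr.
have := ip_cvg mS LP Lwa (L2_Pol LG) cP.
suff -> : (fun n => ip mu2 strip (Pol (fourier2 (u_ n))) (Pol G)) = (fun n => A (u_ n)) by [].
apply/funext => n; have [? ?] := Lu n.
by rewrite ip_Pol//; [exact: AP|exact: L2_fourier2].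
Qed.

(** For integrable u the transform F_1 A u is F_2 u in polar coordinates; both sides are continuous in u. *)
Lemma F1_radon_parseval u a phi : is_F1_radon u a -> L1 mu2 setT phi -> L2 mu2 setT phi ->
  ip mu2 strip (wt a) (Pol (fourier2 phi)) = ip mu2 setT u phi.
Proof.
move=> ua L1p L2p; have [Lu _ _ [u_ [Lu_ cu ca]]] := ua.
have c1 := approx ua (L2_fourier2 L1p L2p) (fun v L1v L2v => parseval2 L1v L2v L1p L2p) Lu_ ca.
have c2 := ip_cvg measurableT (fun n => proj2 (Lu_ n)) Lu L2p cu.
exact: (cvg_unique _ c1 c2).
Qed.

Lemma F1_radon_adjoint u a V : is_F1_radon u a -> L1 mu2 setT V -> L2 mu2 setT V ->
  ip mu2 strip (wt a) (Pol V) = ip mu2 setT u (fourier2_inv V).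
Proof.
move=> ua L1p L2p; have [Lu _ _ [u_ [Lu_ cu ca]]] := ua.
have c1 := approx ua L2p (fun v L1v L2v => ip_fourier2 L1v L1p) Lu_ ca.
have c2 := ip_cvg measurableT (fun n => proj2 (Lu_ n)) Lu (L2_fourier2_inv L1p L2p) cu.
exact: (cvg_unique _ c1 c2).
Qed.

Lemma weighted_normsq_F1_radon u a : is_F1_radon u a -> weighted_normsq a = L2normsq mu2 setT u.
Proof.
have mS := @measurable_strip R.
move=> ua; have [Lu ma fa [u_ [Lu_ cu ca]]] := ua.
have Lwa : L2 mu2 strip (wt a).
  by split; [exact: cmeasurable_wt|rewrite L2normsq_wt].
have LP n : L2 mu2 strip (Pol (fourier2 (u_ n))).
  by have [? ?] := Lu_ n; apply: L2_Pol; exact: L2_fourier2.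
have cP : L2cvg mu2 strip (fun n => Pol (fourier2 (u_ n))) (wt a).
  rewrite /L2cvg (_ : (fun n => _) = fun n => weighted_normsq (fun z => fourier_integral (radon (u_ n)) z - a z))//.
  apply/funext => n; rewrite -L2normsq_wt; congr L2normsq; apply/funext => z.
  have [L1u _] := Lu_ n.
  by rewrite fourier_radonE// /Pol /wt /= mulrBr.
have c1 := ip_norm_cvg mS LP Lwa cP.
have c2 := ip_norm_cvg measurableT (fun n => proj2 (Lu_ n)) Lu cu.
rewrite -L2normsq_wt L2normsq_fin// L2normsq_fin//; congr (_%:E).
apply: (cvg_unique _ _ c2) => //; move: c1.
suff -> : (fun n => ip mu2 strip (Pol (fourier2 (u_ n))) (Pol (fourier2 (u_ n)))) =
  (fun n => ip mu2 setT (u_ n) (u_ n)) by [].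
apply/funext => n; have [? ?] := Lu_ n.
by rewrite ip_Pol ?parseval2//; exact: L2_fourier2.
Qed.

End RadonParseval.

Section PolarInverse.
Variable R : realType.
Notation leb := (@lebesgue_measure R).
Notation mu2 := (@leb2 R).
Notation strip := (@strip R).

(** the angle is measured through its cotangent, which is one-to-one on (0, pi) *)
Definition pinv (p : R * R) : R * R :=
  let th := pi / 2 - atan (p.1 / p.2) in (p.2 / sin th, th).

Let sinh (x : R) : sin (pi / 2 - x) = cos x.
Proof. by rewrite sinB sin_pihalf cos_pihalf mul1r mul0r subr0. Qed.

Let cosh (x : R) : cos (pi / 2 - x) = sin x.
Proof. by rewrite cosB sin_pihalf cos_pihalf mul1r mul0r add0r. Qed.

Lemma measurable_pinv : measurable_fun setT pinv.
Proof.
have md : measurable_fun setT (fun p : R * R => p.1 / p.2).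
  by apply: measurable_funM => //; exact: measurable_funV.
have mth : measurable_fun setT (fun p : R * R => pi / 2 - atan (p.1 / p.2)).
  apply: measurable_funB; first exact: measurable_cst.
  exact: (measurableT_comp (@measurable_atan R)).
apply: measurable_pair2 => //; apply: measurable_funM => //; apply: measurable_funV.
have ms : measurable_fun setT (@sin R).
  by apply: continuous_measurable_fun; exact: continuous_sin.
exact: (measurableT_comp ms).
Qed.

Lemma polar_pinv p : p.2 != 0 -> polar (pinv p) = p.
Proof.
case: p => x y /= y0; rewrite /polar /pinv /= sinh cosh.
have c0 : cos (atan (x / y)) != 0 by rewrite cos_atan invr_eq0 gt_eqF// sqrtr_gt0 ltr_pwDl// sqr_ge0.
rewrite divfK//; congr pair.
rewrite mulrAC -mulrA -[sin _ / _]/(tan _) atanK; by field.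
Qed.

Lemma pinv_polar z : 0 < z.2 < pi -> z.1 != 0 -> pinv (polar z) = z.
Proof.
case: z => r th /= /andP[t0 tp] r0; rewrite /pinv /polar /=.
have s0 : sin th != 0 by rewrite gt_eqF// sin_gt0_pi// t0.
have -> : r * cos th / (r * sin th) = tan (pi / 2 - th).
  by rewrite /tan sinh cosh; move: (cos th) (sin th) s0 => c s s0; field; apply/andP.
rewrite tanK; last by rewrite in_itv /=; apply/andP; split; lra.
have -> : pi / 2 - (pi / 2 - th) = th by rewrite opprB addrC subrK.
by rewrite mulfK.
Qed.

(** A bounded function on the strip living away from r = 0 and from infinity comes from a bounded plane function with bounded support. The angles 0 and pi, where the inverse fails, form a null set. *)
Lemma polar_lift (v : R * R -> R[i]) (d C : R) : 0 < d -> cmeasurable setT v ->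
  (forall z, v z != 0 -> d <= `|z.1| <= d^-1) ->
  (forall z, Normc.normc (v z) <= C) ->
  exists V : R * R -> R[i], [/\ L1 mu2 setT V, L2 mu2 setT V,
    forall p, Normc.normc (V p) <= C &
    forall z, 0 < z.2 < pi -> V (polar z) = v z].
Proof.
move=> d0 mv vd vC; exists (v \o pinv).
have mV : cmeasurable setT (v \o pinv) by exact: (cmeasurable_comp mv measurable_pinv).
pose S : set (R * R) := `[- d^-1, d^-1]%classic `*` `[- d^-1, d^-1]%classic.
have mS : measurable (S : set (measurableTypeR R * measurableTypeR R)).
  by apply: measurableX; exact: measurable_itv.
have fS : (mu2 S < +oo)%E.
  rewrite [X in (X < _)%E](@product_measure1E _ _ _ _ R leb leb); [|exact: measurable_itv|exact: measurable_itv].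
  apply: lte_mul_pinfty => //; last exact: leb_itv_lty.
  by rewrite ge0_fin_numE//; exact: leb_itv_lty.
have V0 p : ~ S p -> (v \o pinv) p = 0.
  apply: contra_notP => /eqP /= vp; have /andP[h1 h2] := vd _ vp.
  have p2 : p.2 != 0.
    by apply: contraTneq h1 => e; rewrite /pinv /= e mul0r normr0 -ltNge.
  rewrite -(polar_pinv p2) /S /polar /= !in_itv/= -!ler_norml; split.
    rewrite normrM (le_trans _ h2)// -[leRHS]mulr1 ler_wpM2l//; exact: norm_cos_le1.
  rewrite normrM (le_trans _ h2)// -[leRHS]mulr1 ler_wpM2l//; exact: norm_sin_le1.
have [L1V L2V] := @bounded_finite_support _ _ _ mu2 _ S C mS fS V0 (fun p => vC _) mV.
split => // [p|z z2 /=]; first exact: vC.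
have [z1|z1] := eqVneq z.1 0; last by rewrite pinv_polar.
have nul w : w.1 = 0 -> v w = 0.
  move=> w0; apply/eqP; apply: contraT => /vd; rewrite w0 normr0 => /andP[].
  by rewrite leNgt d0.
by rewrite !nul// /pinv /polar /= z1 !mul0r.
Qed.

Let leb1 (c : R) : leb [set c] = 0%E.
Proof. by rewrite -set_itv1 lebesgue_measure_itv/= ltxx. Qed.

Let mu2X (A B : set (measurableTypeR R)) : measurable A -> measurable B ->
  mu2 (A `*` B) = (leb A * leb B)%E.
Proof. by move=> mA mB; exact: (@product_measure1E _ _ _ _ R leb leb). Qed.

Lemma ae_fst_neq0 : {ae mu2, forall z : R * R, z.1 != 0}.
Proof.
exists ([set 0] `*` setT); split.
- by apply: measurableX => //; exact: measurable_set1.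
- rewrite mu2X//; by rewrite leb1 mul0e.
- by move=> z /= /negP; rewrite negbK => /eqP.
Qed.

Lemma ae_strip_interior : {ae mu2, forall z, strip z -> 0 < z.2 < pi}.
Proof.
exists (setT `*` [set 0; pi]); split.
- by apply: measurableX => //; apply: measurableU; exact: measurable_set1.
- rewrite mu2X//; last by apply: measurableU; exact: measurable_set1.
  suff -> : leb [set 0; pi] = 0%E by rewrite mule0.
  have m1 (c : R) : measurable ([set c] : set (measurableTypeR R)) by exact: measurable_set1.
  by rewrite (measureU0 (m1 0) (m1 pi) (leb1 pi)); exact: leb1.
- move=> [r th] /= /not_implyP[[_]]; rewrite /= in_itv/= => /andP[t0 tp] h; split => //.
  move: t0 tp h; rewrite !le_eqVlt => /orP[/eqP <-|t0]; first by left.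
  by move=> /orP[/eqP ->|tp]; [right|rewrite t0 tp].
Qed.

End PolarInverse.

(** * Regularization by exponential damping *)

Section Smoothing.
Variable R : realType.
Notation leb := (@lebesgue_measure R).
Notation mu2 := (@leb2 R).
Notation strip := (@strip R).
Implicit Types V phi : R * R -> R[i].

(** Exponential damping makes inverse transforms of L2 functions admissible as test functions. *)
Definition damp (e : R) phi (x : R * R) : R[i] :=
  (expabs e x.1 * expabs e x.2)%:C%C * phi x.

Let mE (e : R) : measurable_fun setT (fun x : R * R => expabs e x.1 * expabs e x.2).
Proof.
by apply: measurable_funM; exact: (measurableT_comp (measurable_expabs e)).
Qed.

Let E01 (e : R) (x : R * R) : 0 < e -> 0 <= expabs e x.1 * expabs e x.2 <= 1.
Proof.
move=> e0; rewrite mulr_ge0 ?expabs_ge0//=.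
by rewrite -[leRHS]mulr1 ler_pM ?expabs_ge0// expabs_le1.
Qed.

Lemma normc_real (a : R) : Normc.normc a%:C%C = `|a|.
Proof. by rewrite normcV /cdot/= mul0r addr0 -expr2 sqrtr_sqr. Qed.

Lemma decays_damp e phi (C : R) : 0 < e -> 0 <= C -> cmeasurable setT phi ->
  (forall x, Normc.normc (phi x) <= C) -> decays (damp e phi).
Proof.
move=> e0 C0 mphi phiC; split.
  by apply: cmeasurableM => //; apply: cmeasurable_real; exact: mE.
exists C, e; split => // x; have /andP[E0 _] := E01 x e0.
by rewrite normcM' normc_real ger0_norm// mulrC ler_wpM2r.
Qed.

Lemma damp_cvg phi : L2 mu2 setT phi ->
  L2cvg mu2 setT (fun n => damp n.+1%:R^-1 phi) phi.
Proof.
move=> Lphi; have [mphi _] := Lphi.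
have e0 n : 0 < (n.+1%:R^-1 : R) by rewrite invr_gt0.
have md n : cmeasurable setT (damp n.+1%:R^-1 phi).
  by apply: cmeasurableM => //; apply: cmeasurable_real; exact: mE.
have Ld n : L2 mu2 setT (damp n.+1%:R^-1 phi).
  apply: (L2M_bounded measurableT (C := 1)) => //.
    by apply: cmeasurable_real; exact: mE.
  move=> x _; rewrite /cdot/= mulr0 addr0; have /andP[a0 a1] := E01 x (e0 n).
  by rewrite -[leRHS]mulr1 ler_pM.
apply/(L2cvgP measurableT) => //.
have mB n : cmeasurable setT (fun x => damp n.+1%:R^-1 phi x - phi x) by exact: cmeasurableB.
pose q n (x : R * R) := (expabs n.+1%:R^-1 x.1 * expabs n.+1%:R^-1 x.2 - 1) ^+ 2.
have dE n x : cdot (damp n.+1%:R^-1 phi x - phi x) (damp n.+1%:R^-1 phi x - phi x) =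
    q n x * cdot (phi x) (phi x).
  rewrite /damp /q; move: (_ * _) (phi x) => a [b c].
  by rewrite /cdot /=; ring.
have [|||||_ c] := @Rdominated_convergence _ _ _ mu2 setT measurableT
  (fun n x => cdot (damp n.+1%:R^-1 phi x - phi x) (damp n.+1%:R^-1 phi x - phi x)) (cst 0)
  (fun x => cdot (phi x) (phi x)).
- by move=> n; exact: (measurable_cdot (mB n) (mB n)).
- exact: measurable_cst.
- move=> x _.
  have cE (a : R) : expabs n.+1%:R^-1 a @[n --> \oo] --> (1 : R).
    have c : (- n.+1%:R^-1 * `|a|) @[n --> \oo] --> (- 0 * `|a| : R).
      by apply: cvgMl; apply: cvgN; exact: cvg_harmonic.
    have cc := @continuous_expR R (- 0 * `|a|).
    have := cvg_comp _ _ c cc.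
    by rewrite [X in expR X](_ : _ = 0) ?expR0// oppr0 mul0r.
  have c : (expabs n.+1%:R^-1 x.1 * expabs n.+1%:R^-1 x.2 - 1) @[n --> \oo] --> (1 * 1 - 1 : R).
    by apply: cvgB; [apply: cvgM; exact: cE|exact: cvg_cst].
  have cq : q n x * cdot (phi x) (phi x) @[n --> \oo] --> ((1 * 1 - 1) * (1 * 1 - 1) * cdot (phi x) (phi x) : R).
    by apply: cvgMl; exact: (cvgM c c).
  move: cq; rewrite mulr1 subrr !mul0r.
  rewrite (_ : (fun n => q n x * _) = (fun n => cdot (damp n.+1%:R^-1 phi x - phi x) (damp n.+1%:R^-1 phi x - phi x)))//.
  by apply/funext => n; rewrite dE.
- exact: integrable_cdot.
- move=> n x _; rewrite ger0_norm ?cdot_ge0// dE -[leRHS]mul1r ler_wpM2r ?cdot_ge0//.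
  have /andP[a0 a1] := E01 x (e0 n); rewrite /q.
  move: (expabs _ _ * expabs _ _) a0 a1 => a a0 a1; nra.
by move: c; rewrite /ip Rintegral_cst// mul0r.
Qed.

(** the Fourier transform of the damping factor is a product of Poisson kernels *)
Lemma cintegral_damp_kernel e (xi eta : R * R) : 0 < e ->
  cintegral mu2 setT (fun x => (expabs e x.1 * expabs e x.2)%:C%C *
    expm2pi (x.1 * (eta.1 - xi.1) + x.2 * (eta.2 - xi.2))) =
  (poisson e (eta.1 - xi.1) * poisson e (eta.2 - xi.2))%:C%C.
Proof.
move=> e0; set a := eta.1 - xi.1; set b := eta.2 - xi.2.
have mc k : measurable_fun setT (fun r : R => cos (2 * pi * k * r)).
  by apply: continuous_measurable_fun; exact: continuous_cosM.
have ms k : measurable_fun setT (fun r : R => sin (2 * pi * k * r)).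
  by apply: continuous_measurable_fun; exact: continuous_sinM.
have Ic k := integrable_expabsM e0 (mc k) (fun r => norm_cos_le1 (2 * pi * k * r)).
have Is k := integrable_expabsM e0 (ms k) (fun r => norm_sin_le1 (2 * pi * k * r)).
have Icc := @integrable_mul _ _ _ _ R leb leb _ _ (Ic a) (Ic b).
have Iss := @integrable_mul _ _ _ _ R leb leb _ _ (Is a) (Is b).
have Ics := @integrable_mul _ _ _ _ R leb leb _ _ (Ic a) (Is b).
have Isc := @integrable_mul _ _ _ _ R leb leb _ _ (Is a) (Ic b).
have eA (x : R * R) : 2 * pi * (x.1 * a + x.2 * b) = 2 * pi * a * x.1 + 2 * pi * b * x.2.
  by ring.
apply: complexP => /=.
  transitivity (\int[mu2]_x (expabs e x.1 * cos (2 * pi * a * x.1) * (expabs e x.2 * cos (2 * pi * b * x.2)) -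
      expabs e x.1 * sin (2 * pi * a * x.1) * (expabs e x.2 * sin (2 * pi * b * x.2)))).
    by apply: eq_Rintegral => x _; rewrite eA cosD; ring.
  rewrite (RintegralB measurableT Icc Iss).
  rewrite (@Rintegral_mul _ _ _ _ R leb leb _ _ (Ic a) (Ic b)).
  rewrite (@Rintegral_mul _ _ _ _ R leb leb _ _ (Is a) (Is b)).
  by rewrite !Rintegral_expabs_cos// !Rintegral_expabs_sin// mulr0 subr0.
transitivity (\int[mu2]_x (- (expabs e x.1 * sin (2 * pi * a * x.1) * (expabs e x.2 * cos (2 * pi * b * x.2)) +
      expabs e x.1 * cos (2 * pi * a * x.1) * (expabs e x.2 * sin (2 * pi * b * x.2))))).
  by apply: eq_Rintegral => x _; rewrite eA sinD; ring.
have In := integrableD measurableT Isc Ics.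
under eq_Rintegral do rewrite -mulN1r.
rewrite RintegralZl//.
rewrite (RintegralD measurableT Isc Ics).
rewrite (@Rintegral_mul _ _ _ _ R leb leb _ _ (Is a) (Ic b)).
rewrite (@Rintegral_mul _ _ _ _ R leb leb _ _ (Ic a) (Is b)).
by rewrite !Rintegral_expabs_sin// mul0r mulr0 addr0 mulr0.
Qed.

Let expm2piD (a b : R) : expm2pi a * expm2pi b = expm2pi (a + b).
Proof.
have -> : expm2pi a * expm2pi b = Complex
  (cos (2 * pi * a) * cos (2 * pi * b) - sin (2 * pi * a) * sin (2 * pi * b))
  (- (sin (2 * pi * a) * cos (2 * pi * b) + cos (2 * pi * a) * sin (2 * pi * b))).
  by apply: complexP => /=; ring.
by rewrite -cosD -sinD -mulrDr.
Qed.

Let mfst2 : measurable_fun setT (fun z : (R * R) * (R * R) => z.1).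
Proof. exact: (@measurable_fst _ _ (measurableTypeR R * measurableTypeR R)%type (measurableTypeR R * measurableTypeR R)%type). Qed.

Let msnd2 : measurable_fun setT (fun z : (R * R) * (R * R) => z.2).
Proof. exact: (@measurable_snd _ _ (measurableTypeR R * measurableTypeR R)%type (measurableTypeR R * measurableTypeR R)%type). Qed.

Let mf1 : measurable_fun setT (fun z : R * R => z.1).
Proof. exact: (@measurable_fst _ _ (measurableTypeR R) (measurableTypeR R)). Qed.

Let mf2 : measurable_fun setT (fun z : R * R => z.2).
Proof. exact: (@measurable_snd _ _ (measurableTypeR R) (measurableTypeR R)). Qed.

(** Fubini reduces the transform of a damped inverse transform to an average against the transform of the damping factor. *)
Lemma fourier2_damp V e xi : 0 < e -> L1 mu2 setT V ->
  fourier2 (damp e (fourier2_inv V)) xi =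
  cintegral mu2 setT (fun eta => V eta * (poisson e (xi.1 - eta.1) * poisson e (xi.2 - eta.2))%:C%C).
Proof.
move=> e0 LV; have [mV _] := LV; have /L1P[_ IV] := LV.
pose E (x : R * R) := expabs e x.1 * expabs e x.2.
have mEx : measurable_fun setT E by exact: mE.
have IE := integrable_expabs2 e0.
pose dot2 (z : (R * R) * (R * R)) : R := - (z.1.1 * z.2.1 + z.1.2 * z.2.2).
have mdot : measurable_fun setT dot2.
  apply: measurable_funN; apply: measurable_funD; apply: measurable_funM.
  - exact: (measurableT_comp mf1 mfst2).
  - exact: (measurableT_comp mf1 msnd2).
  - exact: (measurableT_comp mf2 mfst2).
  - exact: (measurableT_comp mf2 msnd2).
have mxi : measurable_fun setT (fun x : R * R => x.1 * xi.1 + x.2 * xi.2).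
  by apply: measurable_funD; apply: measurable_funM => //; exact: measurable_cst.
pose k x : R[i] := (E x)%:C%C * expm2pi (x.1 * xi.1 + x.2 * xi.2).
have mk : cmeasurable setT k.
  by apply: cmeasurableM; [exact: cmeasurable_real|exact: cmeasurable_expm2pi_comp].
pose G (z : (R * R) * (R * R)) : R[i] := V z.2 * expm2pi (dot2 z) * k z.1.
have nk x : Normc.normc (k x) = E x.
  rewrite normcM' normc_expm2pi mulr1 normc_real ger0_norm//.
  by have /andP[] := E01 x e0.
have LG : L1 (@plane_measure R \x @plane_measure R)%E setT G.
  apply/L1P; split.
    apply: cmeasurableM; last exact: (cmeasurable_comp mk mfst2).
    apply: cmeasurableM; first exact: (cmeasurable_comp mV msnd2).
    exact: cmeasurable_expm2pi_comp.
  have := @integrable_mul _ _ _ _ R (@plane_measure R) (@plane_measure R) _ _ IE IV.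
  congr integrable; apply/funext => z /=.
  by rewrite /G normcM' nk normcM' normc_expm2pi mulr1 mulrC.
transitivity (cintegral (@plane_measure R) setT (fun x => cintegral (@plane_measure R) setT (fun eta => G (x, eta)))).
  apply: eq_cintegral => x _; rewrite /damp /fourier2_inv -/(E x).
  have LVx : L1 (@plane_measure R) setT (fun eta => V eta * expm2pi (dot2 (x, eta))).
    apply: L1_expm2pi => //; apply: measurable_funN; apply: measurable_funD;
      by apply: measurable_funM => //; exact: measurable_cst.
  have -> : (fun eta => G (x, eta)) = (fun eta => V eta * expm2pi (dot2 (x, eta)) * k x) by [].
  by rewrite cintegralMr// /k [RHS]mulrA; congr (_ * _); exact: mulrC.
rewrite (cintegral_fubini1 LG) -(cintegral_fubini2 LG).
apply: eq_cintegral => eta _.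
rewrite -cintegral_damp_kernel//.
have mde : measurable_fun setT (fun x : R * R => x.1 * (xi.1 - eta.1) + x.2 * (xi.2 - eta.2)).
  by apply: measurable_funD; apply: measurable_funM => //; exact: measurable_cst.
have LE : L1 mu2 setT (fun x => (E x)%:C%C * expm2pi (x.1 * (xi.1 - eta.1) + x.2 * (xi.2 - eta.2))).
  apply: L1_expm2pi => //; apply/L1P; split; first exact: cmeasurable_real.
  move: IE; congr integrable; apply/funext => x; rewrite [RHS]/comp normc_real.
  by rewrite ger0_norm//; have /andP[] := E01 x e0.
rewrite mulrC -cintegralMr//; apply: eq_cintegral => x _.
rewrite /G /k /dot2 /= [RHS]mulrC -mulrA; congr (_ * _).
rewrite mulrCA expm2piD; congr (_ * expm2pi _); ring.
Qed.

(** The smoothed function is an average of V against a probability density. *)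
Lemma normc_fourier2_damp_le V e xi (C : R) : 0 < e -> L1 mu2 setT V ->
  (forall x, Normc.normc (V x) <= C) ->
  Normc.normc (fourier2 (damp e (fourier2_inv V)) xi) <= C.
Proof.
move=> e0 LV VC; have [mV _] := LV; rewrite fourier2_damp//.
have C0 : 0 <= C by apply: le_trans (VC 0); exact: normc_ge0.
have Ip k : leb.-integrable setT (EFin \o (fun y => poisson e (-1 * y + k))).
  by apply: integrable_affine; [rewrite oppr_eq0 oner_eq0|exact: integrable_poisson].
have IK : mu2.-integrable setT (EFin \o (fun eta : R * R => poisson e (-1 * eta.1 + xi.1) * poisson e (-1 * eta.2 + xi.2))).
  exact: (@integrable_mul _ _ _ _ R leb leb _ _ (Ip xi.1) (Ip xi.2)).
have kE k y : poisson e (k - y) = poisson e (-1 * y + k) by rewrite mulN1r addrC.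
have mK := measurable_int _ IK; move/measurable_EFinP in mK.
have nK eta : 0 <= poisson e (-1 * eta.1 + xi.1) * poisson e (-1 * eta.2 + xi.2).
  by rewrite mulr_ge0 ?poisson_ge0.
pose f eta := V eta * (poisson e (-1 * eta.1 + xi.1) * poisson e (-1 * eta.2 + xi.2))%:C%C.
rewrite (_ : (fun eta => _) = f); last by apply/funext => eta; rewrite !kE.
have mf : cmeasurable setT f by apply: cmeasurableM => //; exact: cmeasurable_real.
have fle eta : Normc.normc (f eta) <= C * (poisson e (-1 * eta.1 + xi.1) * poisson e (-1 * eta.2 + xi.2)).
  by rewrite normcM' normc_real ger0_norm ?nK// ler_wpM2r.
have Lf : L1 mu2 setT f.
  apply/L1P; split => //.
  apply: (Rle_integrable measurableT _ _ (integrableCl C IK)); first exact: measurable_normc.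
  by move=> eta _; rewrite ger0_norm ?normc_ge0.
apply: le_trans (normc_cintegral_le Lf) _.
have /L1P[_ If] := Lf.
apply: le_trans (le_Rintegral measurableT If (integrableCl C IK) (fun eta _ => fle eta)) _.
rewrite RintegralZl//.
rewrite (@Rintegral_mul _ _ _ _ R leb leb _ _ (Ip xi.1) (Ip xi.2)).
have e1 k : \int[leb]_y poisson e (-1 * y + k) = 1.
  have := @Rintegral_affine R (-1) k (poisson e) _ (integrable_poisson e0).
  rewrite normrN normr1 mul1r => <-; last by rewrite oppr_eq0 oner_eq0.
  by rewrite /Rintegral integral_poisson.
by rewrite !e1 !mulr1.
Qed.

Lemma decays_damp_fourier2_inv V e : 0 < e -> L1 mu2 setT V ->
  decays (damp e (fourier2_inv V)).
Proof.
move=> e0 L1V; have mf : cmeasurable setT (fourier2_inv V).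
  by have [mV _] := L1V; exact: cmeasurable_fourier2_inv.
pose C := \int[mu2]_x (Normc.normc (V x) : R).
have fC x : Normc.normc (fourier2_inv V x) <= C.
  rewrite fourier2_invE; apply: le_trans (normc_cintegral_le (L1_fourier2_kernel _ L1V)) _.
  rewrite le_eqVlt; apply/orP; left; apply/eqP; apply: eq_Rintegral => y _.
  by rewrite normcM' normc_expm2pi mulr1.
have C0 : 0 <= C by apply: le_trans (fC 0); exact: normc_ge0.
exact: decays_damp C0 mf fC.
Qed.

(** Expanding the square, only norms and pairings of the damped inverse transforms occur, and these converge. *)
Lemma fourier2_damp_cvg V : L1 mu2 setT V -> L2 mu2 setT V ->
  L2cvg mu2 setT (fun n => fourier2 (damp n.+1%:R^-1 (fourier2_inv V))) V.
Proof.
move=> L1V L2V; have L2f := L2_fourier2_inv L1V L2V; have [mf _] := L2f.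
have e0 n : 0 < (n.+1%:R^-1 : R) by rewrite invr_gt0.
have dd n := decays_damp_fourier2_inv (e0 n) L1V.
have L1d n : L1 mu2 setT (damp n.+1%:R^-1 (fourier2_inv V)) by have [] := decays_L12 (dd n).
have L2d n : L2 mu2 setT (damp n.+1%:R^-1 (fourier2_inv V)) by have [] := decays_L12 (dd n).
have L2F n := L2_fourier2 (L1d n) (L2d n).
apply/(L2cvgP measurableT L2F L2V).
have cd := damp_cvg L2f.
have c1 := ip_norm_cvg measurableT L2d L2f cd.
have c2 := ip_cvg measurableT L2d L2f L2f cd.
have nV : ip mu2 setT V V = ip mu2 setT (fourier2_inv V) (fourier2_inv V).
  by apply: EFin_inj; rewrite -!L2normsq_fin// plancherel2_inv.
have e n : ip mu2 setT (fun x => fourier2 (damp n.+1%:R^-1 (fourier2_inv V)) x - V x)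
    (fun x => fourier2 (damp n.+1%:R^-1 (fourier2_inv V)) x - V x) =
    ip mu2 setT (damp n.+1%:R^-1 (fourier2_inv V)) (damp n.+1%:R^-1 (fourier2_inv V)) -
    2 * ip mu2 setT (damp n.+1%:R^-1 (fourier2_inv V)) (fourier2_inv V) +
    ip mu2 setT (fourier2_inv V) (fourier2_inv V).
  by rewrite (ipBB measurableT (L2F n) L2V) parseval2// ip_fourier2// nV.
rewrite (funext e); pose A := ip mu2 setT (fourier2_inv V) (fourier2_inv V).
have e' : 0 = A - 2 * A + A by ring.
rewrite [X in _ --> X]e'; apply: cvgD; last exact: cvg_cst.
by apply: cvgB => //; apply: cvgMr.
Qed.

End Smoothing.

(** * The reconstruction error on the Fourier side *)

(** Fatou along functions that eventually coincide with f at every point. *)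
Lemma L2normsq_exhaust d (X : measurableType d) (R : realType) (mu : {measure set X -> \bar R})
    (f : X -> R[i]) (f_ : nat -> X -> R[i]) (K : R) :
  cmeasurable setT f -> (forall n, cmeasurable setT (f_ n)) ->
  (forall x, \forall n \near \oo, f_ n x = f x) ->
  (forall n, (L2normsq mu setT (f_ n) <= K%:E)%E) -> (L2normsq mu setT f <= K%:E)%E.
Proof.
move=> mf mf_ ff fK; rewrite L2normsqE.
have c x : (cdot (f_ n x) (f_ n x))%:E @[n --> \oo] --> (cdot (f x) (f x))%:E.
  by apply: cvg_near_cst; apply: filterS (ff x) => n ->.
rewrite (_ : (fun x => _) = (fun x => limn_einf (fun n => (cdot (f_ n x) (f_ n x))%:E))); last first.
  by apply/funext => x; have [-> _] := cvg_limn_einf_sup (c x).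
have mc n : measurable_fun setT (fun x => (cdot (f_ n x) (f_ n x))%:E).
  by apply/measurable_EFinP; exact: measurable_cdot.
have c0 n x : setT x -> (0 <= (cdot (f_ n x) (f_ n x))%:E)%E by rewrite lee_fin cdot_ge0.
apply: le_trans (fatou mu measurableT mc c0) _.
rewrite limn_einf_lim; apply: lime_le; first exact: is_cvg_einfs.
apply: nearW => k; apply: (@le_trans _ _ (L2normsq mu setT (f_ k))) => //.
by rewrite L2normsqE; apply: ereal_inf_lbound; exists k => /=.
Qed.

Lemma le_of_sqr_le (R : realType) (x K : R) : 0 <= x -> 0 <= K -> x ^+ 2 <= K * x -> x <= K.
Proof.
rewrite le_eqVlt => /orP[/eqP <-//|x0] K0.
by rewrite expr2 ler_pM2r.
Qed.

Lemma integrableClS d (X : measurableType d) (R : realType) (mu : {measure set X -> \bar R})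
    (D : set X) (C : R) (f : X -> R) : measurable D -> mu.-integrable D (EFin \o f) ->
  mu.-integrable D (EFin \o (fun x => C * f x)).
Proof. by move=> mD If; have := integrableZl mD C If; congr integrable. Qed.

Section ErrorIdentity.
Variable R : realType.
Notation leb := (@lebesgue_measure R).
Notation mu2 := (@leb2 R).
Notation strip := (@strip R).
Variables (u a h g : R * R -> R[i]).
Hypotheses (ua : is_F1_radon u a) (hg : is_F1 h g).

Let mS := @measurable_strip R.

(** the defect on the Fourier side, in the isometric L^2(strip) picture *)
Definition defect (z : R * R) : R[i] := wt a z - (Num.sqrt `|z.1|)^-1%:C%C * g z.

Let Lu : L2 mu2 setT u. Proof. by case: ua. Qed.
Let Lh : L2 mu2 strip h. Proof. by case: hg. Qed.
Let Lg : L2 mu2 strip g. Proof. by case: hg. Qed.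
Let Lwa : L2 mu2 strip (wt a).
Proof.
by have [_ ma fa _] := ua; split; [exact: cmeasurable_wt|rewrite L2normsq_wt].
Qed.

Let residual x := u x - backprojection h x.

Let mres : cmeasurable setT residual.
Proof. by apply: cmeasurableB; [case: Lu|exact: cmeasurable_backprojection]. Qed.

Let msq : measurable_fun setT (fun z : R * R => Num.sqrt `|z.1|).
Proof.
apply: (measurableT_comp (@measurable_sqrt R)).
exact: (measurableT_comp (@normr_measurable R setT)).
Qed.

Let mdef : cmeasurable strip defect.
Proof.
apply: cmeasurableB; first by case: Lwa.
apply: cmeasurableM; last by case: Lg.
apply: cmeasurable_real; apply: measurable_funTS; exact: measurable_funV.
Qed.

Let integrable_residual phi : decays phi ->
  mu2.-integrable setT (EFin \o (fun x => cdot (residual x) (phi x))).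
Proof.
move=> dphi; have [_ L2p] := decays_L12 dphi.
have := integrableB measurableT (integrable_cdot measurableT Lu L2p) (integrable_backprojection Lh dphi).
by congr integrable; apply/funext => x /=; rewrite cdotBl.
Qed.

Let residualE phi : decays phi -> ip mu2 setT residual phi =
  ip mu2 strip (wt a) (Pol (fourier2 phi)) - ip mu2 strip g (fourier2 phi \o @polar R).
Proof.
move=> dphi; have [L1p L2p] := decays_L12 dphi; have [L1r L2r] := radon_L12 dphi.
rewrite (F1_radon_parseval ua L1p L2p) -fourier_radonE// (F1_parseval hg L1r L2r).
rewrite -(backprojection_adjoint Lh dphi) /ip -RintegralB//.
- by apply: eq_Rintegral => x _; rewrite cdotBl.
- exact: (integrable_cdot measurableT Lu L2p).
- exact: (integrable_backprojection Lh dphi).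
Qed.

(** the singular factor 1 / sqrt |r| of the defect is absorbed by that of Pol *)
Let defectE F : L2 mu2 setT F -> L2 mu2 strip (F \o @polar R) ->
  ip mu2 strip (wt a) (Pol F) - ip mu2 strip g (F \o @polar R) =
  \int[mu2]_(z in strip) cdot (defect z) (Pol F z).
Proof.
move=> LF LFp; have LPF := L2_Pol LF.
rewrite /ip -RintegralB//; last 2 first.
- exact: integrable_cdot.
- exact: integrable_cdot.
have [mF _] := LF; have [mPF _] := LPF; have [mwa _] := Lwa.
have [mg _] := Lg; have [mFp _] := LFp.
apply: ae_eq_Rintegral => //.
- by apply: measurable_funB; apply: measurable_cdot.
- exact: measurable_cdot.
have := ae_fst_neq0 R; apply: ae_imp => z z0 _.
have n0 : Num.sqrt `|z.1| != 0 by rewrite gt_eqF// sqrtr_gt0 normr_gt0.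
have e : cdot (g z) (Pol F z) = Num.sqrt `|z.1| * cdot (g z) ((F \o @polar R) z).
  by rewrite cdotC cdotZl cdotC.
by rewrite /defect cdotBl [cdot (_%:C%C * g z) _]cdotZl e mulKf.
Qed.

Let L2_F_polar phi : decays phi -> L2 mu2 strip (fourier2 phi \o @polar R).
Proof.
move=> dphi; have [L1p _] := decays_L12 dphi; have [L1r L2r] := radon_L12 dphi.
by have := L2_fourier_strip L1r L2r; rewrite (fourier_radonE L1p).
Qed.

(** Testing against truncations phi_n of the residual gives [|| phi_n ||^2 = <residual, phi_n>], which is at most the norm of the defect times that of phi_n. *)
Lemma L2normsq_residual_le : (L2normsq mu2 strip defect < +oo)%E ->
  (L2normsq mu2 setT residual <= L2normsq mu2 strip defect)%E.
Proof.
move=> fd; have Ld : L2 mu2 strip defect by [].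
rewrite (L2normsq_fin mS Ld).
pose B n : set (R * R) := [set x | `|x.1| <= n%:R] `&` [set x | `|x.2| <= n%:R] `&`
  [set x | Normc.normc (residual x) <= n%:R].
have mn : measurable_fun setT (fun x => Normc.normc (residual x) : R) by exact: measurable_normc.
have mB n : measurable (B n : set (measurableTypeR R * measurableTypeR R)).
  apply: measurableI; [apply: measurableI|].
  - by apply: measurable_set_le; [exact: measurableT_comp|exact: measurable_cst].
  - by apply: measurable_set_le; [exact: measurableT_comp|exact: measurable_cst].
  - by apply: measurable_set_le => //; exact: measurable_cst.
pose phi n := zext (B n) residual.
have mphi n : cmeasurable setT (phi n).
  by apply: cmeasurable_zext; [exact: mB|exact: cmeasurableTS].
have dphi n : decays (phi n).
  split => //; exists (n%:R * expR n%:R ^+ 2), 1; split => //.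
  move=> x; rewrite /phi /zext; case: ifP => [/set_mem[[x1 x2] xr]|_].
    apply: le_trans xr _; rewrite -[leLHS]mulr1 -mulrA ler_wpM2l//.
    rewrite expr2 mulrACA /expabs -!expRD -[leLHS]expR0 ler_expR.
    by move: x1 x2 => /=; lra.
  by rewrite Normc.normc0 !mulr_ge0 ?expabs_ge0// ?exprn_ge0 ?expR_ge0.
apply: (@L2normsq_exhaust _ _ _ mu2 residual phi (ip mu2 strip defect defect)) => // [x|n].
  near=> n; rewrite /phi zext_id//; split; [split|] => /=; near: n; exact: nbhs_infty_ger.
have [L1p L2p] := decays_L12 (dphi n).
rewrite (L2normsq_fin measurableT L2p) lee_fin.
apply: le_of_sqr_le; [exact: ip_ge0|exact: ip_ge0|].
have -> : ip mu2 setT (phi n) (phi n) = ip mu2 setT residual (phi n).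
  apply: eq_Rintegral => x _; rewrite /phi /zext; case: ifP => // _.
  by rewrite [RHS]cdotC !cdot0l.
have LFp := L2_fourier2 L1p L2p.
rewrite {1}(residualE (dphi n)) (defectE LFp (L2_F_polar (dphi n))).
apply: le_trans (ip_CS mS Ld (L2_Pol LFp)) _.
rewrite ler_wpM2l ?ip_ge0// ip_Pol// parseval2// le_eqVlt; apply/orP; left; apply/eqP.
apply: eq_Rintegral => x _; rewrite /phi /zext; case: ifP => // _.
by rewrite [RHS]cdotC !cdot0l.
Unshelve. all: by end_near.
Qed.

Let polar_bound Q (C eta : R) : L2 mu2 setT Q -> 0 < eta -> (forall x, Normc.normc (Q x) <= C) ->
  L2 mu2 strip (Q \o @polar R) /\
  ip mu2 strip (Q \o @polar R) (Q \o @polar R) <= C ^+ 2 * (2 * eta * pi) + eta^-1 * ip mu2 setT Q Q.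
Proof.
move=> LQ e0 QC; have [mQ _] := LQ.
have mQp : cmeasurable strip (Q \o @polar R).
  by apply: cmeasurableTS; exact: (cmeasurable_comp mQ (@measurable_polar R)).
have LPQ := L2_Pol LQ.
pose I : set (R * R) := `[- eta, eta]%classic `*` `[0, pi]%classic.
have mI : measurable (I : set (measurableTypeR R * measurableTypeR R)).
  by apply: measurableX; exact: measurable_itv.
have muI : mu2 I = (2 * eta * pi)%:E.
  have -> : mu2 I = (leb `[(- eta)%R, eta]%classic * leb `[0%R, pi]%classic)%E.
    by apply: (@product_measure1E _ _ _ _ R leb leb); exact: measurable_itv.
  rewrite !lebesgue_measure_itv/= !lte_fin pi_gt0 ifT; last by lra.
  by rewrite -!EFinB -EFinM; congr (_%:E); ring.
have mII : measurable_fun strip (\1_I : R * R -> R) by exact: measurable_indic.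
have bnd z : strip z -> cdot (Q (polar z)) (Q (polar z)) <=
    C ^+ 2 * \1_I z + eta^-1 * cdot (Pol Q z) (Pol Q z).
  move=> [_ z2]; rewrite cdot_wt /=.
  have q0 := cdot_ge0 (Q (polar z)).
  have qC : cdot (Q (polar z)) (Q (polar z)) <= C ^+ 2.
    by rewrite -normc_sq ler_sqr ?nnegrE ?normc_ge0// (le_trans (normc_ge0 _) (QC (polar z))).
  have [zI|zI] := boolP (z \in I).
    rewrite indicE zI mulr1 (le_trans qC)// lerDl mulr_ge0// ?invr_ge0 ?(ltW e0)// mulr_ge0//.
  rewrite indicE (negbTE zI) mulr0 add0r mulrA -[leLHS]mul1r ler_wpM2r//.
  rewrite ler_pdivlMl// mulr1 leNgt; apply: contra zI => rh.
  by apply/mem_set; split => //=; rewrite in_itv/= -ler_norml ltW.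
have II : mu2.-integrable strip (EFin \o (\1_I : R * R -> R)).
  apply/(ge0_integrableP mu2) => //.
  rewrite integral_indic//; apply: (@le_lt_trans _ _ (mu2 I)); last by rewrite muI ltry.
  by apply: le_measure; rewrite ?inE//; exact: measurableI.
have IP := integrable_cdot mS LPQ LPQ.
have IB := integrableD mS (integrableClS (C ^+ 2) mS II) (integrableClS eta^-1 mS IP).
have LQp : L2 mu2 strip (Q \o @polar R).
  split => //; rewrite L2normsqE; apply/(ge0_integrableP mu2) => //.
  - exact: measurable_cdot.
  - by move=> z _; exact: cdot_ge0.
  apply: (Rle_integrable mS _ _ IB); first exact: measurable_cdot.
  by move=> z Dz; rewrite ger0_norm ?cdot_ge0//; exact: bnd.
split => //.
apply: le_trans (le_Rintegral mS (integrable_cdot mS LQp LQp) IB bnd) _.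
rewrite (RintegralD mS (integrableClS (C ^+ 2) mS II) (integrableClS eta^-1 mS IP)).
rewrite !RintegralZl// -/(ip _ _ _ _) ip_Pol// lerD2r ler_wpM2l ?sqr_ge0//.
rewrite -lee_fin EFin_Rintegral// integral_indic// -muI.
by apply: le_measure; rewrite ?inE//; exact: measurableI.
Qed.

Let Pol_cvg G_ V : (forall k, L2 mu2 setT (G_ k)) -> L2 mu2 setT V -> L2cvg mu2 setT G_ V ->
  L2cvg mu2 strip (fun k => Pol (G_ k)) (Pol V).
Proof.
move=> LG LV; rewrite /L2cvg.
rewrite (_ : (fun n => L2normsq mu2 strip _) = (fun n => L2normsq mu2 setT (fun x => G_ n x - V x)))//.
apply/funext => k; rewrite -L2normsq_Pol.
  by congr L2normsq; apply/funext => z; rewrite PolB.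
by apply: cmeasurableB; [case: (LG k)|case: LV].
Qed.

(** the weight |r| degenerates at r = 0, where uniform boundedness takes over *)
Let polar_cvg G_ V (C : R) : (forall k, L2 mu2 setT (G_ k)) -> L2 mu2 setT V ->
  (forall k x, Normc.normc (G_ k x) <= C) -> (forall x, Normc.normc (V x) <= C) ->
  L2cvg mu2 setT G_ V -> L2cvg mu2 strip (fun k => G_ k \o @polar R) (V \o @polar R).
Proof.
move=> LG LV GC VC; have LQ k := L2B measurableT (LG k) LV.
have QC k x : Normc.normc (G_ k x - V x) <= 2 * C.
  have -> : 2 * C = C + C by ring.
  apply: le_trans (normcD_le _ _) _; apply: lerD => //.
  by rewrite normcV cdotNl cdotC cdotNl opprK -normcV.
have LGp k : L2 mu2 strip (G_ k \o @polar R) by have [] := polar_bound (LG k) ltr01 (GC k).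
have LVp : L2 mu2 strip (V \o @polar R) by have [] := polar_bound LV ltr01 VC.
move=> /(L2cvgP measurableT LG LV) c; apply/(L2cvgP mS LGp LVp).
pose M := (2 * C) ^+ 2 * (2 * pi) + 1.
have M0 : 0 < M by rewrite ltr_wpDl// mulr_ge0 ?sqr_ge0// mulr_ge0// pi_ge0.
apply/cvgr0Pnorm_le => /= e e0.
pose eta := e / (2 * M).
have eta0 : 0 < eta by rewrite divr_gt0// mulr_gt0.
have ee : 0 < eta * (e / 2) by rewrite mulr_gt0// divr_gt0.
move/cvgr0Pnorm_le : c => /(_ _ ee); apply: filterS => k.
rewrite !ger0_norm ?ip_ge0// => hk.
have [_ h1] := polar_bound (LQ k) eta0 (QC k).
apply: le_trans h1 _.
have -> : e = M * eta + e / 2 by rewrite /eta; field; rewrite gt_eqF.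
apply: lerD; last by rewrite ler_pdivrMl.
have -> : M * eta = (2 * C) ^+ 2 * (2 * eta * pi) + eta by rewrite /M; ring.
by rewrite lerDl ltW.
Qed.

(** Truncations of the defect away from r = 0 are lifted to bounded plane functions V, and damped inverse transforms of V are used as tests; the limit in the damping recovers V. *)
Lemma L2normsq_defect_le : (L2normsq mu2 setT residual < +oo)%E ->
  (L2normsq mu2 strip defect <= L2normsq mu2 setT residual)%E.
Proof.
move=> fr; have Lr : L2 mu2 setT residual by [].
rewrite (L2normsq_fin measurableT Lr) -L2normsq_zext.
pose f := zext strip defect.
have mf : cmeasurable setT f by exact: cmeasurable_zext.
have f0 z : z.1 = 0 -> f z = 0.
  move=> z0; rewrite /f /zext; case: ifP => // _.
  by rewrite /defect /wt z0 normr0 sqrtr0 invr0 !mul0r subr0.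
pose B n : set (R * R) := (strip_box n.+1 `&` [set z | n.+1%:R^-1 <= `|z.1|]) `&`
  [set z | Normc.normc (f z) <= n%:R].
have mn : measurable_fun setT (fun z => Normc.normc (f z) : R) by exact: measurable_normc.
have mB n : measurable (B n : set (measurableTypeR R * measurableTypeR R)).
  apply: measurableI; first apply: measurableI.
  - exact: measurable_strip_box.
  - by apply: measurable_set_le; [exact: measurable_cst|exact: measurableT_comp].
  - by apply: measurable_set_le => //; exact: measurable_cst.
pose fn n := zext (B n) f.
have mfn n : cmeasurable setT (fn n).
  by apply: cmeasurable_zext; [exact: mB|exact: cmeasurableTS].
rewrite -/f.
apply: (@L2normsq_exhaust _ _ _ mu2 f fn (ip mu2 setT residual residual)) => // [z|n].
  have [fz|fz] := eqVneq (f z) 0; first by apply: nearW => n; rewrite /fn /zext fz if_same.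
  have z1 : z.1 != 0 by apply: contraNneq fz => /f0 ->.
  have zS : strip z.
    by apply/set_mem; apply: contraT => zS; move: fz; rewrite /f /zext (negbTE zS) eqxx.
  near=> n; rewrite /fn zext_id//; split; [split; [split => //|]|] => /=.
  - apply: (@le_trans _ _ n%:R); last by rewrite ler_nat.
    by near: n; exact: nbhs_infty_ger.
  - rewrite invf_ple ?posrE ?normr_gt0//.
    apply: (@le_trans _ _ n%:R); last by rewrite ler_nat.
    by near: n; exact: nbhs_infty_ger.
  - by near: n; exact: nbhs_infty_ger.
have fnB z : fn n z != 0 -> B n z.
  by rewrite /fn /zext; case: ifP => [/set_mem //|]; rewrite eqxx.
have fnle z : Normc.normc (fn n z) <= n%:R :> R.
  by rewrite /fn /zext; case: ifP => [/set_mem[]//|_]; rewrite Normc.normc0.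
have [L1f L2f] : L1 mu2 setT (fn n) /\ L2 mu2 setT (fn n).
  have s0 z : ~ strip_box n.+1 z -> fn n z = 0.
    by apply: contra_notP => /eqP /fnB[[]].
  exact: (@bounded_finite_support _ _ _ mu2 _ _ n%:R (measurable_strip_box n.+1)
    (strip_box_lty _ n.+1) s0 fnle (mfn n)).
pose v z := (Num.sqrt `|z.1|)^-1%:C%C * fn n z.
have mv : cmeasurable setT v.
  by apply: cmeasurableM => //; apply: cmeasurable_real; exact: measurable_funV.
have d0 : 0 < (n.+1%:R^-1 : R) by rewrite invr_gt0.
have vd z : v z != 0 -> n.+1%:R^-1 <= `|z.1| <= (n.+1%:R^-1)^-1.
  by rewrite mulf_eq0 negb_or invrK => /andP[_ /fnB[[[? ?] ?] ?]]; apply/andP.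
have vC z : Normc.normc (v z) <= Num.sqrt n.+1%:R * n%:R :> R.
  have [vz|vz] := eqVneq (v z) 0; first by rewrite vz Normc.normc0 mulr_ge0 ?sqrtr_ge0.
  have /andP[z1 _] := vd _ vz.
  rewrite normcM' normc_real ger0_norm ?invr_ge0 ?sqrtr_ge0//.
  rewrite ler_pM ?invr_ge0 ?sqrtr_ge0 ?normc_ge0//.
  by rewrite -sqrtrV// ler_wsqrtr// invf_ple ?posrE// (lt_le_trans d0).
have [V [L1V L2V VC Vv]] := polar_lift d0 mv vd vC.
have PVf : {ae mu2, forall z, strip z -> Pol V z = fn n z}.
  move: (ae_fst_neq0 R) (ae_strip_interior R); apply: ae_imp2 => z z1 zi zS.
  rewrite /Pol /wt /= Vv ?zi// /v mulrA -rmorphM/= divff ?mul1r//.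
  by rewrite gt_eqF// sqrtr_gt0 normr_gt0.
have e0 k : 0 < (k.+1%:R^-1 : R) by rewrite invr_gt0.
pose phi k := damp k.+1%:R^-1 (fourier2_inv V).
have dd k : decays (phi k) by exact: decays_damp_fourier2_inv.
have L1p k : L1 mu2 setT (phi k) by have [] := decays_L12 (dd k).
have L2p k : L2 mu2 setT (phi k) by have [] := decays_L12 (dd k).
have LF := L2_fourier2_inv L1V L2V.
have cphi := damp_cvg LF.
have LG k : L2 mu2 setT (fourier2 (phi k)) by exact: L2_fourier2.
have cG := fourier2_damp_cvg L1V L2V.
have GC k x := normc_fourier2_damp_le x (e0 k) L1V VC.
have [LVp _] := polar_bound L2V ltr01 VC.
have c1 := ip_cvg measurableT L2p LF Lr cphi.
have c2 := ip_cvg mS (fun k => L2_Pol (LG k)) (L2_Pol L2V) Lwa (Pol_cvg LG L2V cG).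
have c3 := ip_cvg mS (fun k => L2_F_polar (dd k)) LVp Lg (polar_cvg LG L2V GC VC cG).
have main : ip mu2 setT residual (fourier2_inv V) =
    ip mu2 strip (wt a) (Pol V) - ip mu2 strip g (V \o @polar R).
  have E1 F : ip mu2 setT residual F = ip mu2 setT F residual by exact: ipC.
  have E2 F : ip mu2 strip (wt a) F = ip mu2 strip F (wt a) by exact: ipC.
  have E3 F : ip mu2 strip g F = ip mu2 strip F g by exact: ipC.
  rewrite E1 E2 E3.
  have e k : ip mu2 strip (Pol (fourier2 (phi k))) (wt a) -
      ip mu2 strip (fourier2 (phi k) \o @polar R) g = ip mu2 setT (phi k) residual.
    by rewrite -E1 (residualE (dd k)) E2 E3.
  have c4 : ip mu2 strip (Pol (fourier2 (phi k))) (wt a) -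
      ip mu2 strip (fourier2 (phi k) \o @polar R) g @[k --> \oo] -->
      ip mu2 strip (Pol V) (wt a) - ip mu2 strip (V \o @polar R) g by exact: (cvgB c2 c3).
  by move: c4; rewrite (funext e) => c4; exact: (cvg_unique _ c1 c4).
rewrite (L2normsq_fin measurableT L2f) lee_fin.
apply: le_of_sqr_le; [exact: ip_ge0|exact: ip_ge0|].
have LPV := L2_Pol L2V; have [mPV _] := LPV.
have mfnS : cmeasurable strip (fn n) by exact: cmeasurableTS.
have fnS : zext strip (fn n) = fn n.
  apply/funext => z; rewrite /zext; case: ifP => // /negbT zS; apply/esym/eqP.
  by apply: contraNT zS => /fnB[[[_ ?] _] _]; apply/mem_set.
have eV : ip mu2 setT V V = ip mu2 setT (fn n) (fn n).
  rewrite -(ip_Pol L2V L2V) -{1 2}fnS ip_zext.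
  apply: ae_eq_Rintegral => //; try exact: measurable_cdot.
  by apply: ae_imp PVf => z h1 zS; rewrite h1.
have ef : ip mu2 setT (fn n) (fn n) = ip mu2 setT residual (fourier2_inv V).
  rewrite main (defectE L2V LVp).
  transitivity (ip mu2 strip defect (fn n)).
    rewrite -[RHS]ip_zext fnS; apply: eq_Rintegral => z _.
    rewrite -/f /fn /zext; case: ifP => // _; by rewrite [RHS]cdotC !cdot0l.
  apply: ae_eq_Rintegral => //; try exact: measurable_cdot.
  by apply: ae_imp PVf => z h1 zS; rewrite h1.
rewrite {1}ef; apply: le_trans (ip_CS measurableT Lr LF) _.
rewrite ler_wpM2l ?ip_ge0// -eV le_eqVlt; apply/orP; left; apply/eqP.
by apply: EFin_inj; rewrite -!L2normsq_fin// plancherel2_inv.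
Unshelve. all: by end_near.
Qed.

End ErrorIdentity.

(** * Independence and band-limited tests *)

Section IndependentProduct.
Context dO (Omega : measurableType dO) (R : realType) (P : probability Omega R).

(** A copy of f carrying its measurability proof, so that its law is a probability measure by inference. *)
Definition random_value d (T : measurableType d) (f : Omega -> T)
  (mf : measurable_fun setT f) := f.

HB.instance Definition _ d (T : measurableType d) (f : Omega -> T)
  (mf : measurable_fun setT f) :=
  isMeasurableFun.Build _ _ Omega T (random_value mf) mf.

(** Independence says that the joint law is the product of the laws; Fubini then factors the integral of x y. *)
Lemma independent_expectation (f g : Omega -> R)
    (mf : measurable_fun setT f) (mg : measurable_fun setT g) :
  (forall A B : set R, measurable A -> measurable B ->
     P (f @^-1` A `&` g @^-1` B) = (P (f @^-1` A) * P (g @^-1` B))%E) ->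
  P.-integrable setT (EFin \o f) -> P.-integrable setT (EFin \o g) ->
  P.-integrable setT (EFin \o (fun w => f w * g w)) /\
  \int[P]_w (f w * g w) = (\int[P]_w f w) * (\int[P]_w g w).
Proof.
move=> indep If Ig.
have mfg : measurable_fun setT (fun w => (f w, g w)) by exact: measurable_fun_pair.
pose muf : probability R R := distribution P (random_value mf).
pose mug : probability R R := distribution P (random_value mg).
pose joint : probability (R * R)%type R := distribution P (random_value mfg).
have jointE X : measurable X -> (muf \x mug)%E X = joint X.
  move=> mX; have h (B C : set R) : measurable B -> measurable C ->
      joint (B `*` C) = (muf B * mug C)%E.
    by move=> mB mC; rewrite -(indep B C mB mC).
  exact: (product_measure_unique h mX).
have mid : measurable_fun setT (EFin : R -> \bar R) by exact/measurable_EFinP.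
have If' : muf.-integrable setT (EFin \o (id : R -> R)).
  exact: (integrable_pushforward mf mid If measurableT).
have Ig' : mug.-integrable setT (EFin \o (id : R -> R)).
  exact: (integrable_pushforward mg mid Ig measurableT).
have I2 := @integrable_mul _ _ _ _ R muf mug _ _ If' Ig'.
have m2 := measurable_int _ I2.
have I3 : P.-integrable setT (EFin \o (fun w => f w * g w)).
  have mp : measurable_fun setT (fun w => f w * g w) by exact: measurable_funM.
  apply/integrableP; split; first exact/measurable_EFinP.
  have /integrableP[_] := I2.
  have m3 : measurable_fun setT (fun z : R * R => `|(EFin \o (fun z : R * R => id z.1 * id z.2)%R) z|%E).
    exact: (measurableT_comp _ m2).
  rewrite (eq_measure_integral joint); last by move=> A mA _; exact: jointE.
  by rewrite (ge0_integral_pushforward mfg P measurableT m3).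
split => //.
rewrite /Rintegral.
have -> : (\int[P]_w (f w * g w)%:E = \int[joint]_z (z.1 * z.2)%:E)%E.
  by rewrite (integral_pushforward mfg m2 I3 measurableT).
rewrite (eq_measure_integral (muf \x mug)%E); last first.
  by move=> B mB _; apply/esym; exact: jointE.
have := @Rintegral_mul _ _ _ _ R muf mug _ _ If' Ig'; rewrite /Rintegral /= => ->.
congr (fine _ * fine _).
  by rewrite (integral_pushforward mf mid If measurableT).
by rewrite (integral_pushforward mg mid Ig measurableT).
Qed.

End IndependentProduct.

Section Functionals.
Context dO (Omega : measurableType dO) (R : realType) (P : probability Omega R).
Context d (X : measurableType d) (mu : {measure set X -> \bar R}) (D : set X).
Hypothesis mD : measurable D.
Variable U : Omega -> X -> R[i].
Hypothesis rU : L2random mu D U.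

(** Cauchy-Schwarz: a small change of u changes the pairing by little. *)
Lemma L2open_functional psi (c : R) : L2 mu D psi ->
  L2open mu D [set u | L2 mu D u /\ c < ip mu D u psi].
Proof.
move=> Lpsi; split=> [u []//|u [Lu cu]].
pose dl := ip mu D u psi - c; have dl0 : 0 < dl by rewrite subr_gt0.
have p0 : 0 < ip mu D psi psi + 1 by rewrite ltr_wpDl// ip_ge0.
exists (dl ^+ 2 / (ip mu D psi psi + 1)); first by rewrite divr_gt0// exprn_gt0.
move=> g Lg; have LB := L2B mD Lg Lu.
rewrite (L2normsq_fin mD LB) lte_fin ltr_pdivlMr// => h; split => //.
have cs := ip_CS mD LB Lpsi; have b0 := ip_ge0 mu D (fun x => g x - u x).
rewrite (ipBl mD Lg Lu Lpsi) in cs.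
have h2 : (ip mu D g psi - ip mu D u psi) ^+ 2 < dl ^+ 2.
  apply: le_lt_trans cs _; apply: le_lt_trans h; rewrite ler_wpM2l//; lra.
have : `|ip mu D g psi - ip mu D u psi| < dl.
  by rewrite -(ltr_sqr)?nnegrE ?normr_ge0 ?ltW// real_normK ?num_real.
rewrite ltr_norml /dl => /andP[h3 _]; lra.
Qed.

Let G := [set U @^-1` O | O in L2open mu D].

Let Gfun psi : L2 mu D psi ->
  measurable_fun setT ((fun w => ip mu D (U w) psi) : g_sigma_algebraType G -> R).
Proof.
move=> Lpsi; apply: (measurability _ (RGenOInfty.measurableE R)) => _ [_ [c ->] <-].
apply: sub_sigma_algebra; exists [set u | L2 mu D u /\ c < ip mu D u psi].
  exact: L2open_functional.
rewrite setTI; apply/seteqP; split => w /=; rewrite in_itv/= andbT.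
  by case.
by move=> h; split => //; have [] := rU.
Qed.

(** The open half lines generate the Borel sets and have open preimages. *)
Lemma L2sigma_functional psi (B : set R) : L2 mu D psi -> measurable B ->
  L2sigma mu D U ((fun w => ip mu D (U w) psi) @^-1` B).
Proof.
by move=> Lpsi mB; have := Gfun Lpsi measurableT mB; rewrite setTI.
Qed.

Lemma measurable_functional psi : L2 mu D psi ->
  measurable_fun setT (fun w => ip mu D (U w) psi).
Proof.
move=> Lpsi _ B mB; rewrite setTI; have := L2sigma_functional Lpsi mB.
have [_ mU] := rU; apply: smallest_sub; first exact: sigma_algebra_measurable.
by move=> _ [V oV <-]; exact: mU.
Qed.

End Functionals.

Section BandLimitedTests.
Variable R : realType.
Notation leb := (@lebesgue_measure R).
Notation mu2 := (@leb2 R).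
Notation strip := (@strip R).
Variables (t : R * R -> R[i]) (n : nat) (C : R).
Hypothesis mt : cmeasurable setT t.
Hypothesis tS : forall z, t z != 0 -> strip_box n.+1 z /\ n.+1%:R^-1 <= `|z.1|.
Hypothesis tC : forall z, Normc.normc (t z) <= C.

Let t0 z : ~ strip_box n.+1 z -> t z = 0.
Proof. by apply: contra_notP => /eqP /tS[]. Qed.

Lemma test_L12 : L1 mu2 setT t /\ L2 mu2 setT t.
Proof.
exact: (@bounded_finite_support _ _ _ mu2 _ _ C (measurable_strip_box n.+1)
    (strip_box_lty _ n.+1) t0 tC mt).
Qed.

(** Dividing the test by |r| and lifting it to the plane expresses the pairing through F_2, whose adjoint produces psi. *)
Lemma F1_radon_test : exists2 psi, L2 mu2 setT psi &
  forall u a, is_F1_radon u a -> ip mu2 strip a t = ip mu2 setT u psi.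
Proof.
pose v z := (`|z.1|^-1)%:C%C * t z.
have mv : cmeasurable setT v.
  apply: cmeasurableM => //; apply: cmeasurable_real; apply: measurable_funV.
  exact: (measurableT_comp (@normr_measurable R setT)).
have d0 : 0 < (n.+1%:R^-1 : R) by rewrite invr_gt0.
have vd z : v z != 0 -> n.+1%:R^-1 <= `|z.1| <= (n.+1%:R^-1)^-1.
  by rewrite mulf_eq0 negb_or invrK => /andP[_ /tS[[? ?] ?]]; apply/andP.
have C0 : 0 <= C by apply: le_trans (tC 0); exact: normc_ge0.
have vC z : Normc.normc (v z) <= n.+1%:R * C.
  have [vz|vz] := eqVneq (v z) 0; first by rewrite vz Normc.normc0 mulr_ge0.
  have /andP[z1 _] := vd _ vz.
  rewrite normcM' normc_real ger0_norm ?invr_ge0//.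
  rewrite ler_pM ?invr_ge0 ?normc_ge0//.
  by rewrite invf_ple ?posrE// (lt_le_trans d0).
have [V [L1V L2V VC Vv]] := polar_lift d0 mv vd vC.
exists (fourier2_inv V); first exact: L2_fourier2_inv.
move=> u a ua; rewrite -(F1_radon_adjoint ua L1V L2V).
have [_ ma _ _] := ua; have [mV _] := L2_Pol L2V.
apply: ae_eq_Rintegral.
- exact: measurable_strip.
- by apply: measurable_cdot => //; exact: cmeasurableTS.
- by apply: measurable_cdot => //; exact: cmeasurable_wt.
move: (ae_fst_neq0 R) (ae_strip_interior R); apply: ae_imp2 => z z1 zi zS.
rewrite cdot_wt /= Vv ?zi// /v [in RHS]cdotC cdotZl [in RHS]cdotC mulrA divff ?mul1r//.
by rewrite normr_eq0.
Qed.

(** A band-limited test is integrable and square integrable, so its inverse transform is defined by the integral and serves as chi. *)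
Lemma F1_test : exists2 chi, L2 mu2 strip chi &
  forall f g, is_F1 f g -> ip mu2 strip g t = ip mu2 strip f chi.
Proof.
have [L1t L2t] := test_L12.
exists (fourier_integral_inv t).
  by apply: L2_fourier_inv_strip; [apply: L1_subset => //|apply: L2_subset => //]; exact: measurable_strip.
move=> f g fg; apply: F1_adjoint => //.
  by apply: L1_subset => //; exact: measurable_strip.
by apply: L2_subset => //; exact: measurable_strip.
Qed.

End BandLimitedTests.

Lemma cdotM_split (R : realType) (s t z w : R[i]) : cdot (s * z) (t * w) =
  complex.Re (t^*%C * s) * cdot z w + complex.Im (t^*%C * s) * cdot ('i%C * z) w.
Proof.
by case: s t z w => [? ?] [? ?] [? ?] [? ?]; rewrite /cdot /=; ring.
Qed.

Section SecondMoments.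
Context dO (Omega : measurableType dO) (R : realType) (P : probability Omega R).
Variables (p q : Omega -> R[i]).
Hypotheses (mp : cmeasurable setT p) (mq : cmeasurable setT q).
Hypothesis fp : (L2normsq P setT p < +oo)%E.
Hypothesis pq : (L2normsq P setT q < +oo)%E ->
  ip P setT p q = 0 /\ ip P setT (fun w => 'i%C * p w) q = 0.

(** When q has infinite second moment both sides are infinite unless t vanishes, since q would otherwise be a combination of square integrable variables. *)
Lemma second_moment_combination (s t : R[i]) :
  L2normsq P setT (fun w => s * p w - t * q w) =
  ((cdot s s)%:E * L2normsq P setT p + (cdot t t)%:E * L2normsq P setT q)%E.
Proof.
have Lp : L2 P setT p by [].
have mT := @measurableT _ Omega.
have LZ c f : L2 P setT f -> L2 P setT (fun w => c * f w) by exact: L2Z.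
have nZ c f : L2 P setT f -> L2normsq P setT (fun w => c * f w) = ((cdot c c)%:E * L2normsq P setT f)%E.
  move=> Lf; rewrite !L2normsqE -ge0_integralZl_EFin//.
  - by apply: eq_integral => w _; rewrite cdotMM EFinM.
  - by move=> w _; rewrite lee_fin cdot_ge0.
  - by apply/measurable_EFinP; have [mf _] := Lf; exact: measurable_cdot.
  - exact: cdot_ge0.
have [t0|t0] := eqVneq t 0.
  rewrite t0 cdot0l mul0e adde0 -nZ//; congr L2normsq; apply/funext => w.
  by rewrite mul0r subr0.
have [fq|nfq] := boolP (L2normsq P setT q < +oo)%E; last first.
  have qoo : L2normsq P setT q = +oo%E by move: nfq; rewrite -leNgt leye_eq => /eqP.
  have ct : 0 < cdot t t.
    by rewrite lt_neqAle cdot_ge0 andbT eq_sym; apply: contraNneq t0 => /cdot_eq0 ->.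
  rewrite qoo gt0_muley ?lte_fin// addey; last first.
    by rewrite (L2normsq_fin mT Lp) -EFinM.
  apply/eqP; rewrite -leye_eq leNgt; apply/negP => fd; move/negP: nfq; apply.
  have Ld : L2 P setT (fun w => s * p w - t * q w).
    by split => //; apply: cmeasurableB; apply: cmeasurableM => //; exact: cmeasurable_cst.
  have := LZ t^-1 _ (L2B mT (LZ s _ Lp) Ld).
  rewrite (_ : (fun w => _) = q); first by case.
  by apply/funext => w; rewrite opprB addrC subrK mulKf.
have Lq : L2 P setT q by [].
have [pq1 pq2] := pq fq.
have Lip := LZ 'i%C _ Lp.
have cross : ip P setT (fun w => s * p w) (fun w => t * q w) = 0.
  have e w : cdot (s * p w) (t * q w) = complex.Re (t^*%C * s) * cdot (p w) (q w) +
      complex.Im (t^*%C * s) * cdot ('i%C * p w) (q w).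
    by rewrite cdotM_split.
  rewrite /ip; under eq_Rintegral do rewrite e.
  rewrite RintegralD//; last 2 first.
  - by apply: integrableCl; exact: integrable_cdot.
  - by apply: integrableCl; exact: integrable_cdot.
  rewrite !RintegralZl//; try exact: integrable_cdot.
  by rewrite -!/(ip _ _ _ _) pq1 pq2 !mulr0 addr0.
rewrite (L2normsq_fin mT (L2B mT (LZ s _ Lp) (LZ t _ Lq))) (ipBB mT (LZ s _ Lp) (LZ t _ Lq)).
rewrite cross mulr0 subr0 EFinD -!L2normsq_fin ?nZ//; exact: LZ.
Qed.

End SecondMoments.

(** * Signal and noise are uncorrelated *)

Section CrossTerm.
Context dO (Omega : measurableType dO) (R : realType) (P : probability Omega R).
Notation leb := (@lebesgue_measure R).
Notation mu2 := (@leb2 R).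
Notation pl := (@plane_measure R).
Notation strip := (@strip R).
Notation PP := (P \x pl)%E.
Implicit Types X Y V : Omega * (R * R) -> R[i].

Let mw : measurable_fun setT (fun v : (Omega * (R * R)) * (R * R) => v.1.1).
Proof.
exact: (measurableT_comp (@measurable_fst _ _ Omega (measurableTypeR R * measurableTypeR R)%type)
  (@measurable_fst _ _ (Omega * (measurableTypeR R * measurableTypeR R))%type (measurableTypeR R * measurableTypeR R)%type)).
Qed.

Let mzeta : measurable_fun setT (fun v : (Omega * (R * R)) * (R * R) => v.1.2).
Proof.
exact: (measurableT_comp (@measurable_snd _ _ Omega (measurableTypeR R * measurableTypeR R)%type)
  (@measurable_fst _ _ (Omega * (measurableTypeR R * measurableTypeR R))%type (measurableTypeR R * measurableTypeR R)%type)).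
Qed.

Let mz : measurable_fun setT (fun v : (Omega * (R * R)) * (R * R) => v.2).
Proof.
exact: (@measurable_snd _ _ (Omega * (measurableTypeR R * measurableTypeR R))%type (measurableTypeR R * measurableTypeR R)%type).
Qed.

Let mf1 : measurable_fun setT (fun z : R * R => z.1).
Proof. exact: (@measurable_fst _ _ (measurableTypeR R) (measurableTypeR R)). Qed.

Let mf2 : measurable_fun setT (fun z : R * R => z.2).
Proof. exact: (@measurable_snd _ _ (measurableTypeR R) (measurableTypeR R)). Qed.

Let coef (X : Omega * (R * R) -> R[i]) (v : Omega * (R * R)) := fourier2 (fun z => X (v.1, z)) v.2.

Let mcoef X : cmeasurable setT X -> cmeasurable setT (coef X).
Proof.
move=> mX.
have mF : cmeasurable setT (fun v : (Omega * (R * R)) * (R * R) =>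
    X (v.1.1, v.2) * expm2pi (v.2.1 * v.1.2.1 + v.2.2 * v.1.2.2)).
  apply: cmeasurableM.
    apply: (cmeasurable_comp (h := fun v : (Omega * (R * R)) * (R * R) => (v.1.1, v.2)) mX).
    exact: measurable_fun_pair.
  apply: cmeasurable_expm2pi_comp; apply: measurable_funD; apply: measurable_funM.
  - exact: (measurableT_comp mf1 mz).
  - exact: (measurableT_comp mf1 mzeta).
  - exact: (measurableT_comp mf2 mz).
  - exact: (measurableT_comp mf2 mzeta).
exact: (cmeasurable_cintegral1 pl mF).
Qed.

Lemma cmeasurable_section1 X w : cmeasurable setT X -> cmeasurable setT (fun z : R * R => X (w, z)).
Proof.
move=> mX; apply: (cmeasurable_comp (h := fun z : R * R => (w, z)) mX).
exact: (@pair1_measurable _ _ _ _ w).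
Qed.

Lemma cmeasurable_section2 X z : cmeasurable setT X -> cmeasurable setT (fun w => X (w, z)).
Proof.
move=> mX; apply: (cmeasurable_comp (h := fun w => (w, z)) mX).
exact: (@pair2_measurable _ _ _ _ z).
Qed.

Lemma ae_L2_section1 X : L2 PP setT X -> {ae P, forall w, L2 mu2 setT (fun z => X (w, z))}.
Proof.
move=> LX; have [mX _] := LX.
have := Rfubini_ae1 (integrable_cdot measurableT LX LX); apply: ae_imp => w Iw.
split; first exact: cmeasurable_section1.
rewrite L2normsqE; apply/(ge0_integrableP mu2) => //.
- by apply: measurable_cdot; exact: cmeasurable_section1.
- by move=> z _; exact: cdot_ge0.
Qed.

Lemma ae_L2_section2 X : L2 PP setT X -> {ae mu2, forall z, L2 P setT (fun w => X (w, z))}.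
Proof.
move=> LX; have [mX _] := LX.
have := Rfubini_ae2 (integrable_cdot measurableT LX LX); apply: ae_imp => z Iz.
split; first exact: cmeasurable_section2.
rewrite L2normsqE; apply/(ge0_integrableP P) => //.
- by apply: measurable_cdot; exact: cmeasurable_section2.
- by move=> w _; exact: cdot_ge0.
Qed.

Lemma L2normsq_prod1 X : cmeasurable setT X ->
  L2normsq PP setT X = (\int[P]_w L2normsq mu2 setT (fun z => X (w, z)))%E.
Proof.
move=> mX; rewrite L2normsqE (@fubini_tonelli1 _ _ _ _ R P pl).
- by apply: eq_integral => w _; rewrite L2normsqE.
- by apply/measurable_EFinP; exact: measurable_cdot.
- by move=> z; rewrite lee_fin cdot_ge0.
Qed.

Lemma measurable_L2normsq_prod1 X : cmeasurable setT X ->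
  measurable_fun setT (fun w => L2normsq mu2 setT (fun z => X (w, z))).
Proof.
move=> mX.
have m : measurable_fun setT (fun v => (cdot (X v) (X v))%:E).
  by apply/measurable_EFinP; exact: measurable_cdot.
have := @measurable_fun_fubini_tonelli_F _ _ _ _ R pl _ m (fun v => _).
rewrite (_ : (fun w => L2normsq _ _ _) = fubini_F pl (fun v => (cdot (X v) (X v))%:E)).
  by apply => v; rewrite lee_fin cdot_ge0.
by apply/funext => w; rewrite L2normsqE.
Qed.

Lemma L2normsq_prod2 X : cmeasurable setT X ->
  L2normsq PP setT X = (\int[mu2]_z L2normsq P setT (fun w => X (w, z)))%E.
Proof.
move=> mX; rewrite L2normsqE (@fubini_tonelli2 _ _ _ _ R P pl).
- by apply: eq_integral => w _; rewrite L2normsqE.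
- by apply/measurable_EFinP; exact: measurable_cdot.
- by move=> z; rewrite lee_fin cdot_ge0.
Qed.

Lemma measurable_L2normsq_prod2 X : cmeasurable setT X ->
  measurable_fun setT (fun z => L2normsq P setT (fun w => X (w, z))).
Proof.
move=> mX.
have m : measurable_fun setT (fun v => (cdot (X v) (X v))%:E).
  by apply/measurable_EFinP; exact: measurable_cdot.
have := @measurable_fun_fubini_tonelli_G _ _ _ _ R P _ m (fun v => _).
rewrite (_ : (fun w => L2normsq _ _ _) = fubini_G P (fun v => (cdot (X v) (X v))%:E)).
  by apply => v; rewrite lee_fin cdot_ge0.
by apply/funext => w; rewrite L2normsqE.
Qed.

Section Uncorrelated.
Variables (X Y : Omega * (R * R) -> R[i]) (S : set (R * R)).
Hypotheses (LX : L2 PP setT X) (LY : L2 PP setT Y).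
Hypothesis mS : measurable (S : set (measurableTypeR R * measurableTypeR R)).
Hypothesis fS : (mu2 S < +oo)%E.
Hypothesis X0 : forall w z, ~ S z -> X (w, z) = 0.
Hypothesis Y0 : forall w z, ~ S z -> Y (w, z) = 0.

Let mX : cmeasurable setT X. Proof. by case: LX. Qed.
Let mY : cmeasurable setT Y. Proof. by case: LY. Qed.

Let L1_slice V w : (forall w z, ~ S z -> V (w, z) = 0) ->
  L2 mu2 setT (fun z => V (w, z)) -> L1 mu2 setT (fun z => V (w, z)).
Proof. by move=> V0 LV; apply: (L2_finite_support mS fS (V0 w)). Qed.

Let Lcoef V : L2 PP setT V -> (forall w z, ~ S z -> V (w, z) = 0) -> L2 PP setT (coef V).
Proof.
move=> LV V0; have [mV fV] := LV; split; first exact: mcoef.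
rewrite L2normsq_prod1; last exact: mcoef.
rewrite (ae_eq_integral (fun w => L2normsq mu2 setT (fun z => V (w, z)))) => //.
- by rewrite -L2normsq_prod1.
- by apply: measurable_L2normsq_prod1; exact: mcoef.
- exact: measurable_L2normsq_prod1.
have := ae_L2_section1 LV; apply: ae_imp => w Lw _.
by rewrite -(plancherel2 (L1_slice V0 Lw) Lw).
Qed.

(** Parseval in z for almost every outcome, followed by an exchange of integrals. *)
Lemma uncorrelated_coefficients :
  (forall zeta, L2 P setT (fun w => fourier2 (fun z => X (w, z)) zeta) ->
    L2 P setT (fun w => fourier2 (fun z => Y (w, z)) zeta) ->
    ip P setT (fun w => fourier2 (fun z => X (w, z)) zeta)
      (fun w => fourier2 (fun z => Y (w, z)) zeta) = 0) ->
  ip PP setT X Y = 0.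
Proof.
move=> unc; have IXY := integrable_cdot measurableT LX LY.
have LcX := Lcoef LX X0; have LcY := Lcoef LY Y0.
have Ic := integrable_cdot measurableT LcX LcY.
have mc := measurable_int _ Ic; move/measurable_EFinP in mc.
have mxy := measurable_int _ IXY; move/measurable_EFinP in mxy.
rewrite /ip -(Rfubini1 IXY).
transitivity (\int[P]_w \int[pl]_zeta cdot (coef X (w, zeta)) (coef Y (w, zeta))).
  apply: ae_eq_Rintegral => //.
  - exact: (measurable_Rintegral1 pl mxy).
  - exact: (measurable_Rintegral1 pl mc).
  move: (ae_L2_section1 LX) (ae_L2_section1 LY); apply: ae_imp2 => w LXw LYw _.
  exact/esym/(parseval2 (L1_slice X0 LXw) LXw (L1_slice Y0 LYw) LYw).
rewrite (Rfubini1 Ic) -(Rfubini2 Ic).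
rewrite (@ae_eq_Rintegral _ _ _ pl setT _ (fun=> 0))//.
- by rewrite Rintegral_cst// mul0r.
- exact: (measurable_Rintegral2 P mc).
have unc' zeta : L2 P setT (fun w => coef X (w, zeta)) -> L2 P setT (fun w => coef Y (w, zeta)) ->
    \int[P]_w cdot (coef X (w, zeta)) (coef Y (w, zeta)) = 0 := unc zeta.
have a : {ae mu2, forall zeta, \int[P]_w cdot (coef X (w, zeta)) (coef Y (w, zeta)) = 0}.
  by move: (ae_L2_section2 LcX) (ae_L2_section2 LcY); apply: ae_imp2 => zeta; exact: unc'.
by apply: ae_imp a => zeta e _; exact: e.
Qed.

End Uncorrelated.

Variables (U nu : Omega -> R * R -> R[i]) (FAU Fnu : Omega * (R * R) -> R[i]).
Hypothesis rU : L2random mu2 (@plane R) U.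
Hypothesis rnu : L2random mu2 strip nu.
Hypothesis cnu : L2centered P mu2 strip nu.
Hypothesis indep : L2independent P mu2 (@plane R) U mu2 strip nu.
Hypothesis vU : {ae P, forall w, is_F1_radon (U w) (fun z => FAU (w, z))}.
Hypothesis vnu : {ae P, forall w, is_F1 (nu w) (fun z => Fnu (w, z))}.

Lemma centered_functional chi : L2 mu2 strip chi -> \int[P]_w ip mu2 strip (nu w) chi = 0.
Proof.
move=> Lchi; have [_ /(_ _ Lchi) h] := cnu.
have := congr1 (@complex.Re R) h; rewrite /cintegral /= => h'.
rewrite -[RHS]h'; apply: eq_Rintegral => w _; apply: eq_Rintegral => z _.
by case: (nu w z) (chi z) => [? ?] [? ?]; rewrite /cdot /=; ring.
Qed.

Let ae_eq_integrable (f g : Omega -> R) : measurable_fun setT f ->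
  P.-integrable setT (EFin \o g) -> {ae P, forall w, f w = g w} ->
  P.-integrable setT (EFin \o f).
Proof.
move=> mf Ig fg; have mg := measurable_int _ Ig.
have mEf : measurable_fun setT (EFin \o f) by exact/measurable_EFinP.
have /integrableP[_ fg'] := Ig; apply/integrableP; split => //.
rewrite (ae_eq_integral (fun w => `|(EFin \o g) w|%E))//.
- exact: measurableT_comp.
- exact: measurableT_comp.
- by apply: ae_imp fg => w /= -> _.
Qed.

Section BandLimited.
Variables (c : R * R -> R[i]) (n : nat) (C : R) (Z : set (R * R)).
Hypothesis mc : cmeasurable setT c.
Hypothesis cC : forall z, Normc.normc (c z) <= C.
Hypothesis mZ : measurable (Z : set (measurableTypeR R * measurableTypeR R)).
Hypothesis ZS : forall z, Z z -> strip_box n.+1 z /\ n.+1%:R^-1 <= `|z.1|.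

Let X v := zext (setT `*` Z) (fun v => c v.2 * FAU v) v.
Let Y v := zext (setT `*` Z) Fnu v.

Let test (k : R[i]) (b : R * R -> R[i]) zeta z :=
  zext Z (fun z => (b z * expm2pi (z.1 * zeta.1 + z.2 * zeta.2))^*%C * k) z.

Let mtest k b zeta : cmeasurable setT b -> cmeasurable setT (test k b zeta).
Proof.
move=> mb; apply: cmeasurable_zext; first exact: mZ.
apply: cmeasurableTS; apply: cmeasurableM; last exact: cmeasurable_cst.
apply: cmeasurable_conj; apply: cmeasurableM => //; apply: cmeasurable_expm2pi_comp.
by apply: measurable_funD; apply: measurable_funM => //; exact: measurable_cst.
Qed.

Let testS k b zeta z : test k b zeta z != 0 -> strip_box n.+1 z /\ n.+1%:R^-1 <= `|z.1|.
Proof. by rewrite /test /zext; case: ifP => [/set_mem /ZS//|]; rewrite eqxx. Qed.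

Let testC k b zeta (B : R) : 0 <= B -> (forall z, Normc.normc (b z) <= B) ->
  forall z, Normc.normc (test k b zeta z) <= B * Normc.normc k.
Proof.
move=> B0 bB z; rewrite /test /zext; case: ifP => _; last by rewrite Normc.normc0 mulr_ge0 ?normc_ge0.
have nc (y : R[i]) : Normc.normc y^*%C = Normc.normc y :> R by rewrite !normcV cdot_conj.
by rewrite normcM' nc normcM' normc_expm2pi mulr1 ler_wpM2r ?normc_ge0.
Qed.

(** a real coordinate of a Fourier coefficient is a pairing with a test *)
Let coordE k b (F : Omega * (R * R) -> R[i]) w zeta :
  L1 mu2 setT (fun z => zext (setT `*` Z) (fun v => b v.2 * F v) (w, z)) ->
  cdot (fourier2 (fun z => zext (setT `*` Z) (fun v => b v.2 * F v) (w, z)) zeta) k =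
  ip mu2 strip (fun z => F (w, z)) (test k b zeta).
Proof.
move=> LV; rewrite (cdot_cintegral _ (L1_fourier2_kernel zeta LV)) /ip [RHS]Rintegral_mkcond.
apply: eq_Rintegral => z _; rewrite patchE /test /zext.
have -> : ((w, z) \in setT `*` Z) = (z \in Z).
  by apply/idP/idP => /set_mem => [[_ ?]|?]; apply/mem_set.
have [zZ|zZ] := boolP (z \in Z).
  have -> : z \in strip by apply/mem_set; have [[_ ?] _] := ZS (set_mem zZ).
  by rewrite /= -cdotMl mulrAC.
by rewrite mul0r cdot0l; case: ifP => // _; rewrite cdotC cdot0l.
Qed.

(** The real and imaginary parts of each Fourier coefficient are pairings of U, respectively nu, with fixed functions, hence independent, and the second one is centered. *)
Lemma band_limited_uncorrelated : L2 PP setT X -> L2 PP setT Y -> ip PP setT X Y = 0.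
Proof.
move=> LX LY.
have S0 V w z : ~ strip_box n.+1 z -> zext (setT `*` Z) V (w, z) = 0 :> R[i].
  by rewrite /zext; case: ifP => // /set_mem[_ /ZS[]].
have mB := measurable_strip_box (R := R) n.+1; have fB := strip_box_lty R n.+1.
apply: (uncorrelated_coefficients LX LY mB fB (S0 _) (S0 _)) => zeta LcX LcY.
have C0 : 0 <= C by apply: le_trans (cC 0); exact: normc_ge0.
have YE : Y = zext (setT `*` Z) (fun v => (fun=> 1) v.2 * Fnu v).
  by apply/funext => v; rewrite /Y /zext mul1r.
have aL1 V : L2 PP setT V -> (forall w z, ~ strip_box n.+1 z -> V (w, z) = 0) ->
    {ae P, forall w, L1 mu2 setT (fun z => V (w, z))}.
  move=> LV V0; have := ae_L2_section1 LV; apply: ae_imp => w Lw.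
  exact: (L2_finite_support mB fB (V0 w)).
have m1 : cmeasurable [set: measurableTypeR R * measurableTypeR R] (fun=> 1 : R[i]).
    exact: cmeasurable_cst.
have b1 (z : R * R) : Normc.normc (1 : R[i]) <= 1 :> R by rewrite -[1]/(1%:C%C) normc_real normr1.
have coord k : P.-integrable setT (EFin \o (fun w => cdot (fourier2 (fun z => X (w, z)) zeta) k *
      cdot (fourier2 (fun z => Y (w, z)) zeta) k)) /\
    \int[P]_w (cdot (fourier2 (fun z => X (w, z)) zeta) k *
      cdot (fourier2 (fun z => Y (w, z)) zeta) k) = 0.
  have [psi Lpsi psiP] := F1_radon_test (mtest k zeta mc) (@testS k c zeta) (testC k zeta C0 cC).
  have [chi Lchi chiP] := F1_test (mtest k zeta m1) (@testS k (fun=> 1) zeta) (testC k zeta ler01 b1).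
  pose f w := ip mu2 (@plane R) (U w) psi; pose g w := ip mu2 strip (nu w) chi.
  have mf : measurable_fun setT f by exact: (measurable_functional (@measurableT _ _) rU Lpsi).
  have mg : measurable_fun setT g by exact: (measurable_functional (@measurable_strip R) rnu Lchi).
  have fE : {ae P, forall w, f w = cdot (fourier2 (fun z => X (w, z)) zeta) k}.
    move: vU (aL1 _ LX (S0 _)); apply: ae_imp2 => w Uw LXw.
    by rewrite (coordE k zeta LXw) (psiP _ _ Uw).
  have gE : {ae P, forall w, g w = cdot (fourier2 (fun z => Y (w, z)) zeta) k}.
    move: vnu (aL1 _ LY (S0 _)); apply: ae_imp2 => w nw; rewrite YE => LYw.
    rewrite /g -(chiP _ _ nw); exact/esym/(coordE (b := fun=> 1) k zeta LYw).
  have Lk : L2 P setT (fun=> k).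
    split; first exact: cmeasurable_cst.
    rewrite L2normsqE (integral_cst _ measurableT).
    by apply: lte_mul_pinfty; rewrite ?lee_fin ?cdot_ge0//; exact: le_lt_trans (probability_le1 P measurableT) (ltry _).
  have If : P.-integrable setT (EFin \o f).
    exact: (ae_eq_integrable mf (integrable_cdot measurableT LcX Lk) fE).
  have Ig : P.-integrable setT (EFin \o g).
    exact: (ae_eq_integrable mg (integrable_cdot measurableT LcY Lk) gE).
  have ind A B : measurable A -> measurable B ->
      P (f @^-1` A `&` g @^-1` B) = (P (f @^-1` A) * P (g @^-1` B))%E.
    move=> mA mB'; apply: indep.
      exact: (L2sigma_functional (@measurableT _ _) rU Lpsi mA).
    exact: (L2sigma_functional (@measurable_strip R) rnu Lchi mB').
  have [Ifg Efg] := independent_expectation mf mg ind If Ig.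
  have mfg : measurable_fun setT (fun w => cdot (fourier2 (fun z => X (w, z)) zeta) k *
      cdot (fourier2 (fun z => Y (w, z)) zeta) k).
    have [mcX _] := LcX; have [mcY _] := LcY.
    by apply: measurable_funM; apply: measurable_cdot => //; exact: cmeasurable_cst.
  have fgE : {ae P, forall w, cdot (fourier2 (fun z => X (w, z)) zeta) k *
      cdot (fourier2 (fun z => Y (w, z)) zeta) k = f w * g w}.
    by move: fE gE; apply: ae_imp2 => w -> ->.
  split; first exact: (ae_eq_integrable mfg Ifg fgE).
  rewrite (ae_eq_Rintegral (g := fun w => f w * g w) measurableT)//.
  - by rewrite Efg centered_functional// mulr0.
  - exact: measurable_funM.
  - by apply: ae_imp fgE => w ->.
have [I1 E1] := coord 1; have [Ii Ei] := coord 'i%C.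
have s := RintegralD measurableT I1 Ii; rewrite E1 Ei addr0 in s; rewrite -[RHS]s.
by apply: eq_Rintegral => w _; rewrite -!Re_cdot -!Im_cdot.
Qed.

End BandLimited.
End CrossTerm.

(** * The expected error as an integral of pointwise errors *)

Section NonmeasurableIntegrands.
Context d (T : measurableType d) (R : realType) (mu : {measure set T -> \bar R}).

(** The integral of a nonnegative function is a supremum over the simple functions below it, whether or not it is measurable. *)
Lemma ge0_le_integral_nonmeasurable (f g : T -> \bar R) : (forall x, 0 <= f x)%E ->
  (forall x, f x <= g x)%E -> (\int[mu]_x f x <= \int[mu]_x g x)%E.
Proof.
move=> f0 fg; have g0 x : (0 <= g x)%E by exact: le_trans (f0 x) (fg x).
rewrite ge0_integralTE// ge0_integralTE//; apply: ereal_sup_le => _ [h hf <-].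
by exists h => // x; exact: le_trans (hf x) (fg x).
Qed.

(** Comparison in which the upper integrand may fail to be measurable: modify the lower one on a null set and compare suprema over simple functions. *)
Lemma ae_ge0_le_integral_l (f g : T -> \bar R) : (forall x, 0 <= f x)%E ->
  (forall x, 0 <= g x)%E -> measurable_fun setT f ->
  {ae mu, forall x, f x <= g x}%E -> (\int[mu]_x f x <= \int[mu]_x g x)%E.
Proof.
move=> f0 g0 mf [N [mN N0 hN]].
have mNc : measurable (~` N) by exact: measurableC.
rewrite (ae_eq_integral (f \_ (~` N)))//.
- apply: ge0_le_integral_nonmeasurable => x; rewrite patchE; case: ifP => // /set_mem xN.
  by apply: contrapT => h; apply: xN; exact: hN.
- by apply/(measurable_restrictT _ mNc); exact: measurable_funTS.
- exists N; split => // x /= h; apply: contrapT => xN; apply: h => _.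
  by rewrite patchE mem_set.
Qed.

Lemma ae_ge0_le_integral_r (f g : T -> \bar R) : (forall x, 0 <= f x)%E ->
  (forall x, 0 <= g x)%E -> measurable_fun setT g ->
  {ae mu, forall x, f x <= g x}%E -> (\int[mu]_x f x <= \int[mu]_x g x)%E.
Proof.
move=> f0 g0 mg [N [mN N0 hN]].
have mNc : measurable (~` N) by exact: measurableC.
pose g' x := ((g \_ (~` N)) x + ((cst +oo) \_ N) x)%E.
have mg' : measurable_fun setT g'.
  apply: emeasurable_funD.
    by apply/(measurable_restrictT _ mNc); exact: measurable_funTS.
  by apply/(measurable_restrictT _ mN); exact: measurable_cst.
have g'N x : N x -> g' x = +oo%E.
  move=> xN; rewrite /g' !patchE [x \in N]mem_set// ifF ?add0e//.
  by apply/negbTE/negP => /set_mem; apply.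
have g'C x : ~ N x -> g' x = g x.
  move=> xN; have xC : x \in ~` N by exact: mem_set.
  by rewrite /g' !patchE xC (memNset xN) adde0.
rewrite [leRHS](ae_eq_integral g')//.
- apply: ge0_le_integral_nonmeasurable => // x.
  have [xN|xN] := pselect (N x); first by rewrite g'N// leey.
  by rewrite g'C//; apply: contrapT => h; apply: xN; exact: hN.
- exists N; split => // x /= h; apply: contrapT => xN; apply: h => _.
  by rewrite g'C.
Qed.

End NonmeasurableIntegrands.

Section ErrorFormula.
Variable R : realType.
Notation mu2 := (@leb2 R).
Notation strip := (@strip R).
Implicit Types u a b rho g : R * R -> R[i].

Lemma F1_invertibleP g : F1_invertible g -> is_F1 (F1inv g) g.
Proof.
by case=> h hg; rewrite /F1inv; case: xgetP => [h' _ //|no]; case: (no h).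
Qed.

(** The two inequalities combine also when one side is infinite. *)
Lemma error_identity u a h g : is_F1_radon u a -> is_F1 h g ->
  L2normsq mu2 setT (fun x => u x - backprojection h x) = L2normsq mu2 strip (defect a g).
Proof.
move=> ua hg; have h1 := L2normsq_residual_le ua hg; have h2 := L2normsq_defect_le ua hg.
have [fd|fd] := boolP (L2normsq mu2 strip (defect a g) < +oo)%E.
  by apply/eqP; rewrite eq_le h1//=; apply: h2; exact: le_lt_trans (h1 fd) fd.
have [fr|fr] := boolP (L2normsq mu2 setT (fun x => (u x - backprojection h x)%R) < +oo)%E.
  by move: (le_lt_trans (h2 fr) fr); rewrite (negbTE fd).
by move: fd fr; rewrite -!leNgt !leye_eq => /eqP -> /eqP ->.
Qed.

Lemma sq_error_ge u a b rho : is_F1_radon u a ->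
  (L2normsq mu2 strip (defect a (fun z => rho z * (a z + b z))%R) <=
   sq_error u (fun z => a z + b z)%R rho)%E.
Proof.
move=> ua; rewrite /sq_error; case: asboolP => [iv|_]; last by rewrite leey.
by rewrite -(error_identity ua (F1_invertibleP iv)).
Qed.

Lemma sq_errorE u a b rho : is_F1_radon u a -> L2 mu2 strip (fun z => rho z * (a z + b z)) ->
  sq_error u (fun z => a z + b z)%R rho =
  L2normsq mu2 strip (defect a (fun z => rho z * (a z + b z))%R).
Proof.
move=> ua /F1_surjective iv; rewrite /sq_error; case: asboolP => [_|//].
by rewrite -(error_identity ua (F1_invertibleP iv)).
Qed.

End ErrorFormula.

Section ExpectedError.
Context dO (Omega : measurableType dO) (R : realType) (P : probability Omega R).
Notation leb := (@lebesgue_measure R).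
Notation mu2 := (@leb2 R).
Notation pl := (@plane_measure R).
Notation strip := (@strip R).
Notation PP := (P \x pl)%E.
Variables (U nu : Omega -> R * R -> R[i]) (FAU Fnu : Omega * (R * R) -> R[i]).
Hypothesis rU : L2random mu2 (@plane R) U.
Hypothesis fU : (\int[P]_w L2normsq mu2 (@plane R) (U w) < +oo)%E.
Hypothesis rnu : L2random mu2 strip nu.
Hypothesis cnu : L2centered P mu2 strip nu.
Hypothesis indep : L2independent P mu2 (@plane R) U mu2 strip nu.
Hypothesis vU : measurable_version P (@is_F1_radon R) U FAU.
Hypothesis vnu : measurable_version P (@is_F1 R) nu Fnu.

Let Pi := second_moment P FAU.
Let Delta := second_moment P Fnu.
Let Os : set (Omega * (R * R)) := setT `*` strip.

Let mOs : measurable Os.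
Proof. by apply: measurableX => //; exact: measurable_strip. Qed.

Let FA0 := zext Os FAU.
Let FN0 := zext Os Fnu.

Let mFA0 : cmeasurable setT FA0.
Proof. by apply: cmeasurable_zext => //; case: vU. Qed.

Let mFN0 : cmeasurable setT FN0.
Proof. by apply: cmeasurable_zext => //; case: vnu. Qed.

Let inOs w z : ((w, z) \in Os) = (z \in strip).
Proof. by apply/idP/idP => /set_mem => [[_ ?]|?]; apply/mem_set. Qed.

Let zext_slice (F : Omega * (R * R) -> R[i]) w z : zext Os F (w, z) = zext strip (fun z => F (w, z)) z.
Proof. by rewrite /zext inOs. Qed.

Let PiE z : strip z -> L2normsq P setT (fun w => FA0 (w, z)) = Pi z.
Proof.
move=> zS; congr L2normsq; apply/funext => w.
by rewrite /FA0 zext_slice zext_id.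
Qed.

Let DeltaE z : strip z -> L2normsq P setT (fun w => FN0 (w, z)) = Delta z.
Proof.
move=> zS; congr L2normsq; apply/funext => w.
by rewrite /FN0 zext_slice zext_id.
Qed.

Let msq : measurable_fun setT (fun z : R * R => Num.sqrt `|z.1|).
Proof.
apply: (measurableT_comp (@measurable_sqrt R)).
exact: (measurableT_comp (@normr_measurable R setT)).
Qed.

Let msnd : measurable_fun setT (fun v : Omega * (R * R) => v.2).
Proof. exact: (@measurable_snd _ _ Omega (measurableTypeR R * measurableTypeR R)%type). Qed.

Lemma measurable_Pi : measurable_fun strip Pi.
Proof.
have m := measurable_L2normsq_prod2 P mFA0.
apply: eq_measurable_fun (measurable_funTS m) => z /set_mem zS; exact: PiE.
Qed.

Lemma measurable_Delta : measurable_fun strip Delta.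
Proof.
have m := measurable_L2normsq_prod2 P mFN0.
apply: eq_measurable_fun (measurable_funTS m) => z /set_mem zS; exact: DeltaE.
Qed.

(** r |-> sqrt |r| F_1 A U, which has the energy of U *)
Let XW (v : Omega * (R * R)) : R[i] := (Num.sqrt `|v.2.1|)%:C%C * FA0 v.

Let mXW : cmeasurable setT XW.
Proof. by apply: cmeasurableM => //; apply: cmeasurable_real; exact: (measurableT_comp msq msnd). Qed.

Let L2XW : L2 PP setT XW.
Proof.
split; first exact: mXW.
rewrite L2normsq_prod1//; apply: le_lt_trans fU.
have L0 d (X : measurableType d) (mu : {measure set X -> \bar R}) D f : (0 <= L2normsq mu D f)%E.
  by rewrite L2normsqE; apply: integral_ge0 => x _; rewrite lee_fin cdot_ge0.
apply: ae_ge0_le_integral_l => //; first exact: measurable_L2normsq_prod1.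
have [_ v] := vU; apply: ae_imp v => w Uw; rewrite -(weighted_normsq_F1_radon Uw) -L2normsq_wt.
rewrite -[leRHS]L2normsq_zext le_eqVlt; apply/orP; left; apply/eqP; congr L2normsq.
apply/funext => z; rewrite /XW /FA0 zext_slice /zext /wt.
by case: ifP => // _; rewrite mulr0.
Qed.

Let XWE z : strip z -> L2normsq P setT (fun w => XW (w, z)) = (`|z.1|%:E * Pi z)%E.
Proof.
move=> zS; rewrite -PiE// !L2normsqE -ge0_integralZl_EFin//.
- apply: eq_integral => w _; rewrite -EFinM; congr (_%:E).
  by rewrite /XW /= cdotZl cdotC cdotZl mulrA -expr2 sqr_sqrtr.
- by move=> w _; rewrite lee_fin cdot_ge0.
- by apply/measurable_EFinP; apply: measurable_cdot; exact: cmeasurable_section2.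
Qed.

Lemma weighted_Pi_lty : (\int[mu2]_(z in strip) (`|z.1|%:E * Pi z) < +oo)%E.
Proof.
have [_] := L2XW; rewrite L2normsq_prod2//; apply: le_lt_trans.
have L0 f : (0 <= L2normsq P setT f)%E.
  by rewrite L2normsqE; apply: integral_ge0 => x _; rewrite lee_fin cdot_ge0.
rewrite [leLHS]integral_mkcond; apply: ge0_le_integral_nonmeasurable => z; rewrite patchE.
  by case: ifP => [/set_mem zS|_] //; rewrite -XWE//; exact: L0.
by case: ifP => [/set_mem zS|_]; [rewrite XWE|exact: L0].
Qed.

Lemma ae_Pi_lty : {ae mu2, forall z, strip z -> (Pi z < +oo)%E}.
Proof.
move: (ae_L2_section2 L2XW) (ae_fst_neq0 R); apply: ae_imp2 => z [_ fz] z1 zS.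
move: fz; rewrite XWE//; apply: contraTT; rewrite -!leNgt !leye_eq => /eqP ->.
by rewrite gt0_muley// lte_fin normr_gt0.
Qed.

Section Regularized.
Variable k : nat.

Let Z : set (R * R) := (strip_box k.+1 `&` [set z | k.+1%:R^-1 <= `|z.1|]) `&`
  ([set z | L2normsq P setT (fun w => FA0 (w, z)) <= k%:R%:E]%E `&`
   [set z | L2normsq P setT (fun w => FN0 (w, z)) <= k%:R%:E]%E).

Let mZ : measurable (Z : set (measurableTypeR R * measurableTypeR R)).
Proof.
apply: measurableI; apply: measurableI.
- exact: measurable_strip_box.
- by apply: measurable_set_le; [exact: measurable_cst|exact: measurableT_comp].
- by have := emeasurable_fun_infty_c measurableT (measurable_L2normsq_prod2 P mFA0) k%:R%:E; rewrite setTI.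
- by have := emeasurable_fun_infty_c measurableT (measurable_L2normsq_prod2 P mFN0) k%:R%:E; rewrite setTI.
Qed.

Let ZS z : Z z -> strip z. Proof. by case=> [[[]]]. Qed.

Let XA := zext (setT `*` Z) FAU.
Let YB := zext (setT `*` Z) Fnu.

Let inZ (w : Omega) z : ((w, z) \in setT `*` Z) = (z \in Z).
Proof. by apply/idP/idP => /set_mem => [[_ ?]|?]; apply/mem_set. Qed.

Let mOZ : measurable (setT `*` Z : set (Omega * (measurableTypeR R * measurableTypeR R))).
Proof. exact: measurableX. Qed.

Let sub : (setT : set Omega) `*` Z `<=` Os.
Proof. by move=> [w z] [_ /ZS]. Qed.

Let mXA : cmeasurable setT XA.
Proof.
apply: cmeasurable_zext => //; have [[mr mi] _] := vU.
by split; [exact: measurable_funS sub mr|exact: measurable_funS sub mi].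
Qed.

Let mYB : cmeasurable setT YB.
Proof.
apply: cmeasurable_zext => //; have [[mr mi] _] := vnu.
by split; [exact: measurable_funS sub mr|exact: measurable_funS sub mi].
Qed.

Let fZ : (mu2 Z < +oo)%E.
Proof.
apply: le_lt_trans (strip_box_lty R k.+1); apply: le_measure; rewrite ?inE//.
  exact: measurable_strip_box.
by move=> z [[]].
Qed.

Let slice_le (F : Omega * (R * R) -> R[i]) z :
  (forall z, Z z -> (L2normsq P setT (fun w => zext Os F (w, z)) <= k%:R%:E)%E) ->
  (L2normsq P setT (fun w => zext (setT `*` Z) F (w, z)) <= k%:R%:E * (\1_Z z)%:E)%E.
Proof.
move=> h; rewrite indicE; have [zZ|zZ] := boolP (z \in Z).
  rewrite mule1; have := h z (set_mem zZ); congr (_ <= _)%E; congr L2normsq.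
  by apply/funext => w; rewrite /zext inZ inOs zZ mem_set//; exact/ZS/set_mem.
rewrite mule0 L2normsqE integral0_eq// => w _.
by rewrite /zext inZ (negbTE zZ) cdot0l.
Qed.

Let L2zext F : cmeasurable setT (zext (setT `*` Z) F) ->
  (forall z, Z z -> (L2normsq P setT (fun w => zext Os F (w, z)) <= k%:R%:E)%E) ->
  L2 PP setT (zext (setT `*` Z) F).
Proof.
move=> mF h; split => //; rewrite L2normsq_prod2//.
apply: (@le_lt_trans _ _ (\int[mu2]_z (k%:R%:E * (\1_Z z)%:E))%E).
  apply: ge0_le_integral_nonmeasurable => z; last exact: slice_le.
  by rewrite L2normsqE; apply: integral_ge0 => x _; rewrite lee_fin cdot_ge0.
rewrite ge0_integralZl_EFin//.
- by rewrite integral_indic// setIT; apply: lte_mul_pinfty.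
- by apply/measurable_EFinP; exact: measurable_indic.
Qed.

Let LXA : L2 PP setT XA. Proof. by apply: L2zext => // z [_ []]. Qed.
Let LYB : L2 PP setT YB. Proof. by apply: L2zext => // z [_ []]. Qed.

Let Lslice F z : cmeasurable setT (zext (setT `*` Z) F) ->
  (forall z, Z z -> (L2normsq P setT (fun w => zext Os F (w, z)) <= k%:R%:E)%E) ->
  L2 P setT (fun w => zext (setT `*` Z) F (w, z)) /\
  ip P setT (fun w => zext (setT `*` Z) F (w, z)) (fun w => zext (setT `*` Z) F (w, z)) <= k%:R.
Proof.
move=> mF h; have s := slice_le z h.
have s' : (L2normsq P setT (fun w => zext (setT `*` Z) F (w, z)) <= k%:R%:E)%E.
  by apply: le_trans s _; rewrite -EFinM lee_fin indicE -[leRHS]mulr1 ler_wpM2l//; case: (_ \in _).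
have L : L2 P setT (fun w => zext (setT `*` Z) F (w, z)).
  by split; [exact: (cmeasurable_section2 z mF)|exact: le_lt_trans s' (ltry _)].
by split => //; move: s'; rewrite (L2normsq_fin measurableT L) lee_fin.
Qed.

(** Testing with the correlation M itself, localized to frequencies where both second moments are at most k, gives a vanishing integral of M^2. *)
Lemma uncorrelated_regularized (q : R[i]) : Normc.normc q = 1 ->
  {ae mu2, forall z, Z z -> ip P setT (fun w => q * FAU (w, z)) (fun w => Fnu (w, z)) = 0}.
Proof.
move=> q1; pose G v := cdot (q * XA v) (YB v).
have mqX : cmeasurable setT (fun v => q * XA v) by apply: cmeasurableM => //; exact: cmeasurable_cst.
have cq : cdot q q = 1 by rewrite -normc_sq q1 expr1n.
have mG : measurable_fun setT G by exact: measurable_cdot.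
pose M z := \int[P]_w G (w, z).
have mM : measurable_fun setT M by exact: (measurable_Rintegral2 P mG).
have LXs z : L2 P setT (fun w => XA (w, z)) /\ ip P setT (fun w => XA (w, z)) (fun w => XA (w, z)) <= k%:R.
  by apply: (Lslice z mXA) => y [_ []].
have LYs z : L2 P setT (fun w => YB (w, z)) /\ ip P setT (fun w => YB (w, z)) (fun w => YB (w, z)) <= k%:R.
  by apply: (Lslice z mYB) => y [_ []].
have LqX z : L2 P setT (fun w => q * XA (w, z)) by apply: L2Z => //; have [] := LXs z.
have Mk z : `|M z| <= k%:R.
  have [_ x1] := LXs z; have [LY y1] := LYs z.
  have cs := ip_CS measurableT (LqX z) LY.
  have e : ip P setT (fun w => q * XA (w, z)) (fun w => q * XA (w, z)) =
      ip P setT (fun w => XA (w, z)) (fun w => XA (w, z)).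
    by apply: eq_Rintegral => w _; rewrite cdotMM cq mul1r.
  rewrite e in cs; rewrite -ler_sqr ?nnegrE// real_normK ?num_real//.
  apply: le_trans cs _; rewrite expr2; apply: ler_pM => //; exact: ip_ge0.
pose c z : R[i] := q * (M z)%:C%C.
have mc : cmeasurable setT c.
  by apply: cmeasurableM; [exact: cmeasurable_cst|exact: cmeasurable_real].
have cC z : Normc.normc (c z) <= k%:R by rewrite normcM' q1 mul1r normc_real.
pose X v := zext (setT `*` Z) (fun v => c v.2 * FAU v) v.
have XE v : X v = c v.2 * XA v.
  by rewrite /X /XA /zext; case: ifP => // _; rewrite mulr0.
have LX : L2 PP setT X.
  rewrite (_ : X = fun v => c v.2 * XA v); last by apply/funext => v; rewrite XE.
  apply: (L2M_bounded measurableT (C := k%:R ^+ 2)) => //; first exact: (cmeasurable_comp mc msnd).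
  by move=> v _; rewrite -normc_sq ler_sqr ?nnegrE ?normc_ge0.
have ZB z : Z z -> strip_box k.+1 z /\ k.+1%:R^-1 <= `|z.1| by case=> [[]].
have [_ vU'] := vU; have [_ vnu'] := vnu.
have zero := band_limited_uncorrelated rU rnu cnu indep vU' vnu' mc cC mZ ZB LX LYB.
have IXY := integrable_cdot measurableT LX LYB.
have GE v : cdot (X v) (YB v) = M v.2 * G v.
  by rewrite XE /c /G [q * _]mulrC -mulrA cdotZl.
have ME z : \int[P]_w cdot (X (w, z)) (YB (w, z)) = M z * M z.
  have IG : P.-integrable setT (EFin \o (fun w => G (w, z))).
    by apply: integrable_cdot => //; have [] := LYs z.
  transitivity (\int[P]_w (M z * G (w, z))); last by rewrite RintegralZl.
  by apply: eq_Rintegral => w _; rewrite GE.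
have I2 := integrable_Rfubini2 IXY.
have := Rfubini2 IXY; rewrite -/(ip _ _ _ _) zero => zero2.
have I3 : mu2.-integrable setT (EFin \o (fun z => M z * M z)).
  by move: I2; congr integrable; apply/funext => z /=; rewrite ME.
have z3 : (\int[mu2]_z `|(M z * M z)%:E| = 0)%E.
  have -> : (\int[mu2]_z `|(M z * M z)%:E| = \int[mu2]_z (M z * M z)%:E)%E.
    by apply: eq_integral => z _; rewrite gee0_abs// lee_fin -expr2 sqr_ge0.
  rewrite -(EFin_Rintegral measurableT I3) -[RHS]/(0%:E) -[in RHS]zero2; congr (_%:E).
  by apply: eq_Rintegral => z _; rewrite -ME.
have mMM := measurable_int _ I3.
have := proj1 (ae_eq_integral_abs mu2 measurableT mMM) z3.
apply: ae_imp => z /(_ I) /= [MM] Zz.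
have : M z = 0 by apply/eqP; have /eqP := MM; rewrite mulf_eq0 orbb.
move=> M0; rewrite -[RHS]M0; apply: eq_Rintegral => w _.
by rewrite /G /XA /YB /zext inZ mem_set.
Qed.

End Regularized.

Lemma uncorrelated : {ae mu2, forall z, strip z -> (Pi z < +oo)%E -> (Delta z < +oo)%E ->
  ip P setT (fun w => FAU (w, z)) (fun w => Fnu (w, z)) = 0 /\
  ip P setT (fun w => 'i%C * FAU (w, z)) (fun w => Fnu (w, z)) = 0}.
Proof.
have n1 : Normc.normc (1 : R[i]) = 1 by rewrite -[1 in LHS]/(1%:C%C) normc_real normr1.
have ni : Normc.normc ('i%C : R[i]) = 1 by rewrite normcV /cdot/= mul0r add0r mulr1 sqrtr1.
have h1 := ae_foralln (fun k => uncorrelated_regularized k n1).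
have hi := ae_foralln (fun k => uncorrelated_regularized k ni).
move: h1 (ae_imp2 (fun z a b => conj a b) hi (ae_fst_neq0 R)); apply: ae_imp2.
move=> z h1 [hj z1] zS fP fD.
have P0 : (0 <= Pi z)%E by rewrite -PiE// L2normsqE; apply: integral_ge0 => x _; rewrite lee_fin cdot_ge0.
have D0 : (0 <= Delta z)%E by rewrite -DeltaE// L2normsqE; apply: integral_ge0 => x _; rewrite lee_fin cdot_ge0.
pose m := Num.max (Num.max `|z.1| `|z.1|^-1) (Num.max (fine (Pi z)) (fine (Delta z))).
pose k := (Num.truncn m).+1.
have mk : m <= k%:R by apply/ltW; exact: truncnS_gt.
move: (mk); rewrite !ge_max => /andP[/andP[m1 m2] /andP[m3 m4]].
have kS : k%:R <= k.+1%:R :> R by rewrite ler_nat.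
have Zz : ((strip_box k.+1 `&` [set z | k.+1%:R^-1 <= `|z.1|]) `&`
  ([set z | L2normsq P setT (fun w => FA0 (w, z)) <= k%:R%:E]%E `&`
   [set z | L2normsq P setT (fun w => FN0 (w, z)) <= k%:R%:E]%E)) z.
  split; [split; [split => //=|]|split => /=].
  - exact: le_trans m1 kS.
  - by rewrite /= invf_ple ?posrE ?normr_gt0//; exact: le_trans m2 kS.
  - by rewrite PiE// -(@fineK _ (Pi z)) ?lee_fin// ge0_fin_numE.
  - by rewrite DeltaE// -(@fineK _ (Delta z)) ?lee_fin// ge0_fin_numE.
split; last exact: (hj k Zz).
rewrite -[RHS](h1 k Zz); apply: eq_Rintegral => w _; by rewrite mul1r.
Qed.

(** weights of F_1 A U and of F_1 nu in the defect *)
Definition signal_gain (rho : R * R -> R[i]) (z : R * R) : R[i] :=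
  (Num.sqrt `|z.1|)%:C%C - (Num.sqrt `|z.1|)^-1%:C%C * rho z.
Definition noise_gain (rho : R * R -> R[i]) (z : R * R) : R[i] :=
  (Num.sqrt `|z.1|)^-1%:C%C * rho z.

Definition pointwise_error rho z : \bar R :=
  ((cdot (signal_gain rho z) (signal_gain rho z))%:E * Pi z +
   (cdot (noise_gain rho z) (noise_gain rho z))%:E * Delta z)%E.

Section FixedFilter.
Variable rho : R * R -> R[i].
Hypothesis mrho : cmeasurable strip rho.

Let W := zext Os (fun v => signal_gain rho v.2 * FAU v - noise_gain rho v.2 * Fnu v).

Let minv : cmeasurable setT (fun z : R * R => ((Num.sqrt `|z.1|)^-1)%:C%C).
Proof. by apply: cmeasurable_real; exact: measurable_funV. Qed.

Let mrho0 : cmeasurable setT (zext strip rho).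
Proof. by apply: cmeasurable_zext => //; exact: measurable_strip. Qed.

Let WE v : W v = ((Num.sqrt `|v.2.1|)%:C%C - (Num.sqrt `|v.2.1|)^-1%:C%C * zext strip rho v.2) * FA0 v -
  ((Num.sqrt `|v.2.1|)^-1%:C%C * zext strip rho v.2) * FN0 v.
Proof.
case: v => w z; rewrite /W /FA0 /FN0 /zext inOs; case: ifP => // _.
by rewrite !mulr0 subr0.
Qed.

Let mW : cmeasurable setT W.
Proof.
rewrite (funext WE).
have m1 := cmeasurable_comp minv msnd; have m2 := cmeasurable_comp mrho0 msnd.
have m3 : cmeasurable setT (fun v : Omega * (R * R) => (Num.sqrt `|v.2.1|)%:C%C).
  by apply: cmeasurable_real; exact: (measurableT_comp msq msnd).
apply: cmeasurableB; apply: cmeasurableM => //; last exact: cmeasurableM.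
by apply: cmeasurableB => //; exact: cmeasurableM.
Qed.

Let L2W w : L2normsq mu2 setT (fun z => W (w, z)) =
  L2normsq mu2 strip (defect (fun z => FAU (w, z)) (fun z => rho z * (FAU (w, z) + Fnu (w, z)))).
Proof.
rewrite -[RHS]L2normsq_zext; congr L2normsq; apply/funext => z.
rewrite /W zext_slice; congr (zext strip _ _); apply/funext => y.
by rewrite /signal_gain /noise_gain /defect /wt; ring.
Qed.

Lemma measurable_pointwise_error : measurable_fun strip (pointwise_error rho).
Proof.
have m1 : cmeasurable strip (fun z => ((Num.sqrt `|z.1|)^-1)%:C%C) by exact: cmeasurableTS.
have m2 : cmeasurable strip (noise_gain rho) by exact: cmeasurableM.
have m3 : cmeasurable strip (signal_gain rho).
  by apply: cmeasurableB => //; apply: cmeasurable_real; exact: measurable_funTS.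
apply: emeasurable_funD; apply: emeasurable_funM.
- by apply/measurable_EFinP; exact: measurable_cdot.
- exact: measurable_Pi.
- by apply/measurable_EFinP; exact: measurable_cdot.
- exact: measurable_Delta.
Qed.

Let energy : (\int[P]_w L2normsq mu2 setT (fun z => W (w, z)) =
  \int[mu2]_(z in strip) pointwise_error rho z)%E.
Proof.
transitivity (L2normsq PP setT W); first by rewrite L2normsq_prod1.
rewrite L2normsq_prod2// [RHS]integral_mkcond.
apply: ae_eq_integral => //.
- exact: measurable_L2normsq_prod2.
- apply/(measurable_restrictT _ (@measurable_strip R)); exact: measurable_pointwise_error.
move: uncorrelated ae_Pi_lty; apply: ae_imp2 => z unc fP _; rewrite patchE.
case: ifP => [/set_mem zS|zS].
  have mF (F : Omega * (R * R) -> R[i]) : cmeasurable setT (zext Os F) ->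
      cmeasurable setT (fun w => F (w, z)).
    move=> /(@cmeasurable_section2 _ _ _ _ z); congr cmeasurable; apply/funext => w.
    by rewrite zext_slice zext_id.
  rewrite /pointwise_error -(second_moment_combination (mF _ mFA0) (mF _ mFN0) (fP zS) (unc zS (fP zS))).
  by congr L2normsq; apply/funext => w; rewrite /W zext_slice zext_id.
by rewrite L2normsqE integral0_eq// => w _; rewrite /W /zext inOs zS cdot0l.
Qed.

Let L2ge0 d (X : measurableType d) (mu : {measure set X -> \bar R}) D f : (0 <= L2normsq mu D f)%E.
Proof. by rewrite L2normsqE; apply: integral_ge0 => x _; rewrite lee_fin cdot_ge0. Qed.

Let sq_error_ge0 u f r : (0 <= @sq_error R u f r)%E.
Proof. by rewrite /sq_error; case: ifP => // _; exact: L2ge0. Qed.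

(** Only an inequality in general: for outcomes outside the domain of the inverse transform the error is infinite by convention. *)
Lemma expected_error_ge :
  (\int[mu2]_(z in strip) pointwise_error rho z <= expected_error P U FAU Fnu rho)%E.
Proof.
rewrite -energy; apply: ae_ge0_le_integral_l.
- by move=> w; exact: L2ge0.
- by move=> w; exact: sq_error_ge0.
- exact: measurable_L2normsq_prod1.
have [_ v] := vU; apply: ae_imp v => w Uw; rewrite L2W; exact: sq_error_ge.
Qed.

Lemma expected_errorE :
  {ae P, forall w, L2 mu2 strip (fun z => rho z * (FAU (w, z) + Fnu (w, z)))} ->
  expected_error P U FAU Fnu rho = (\int[mu2]_(z in strip) pointwise_error rho z)%E.
Proof.
move=> Lr; apply/eqP; rewrite eq_le expected_error_ge andbT -energy.
apply: ae_ge0_le_integral_r.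
- by move=> w; exact: sq_error_ge0.
- by move=> w; exact: L2ge0.
- exact: measurable_L2normsq_prod1.
have [_ v] := vU; move: v Lr; apply: ae_imp2 => w Uw Lw.
by rewrite L2W (sq_errorE Uw Lw).
Qed.

End FixedFilter.
End ExpectedError.

(** * Pointwise minimization *)

Lemma one_sube (R : realType) (x : R) : (1 - x%:E = (1 - x)%:E)%E.
Proof. by []. Qed.

Lemma sube0_eq (R : realType) (x y : \bar R) : (x - y = 0)%E -> y \is a fin_num -> x = y.
Proof.
case: y => [y||]// e _; case: x e => [x||]// [/eqP].
by rewrite subr_eq0 => /eqP ->.
Qed.

Section PointwiseOptimum.
Variable R : realType.
Variables (s p : R) (D : \bar R).
Hypotheses (s0 : 0 < s) (p0 : 0 <= p) (D0 : (0 <= D)%E).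
Hypothesis pD : (0 < p%:E \/ 0 < D)%E.

Let err (rho : R[i]) : \bar R :=
  ((cdot (s%:C%C - s^-1%:C%C * rho) (s%:C%C - s^-1%:C%C * rho))%:E * p%:E +
   (cdot (s^-1%:C%C * rho) (s^-1%:C%C * rho))%:E * D)%E.

Let best : R[i] := (s ^+ 2 * fine (p%:E / (p%:E + D))%E)%:C%C.

Let ratio_fin d : D = d%:E -> 0 < p + d /\ (p%:E / (p%:E + D) = (p / (p + d))%:E)%E.
Proof.
move=> Dd; have d0 : 0 <= d by move: D0; rewrite Dd lee_fin.
have h : 0 < p + d.
  by case: pD => [|]; rewrite ?Dd lte_fin => h; [rewrite ltr_wpDr|rewrite ltr_wpDl].
by split => //; rewrite Dd -EFinD inver gt_eqF// -EFinM.
Qed.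

Let ratio_oo : D = +oo%E -> (p%:E / (p%:E + D) = 0)%E.
Proof. by move=> ->; rewrite addey// invey mule0. Qed.

Let errE d rho : D = d%:E -> err rho = (cdot (s^-1%:C%C * (rho - best)) (s^-1%:C%C * (rho - best)) * (p + d)
  + s ^+ 2 * p * (1 - p / (p + d)))%:E.
Proof.
move=> Dd; have [h e] := ratio_fin Dd; rewrite /err /best e Dd -!EFinM -EFinD; congr (_%:E) => /=.
have h' : p + d != 0 by rewrite gt_eqF.
have s' : s != 0 by rewrite gt_eqF.
by case: rho => x y; rewrite /cdot /=; field; rewrite h' s'.
Qed.

(** Completing the square: the error exceeds its minimum by (p + D) times the squared distance of s^-1 rho to s^-1 best. For D infinite the best value is 0. *)
Lemma pointwise_best : err best = ((s ^+ 2)%:E * p%:E * (1 - p%:E / (p%:E + D)))%E.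
Proof.
have [Dd|Dd] := boolP (D \is a fin_num).
  have De := esym (fineK Dd); have [h e] := ratio_fin De.
  by rewrite (errE _ De) e subrr mulr0 cdot0l mul0r add0r -!EFinM.
have Doo : D = +oo%E by apply/eqP; rewrite -leye_eq leNgt -ge0_fin_numE.
rewrite /err /best ratio_oo// Doo mulr0 mulr0 subr0 cdot0l mul0e adde0 sube0 mule1 -EFinM.
by rewrite /cdot /=; congr (_%:E); ring.
Qed.

Lemma pointwise_le rho : (err best <= err rho)%E.
Proof.
have [Dd|Dd] := boolP (D \is a fin_num).
  have De := esym (fineK Dd); have [h _] := ratio_fin De.
  by rewrite !(errE _ De) lee_fin subrr mulr0 cdot0l mul0r lerD2r mulr_ge0 ?cdot_ge0// ltW.
have Doo : D = +oo%E by apply/eqP; rewrite -leye_eq leNgt -ge0_fin_numE.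
have [r0|r0] := eqVneq rho 0.
  by rewrite r0 /best ratio_oo//= mulr0.
rewrite [leRHS]/err Doo gt0_muley ?addey// ?leey// lte_fin lt_neqAle cdot_ge0 andbT eq_sym.
by apply: contraNneq r0 => /cdot_eq0/eqP; rewrite mulf_eq0 => /orP[|//] /eqP[/eqP]; rewrite invr_eq0 gt_eqF.
Qed.

Lemma pointwise_unique rho : err rho = err best -> rho = best.
Proof.
have [Dd|Dd] := boolP (D \is a fin_num).
  have De := esym (fineK Dd); have [h _] := ratio_fin De.
  rewrite !(errE _ De) => -[]; rewrite subrr mulr0 cdot0l mul0r => /addIr/eqP.
  rewrite mulf_eq0 (gt_eqF h) orbF => /eqP/cdot_eq0/eqP; rewrite mulf_eq0 subr_eq0.
  by move=> /orP[/eqP[/eqP]|/eqP//]; rewrite invr_eq0 gt_eqF.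
have Doo : D = +oo%E by apply/eqP; rewrite -leye_eq leNgt -ge0_fin_numE.
have b0 : best = 0 by rewrite /best ratio_oo//= mulr0.
have [r0|r0] := eqVneq rho 0; first by rewrite r0 b0.
have c0 : 0 < cdot (s^-1%:C%C * rho) (s^-1%:C%C * rho).
  rewrite lt_neqAle cdot_ge0 andbT eq_sym.
  by apply: contraNneq r0 => /cdot_eq0/eqP; rewrite mulf_eq0 => /orP[|//] /eqP[/eqP]; rewrite invr_eq0 gt_eqF.
rewrite pointwise_best ratio_oo// sube0 mule1 -EFinM /err Doo gt0_muley ?lte_fin// addey//.
Qed.

End PointwiseOptimum.

Section OptimalFilter.
Context dO (Omega : measurableType dO) (R : realType) (P : probability Omega R).
Notation leb := (@lebesgue_measure R).
Notation mu2 := (@leb2 R).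
Notation strip := (@strip R).
Variables (U nu : Omega -> R * R -> R[i]) (FAU Fnu : Omega * (R * R) -> R[i]).
Hypothesis rU : L2random mu2 (@plane R) U.
Hypothesis fU : (\int[P]_w L2normsq mu2 (@plane R) (U w) < +oo)%E.
Hypothesis rnu : L2random mu2 strip nu.
Hypothesis cnu : L2centered P mu2 strip nu.
Hypothesis indep : L2independent P mu2 (@plane R) U mu2 strip nu.
Hypothesis vU : measurable_version P (@is_F1_radon R) U FAU.
Hypothesis vnu : measurable_version P (@is_F1 R) nu Fnu.

Let Pi := second_moment P FAU.
Let Delta := second_moment P Fnu.
Let rhobar z : R[i] := (optimal_filter Pi Delta z)%:C%C.
Let err := expected_error P U FAU Fnu.
Let pe := pointwise_error P FAU Fnu.

Hypothesis pos : {ae mu2, forall z, strip z -> (0 < Pi z)%E \/ (0 < Delta z)%E}.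
Hypothesis dom : noise_dominates Pi Delta.

Let mS := @measurable_strip R.

Let Pi_ge0 z : (0 <= Pi z)%E.
Proof. by apply: integral_ge0 => w _; rewrite lee_fin sqr_ge0. Qed.

Let Delta_ge0 z : (0 <= Delta z)%E.
Proof. by apply: integral_ge0 => w _; rewrite lee_fin sqr_ge0. Qed.

Let mPi : measurable_fun strip Pi. Proof. exact: measurable_Pi vU. Qed.
Let mDelta : measurable_fun strip Delta. Proof. exact: measurable_Delta vnu. Qed.

Let ratio (x y : \bar R) : (0 <= x)%E -> (0 <= y)%E -> (x / (x + y) =
  (fine x * (fine x + fine y)^-1 * (if y == +oo%E then 0 else 1))%:E)%E.
Proof.
case: x => [x||]// x0; case: y => [y||]// y0.
- rewrite -EFinD inver /= mulr1; case: ifP => [/eqP h|h]; last by rewrite -EFinM.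
  move: x0 y0; rewrite !lee_fin => x0 y0.
  have -> : x = 0 by lra.
  by rewrite mul0e mul0r.
- by rewrite addey// invey mule0 /= mulr0.
- by rewrite addye// invey mule0 /= !mul0r.
- by rewrite addye// invey mule0 /= !mul0r.
Qed.

Let T z : R := fine (Pi z / (Pi z + Delta z))%E.

Let TE z : (Pi z / (Pi z + Delta z) = (T z)%:E)%E.
Proof. by rewrite /T ratio. Qed.

Let T01 z : 0 <= T z <= 1.
Proof.
rewrite /T ratio//=; case: ifP => _; first by rewrite mulr0 lexx ler01.
have a0 := fine_ge0 (Pi_ge0 z); have b0 := fine_ge0 (Delta_ge0 z).
rewrite mulr1 divr_ge0//= ?addr_ge0//.
have [e|e] := eqVneq (fine (Pi z) + fine (Delta z)) 0; first by rewrite e invr0 mulr0.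
by rewrite ler_pdivrMr ?mul1r ?lerDl// lt_neqAle eq_sym e addr_ge0.
Qed.

Let mT : measurable_fun strip T.
Proof.
have e : {in strip, (fun z => fine (Pi z) * (fine (Pi z) + fine (Delta z))^-1 *
    (if Delta z == +oo%E then 0 else 1)) =1 T}.
  by move=> z _; rewrite /T ratio.
apply: eq_measurable_fun e _.
have mf : measurable_fun strip (fun z => fine (Pi z)) by exact: measurableT_comp.
have mg : measurable_fun strip (fun z => fine (Delta z)) by exact: measurableT_comp.
apply: measurable_funM; first apply: measurable_funM => //.
  by apply: (measurableT_comp (@measurable_inv R)); exact: measurable_funD.
apply: measurable_fun_if; [exact: mS| |exact: measurable_cst|exact: measurable_cst].
apply: (measurable_fun_bool true).
rewrite (_ : strip `&` _ = strip `&` [set z | +oo <= Delta z]%E).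
  exact: emeasurable_fun_c_infty.
by apply/seteqP; split => z /= [zS h]; split => //; move: h; rewrite leye_eq.
Qed.

Let rhobarE z : optimal_filter Pi Delta z = `|z.1| * T z.
Proof. by []. Qed.

Let mrhobar : cmeasurable strip rhobar.
Proof.
apply: cmeasurable_real; apply: measurable_funM; last exact: mT.
apply: measurable_funTS; exact: (measurableT_comp (@normr_measurable R setT)).
Qed.

Let rhobar_bound : exists2 C : R, 0 <= C & {ae mu2, forall z, strip z -> optimal_filter Pi Delta z <= C}.
Proof.
have [M hM] := dom 1; exists (Num.max M 1); first by rewrite le_max ler01 orbT.
move: hM (ae_imp2 (fun z a b => conj a b) (ae_fst_neq0 R) (ae_Pi_lty fU vU)); apply: ae_imp2.
move=> z hz [z1 fP] zS; rewrite rhobarE le_max; have /andP[T0 T1] := T01 z.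
have [rM|rM] := leP M `|z.1|; last first.
  by rewrite (le_trans _ (ltW rM))// -[leRHS]mulr1 ler_wpM2l.
apply/orP; right.
have fP1 : (Pi z < +oo)%E := fP zS.
have := hz zS rM; move: fP1 (Pi_ge0 z) (Delta_ge0 z) => fP1 P0 D1; move: D1 P0 fP1.
have r0 : 0 < `|z.1| by rewrite normr_gt0.
rewrite /T; case: (Pi z) => [p||]; [|by move=> _ _; rewrite ltxx|by []].
move=> D0 p0 _; case: (Delta z) D0 => [d||]// D0; last first.
  by rewrite addey// invey mule0 /= mulr0 ler01.
move: p0 D0; rewrite !lee_fin => p0 d0.
have [-> _|pn] := eqVneq p 0; first by rewrite mul0e mulr0 ler01.
have pp : 0 < p by rewrite lt_neqAle eq_sym pn.
rewrite -EFinM inver gt_eqF ?mulr_gt0// -EFinM lee_fin ler_pdivlMr ?mulr_gt0// mul1r => h.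
rewrite -EFinD inver gt_eqF ?ltr_pwDl//= mulrA ler_pdivrMr ?ltr_pwDl// mul1r.
by rewrite mulrC (le_trans h)// lerDr.
Qed.

Let rhobar_filter : ess_bounded_filter rhobar.
Proof.
split; first exact: mrhobar.
have [C C0 hC] := rhobar_bound; exists C; apply: ae_imp hC => z h zS.
rewrite normc_real rhobarE normrM normr_id ger0_norm; first exact: h.
by have /andP[] := T01 z.
Qed.

Let good : {ae mu2, forall z, strip z -> [/\ z.1 != 0, (Pi z < +oo)%E &
  (0 < Pi z)%E \/ (0 < Delta z)%E]}.
Proof.
move: (ae_imp2 (fun z a b => conj a b) (ae_fst_neq0 R) (ae_Pi_lty fU vU)) pos.
by apply: ae_imp2 => z [a b] c zS; split => //; [exact: b|exact: c].
Qed.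

Let num z : strip z -> z.1 != 0 -> (Pi z < +oo)%E -> (0 < Pi z)%E \/ (0 < Delta z)%E ->
  [/\ pe rhobar z = (`|z.1|%:E * Pi z * (1 - Pi z / (Pi z + Delta z)))%E,
      forall rho, (pe rhobar z <= pe rho z)%E &
      forall rho, pe rho z = pe rhobar z -> rho z = rhobar z].
Proof.
move=> zS z1 fP; have s0 : 0 < Num.sqrt `|z.1| by rewrite sqrtr_gt0 normr_gt0.
have s2 : Num.sqrt `|z.1| ^+ 2 = `|z.1| by rewrite sqr_sqrtr.
have Pe : Pi z = (fine (Pi z))%:E by rewrite fineK// ge0_fin_numE.
have p0 := fine_ge0 (Pi_ge0 z).
have bE : rhobar z = (Num.sqrt `|z.1| ^+ 2 * fine ((fine (Pi z))%:E / ((fine (Pi z))%:E + Delta z))%E)%:C%C.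
  by rewrite -Pe s2.
have peE rho : pe rho z = ((cdot (signal_gain rho z) (signal_gain rho z))%:E * (fine (Pi z))%:E +
   (cdot (noise_gain rho z) (noise_gain rho z))%:E * Delta z)%E.
  by rewrite -Pe.
rewrite {1}Pe => pD; split.
- rewrite peE /signal_gain /noise_gain bE (pointwise_best s0 p0 (Delta_ge0 z) pD).
  by rewrite s2 -Pe.
- move=> rho; rewrite !peE /signal_gain /noise_gain bE.
  exact: (pointwise_le s0 p0 (Delta_ge0 z) pD).
- move=> rho; rewrite !peE /signal_gain /noise_gain bE.
  exact: (pointwise_unique s0 p0 (Delta_ge0 z) pD).
Qed.

Let pe_ge0 rho z : (0 <= pe rho z)%E.
Proof. by apply: adde_ge0; apply: mule_ge0; rewrite ?lee_fin ?cdot_ge0. Qed.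

Let mpe rho : cmeasurable strip rho -> measurable_fun strip (pe rho).
Proof. exact: (measurable_pointwise_error vU vnu). Qed.

Let errbar : err rhobar = (\int[mu2]_(z in strip) pe rhobar z)%E.
Proof.
apply: (expected_errorE rU fU rnu cnu indep vU vnu mrhobar).
have [C C0 hC] := rhobar_bound.
have [_ vU'] := vU; have [_ vnu'] := vnu; move: vU' vnu'; apply: ae_imp2 => w Uw nw.
have [_ ma fa _] := Uw; have [_ [mb fb] _] := nw.
have mab : cmeasurable strip (fun z => rhobar z * (FAU (w, z) + Fnu (w, z))).
  by apply: cmeasurableM; [exact: mrhobar|exact: cmeasurableD].
split => //; rewrite L2normsqE.
pose g z := (2 * C * cdot (wt (fun z => FAU (w, z)) z) (wt (fun z => FAU (w, z)) z) +
  2 * C ^+ 2 * cdot (Fnu (w, z)) (Fnu (w, z))).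
have Lwa : L2 mu2 strip (wt (fun z => FAU (w, z))).
  by split; [exact: cmeasurable_wt|rewrite L2normsq_wt].
have Lb : L2 mu2 strip (fun z => Fnu (w, z)) by [].
have Ig : mu2.-integrable strip (EFin \o g).
  exact: (integrableD mS (integrableClS (2 * C) mS (integrable_cdot mS Lwa Lwa))
    (integrableClS (2 * C ^+ 2) mS (integrable_cdot mS Lb Lb))).
have mg := measurable_int _ Ig.
have g0 z : 0 <= g z by rewrite addr_ge0// !mulr_ge0 ?sqr_ge0 ?cdot_ge0.
have fg : (\int[mu2]_(z in strip) (g z)%:E < +oo)%E.
  by apply: (proj1 (ge0_integrableP mu2 (proj1 (measurable_EFinP _ _) mg) (fun z _ => g0 z))).
apply: le_lt_trans fg; apply: ae_ge0_le_integral => //.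
- by move=> z _; rewrite lee_fin cdot_ge0.
- by apply/measurable_EFinP; exact: measurable_cdot.
- by move=> z _; rewrite lee_fin.
apply: ae_imp hC => z h zS; rewrite lee_fin; have {h} := h zS.
have /andP[T0 T1] := T01 z; rewrite cdotMM /g cdot_wt /rhobar rhobarE => rC.
have sum : cdot (FAU (w, z) + Fnu (w, z)) (FAU (w, z) + Fnu (w, z)) <=
    2 * cdot (FAU (w, z)) (FAU (w, z)) + 2 * cdot (Fnu (w, z)) (Fnu (w, z)).
  exact: cdotDD_le.
have -> : cdot (`|z.1| * T z)%:C%C (`|z.1| * T z)%:C%C = (`|z.1| * T z) ^+ 2.
  by rewrite /cdot /= mulr0 addr0 expr2.
have a0 := cdot_ge0 (FAU (w, z)); have b0 := cdot_ge0 (Fnu (w, z)).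
have q0 := normr_ge0 z.1; have rq : `|z.1| * T z <= `|z.1| by rewrite -[leRHS]mulr1 ler_wpM2l.
have r0 : 0 <= `|z.1| * T z by rewrite mulr_ge0.
apply: le_trans (ler_wpM2l (sqr_ge0 _) sum) _.
have key (r q a b : R) : 0 <= a -> 0 <= b -> 0 <= r -> r <= q -> r <= C ->
    r ^+ 2 * (2 * a + 2 * b) <= 2 * C * (q * a) + 2 * C ^+ 2 * b.
  move=> ha hb hr rq' rC'.
  have h1 : r ^+ 2 <= C * q by rewrite expr2; apply: ler_pM.
  have h2 : r ^+ 2 <= C ^+ 2 by rewrite ler_sqr ?nnegrE.
  have h3 := ler_wpM2r ha h1; have h4 := ler_wpM2r hb h2; lra.
exact: key.
Qed.

Lemma optimal_filter_le rho : cmeasurable strip rho -> (err rhobar <= err rho)%E.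
Proof.
move=> mr; apply: le_trans (expected_error_ge rU fU rnu cnu indep vU vnu mr).
rewrite errbar.
apply: (ae_ge0_le_integral mS (fun z _ => pe_ge0 rhobar z) (mpe mrhobar)
  (fun z _ => pe_ge0 rho z) (mpe mr)).
apply: ae_imp good => z h zS; have [z1 fP pD] := h zS.
by have [_ + _] := num zS z1 fP pD; apply.
Qed.

Let errbar_lty : (\int[mu2]_(z in strip) pe rhobar z < +oo)%E.
Proof.
have w0 z : strip z -> (0 <= `|z.1|%:E * Pi z)%E by move=> _; rewrite mule_ge0.
have mw : measurable_fun strip (fun z => `|z.1|%:E * Pi z)%E.
  apply: emeasurable_funM; last exact: mPi.
  apply/measurable_EFinP; apply: measurable_funTS.
  exact: (measurableT_comp (@normr_measurable R setT)).
apply: le_lt_trans (weighted_Pi_lty fU vU).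
apply: (ae_ge0_le_integral mS (fun z _ => pe_ge0 rhobar z) (mpe mrhobar) w0 mw).
apply: ae_imp good => z h zS; have [z1 fP pD] := h zS.
have [-> _ _] := num zS z1 fP pD; rewrite TE -[leRHS]mule1 lee_wpmul2l ?mule_ge0//.
by rewrite one_sube lee_fin gerBl; have /andP[] := T01 z.
Qed.

(** Equal finite integrals of comparable functions force equality almost everywhere, and the pointwise minimizer is unique. *)
Lemma optimal_filter_unique rho : cmeasurable strip rho -> err rho = err rhobar ->
  {ae mu2, forall z, strip z -> rho z = rhobar z}.
Proof.
move=> mr e.
have le1 := expected_error_ge rU fU rnu cnu indep vU vnu mr; rewrite -/err e errbar in le1.
have gle : {ae mu2, forall z, strip z -> (pe rhobar z <= pe rho z)%E}.
  apply: ae_imp good => z h zS; have [z1 fP pD] := h zS.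
  by have [_ + _] := num zS z1 fP pD; apply.
have le2 : (\int[mu2]_(z in strip) pe rhobar z <= \int[mu2]_(z in strip) pe rho z)%E.
  exact: (ae_ge0_le_integral mS (fun z _ => pe_ge0 rhobar z) (mpe mrhobar)
    (fun z _ => pe_ge0 rho z) (mpe mr) gle).
have eq12 : (\int[mu2]_(z in strip) pe rho z = \int[mu2]_(z in strip) pe rhobar z)%E.
  by apply/eqP; rewrite eq_le le1 le2.
have abs_int r : cmeasurable strip r -> (\int[mu2]_(z in strip) pe r z < +oo)%E ->
    mu2.-integrable strip (pe r).
  move=> mr' fr; apply/integrableP; split; first exact: (mpe mr').
  apply: le_lt_trans fr; rewrite le_eqVlt; apply/orP; left; apply/eqP.
  by apply: eq_integral => z _; exact: gee0_abs (pe_ge0 r z).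
have I0 := abs_int _ mrhobar errbar_lty.
have f1 : (\int[mu2]_(z in strip) pe rho z < +oo)%E by rewrite eq12; exact: errbar_lty.
have I1 := abs_int _ mr f1.
have ID := integrableB mS I1 I0.
have zD : (\int[mu2]_(z in strip) (pe rho z - pe rhobar z) = 0)%E.
  have fin : (\int[mu2]_(z in strip) pe rhobar z)%E \is a fin_num.
    rewrite ge0_fin_numE; first exact: errbar_lty.
    by apply: integral_ge0 => z _; exact: pe_ge0.
  transitivity (\int[mu2]_(z in strip) pe rho z - \int[mu2]_(z in strip) pe rhobar z)%E.
    exact: (integralB mS I1 I0).
  by rewrite eq12; exact: subee fin.
have mD := measurable_int _ ID.
have zA : (\int[mu2]_(z in strip) `|pe rho z - pe rhobar z| = 0)%E.
  have m1 : measurable_fun strip (fun z => `|pe rho z - pe rhobar z|)%E by exact: measurableT_comp.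
  rewrite -[RHS]zD; apply: (ae_eq_integral _ _ mS m1 mD).
  move: gle (integrable_ae mS I0); apply: ae_imp2 => z h1 h2 zS.
  have hb : (pe rhobar z \is a fin_num) || (pe rho z \is a fin_num) by rewrite (h2 zS).
  have h3 : (0 <= pe rho z - pe rhobar z)%E by rewrite (sube_ge0 hb); exact: h1.
  exact: gee0_abs h3.
have az := proj1 (ae_eq_integral_abs mu2 mS mD) zA.
move: az (ae_imp2 (fun z a b => conj a b) good (integrable_ae mS I0)); apply: ae_imp2.
move=> z hz [hg hf] zS; have [z1 fP pD] := hg zS.
have [_ _] := num zS z1 fP pD; apply.
have e0 : (pe rho z - pe rhobar z = 0)%E := hz zS.
have fin : pe rhobar z \is a fin_num := hf zS.
exact: sube0_eq e0 fin.
Qed.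

(** The pointwise minimum is the stated integrand, and the strip integral is an iterated one by Tonelli. *)
Lemma optimal_filter_error : err rhobar = (\int[leb]_(theta in `[0%R, pi])
   \int[leb]_r (`|r|%:E * Pi (r, theta) * (1 - Pi (r, theta) / (Pi (r, theta) + Delta (r, theta)))))%E.
Proof.
pose F (z : R * R) : \bar R := (`|z.1|%:E * Pi z * (1 - Pi z / (Pi z + Delta z)))%E.
have mF : measurable_fun strip F.
  have -> : F = (fun z => `|z.1|%:E * Pi z * (1 - T z)%:E)%E.
    by apply/funext => z; rewrite /F TE.
  apply: emeasurable_funM; first apply: emeasurable_funM => //.
    apply/measurable_EFinP; apply: measurable_funTS.
    exact: (measurableT_comp (@normr_measurable R setT)).
  by apply/measurable_EFinP; apply: measurable_funB => //; exact: measurable_cst.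
have F0 z : strip z -> (0 <= F z)%E.
  move=> _; rewrite /F TE !mule_ge0// one_sube lee_fin subr_ge0.
  by have /andP[] := T01 z.
rewrite errbar -[RHS](ge0_integral_strip mF F0).
apply: (ae_eq_integral _ _ mS (mpe mrhobar) mF).
apply: ae_imp good => z h zS; have [z1 fP pD] := h zS.
by have [] := num zS z1 fP pD.
Qed.

Lemma optimal_filter_admissible : ess_bounded_filter rhobar.
Proof. exact: rhobar_filter. Qed.

End OptimalFilter.

(** * The optimal filter *)

Theorem mainTheorem4 (R : realType) (d : measure_display)
    (Omega : measurableType d) (P : probability Omega R)
    (U nu : Omega -> R * R -> R[i])
    (FAU Fnu : Omega * (R * R) -> R[i]) :
  let mu := @leb2 R in
  let D := @strip R in
  let Pi := second_moment P FAU in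
  let Delta := second_moment P Fnu in
  let err := expected_error P U FAU Fnu in
  let rhobar := fun z : R * R => (optimal_filter Pi Delta z)%:C%C in
  L2random mu (@plane R) U ->
  (\int[P]_w L2normsq mu (@plane R) (U w) < +oo)%E ->
  L2random mu D nu ->
  L2centered P mu D nu ->
  L2independent P mu (@plane R) U mu D nu ->
  measurable_version P (@is_F1_radon R) U FAU ->
  measurable_version P (@is_F1 R) nu Fnu ->
  {ae mu, forall z, D z -> (0 < Pi z)%E \/ (0 < Delta z)%E} ->
  noise_dominates Pi Delta ->
  [/\ ess_bounded_filter rhobar,
      forall rho, ess_bounded_filter rho -> (err rhobar <= err rho)%E,
      forall rho, ess_bounded_filter rho -> err rho = err rhobar ->
        {ae mu, forall z, D z -> rho z = rhobar z} &
      err rhobar =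
        (\int[@lebesgue_measure R]_(theta in `[0%R, pi])
           \int[@lebesgue_measure R]_r
             (`|r|%:E * Pi (r, theta) *
              (1 - Pi (r, theta) / (Pi (r, theta) + Delta (r, theta)))))%E].
Proof.
move=> mu D Pi Delta err rhobar rU fU rnu cnu indep vU vnu pos dom; split.
- eapply optimal_filter_admissible; eassumption.
- by move=> rho [mr _]; eapply optimal_filter_le; eassumption.
- by move=> rho [mr _]; eapply optimal_filter_unique; eassumption.
- eapply optimal_filter_error; eassumption.
Qed.
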